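(* There are, up to isomorphism, exactly $13$ arrangements of $12$ pseudolines in $\mathbb{P}^2_{\mathbb{R}}$ with exactly $19$ triple points and $9$ double points (that is, $t_3=19$, $t_2=9$, and $t_r=0$ for $r\geq 4$), and they are described by the triple lists $\mathcal{C}_1,\ldots,\mathcal{C}_{13}$ given in the context. Precisely: (i) for every such arrangement there is a labelling of the pseudolines by $1,\ldots,12$ under which the set of triples of pseudolines meeting in the triple points is one of $\mathcal{C}_1,\ldots,\mathcal{C}_{13}$; (ii) each of $\mathcal{C}_1,\ldots,\mathcal{C}_{13}$ arises in this way from an arrangement of $12$ pseudolines with $t_3=19$ and $t_2=9$; (iii) $\mathcal{C}_1,\ldots,\mathcal{C}_{13}$ are pairwise non-isomorphic.
   Context: A pseudoline in the real projective plane $\mathbb{P}^2_{\mathbb{R}}$ is a simple closed curve whose removal does not cut $\mathbb{P}^2_{\mathbb{R}}$ into two connected components. A pseudoline arrangement is a finite set of pseudolines such that every two of them have precisely one point in common, at which they cross. For $r\geq 2$, $t_r$ is the number of points incident with precisely $r$ pseudolines of the arrangement; such points are called double points for $r=2$ and triple points for $r=3$. The triple list of a labelled arrangement of $12$ pseudolines is the set of unordered triples $\{i,j,k\}\subset\{1,\ldots,12\}$ such that pseudolines $i,j,k$ are exactly the pseudolines through some triple point. Two triple lists are isomorphic if a permutation of $\{1,\ldots,12\}$ carries one onto the other. The lists (each $(i,j,k)$ denotes an unordered triple): $\mathcal{C}_{1} = \{(1,2,3),(1,4,5),(1,6,7),(1,8,9),(1,10,11),(2,4,7),(2,6,9),(2,8,11),(2,10,12),(3,4,9),(3,5,7),(3,6,11),(3,8,12),(4,6,12),(4,8,10),(5,6,10),(5,9,11),(7,9,10),(7,11,12)\}$,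 $\mathcal{C}_{2} = \{(1,2,3),(1,4,5),(1,6,7),(1,8,9),(1,10,11),(2,4,7),(2,6,9),(2,8,11),(2,10,12),(3,4,9),(3,5,7),(3,6,11),(3,8,12),(4,6,12),(4,8,10),(5,9,11),(7,9,10),(7,11,12),(5,6,8)\}$, $\mathcal{C}_{3} = \{(1,2,3),(1,4,5),(1,6,7),(1,8,9),(1,10,11),(2,4,7),(2,6,9),(2,8,11),(2,10,12),(3,5,7),(3,6,11),(3,8,12),(4,6,12),(4,8,10),(4,9,11),(5,9,12),(7,9,10),(7,11,12),(5,6,8)\}$, $\mathcal{C}_{4} = \{(1,2,3),(1,4,5),(1,6,7),(1,8,9),(1,10,11),(2,4,7),(2,6,9),(2,8,11),(2,10,12),(3,4,10),(3,5,7),(3,6,12),(3,9,11),(4,6,11),(4,8,12),(5,6,8),(5,9,12),(7,11,12),(7,8,10)\}$, $\mathcal{C}_{5} = \{(1,2,3),(1,4,5),(1,6,7),(1,8,9),(1,10,11),(2,4,7),(2,6,9),(2,8,11),(2,10,12),(3,4,10),(3,5,7),(3,6,12),(3,9,11),(4,6,11),(4,8,12),(5,8,10),(5,9,12),(7,9,10),(7,11,12)\}$, $\mathcal{C}_{6} = \{(1,2,3),(1,4,5),(1,6,7),(1,8,9),(1,10,11),(2,4,7),(2,6,9),(2,8,11),(2,10,12),(3,4,9),(3,5,7),(3,6,11),(3,8,12),(4,6,8),(4,11,12),(5,6,10),(5,9,12),(7,9,11),(7,8,10)\}$, $\mathcal{C}_{7} = \{(1,2,3),(1,4,5),(1,6,7),(1,8,9),(1,10,11),(2,4,7),(2,6,9),(2,10,12),(3,4,9),(3,5,7),(3,6,8),(3,11,12),(4,6,11),(4,8,12),(5,6,10),(5,8,11),(5,9,12),(7,9,11),(7,8,10)\}$,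 $\mathcal{C}_{8} = \{(1,2,3),(1,4,5),(1,6,7),(1,8,9),(1,10,11),(2,4,7),(2,6,9),(2,8,11),(2,10,12),(3,4,10),(3,5,7),(3,6,8),(3,9,11),(4,6,11),(4,8,12),(5,6,10),(5,9,12),(7,11,12),(7,8,10)\}$, $\mathcal{C}_{9} = \{(1,2,3),(1,4,5),(1,6,7),(1,8,9),(1,10,11),(2,4,7),(2,6,9),(2,8,11),(2,10,12),(3,4,10),(3,6,8),(3,7,11),(3,9,12),(4,6,11),(4,8,12),(5,6,10),(5,7,9),(5,11,12),(7,8,10)\}$, $\mathcal{C}_{10} = \{(1,2,3),(1,4,5),(1,6,7),(1,8,9),(1,10,11),(2,4,7),(2,6,9),(2,8,11),(3,4,9),(3,5,7),(3,6,11),(3,8,10),(4,6,10),(4,8,12),(5,6,8),(5,9,11),(5,10,12),(7,11,12),(7,9,10)\}$, $\mathcal{C}_{11} = \{(1,2,3),(1,4,5),(1,6,7),(1,8,9),(1,10,11),(2,4,7),(2,6,9),(2,8,11),(2,10,12),(3,5,7),(3,6,11),(3,8,12),(4,6,12),(4,8,10),(4,9,11),(5,6,10),(5,9,12),(7,9,10),(7,11,12)\}$, $\mathcal{C}_{12} = \{(1,2,3),(1,4,5),(1,6,7),(1,8,9),(1,10,11),(2,4,7),(2,6,9),(2,8,11),(2,10,12),(3,4,10),(3,5,7),(3,6,12),(3,9,11),(4,6,11),(4,8,12),(5,6,10),(5,9,12),(7,11,12),(7,8,10)\}$, $\mathcal{C}_{13} = \{(1,2,3),(1,4,5),(1,6,7),(1,8,9),(1,10,11),(2,4,7),(2,6,9),(2,8,11),(2,10,12),(3,5,12),(3,7,10),(3,9,11),(4,8,10),(4,11,12),(5,7,8),(5,9,10),(6,8,12),(7,9,12),(3,4,6)\}$.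 *)

(* Defs.v *)
From HB Require Import structures.
From mathcomp Require Import all_boot all_order all_algebra all_fingroup.
From mathcomp Require Import generic_quotient.
From mathcomp Require Import all_classical all_reals all_analysis.
Import Order.TTheory GRing.Theory Num.Theory.
Import numFieldNormedType.Exports.

Set Implicit Arguments.
Unset Strict Implicit.
Unset Printing Implicit Defensive.

Local Open Scope classical_set_scope.
Local Open Scope card_scope.
Local Open Scope ring_scope.
Local Open Scope quotient_scope.

Section ProjectivePlane.
Variable R : realType.

Definition nonzero_vector : Type := [set v : 'rV[R]_3 | v != 0].

HB.instance Definition _ := Topological.on nonzero_vector.

(* [_ == _]%MS is equality of row spaces: the two vectors span the same line
   through the origin. *)
Definition same_line (u v : nonzero_vector) : bool :=
  (set_val u == set_val v)%MS.

Lemma same_line_refl : reflexive same_line.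
Proof. by move=> u; rewrite /same_line submx_refl. Qed.

Lemma same_line_sym : symmetric same_line.
Proof. by move=> u v; rewrite /same_line andbC. Qed.

Lemma same_line_trans : transitive same_line.
Proof.
move=> v u w /andP[uv vu] /andP[vw wv].
by rewrite /same_line (submx_trans uv vw) (submx_trans wv vu).
Qed.

Canonical same_line_equiv :=
  EquivRel same_line same_line_refl same_line_sym same_line_trans.

Definition projective_plane : Type :=
  quotient_topology {eq_quot same_line_equiv}.

HB.instance Definition _ := Topological.on projective_plane.

End ProjectivePlane.

Section Arrangements.
Variable R : realType.
Local Notation P2 := (projective_plane R).

Definition simple_closed_curve (C : set P2) : Prop :=
  exists f : R -> P2,
    [/\ {within `[0, 1], continuous f},
        f 0 = f 1,
        set_inj `[0, 1[ f &
        C = f @` `[0, 1]].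

Definition pseudoline (C : set P2) : Prop :=
  simple_closed_curve C /\ connected (~` C).

(* An open embedding of U into R^2, i.e. a homeomorphism from the open
   neighbourhood U of p onto an open subset of R^2, centred at p. *)
Definition chart_at (p : P2) (U : set P2) (h : P2 -> R * R) : Prop :=
  [/\ open_nbhs p U,
      {within U, continuous h},
      set_inj U h,
      (forall W : set P2, open W -> W `<=` U -> open (h @` W)) &
      h p = (0, 0)].

(* Topological crossing: near p, the pair (C, D) is homeomorphic to the two
   coordinate axes of R^2 near the origin. *)
Definition cross_at (C D : set P2) (p : P2) : Prop :=
  exists (U : set P2) (h : P2 -> R * R),
    chart_at p U h /\
    forall q, U q -> (C q <-> (h q).2 = 0) /\ (D q <-> (h q).1 = 0).

Definition pseudoline_arrangement (A : set (set P2)) : Prop :=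
  [/\ finite_set A,
      A `<=` pseudoline &
      forall C D, A C -> A D -> C <> D ->
        exists p, C `&` D = [set p] /\ cross_at C D p].

(* The number t_r is the cardinality of [multiple_points A r] (for r >= 2);
   t_r = k is stated as [multiple_points A r #= `I_k]. *)
Definition multiple_points (A : set (set P2)) (r : nat) : set P2 :=
  [set p | [set C | A C /\ C p] #= `I_r].

Definition special_arrangement (A : set (set P2)) : Prop :=
  [/\ pseudoline_arrangement A,
      A #= `I_12,
      multiple_points A 3 #= `I_19,
      multiple_points A 2 #= `I_9 &
      forall r, (4 <= r)%N -> multiple_points A r #= `I_0].

Definition labelling (A : set (set P2)) (L : 'I_12 -> set P2) : Prop :=
  set_bij [set: 'I_12] A L.

Definition lines_through (L : 'I_12 -> set P2) (p : P2) : {set 'I_12} :=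
  [set i | p \in L i]%SET.

Definition triple_list (L : 'I_12 -> set P2) : {set {set 'I_12}} :=
  [set S | `[< exists2 p, multiple_points (range L) 3 p
                        & S = lines_through L p >]]%SET.

End Arrangements.

Definition isomorphic_lists (D E : {set {set 'I_12}}) : Prop :=
  exists s : {perm 'I_12}, [set s @: S | S : {set 'I_12} in D]%SET = E.

(* The labels 1, ..., 12 are the elements 0, ..., 11 of 'I_12. *)
Definition label (k : nat) : 'I_12 := inord k.-1.

Definition unordered_triple (t : nat * nat * nat) : {set 'I_12} :=
  let: (i, j, k) := t in [set label i; label j; label k]%SET.

Definition tables : seq (seq (nat * nat * nat)) := [::
    [:: (1,2,3); (1,4,5); (1,6,7); (1,8,9); (1,10,11); (2,4,7); (2,6,9);
        (2,8,11); (2,10,12); (3,4,9); (3,5,7); (3,6,11); (3,8,12); (4,6,12);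
        (4,8,10); (5,6,10); (5,9,11); (7,9,10); (7,11,12)];
    [:: (1,2,3); (1,4,5); (1,6,7); (1,8,9); (1,10,11); (2,4,7); (2,6,9);
        (2,8,11); (2,10,12); (3,4,9); (3,5,7); (3,6,11); (3,8,12); (4,6,12);
        (4,8,10); (5,9,11); (7,9,10); (7,11,12); (5,6,8)];
    [:: (1,2,3); (1,4,5); (1,6,7); (1,8,9); (1,10,11); (2,4,7); (2,6,9);
        (2,8,11); (2,10,12); (3,5,7); (3,6,11); (3,8,12); (4,6,12); (4,8,10);
        (4,9,11); (5,9,12); (7,9,10); (7,11,12); (5,6,8)];
    [:: (1,2,3); (1,4,5); (1,6,7); (1,8,9); (1,10,11); (2,4,7); (2,6,9);
        (2,8,11); (2,10,12); (3,4,10); (3,5,7); (3,6,12); (3,9,11); (4,6,11);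
        (4,8,12); (5,6,8); (5,9,12); (7,11,12); (7,8,10)];
    [:: (1,2,3); (1,4,5); (1,6,7); (1,8,9); (1,10,11); (2,4,7); (2,6,9);
        (2,8,11); (2,10,12); (3,4,10); (3,5,7); (3,6,12); (3,9,11); (4,6,11);
        (4,8,12); (5,8,10); (5,9,12); (7,9,10); (7,11,12)];
    [:: (1,2,3); (1,4,5); (1,6,7); (1,8,9); (1,10,11); (2,4,7); (2,6,9);
        (2,8,11); (2,10,12); (3,4,9); (3,5,7); (3,6,11); (3,8,12); (4,6,8);
        (4,11,12); (5,6,10); (5,9,12); (7,9,11); (7,8,10)];
    [:: (1,2,3); (1,4,5); (1,6,7); (1,8,9); (1,10,11); (2,4,7); (2,6,9);
        (2,10,12); (3,4,9); (3,5,7); (3,6,8); (3,11,12); (4,6,11); (4,8,12);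
        (5,6,10); (5,8,11); (5,9,12); (7,9,11); (7,8,10)];
    [:: (1,2,3); (1,4,5); (1,6,7); (1,8,9); (1,10,11); (2,4,7); (2,6,9);
        (2,8,11); (2,10,12); (3,4,10); (3,5,7); (3,6,8); (3,9,11); (4,6,11);
        (4,8,12); (5,6,10); (5,9,12); (7,11,12); (7,8,10)];
    [:: (1,2,3); (1,4,5); (1,6,7); (1,8,9); (1,10,11); (2,4,7); (2,6,9);
        (2,8,11); (2,10,12); (3,4,10); (3,6,8); (3,7,11); (3,9,12); (4,6,11);
        (4,8,12); (5,6,10); (5,7,9); (5,11,12); (7,8,10)];
    [:: (1,2,3); (1,4,5); (1,6,7); (1,8,9); (1,10,11); (2,4,7); (2,6,9);
        (2,8,11); (3,4,9); (3,5,7); (3,6,11); (3,8,10); (4,6,10); (4,8,12);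
        (5,6,8); (5,9,11); (5,10,12); (7,11,12); (7,9,10)];
    [:: (1,2,3); (1,4,5); (1,6,7); (1,8,9); (1,10,11); (2,4,7); (2,6,9);
        (2,8,11); (2,10,12); (3,5,7); (3,6,11); (3,8,12); (4,6,12); (4,8,10);
        (4,9,11); (5,6,10); (5,9,12); (7,9,10); (7,11,12)];
    [:: (1,2,3); (1,4,5); (1,6,7); (1,8,9); (1,10,11); (2,4,7); (2,6,9);
        (2,8,11); (2,10,12); (3,4,10); (3,5,7); (3,6,12); (3,9,11); (4,6,11);
        (4,8,12); (5,6,10); (5,9,12); (7,11,12); (7,8,10)];
    [:: (1,2,3); (1,4,5); (1,6,7); (1,8,9); (1,10,11); (2,4,7); (2,6,9);
        (2,8,11); (2,10,12); (3,5,12); (3,7,10); (3,9,11); (4,8,10);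
        (4,11,12); (5,7,8); (5,9,10); (6,8,12); (7,9,12); (3,4,6)]
].

(* The index m : 'I_13 starts at 0, so that this is the list C_(m+1). *)
Definition list_C (m : 'I_13) : {set {set 'I_12}} :=
  [set:: map unordered_triple (nth [::] tables m)]%SET.

(* Main.v *)
(* Sweeping a line across an arrangement reduces it to a wiring diagram: a sequence of
   permutations of the pseudolines in which each step reverses a block of two or three
   neighbours. A count of incidences gives a pseudoline with five triple points and one
   double point; it is taken as the line at infinity and the other eleven are labelled in
   the order in which they meet it. A search over all sweeps that perform the leftmost
   possible step first has 358 outcomes, each isomorphic to one of the thirteen lists.

   The passage from topology to combinatorics avoids any structure theorem for
   pseudolines. The curves are lifted to R^3; seen from a point z off the curve a, the
   curve runs through a loop of directions in the plane R^3/z, and the winding parity of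
   this loop (its monodromy along a square root) is locally constant in z and flips when z
   crosses a. This gives every pseudoline two sides on the double cover, hence the order
   of the crossings along the pseudolines, up to signs that a reorientation removes.

   Conversely each list is realized by the graphs of twelve piecewise linear functions
   read off a wiring diagram, and the lists are told apart by a colour refinement
   invariant. *)

Require Import Defs.
From mathcomp Require Import all_boot all_order all_algebra all_fingroup.
From mathcomp Require Import boolp ring lra zify.
Import Order.TTheory GRing.Theory Num.Theory.

Set Implicit Arguments.
Unset Strict Implicit.
Unset Printing Implicit Defensive.

(** * Sweeping a wiring diagram *)

(** Parity keeps the search small. A pseudoline meets eleven others, two at each triple point and
    one at each double point, so it carries an odd number of double points. Away from the line at
    infinity this forces ten incidences with double points out of sixteen; the other six come in
    three pairs, and this budget is the [slack].

    The topological obstacle is to tell the two sides of a curve that is only an injective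
    continuous image. A winding number asks for a lift of angles; a square root asks only for a
    choice of signs, and such choices come from a discrete cocycle argument on the plane, which also
    lifts a curve from the projective plane to vectors. The flip at a crossing is shown without
    evaluating any monodromy: the loops seen from the two sides are deformed until they coincide
    away from the crossing, while near it viewpoint and curve point are exchanged. The exchange
    negates the direction and so multiplies its root by ['i]; going round once meets this factor
    twice.

    The signs obtained obey a cocycle rule on non-concurrent triples, and this is what makes a
    consistent reorientation possible. *)

Inductive wire := Wire (c id : nat) (p : bool).
Definition wire_class w := let: Wire c _ _ := w in c.
Definition wire_id w := let: Wire _ i _ := w in i.
Definition wire_par w := let: Wire _ _ p := w in p.

Definition triple := (nat * nat * nat)%type.

(* Sweeps a wiring diagram from left to right, always performing the leftmost
   possible crossing first: [lrev] lists in reverse the wires in front of the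
   pointer, and the double crossing at the pointer is only allowed if [fresh].
   Wires of the same class do not cross. [nd] and [nt] count the remaining double
   and triple crossings; the flag of a wire tells whether its number of remaining
   double crossings is even, and [slack] is the sum of the halves, rounded down, of
   these numbers. Exhausted fuel shows as the bogus outcome [::]. *)
Fixpoint sweep (fuel : nat) (lrev right : seq wire) (fresh : bool)
    (nd nt slack : nat) (tr : seq triple) : seq (seq triple) :=
  if fuel isn't S fuel then [:: [::]] else
  let back l r nd nt slack tr :=
    match l with
    | a :: b :: l => sweep fuel l (b :: a :: r) false nd nt slack tr
    | [:: a] => sweep fuel [::] (a :: r) true nd nt slack tr
    | [::] => sweep fuel [::] r true nd nt slack tr
    end in
  match nd, nt with
  | 0, 0 => [:: tr]
  | _, _ =>
    match right with
    | (Wire c1 i1 p1 as x) :: ((Wire c2 i2 p2 as y) :: r) =>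
      sweep fuel (x :: lrev) (y :: r) true nd nt slack tr ++
      if Nat.ltb c1 c2 then
        (if fresh then
           match nd with
           | 0 => [::]
           | S nd' =>
             let k sl := back lrev (Wire c2 i2 (negb p2) :: Wire c1 i1 (negb p1) :: r)
                           nd' nt sl tr in
             match p1, p2 with
             | false, false => k slack
             | true, true => match slack with S (S s) => k s | _ => [::] end
             | _, _ => match slack with S s => k s | _ => [::] end
             end
           end
         else [::]) ++
        match nt, r with
        | S nt', (Wire c3 i3 p3 as z) :: r' =>
          if Nat.ltb c2 c3 then
            back lrev (z :: y :: x :: r') nd nt' slack ((i1, i2, i3) :: tr)
          else [::]
        | _, _ => [::]
        end
      else [::]
    | _ => [::]
    end
  end.

Definition init_wires := [seq Wire i./2 i (i == 1) | i <- iota 1 11].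
(* Eleven wires: the line at infinity passes one of their 9 double points and 5 of
   their 19 triple points; only wire 1 has an even number of double crossings left. *)
Definition leaves := sweep 400 [::] init_wires true 8 14 3 [::].

Section ListFacts.
Variable T : eqType.
Implicit Types (r : rel T) (s : seq T).

(** [r] is not assumed transitive. Asymmetry puts [b] behind [a] in [s], and the first element of a
    gap between them would be related to both, which the last hypothesis forbids. *)
Lemma adjacent_split r s a b : pairwise r s ->
  {in s &, forall x y, r x y -> ~~ r y x} -> a \in s -> b \in s -> r a b ->
  {in s, forall x, r a x -> r x b -> False} ->
  exists l m, s = l ++ a :: b :: m.
Proof.
move=> pw asym sa sb rab nbtw.
case/splitPr: sa => l m in pw asym sb nbtw *.
move: (pw); rewrite pairwise_cat /= => /and3P[/allrelP lm _ /andP[/allP am pwm]].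
have {}sb : b \in m.
  move: sb; rewrite mem_cat in_cons => /or3P[bl|/eqP eb|//].
    have := asym a b _ _ rab; rewrite !mem_cat !in_cons bl eqxx !orbT => /(_ isT isT).
    by rewrite lm ?in_cons ?eqxx.
  have := asym a b _ _ rab; rewrite eb !mem_cat !in_cons eqxx orbT => /(_ isT isT).
  by rewrite eb in rab *; rewrite rab.
case/splitPr: sb => m1 m2 in pw nbtw am pwm *.
case: m1 pwm am nbtw {pw lm asym} => [|x m1] pwm am nbtw; first by exists l, m2.
case: (nbtw x); first by rewrite !(mem_cat, in_cons) eqxx !orbT.
  by apply: am; rewrite in_cons eqxx.
move: pwm; rewrite /= => /andP[/allP h _]; apply: h.
by rewrite mem_cat in_cons eqxx orbT.
Qed.

End ListFacts.

Definition lab := iota 1 11.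

Lemma mem_lab i : (i \in lab) = (1 <= i <= 11).
Proof. by rewrite mem_iota; lia. Qed.

(** A class [i./2] is a point on the line at infinity: the labels [2 * c] and [2 * c + 1] are
    parallel, and [1] is alone in class [0]. So [ok] selects the pairs of lines that cross in the
    affine part. *)
Definition ok i j := [&& i \in lab, j \in lab & i./2 != j./2].

Lemma ok_sym i j : ok i j = ok j i.
Proof. by rewrite /ok eq_sym andbCA. Qed.

Lemma ok_neq i j : ok i j -> i != j.
Proof. by case/and3P=> _ _; apply: contra => /eqP->. Qed.

(** * Crossing times along the lines and the vertices they determine *)

Section Times.
Variables (R : realDomainType) (t : nat -> nat -> R).
Local Open Scope ring_scope.

(** [t i j] is the moment at which line [i] meets line [j]. Three lines in order of slope bound one
    of two triangles or pass through one point, and a comparison on any of the three lines decides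
    which. Strict comparisons in both directions are listed so that ties agree as well. *)
Definition signotope := forall i j k : nat, ok i j -> ok j k -> ok i k ->
  (i < j < k)%N ->
  [/\ (t i j < t i k) = (t j i < t j k), (t i j < t i k) = (t k i < t k j),
      (t i k < t i j) = (t j k < t j i) & (t i k < t i j) = (t k j < t k i)].

(** This is the signotope rule for [i], [x] and [k] when the crossing of the parallel lines [i] and
    [x] is imagined after every other crossing on both of them. *)
Definition parallel_order := forall i x k : nat, (i < x)%N -> i./2 = x./2 ->
  ok i k -> x \in lab -> if (i < k)%N then t k x < t k i else t k i < t k x.

Definition on_vertex a b := [seq x <- lab | (x == a) || ok a x && (t a x == t a b)].

Hypothesis sgn : signotope.
Hypothesis par : parallel_order.
Hypothesis simple_vertices : forall a b, ok a b -> (size (on_vertex a b) <= 3)%N.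

(** Equality of two times is the failure of both strict comparisons, so [signotope] moves it from
    one line to another; the six orders of the labels all reduce to [base]. *)
Lemma conc_sym a b c : ok a b -> ok b c -> ok a c ->
  (t a b == t a c) = (t b a == t b c).
Proof.
have base i j k : ok i j -> ok j k -> ok i k -> (i < j < k)%N ->
    (t i j == t i k) = (t j i == t j k) /\ (t i j == t i k) = (t k i == t k j).
  move=> h1 h2 h3 h4; have [e1 e2 e3 e4] := sgn h1 h2 h3 h4.
  rewrite -[t i j == _]negbK -[t j i == _]negbK -[t k i == _]negbK !neq_lt.
  by rewrite e1 e3 [t k i < _]((esym e2)) [t k j < _](esym e4) e1 e3.
move=> ab bc ac.
have [nab nbc nac] := And3 (ok_neq ab) (ok_neq bc) (ok_neq ac).
have [ba cb ca] := And3 (etrans (ok_sym _ _) ab) (etrans (ok_sym _ _) bc) (etrans (ok_sym _ _) ac).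
case: (ltngtP a b) nab => // lab _; case: (ltngtP b c) nbc => // lbc _;
  case: (ltngtP a c) nac => // lac _; try lia.
- by have [-> //] : _ /\ _ := base a b c ab bc ac ltac:(lia).
- by have [h1 h2] := base a c b ac cb ab ltac:(lia); rewrite eq_sym h2.
- by have [h1 h2] := base c a b ca ab cb ltac:(lia); rewrite eq_sym -h1 h2 eq_sym.
- by have [h1 h2] := base b a c ba ac bc ltac:(lia); rewrite h1.
- by have [h1 h2] := base b c a bc ca ba ltac:(lia); rewrite [RHS]eq_sym h2 eq_sym //; move: h1 h2; rewrite eq_sym.
- by have [h1 h2] := base c b a cb ba ca ltac:(lia); rewrite eq_sym -h2 h1 eq_sym.
Qed.

Lemma on_vertexP a b x : ok a b ->
  reflect (x = a \/ ok a x /\ t a x = t a b) (x \in on_vertex a b).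
Proof.
move=> ab; have [la _ _] := and3P ab.
rewrite mem_filter; apply: (iffP andP).
  by move=> [/orP[/eqP->|/andP[ax /eqP e]] _]; [left|right].
by move=> [->|[ax ->]]; rewrite ?eqxx ?ax ?orbT; split=> //; have [] := and3P ax.
Qed.

Lemma parallel_neq k i x : ok k i -> ok k x -> i != x -> t k i = t k x -> i./2 != x./2.
Proof.
move=> ki kx ix e; apply/eqP => ex.
have wl (y z : nat) : (y < z)%N -> y./2 = z./2 -> ok k y -> ok k z -> t k y = t k z -> False.
  move=> yz eyz ky kz e'; have [_ lz _] := and3P kz.
  have yk : ok y k by rewrite ok_sym.
  by have := par yz eyz yk lz; rewrite e' ltxx; case: ifP.
by move: ix; rewrite neq_ltn => /orP[] lt; [apply: wl lt _ ki kx e|apply: wl lt _ kx ki (esym e)].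
Qed.

Lemma on_vertex_ok a b x y : ok a b -> x \in on_vertex a b -> y \in on_vertex a b ->
  x != y -> ok x y.
Proof.
move=> ab /(on_vertexP _ ab)[->|[ax ex]] /(on_vertexP _ ab)[->|[ay ey]] xy; rewrite ?eqxx // in xy *.
  by rewrite ok_sym.
have [_ lx _] := and3P ax; have [_ ly _] := and3P ay.
by rewrite /ok lx ly (parallel_neq ax ay xy) // ex.
Qed.

(** A vertex can be recovered from any two of its lines: the concurrency is carried over to line [a]
    by [conc_sym], and there all lines of the vertex have the time [t a b]. *)
Lemma on_vertex_eq a b x y z : ok a b -> x \in on_vertex a b -> y \in on_vertex a b ->
  x != y -> ok x z -> (t x z == t x y) = (z \in on_vertex a b).
Proof.
move=> ab xV yV xy xz; have okxy := on_vertex_ok ab xV yV xy.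
have base u : u \in on_vertex a b -> u != a -> ok a u /\ t a u = t a b.
  by move=> /(on_vertexP _ ab)[->|//]; rewrite eqxx.
have aV : a \in on_vertex a b by apply/(on_vertexP _ ab); left.
have [ex|xa] := eqVneq x a.
  rewrite ex in xz xy okxy *; have [_ ey] := base y yV (contra_neq esym xy).
  rewrite ey; apply/eqP/(on_vertexP _ ab) => [e|[ez|[]//]]; first by right.
  by move: (ok_neq xz); rewrite ez eqxx.
have [ax ex] := base x xV xa.
have xa' : ok x a by rewrite ok_sym.
have -> : t x y = t x a.
  have [-> //|ya] := eqVneq y a; have [ay ey] := base y yV ya.
  by apply/esym/eqP; rewrite -conc_sym // ex ey.
have [->|za] := eqVneq z a; first by rewrite eqxx aV.
rewrite eq_sym; apply/eqP/idP => [e|zV]; last first.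
  have [az ez] := base z zV za.
  by apply/eqP; rewrite -conc_sym // ex ez.
have [la _ _] := and3P ab; have [_ lz _] := and3P xz.
have az : ok a z.
  by rewrite /ok la lz; apply: (parallel_neq (k := x)) => //; rewrite eq_sym.
apply/(on_vertexP _ ab); right; split=> //; rewrite -ex; apply/esym/eqP.
by rewrite conc_sym // e.
Qed.

(** * A vertex that comes first on each of its lines *)

Section MinimalPair.

(** Read on the line of smaller label. For crossing lines [a] and [b] below [M] that line cannot be
    parallel to [M], whose only parallel line of smaller label is [M - 1]; hence the time compared
    is a genuine one. *)
Let left_of (M a b : nat) : bool := (t (minn a b) (maxn a b) < t (minn a b) M).

Let left_ofC M a b : left_of M a b = left_of M b a.
Proof. by rewrite /left_of minnC maxnC. Qed.

Let left_ofE M a b : ok a b -> (a < M)%N -> (b < M)%N -> M \in lab ->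
  left_of M a b = if a./2 == M./2 then true else t a b < t a M.
Proof.
move=> ab aM bM labM; have [la lb cab] := and3P ab.
rewrite /left_of; have := ok_neq ab; rewrite neq_ltn => /orP[lt|lt].
  rewrite (minn_idPl (ltnW lt)) (maxn_idPr (ltnW lt)).
  by case: eqP => // e; move/eqP: cab; lia.
rewrite (minn_idPr (ltnW lt)) (maxn_idPl (ltnW lt)).
have bM' : ok b M by rewrite /ok lb labM /=; apply/eqP; move/eqP: cab; lia.
case: eqP => e.
  have := par aM e ab labM; rewrite ifN //; lia.
have aM' : ok a M by rewrite /ok la labM /=; apply/eqP.
have ba : ok b a by rewrite ok_sym.
by have [-> _ _ _] := sgn ba aM' bM' ltac:(lia).
Qed.

Let left_of_closed M a b c : ok a b -> ok a c -> (a < M)%N -> (b < M)%N -> (c < M)%N ->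
  M \in lab -> t a c = t a b -> left_of M a b = left_of M a c.
Proof. by move=> ab ac aM bM cM lM e; rewrite !left_ofE // e. Qed.

(** The orders along the single lines must not close up to a cycle. Induction on the number of
    lines, with [M] the one of largest label. The crossings left of [M] form an initial piece of
    every other line, so if [Q] has some there, a minimal one among them is minimal. Otherwise the
    first crossing of [Q] on [M] serves, since an earlier one on another line through it would be
    left of [M]. If [Q] has no crossing on [M], the line is dropped. *)
Lemma minimal_pair M (Q : rel nat) : symmetric Q ->
  (forall a b, Q a b -> ok a b) ->
  (forall a b c, Q a b -> ok a c -> t a c = t a b -> (c < M)%N -> Q a c) ->
  (exists a b, [/\ (a < M)%N, (b < M)%N & Q a b]) ->
  exists a b, [/\ (a < M)%N, (b < M)%N, Q a b &
    forall c d, c \in on_vertex a b -> (c < M)%N -> (d < M)%N -> Q c d ->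
      t c (if c == a then b else a) <= t c d].
Proof.
elim: M Q => [|M IH] Q symQ okQ closQ [a0 [b0 [a0M b0M Qab0]]]; first by [].
have [[a [b [aM bM Qab lab_ab]]]|noL] :
    (exists a b, [/\ (a < M)%N, (b < M)%N, Q a b & left_of M a b && (M \in lab)]) \/
    (forall a b, (a < M)%N -> (b < M)%N -> Q a b -> M \in lab -> ~~ left_of M a b).
  have [/hasP[a sa /hasP[b sb /andP[h1 h2]]]|/hasPn h] :=
    boolP (has (fun a => has (fun b => Q a b && (left_of M a b && (M \in lab))) (iota 0 M)) (iota 0 M)).
    by left; exists a, b; rewrite h1 h2; move: sa sb; rewrite !mem_iota /= !add0n => -> ->.
  right=> a b aM bM Qab lM; apply/negP => lft; have := h a; rewrite mem_iota => /(_ aM) /hasPn/(_ b).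
  by rewrite mem_iota => /(_ bM); rewrite Qab lft lM.
- case/andP: lab_ab => lab_ab labM.
  pose Q' a b := [&& (a < M)%N, (b < M)%N, Q a b & left_of M a b].
  have closQ' x y z : Q' x y -> ok x z -> t x z = t x y -> (z < M)%N -> Q' x z.
    case/and4P=> xM yM Qxy Lxy xz e zM; rewrite /Q' xM zM (closQ _ _ _ Qxy) // 1?ltnW //=.
    by rewrite -(left_of_closed _ _ _ _ _ _ e) // okQ.
  have symQ' : symmetric Q' by move=> x y; rewrite /Q' symQ left_ofC andbCA.
  have okQ' x y : Q' x y -> ok x y by case/and4P=> _ _ /okQ.
  have [//|a1 [b1 [a1M b1M Q1 min1]]] := IH Q' symQ' okQ' closQ'.
    by exists a, b; rewrite /Q' aM bM Qab.
  have [_ _ Q1' L1] := and4P Q1; have ok1 := okQ _ _ Q1'.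
  exists a1, b1; rewrite !ltnS (ltnW a1M) (ltnW b1M); split=> // c d cV cM dM Qcd.
  have cltM : (c < M)%N.
    move: cM; rewrite ltnS leq_eqVlt => /orP[/eqP e|//].
    move: cV; rewrite e => /(on_vertexP _ ok1)[e1|[ok1M eM]]; first by rewrite e1 ltnn in a1M.
    move: L1; rewrite left_ofE //; have [_ _ /negbTE->] := and3P ok1M.
    by rewrite eM ltxx.
  have Qcv : Q' c (if c == a1 then b1 else a1).
    case: ifP => [/eqP->//|/eqP ca]; rewrite symQ'.
    by case/(on_vertexP _ ok1): cV => [//|[ac e]]; apply: closQ' Q1 ac e _.
  set v := (if _ then _ else _) in Qcv *.
  have [_ vM _ Lcv] := and4P Qcv; move: Lcv; rewrite left_ofE ?okQ' // => Lcv.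
  move: dM; rewrite ltnS leq_eqVlt => /orP[/eqP e|dM].
    move: Lcv; rewrite e in Qcd *; have [_ _ /negbTE->] := and3P (okQ _ _ Qcd); exact: ltW.
  have [L|L] := boolP (left_of M c d); first by apply: min1; rewrite ?/Q' ?cltM ?dM ?Qcd.
  move: L; rewrite left_ofE ?okQ //; case: ifP Lcv => // _ lt; rewrite -leNgt => /(lt_le_trans lt).
  exact: ltW.
have [/existsP[a0' Qa0]|/existsPn noM] := boolP [exists a : 'I_M, Q a M].
  have [a Qa mina] := @arg_minP _ _ _ a0' (fun a : 'I_M => Q a M) (fun a : 'I_M => t M a) Qa0.
  have okaM := okQ _ _ Qa; have [_ labM caM] := and3P okaM.
  exists a, M; rewrite ltnS ltnW // ltnS leqnn; split=> // c d cV cM dM Qcd.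
  have okcd := okQ _ _ Qcd.
  have MV : M \in on_vertex a M by apply/(on_vertexP _ okaM); right.
  have aV : (a : nat) \in on_vertex a M by apply/(on_vertexP _ okaM); left.
  have ev : c != M -> t c (if c == a then M else a) = t c M.
    move=> cM'; case: ifP => [_//|/negbT ca]; apply/eqP; rewrite (on_vertex_eq okaM) //.
    by rewrite (on_vertex_ok okaM).
  have [ecM|cM'] := eqVneq c M.
    have dM' : (d < M)%N by move: (ok_neq okcd) dM; rewrite ecM; clear; lia.
    have -> : (c == a) = false by apply/negbTE; rewrite ecM neq_ltn ltn_ord orbT.
    by rewrite ecM in Qcd *; apply: (mina (Ordinal dM')); rewrite symQ.
  rewrite ev //.
  have cM'' := on_vertex_ok okaM cV MV cM'.
  move: dM; rewrite ltnS leq_eqVlt => /orP[/eqP->//|dM].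
  have cltM : (c < M)%N by move: cM cM'; clear; lia.
  have := noL c d cltM dM Qcd labM; rewrite left_ofE //.
  by have [_ _ /negbTE->] := and3P cM''; rewrite -leNgt.
have noM' c : Q c M -> (c < M)%N -> False by move=> Qc cM; have := noM (Ordinal cM); rewrite Qc.
pose Q' a b := [&& (a < M)%N, (b < M)%N & Q a b].
have [||a b c /and3P[aM bM Qab] ac e cM||a1 [b1 [a1M b1M /and3P[_ _ Q1] min1]]] := IH Q'.
- by move=> x y; rewrite /Q' symQ andbCA.
- by move=> x y /and3P[_ _ /okQ].
- by rewrite /Q' aM cM (closQ _ _ _ Qab) // ltnW.
- have ltS (x : nat) : (x < M.+1)%N -> x = M \/ (x < M)%N.
    by rewrite ltnS leq_eqVlt => /orP[/eqP|]; [left|right].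
  exists a0, b0; case: (ltS _ a0M) (ltS _ b0M) => [e|lt1] [e2|lt2].
  + by move: (ok_neq (okQ _ _ Qab0)); rewrite e e2 eqxx.
  + by rewrite e symQ in Qab0; case: (noM' _ Qab0 lt2).
  + by rewrite e2 in Qab0; case: (noM' _ Qab0 lt1).
  by rewrite /Q' lt1 lt2 Qab0.
have ok1 := okQ _ _ Q1.
exists a1, b1; rewrite !ltnS (ltnW a1M) (ltnW b1M); split=> // c d cV cM dM Qcd.
have cltM : (c < M)%N.
  move: cM; rewrite ltnS leq_eqVlt => /orP[/eqP e|//].
  move: cV; rewrite e => /(on_vertexP _ ok1)[e1|[ok1M eM]]; first by rewrite e1 ltnn in a1M.
  by case: (@noM' a1 (closQ _ _ _ Q1 ok1M eM (ltnSn _)) a1M).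
move: dM; rewrite ltnS leq_eqVlt => /orP[/eqP e|dM].
  by rewrite e in Qcd; case: (noM' _ Qcd cltM).
by apply: min1 => //; rewrite /Q' cltM dM.
Qed.
End MinimalPair.

Record vertex (V : seq nat) : Prop := Vertex {
  vertex_sorted : sorted ltn V;
  vertex_size : size V = 2%N \/ size V = 3%N;
  vertex_ok : forall a b, a \in V -> b \in V -> a != b -> ok a b;
  vertex_eq : forall a b x, a \in V -> b \in V -> a != b -> ok a x ->
    (t a x == t a b) = (x \in V) }.

Lemma on_vertex_vertex a b : ok a b -> vertex (on_vertex a b).
Proof.
move=> ab; split.
- by apply: sorted_filter; [exact: ltn_trans|].
- have aV : a \in on_vertex a b by apply/(on_vertexP _ ab); left.
  have bV : b \in on_vertex a b by apply/(on_vertexP _ ab); right.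
  have u : uniq [:: a; b] by rewrite /= inE (ok_neq ab).
  have h : {subset [:: a; b] <= on_vertex a b} by move=> x; rewrite !inE => /orP[]/eqP->.
  by have := simple_vertices ab; have := uniq_leq_size u h; rewrite /=; clear; lia.
- by move=> x y; exact: on_vertex_ok.
by move=> x y z xV yV xy xz; exact: (on_vertex_eq ab).
Qed.

Record available (sw : rel nat) (V : seq nat) : Prop := Available {
  avail_vertex : vertex V;
  avail_unswept : forall a b, a \in V -> b \in V -> a != b -> ~~ sw a b;
  avail_before : forall a b x, a \in V -> b \in V -> a != b -> ok a x ->
    t a x < t a b -> sw a x }.

Record swept (sw : rel nat) : Prop := Swept {
  swept_sym : symmetric sw;
  swept_ok : forall a b, sw a b -> ok a b;
  swept_closed : forall a b c, sw a b -> ok a c -> t a c <= t a b -> sw a c }.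

(** The order of the wires on the sweep line: labels ascend at the start, and two wires of different
    classes change places when their crossing is swept. *)
Definition bef (sw : rel nat) a b := if a./2 == b./2 then (a < b)%N else (a < b)%N (+) sw a b.

(** * Available vertices and the reversal of a block of wires *)

Section Swept.
Variable sw : rel nat.
Hypothesis swP : swept sw.

(** A minimal unswept crossing in the sense of [minimal_pair] is available, because whatever
    precedes it on one of its lines has been swept. All labels are below [12]. *)
Lemma available_exists a b : ok a b -> ~~ sw a b -> exists V, available sw V.
Proof.
move=> ab nab; pose Q x y := ok x y && ~~ sw x y.
have symsw := swept_sym swP.
have symQ : symmetric Q by move=> x y; rewrite /Q ok_sym symsw.
have closQ x y z : Q x y -> ok x z -> t x z = t x y -> Q x z.
  case/andP=> xy nxy xz e; rewrite /Q xz; apply: contra nxy => h.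
  by apply: (swept_closed swP) h xy _; rewrite e.
have lt12 x y : ok x y -> (x < 12)%N by case/and3P; rewrite mem_lab; lia.
have [|x y z Qxy xz e _|//|a1 [b1 [_ _ Q1 min1]]] := @minimal_pair 12 Q symQ.
- by move=> x y /andP[].
- exact: closQ Qxy xz e.
- by exists a, b; rewrite (lt12 a b) // (lt12 b a) 1?ok_sym // /Q ab nab.
have [ok1 _] := andP Q1; have V1 := on_vertex_vertex ok1.
have aV : a1 \in on_vertex a1 b1 by apply/(on_vertexP _ ok1); left.
have bV : b1 \in on_vertex a1 b1 by apply/(on_vertexP _ ok1); right.
have ev c : c \in on_vertex a1 b1 -> let v := if c == a1 then b1 else a1 in
    [/\ v \in on_vertex a1 b1, c != v & Q c v].
  move=> cV; rewrite /=; case: eqP => [->|/eqP ca]; first by rewrite bV (ok_neq ok1).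
  rewrite aV ca; split=> //; rewrite symQ.
  case/(on_vertexP _ ok1): cV => [e|[ac e]]; first by rewrite e eqxx in ca.
  exact: closQ Q1 ac e.
exists (on_vertex a1 b1); split=> // c d.
  move=> cV dV cd; have [vV cv Qcv] := ev c cV.
  have okcd := on_vertex_ok ok1 cV dV cd.
  suff /andP[] : Q c d by [].
  by apply: (closQ _ _ _ Qcv okcd); apply/eqP; rewrite (vertex_eq V1 cV vV cv okcd).
move=> x cV dV cd cx lt; have [vV cv Qcv] := ev c cV.
apply/negPn/negP => nsw.
have Qcx : Q c x by rewrite /Q cx nsw.
have := min1 c x cV (lt12 _ _ cx) (lt12 x c ltac:(by rewrite ok_sym)) Qcx.
have -> : t c (if c == a1 then b1 else a1) = t c d.
  by apply/eqP; rewrite (vertex_eq V1) //; have [] := andP Qcv.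
by rewrite leNgt lt.
Qed.

Variable V : seq nat.
Hypothesis availV : available sw V.

Let vtx := avail_vertex availV.

Lemma bef_vertex a b : a \in V -> b \in V -> a != b -> bef sw a b = (a < b)%N.
Proof.
move=> aV bV ab; have [_ _ /negbTE h] := and3P (vertex_ok vtx aV bV ab).
by rewrite /bef h (negbTE (avail_unswept availV aV bV ab)) addbF.
Qed.

(** A wire [x] between two wires of an available vertex would have to cross one of them before the
    vertex and still be unswept, or be swept too early, or pass through the vertex itself. The
    signotope rule excludes each case; if [x] is parallel to [a] or [z], [par] takes its place. *)
Lemma nothing_between a z x : a \in V -> z \in V -> (a < z)%N -> x \in lab ->
  x \notin V -> bef sw a x -> bef sw x z -> False.
Proof.
move=> aV zV az lx xV; have naz : a != z by rewrite neq_ltn az.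
have okaz := vertex_ok vtx aV zV naz; have [la lz caz] := and3P okaz.
have okza : ok z a by rewrite ok_sym.
have nxa : x != a by apply: contraNneq xV => ->.
have nxz : x != z by apply: contraNneq xV => ->.
have nza : z != a by rewrite eq_sym.
have sym := swept_sym swP.
have half_le (i j : nat) : (i <= j)%N -> (i./2 <= j./2)%N by clear; lia.
rewrite /bef.
have [cax|cax] := eqVneq a./2 x./2.
  move=> ax; rewrite ifN; last by rewrite -cax.
  have xz : (x < z)%N.
    by have := half_le a z (ltnW az); move: caz; rewrite cax; clear; lia.
  rewrite xz /= => nxw.
  have := par ax cax okaz lx; rewrite az => lt.
  have zx : ok z x by rewrite /ok lz lx -cax eq_sym.
  by have := avail_before availV zV aV nza zx lt; rewrite sym (negbTE nxw).
have okax : ok a x by rewrite /ok la lx.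
have [cxz|cxz] := eqVneq x./2 z./2.
  move=> + xz; have ax : (a < x)%N.
    by have := half_le a z (ltnW az); move: caz; rewrite -cxz; clear; lia.
  rewrite ax /= => nxw.
  have xa : ok x a by rewrite ok_sym.
  have := par xz cxz xa lz; rewrite ifN; last by rewrite -leqNgt ltnW.
  by move=> lt; have := avail_before availV aV zV naz okax lt; rewrite (negbTE nxw).
have okxz : ok x z by rewrite /ok lx lz.
have okxa : ok x a by rewrite ok_sym.
have okzx : ok z x by rewrite ok_sym.
have [xa|ax] : (x < a)%N \/ (a < x)%N by move: nxa; rewrite neq_ltn => /orP.
  have xz := ltn_trans xa az.
  rewrite ltnNge (ltnW xa) xz /= => sax nsxz.
  have lt : t x a < t x z.
    rewrite ltNge; apply: contra nsxz => le.
    by apply: (swept_closed swP) okxz le; rewrite sym.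
  have [e1 e2 _ _] := sgn okxa okaz okxz ltac:(by rewrite xa az).
  by have := avail_before availV zV aV nza okzx; rewrite -e2 e1 -e1 lt sym (negbTE nsxz) => /(_ isT).
rewrite ax /= => nax.
have [xz|zx] : (x < z)%N \/ (z < x)%N by move: nxz; rewrite neq_ltn => /orP.
  rewrite xz /= => nxz'.
  have le1 : t a z <= t a x.
    by rewrite leNgt; apply: contra nax => /(avail_before availV aV zV naz okax).
  have le2 : t z a <= t z x.
    by rewrite leNgt; rewrite sym in nxz'; apply: contra nxz' => /(avail_before availV zV aV nza okzx).
  have [_ e2 _ e4] := sgn okax okxz okaz ltac:(by rewrite ax xz).
  case/negP: xV; rewrite -(vertex_eq vtx aV zV naz okax) eq_le le1 andbT.
  by rewrite leNgt e4 -leNgt.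
rewrite ltnNge (ltnW zx) /= => sxz.
have lt : t x z < t x a.
  rewrite ltNge; apply: contra nax => le; rewrite sym.
  exact: (swept_closed swP) sxz okxa le.
have [_ _ e3 e4] := sgn okaz okzx okax ltac:(by rewrite az zx).
by have := avail_before availV aV zV naz okax; rewrite e4 lt (negbTE nax) => /(_ isT).
Qed.

Lemma contiguous s : perm_eq s lab -> pairwise (bef sw) s ->
  exists l r, s = l ++ V ++ r.
Proof.
move=> ps pw; have us : uniq s by rewrite (perm_uniq ps).
have asym : {in s &, forall x y, bef sw x y -> ~~ bef sw y x}.
  move=> x y _ _; rewrite /bef eq_sym (swept_sym swP y x).
  case: eqP => [_|h]; first by rewrite -leqNgt => /ltnW.
  have xy : x <> y by move=> e; apply: h; rewrite e.
  by case: (ltngtP x y) xy => // _ _; case: (sw x y).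
have Vs : {subset V <= s}.
  move=> x xV; rewrite (perm_mem ps).
  have [y yV xy] : exists2 y, y \in V & x != y.
    case: (vertex_size vtx) (vertex_sorted vtx) xV; case: V => [|a [|b V']] //= _ /andP[ab _] _;
      have [->|h] := eqVneq x a; by [exists b; rewrite ?inE ?eqxx ?orbT // neq_ltn ab|exists a; rewrite ?inE ?eqxx].
  by have /and3P[] := vertex_ok vtx xV yV xy.
have btw a z x : a \in V -> z \in V -> (a < z)%N -> x \in s -> bef sw a x -> bef sw x z ->
    [/\ x \in V, (a < x)%N & (x < z)%N].
  move=> aV zV az xs ax xz; have [xV|xV] := boolP (x \in V); last first.
    by case: (nothing_between aV zV az _ xV ax xz); rewrite -(perm_mem ps).
  have nax : a != x by apply: contraTneq ax => <-; rewrite /bef eqxx ltnn.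
  have nxz : x != z by apply: contraTneq xz => <-; rewrite /bef eqxx ltnn.
  by rewrite -(bef_vertex aV xV nax) -(bef_vertex xV zV nxz).
case: (vertex_size vtx) (vertex_sorted vtx); have := Vs; move: btw; have := bef_vertex.
  case: V => [|a [|b []]] // bV btw VS _ /=; rewrite andbT => ab.
  have [|||x xs ax xb|l [m e]] := @adjacent_split _ (bef sw) s a b pw asym.
  - by apply: VS; rewrite inE eqxx.
  - by apply: VS; rewrite !inE eqxx orbT.
  - by rewrite bV ?inE ?eqxx ?orbT // neq_ltn ab.
  - have := btw a b x; rewrite !inE !eqxx orbT => /(_ isT isT ab xs ax xb)[/orP[]/eqP-> ];
      by rewrite ltnn.
  by exists l, m.
case: V => [|a [|b [|c []]]] // bV btw VS _ /= /and3P[ab bc _].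
have ac := ltn_trans ab bc.
have [|||x xs ax xb|l [m e]] := @adjacent_split _ (bef sw) s a b pw asym.
- by apply: VS; rewrite inE eqxx.
- by apply: VS; rewrite !inE eqxx orbT.
- by rewrite bV ?inE ?eqxx ?orbT // neq_ltn ab.
- have := btw a b x; rewrite !inE !eqxx orbT => /(_ isT isT ab xs ax xb)[/or3P[]/eqP-> ];
      rewrite ?ltnn // => _; lia.
have sub : {subset b :: m <= s} by move=> x; rewrite e mem_cat !inE => h; rewrite h !orbT.
have cm : c \in b :: m.
  have : c \in s by apply: VS; rewrite !inE eqxx !orbT.
  rewrite e mem_cat in_cons => /or3P[cl|/eqP eca|//]; last by lia.
  have : bef sw a c by rewrite bV ?inE ?eqxx ?orbT // neq_ltn ac.
  move: pw; rewrite e pairwise_cat => /andP[/allrelP h _].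
  have /asym : bef sw c a by apply: h => //; rewrite inE eqxx.
  rewrite e !mem_cat cl !inE eqxx orbT => /(_ isT isT) h1 h2; by rewrite h2 in h1.
have [|||||x xs bx xc|l' [m' e']] := @adjacent_split _ (bef sw) (b :: m) b c.
- by move: pw; rewrite e pairwise_cat /= => /and4P[].
- by move=> x y /sub xs /sub ys; apply: asym.
- by rewrite inE eqxx.
- exact: cm.
- by rewrite bV ?inE ?eqxx ?orbT // neq_ltn bc.
- have := btw b c x; rewrite !inE !eqxx !orbT => /(_ isT isT bc (sub _ xs) bx xc)[/or3P[]/eqP-> ];
      rewrite ?ltnn //; lia.
case: l' e' => [|y l'] e'; first by case: e' => em; exists l, m'; rewrite e em.
case: e' => eb em.
by move: us; rewrite e cat_uniq /= em mem_cat !inE eqxx !orbT !andbF.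
Qed.

Lemma avail_uniq : uniq V.
Proof. by apply: sorted_uniq (vertex_sorted vtx); [exact: ltn_trans|exact: ltnn]. Qed.

Definition sweep_vertex a b := sw a b || [&& a \in V, b \in V & a != b].

Lemma flip_swept : swept sweep_vertex.
Proof.
split.
- by move=> a b; rewrite /sweep_vertex (swept_sym swP) eq_sym andbCA.
- by move=> a b /orP[/(swept_ok swP)//|/and3P[]]; exact: (vertex_ok vtx).
move=> a b c /orP[sab ac le|/and3P[aV bV ab] ac]; first by rewrite /sweep_vertex (swept_closed swP sab).
rewrite le_eqVlt => /orP[e|lt]; last by rewrite /sweep_vertex (avail_before availV aV bV ab ac lt).
by rewrite /sweep_vertex aV -(vertex_eq vtx aV bV ab ac) e (ok_neq ac) orbT.
Qed.

Lemma bef_flip_out a b : (a \notin V) || (b \notin V) -> bef sweep_vertex a b = bef sw a b.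
Proof. by rewrite /bef /sweep_vertex => /orP[]/negbTE->; rewrite ?andbF ?orbF. Qed.

Lemma bef_flip_in a b : a \in V -> b \in V -> a != b -> bef sweep_vertex a b = (b < a)%N.
Proof.
move=> aV bV ab; have [_ _ /negbTE h] := and3P (vertex_ok vtx aV bV ab).
by rewrite /bef h /sweep_vertex aV bV ab orbT addbT -leqNgt leq_eqVlt eq_sym (negbTE ab).
Qed.

Lemma flip_pairwise l r : uniq (l ++ V ++ r) -> pairwise (bef sw) (l ++ V ++ r) ->
  pairwise (bef sweep_vertex) (l ++ rev V ++ r).
Proof.
rewrite !cat_uniq => /and5P[_ /hasPn lVr _ /hasPn Vr _].
have lV x : x \in l -> x \notin V.
  by move=> xl; apply: contraL xl => xV; apply: lVr; rewrite mem_cat xV.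
rewrite !pairwise_cat => /and5P[/allrelP h1 h2 /allrelP h3 _ h5].
apply/and5P; split.
- apply/allrelP => x y xl yr; have xV := lV _ xl.
  rewrite bef_flip_out ?xV //; apply: h1 => //; move: yr.
  by rewrite !mem_cat mem_rev.
- apply: (sub_in_pairwise (P := [in l])) h2; last by apply/allP.
  by move=> x y /lV xV _; rewrite bef_flip_out ?xV.
- apply/allrelP => x y; rewrite mem_rev => xV yr.
  by rewrite bef_flip_out ?(Vr _ yr) ?orbT //; exact: h3.
- have sub : {in V &, forall x y, (y < x)%N -> bef sweep_vertex x y}.
    by move=> x y xV yV lt; rewrite bef_flip_in // neq_ltn lt orbT.
  apply: (sub_in_pairwise (P := [in V]) (r := fun x y => (y < x)%N)) => //.
    by apply/allP => x; rewrite mem_rev.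
  rewrite -sorted_pairwise ?rev_sorted ?(vertex_sorted vtx) //.
  by move=> x y z /= xy yz; exact: ltn_trans yz xy.
- apply: (sub_in_pairwise (P := [in r])) h5; last by apply/allP.
  by move=> x y /Vr xV _; rewrite bef_flip_out ?xV.
Qed.

End Swept.

(** A vertex that becomes available by sweeping [V] shares a wire with [V], and the wires of [V]
    keep the positions from [size l] on. Its wires being consecutive, it starts at most
    [(size W).-1] places to the left. A vertex disjoint from [V] was available before and is covered
    by the hypothesis that [V] is leftmost. *)
Lemma flip_available sw (swP : swept sw) V (availV : available sw V) l r W :
  perm_eq (l ++ V ++ r) lab -> pairwise (bef sw) (l ++ V ++ r) ->
  (forall W, available sw W -> (size l <= index (head 0%N W) (l ++ V ++ r))%N) ->
  available (sweep_vertex sw V) W ->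
  (size l <= index (head 0%N W) (l ++ rev V ++ r) + (size W).-1)%N.
Proof.
move=> ps pw ptr aW; have us : uniq (l ++ V ++ r) by rewrite (perm_uniq ps).
have ps' : perm_eq (l ++ rev V ++ r) lab.
  by apply: perm_trans ps; rewrite perm_cat2l perm_cat2r perm_rev.
have us' : uniq (l ++ rev V ++ r) by rewrite (perm_uniq ps').
have hW : head 0%N W \in W.
  by case: (vertex_size (avail_vertex aW)); case: (W) => //= a W' _; rewrite inE eqxx.
have [/hasP[c cW cV]|/hasPn nWV] := boolP (has (mem V) W).
  have [l1 [r1 e]] := contiguous (flip_swept swP availV) aW ps' (flip_pairwise availV us pw).
  have hl1 x : x \in W -> x \notin l1.
    move: us'; rewrite e cat_uniq => /and3P[_ /hasPn h _] xW.
    by apply: h; rewrite mem_cat xW.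
  have cl : c \notin l.
    move: us; rewrite cat_uniq => /and3P[_ /hasPn h _].
    by apply: h; rewrite mem_cat [_ \in V]cV.
  have : (size l <= index c (l ++ rev V ++ r))%N by rewrite index_cat (negbTE cl) leq_addr.
  rewrite e !index_cat !(negbTE (hl1 _ _)) // cW hW.
  have := cW; rewrite -index_mem; case: (W) hW => //= a W' _; rewrite eqxx; clear; lia.
have aW' : available sw W.
  split; first exact: (avail_vertex aW).
    by move=> a b aI bI ab; have := avail_unswept aW aI bI ab; rewrite negb_or => /andP[].
  move=> a b x aI bI ab ax lt; have := avail_before aW aI bI ab ax lt.
  by have aV : a \notin V := nWV _ aI; rewrite /sweep_vertex (negbTE aV) orbF.
have hV := nWV _ hW; move: (ptr _ aW'); rewrite !index_cat mem_rev /= in hV *.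
by rewrite (negbTE hV) size_rev; case: ifP => // _; clear; lia.
Qed.

Definition dbl i j := ok i j && all (fun x => ok i x ==> (t i x == t i j) ==> (x == j)) lab.

Definition rem sw i := (\sum_(j <- lab) (dbl i j && ~~ sw i j)%B)%N.

Lemma dbl_vertex V a b : vertex V -> a \in V -> b \in V -> a != b ->
  dbl a b = (size V == 2%N).
Proof.
move=> vtx aV bV ab; rewrite /dbl (vertex_ok vtx aV bV ab) andTb.
have uV : uniq V by apply: sorted_uniq (vertex_sorted vtx); [exact: ltn_trans|exact: ltnn].
apply/allP/eqP => [h|sV].
  case: (vertex_size vtx) => // sV; have uab : uniq [:: a; b] by rewrite /= inE ab.
  have [x xV xab] : exists2 x, x \in V & x \notin [:: a; b].
    apply/hasP/negPn; apply/negP => /hasPn hh.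
    have : {subset V <= [:: a; b]} by move=> x /hh; rewrite negbK.
    by move/(uniq_leq_size uV); rewrite sV.
  move: xab; rewrite !inE negb_or => /andP[xa xb].
  have ax : ok a x by apply: (vertex_ok vtx) => //; rewrite eq_sym.
  have [_ lx _] := and3P ax; have := h x lx; rewrite ax (vertex_eq vtx aV bV ab ax) xV /=.
  by rewrite (negbTE xb).
move=> x lx; apply/implyP => ax; apply/implyP; rewrite (vertex_eq vtx aV bV ab ax) => xV.
apply/negPn/negP => xb.
have u3 : uniq [:: a; b; x] by rewrite /= !inE negb_or ab (ok_neq ax) eq_sym xb.
have : {subset [:: a; b; x] <= V} by move=> y; rewrite !inE => /or3P[]/eqP->.
by move/(uniq_leq_size u3); rewrite sV.
Qed.

Lemma rem_flip sw V i : available sw V ->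
  rem sw i = (rem (sweep_vertex sw V) i + ((i \in V) && (size V == 2)))%N.
Proof.
move=> availV; have vtx := avail_vertex availV.
have [iV|iV] := boolP (i \in V); last first.
  by rewrite addn0; apply: eq_bigr => j _; rewrite /sweep_vertex (negbTE iV) orbF.
case: (vertex_size vtx) => sV; rewrite sV /=; last first.
  rewrite addn0; apply: eq_bigr => j _; rewrite /sweep_vertex iV /=.
  case: (boolP (j \in V)) => jV; rewrite ?orbF //=.
  have [e|ij] := eqVneq i j; first by rewrite orbF.
  by rewrite (dbl_vertex vtx) // sV.
have [j jV ij] : exists2 j, j \in V & i != j.
  apply/hasP/negPn; apply/negP => /hasPn hh.
  have sub : {subset V <= [:: i]} by move=> x /hh; rewrite negbK inE eq_sym.
  by have := uniq_leq_size (avail_uniq availV) sub; rewrite sV.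
have lj : j \in lab by have /and3P[] := vertex_ok vtx iV jV ij.
rewrite /rem !(bigD1_seq j lj (iota_uniq _ _)) /=.
rewrite (dbl_vertex vtx iV jV ij) sV (avail_unswept availV iV jV ij) /sweep_vertex iV jV ij orbT /=.
rewrite add0n addnC; congr (_ + _)%N; apply: eq_bigr => k kj.
have -> // : (k \in V) && (i != k) = false; last by rewrite orbF.
apply/negbTE/negP => /andP[kV ik].
have u3 : uniq [:: i; j; k] by rewrite /= !inE negb_or ij ik eq_sym kj.
have : {subset [:: i; j; k] <= V} by move=> y; rewrite !inE => /or3P[]/eqP->.
by move/(uniq_leq_size u3); rewrite sV.
Qed.

(** * The search follows the sweep of every arrangement *)

Section Soundness.
Variable TS : seq triple.
Hypothesis mem_TS : forall a b c, ((a, b, c) \in TS) =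
  [&& (a < b < c)%N, ok a b, ok b c, ok a c & t a b == t a c].
Hypotheses (uniq_TS : uniq TS) (size_TS : size TS = 14%N).

Local Notation ids lrev right := (map wire_id (rev lrev ++ right)).

Definition wire_ok sw w :=
  (wire_class w == (wire_id w)./2) && (wire_par w == ~~ odd (rem sw (wire_id w))).

(** The invariant tying a state of the search to a set [sw] of swept crossings. In [state_nd] the
    number [nd] is doubled since [rem] meets every double point on both of its lines. [state_ptr]
    says that no available vertex starts in front of the pointer and, unless [fresh], that no double
    one starts at the pointer. *)
Record state_ok lrev right fresh nd nt slack (tr : seq triple) sw : Prop := StateOk {
  state_swept : swept sw;
  state_perm : perm_eq (ids lrev right) lab;
  state_sorted : pairwise (bef sw) (ids lrev right);
  state_wires : all (wire_ok sw) (rev lrev ++ right);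
  state_nd : nd.*2 = (\sum_(i <- lab) rem sw i)%N;
  state_slack : slack = (\sum_(i <- lab) (rem sw i)./2)%N;
  state_nt : (nt + size tr)%N = 14%N;
  state_uniq : uniq tr;
  state_tr : forall T, (T \in tr) = (T \in TS) && sw T.1.1 T.1.2;
  state_ptr : forall W, available sw W ->
    (size lrev + (~~ fresh && (size W == 2)) <= index (head 0%N W) (ids lrev right))%N }.

Definition back_left (l : seq wire) := if l is _ :: _ :: l' then l' else [::].
Definition back_right (l r : seq wire) :=
  match l with a :: b :: _ => b :: a :: r | [:: a] => a :: r | [::] => r end.

Lemma backE l r : rev (back_left l) ++ back_right l r = rev l ++ r.
Proof.
case: l => [|a [|b l]] //=.
by rewrite !rev_cons !cat_rcons.
Qed.

Lemma size_back l : size (back_left l) = (size l - 2)%N.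
Proof. by case: l => [|a [|b l]] //=; rewrite !subSS subn0. Qed.

Lemma ltbE m n : Nat.ltb m n = (m < n)%N.
Proof. by apply/idP/idP => [/PeanoNat.Nat.ltb_lt/ssrnat.ltP|/ssrnat.ltP/PeanoNat.Nat.ltb_lt]. Qed.

Section Unfold.
Variables (fuel : nat) (lrev r : seq wire) (nd nt slack : nat) (tr : seq triple).

Lemma sweep_pass w r' fresh : (0 < nd + nt)%N -> r = w :: r' -> (1 < size r)%N ->
  {subset sweep fuel (w :: lrev) r' true nd nt slack tr
     <= sweep fuel.+1 lrev r fresh nd nt slack tr}.
Proof.
move=> pos -> sz T; case: r' w sz => [|[c2 i2 p2] r'] [c1 i1 p1] //= _ h.
by case: nd pos h => [|nd']; case: nt => [|nt'] //= _ h; rewrite mem_cat h.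
Qed.

Lemma sweep_double c1 i1 p1 c2 i2 p2 : (c1 < c2)%N ->
  {subset sweep fuel (back_left lrev) (back_right lrev (Wire c2 i2 (~~ p2) :: Wire c1 i1 (~~ p1) :: r))
     (size lrev < 2)%N nd nt slack tr
   <= sweep fuel.+1 lrev (Wire c1 i1 p1 :: Wire c2 i2 p2 :: r) true nd.+1 nt (p1 + p2 + slack)%N tr}.
Proof.
move=> lt T h; rewrite /= ltbE lt !mem_cat; apply/orP; right; apply/orP; left.
by case: p1 p2 h => [] [] h; rewrite /= ?addn0 ?add0n ?add1n; case: lrev h => [|a [|b l]].
Qed.

Lemma sweep_triple c1 i1 p1 c2 i2 p2 c3 i3 p3 fresh : (c1 < c2 < c3)%N ->
  {subset sweep fuel (back_left lrev)
     (back_right lrev (Wire c3 i3 p3 :: Wire c2 i2 p2 :: Wire c1 i1 p1 :: r))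
     (size lrev < 2)%N nd nt slack ((i1, i2, i3) :: tr)
   <= sweep fuel.+1 lrev (Wire c1 i1 p1 :: Wire c2 i2 p2 :: Wire c3 i3 p3 :: r) fresh nd nt.+1 slack tr}.
Proof.
move=> /andP[lt1 lt2] T h.
case: nd h => [|nd'] h; rewrite /= !ltbE lt1 lt2 !mem_cat; apply/orP; right;
  apply/orP; right; by case: lrev h => [|a [|b l]].
Qed.

End Unfold.

(** The outcome [[::]] marks exhausted fuel. Admitting it here takes the place of a termination
    argument, since [leaf_ok] rejects it for every actual outcome. *)
Definition good (s : seq (seq triple)) := exists2 T, T \in s & T = [::] \/ T =i TS.

Lemma sub_good s1 s2 : {subset s1 <= s2} -> good s1 -> good s2.
Proof. by move=> sub [T /sub Ts h]; exists T. Qed.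

Lemma state_pass w lrev right fresh nd nt slack tr sw :
  state_ok lrev (w :: right) fresh nd nt slack tr sw ->
  (forall W, available sw W -> size lrev != index (head 0%N W) (ids lrev (w :: right))) ->
  state_ok (w :: lrev) right true nd nt slack tr sw.
Proof.
case=> sP pP wP aP ndP slP ntP uP trP ptP npt.
split=> //; rewrite ?rev_cons ?cat_rcons //.
move=> W aW; have := npt W aW; have := ptP W aW; rewrite /= addn0.
move: (index _ _) (~~ fresh && _) => i b; clear; lia.
Qed.

Lemma state_flip lrev right fresh nd nt slack tr sw vs vs' r V nd' nt' slack' tr' :
  state_ok lrev right fresh nd nt slack tr sw -> available sw V ->
  right = vs ++ r -> map wire_id vs = V -> map wire_id vs' = rev V ->
  all (wire_ok (sweep_vertex sw V)) vs' ->
  nd'.*2 = (\sum_(i <- lab) rem (sweep_vertex sw V) i)%N ->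
  slack' = (\sum_(i <- lab) (rem (sweep_vertex sw V) i)./2)%N ->
  (nt' + size tr')%N = 14%N -> uniq tr' ->
  (forall T, (T \in tr') = (T \in TS) && sweep_vertex sw V T.1.1 T.1.2) ->
  state_ok (back_left lrev) (back_right lrev (vs' ++ r)) (size lrev < 2)%N nd' nt' slack' tr' (sweep_vertex sw V).
Proof.
case=> sP pP wP aP ndP slP ntP uP trP ptP aV er ev ev' okv ndP' slP' ntP' uP' trP'.
rewrite er in pP wP aP ptP.
have idsE : ids (back_left lrev) (back_right lrev (vs' ++ r)) =
    map wire_id (rev lrev) ++ rev V ++ map wire_id r.
  by rewrite backE !map_cat ev'.
have idsE0 : ids lrev (vs ++ r) = map wire_id (rev lrev) ++ V ++ map wire_id r.
  by rewrite !map_cat ev.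
rewrite idsE0 in pP wP ptP.
have us : uniq (map wire_id (rev lrev) ++ V ++ map wire_id r) by rewrite (perm_uniq pP).
split; rewrite ?idsE //.
- exact: flip_swept.
- by apply: perm_trans pP; rewrite perm_cat2l perm_cat2r perm_rev.
- exact: flip_pairwise.
- rewrite backE !all_cat okv /=; move: aP; rewrite !all_cat => /and3P[al _ ar].
  have stable w : wire_id w \notin V -> wire_ok sw w -> wire_ok (sweep_vertex sw V) w.
    by move=> wV; rewrite /wire_ok (rem_flip _ aV) (negbTE wV) addn0.
  have wkeep s : all (wire_ok sw) s -> (forall i, i \in map wire_id s -> i \notin V) ->
      all (wire_ok (sweep_vertex sw V)) s.
    elim: s => [|w s IH] //= /andP[h1 h2] h3.
    rewrite (stable w) ?h3 ?inE ?eqxx //= IH // => i h; apply: h3; by rewrite inE h orbT.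
  move: us; rewrite !cat_uniq => /and5P[_ /hasPn h1 _ /hasPn h2 _].
  rewrite (wkeep _ al) ?(wkeep _ ar) //.
  by move=> i il; apply: contraL il => iV; apply: h1; rewrite mem_cat iV.
move=> W aW; rewrite size_back.
have szl : size (map wire_id (rev lrev)) = size lrev by rewrite size_map size_rev.
(* The bound lets a new triple point start two places left of the reversed block, a new double point
   only one. Hence the pointer goes back two places with [fresh] off; with fewer than two wires in
   front of it, it stops at the left end with [fresh] on. *)
have := flip_available sP aV pP wP _ aW; rewrite szl => /(_ _)/wrap[].
  by move=> W' aW'; apply: leq_trans (ptP W' aW'); rewrite leq_addr.
have := vertex_size (avail_vertex aW).
move: (index _ _) (size W) (size lrev) => a b c; clear; case: b => [|[|[|[]]]] //=; case: ltnP => /=; lia.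
Qed.

Lemma sum_mem (V : seq nat) (f : nat -> nat) : uniq V -> {subset V <= lab} ->
  (\sum_(i <- lab) (i \in V) * f i = \sum_(i <- V) f i)%N.
Proof.
move=> uV sub; transitivity (\sum_(i <- lab | i \in V) f i)%N.
  by rewrite [RHS]big_mkcond; apply: eq_bigr => i _; rewrite mulnbl; case: ifP.
rewrite -big_filter.
apply: perm_big; apply: uniq_perm => //; first exact: filter_uniq (iota_uniq _ _).
by move=> i; rewrite mem_filter; apply/andP/idP => [[]//|iV]; split=> //; exact: sub.
Qed.

Lemma mem_TS_vertex a b c V : (a, b, c) \in TS -> vertex V -> a \in V -> b \in V ->
  V = [:: a; b; c].
Proof.
rewrite mem_TS => /and5P[/andP[ab bc] okab okbc okac e] vtx aV bV.
have cV : c \in V by rewrite -(vertex_eq vtx aV bV (ok_neq okab) okac) eq_sym.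
have uV : uniq V by apply: sorted_uniq (vertex_sorted vtx); [exact: ltn_trans|exact: ltnn].
have u3 : uniq [:: a; b; c] by rewrite /= !inE negb_or (ok_neq okab) (ok_neq okac) (ok_neq okbc).
have sub : {subset [:: a; b; c] <= V} by move=> x; rewrite !inE => /or3P[]/eqP->.
apply: (irr_sorted_eq ltn_trans ltnn (vertex_sorted vtx)); first by rewrite /= ab bc.
have [|_ eqi] := uniq_min_size u3 sub; last by move=> x; rewrite eqi.
by case: (vertex_size vtx) => ->.
Qed.

Lemma pointer_wires lrev right fresh nd nt slack tr sw V :
  state_ok lrev right fresh nd nt slack tr sw -> available sw V ->
  size lrev = index (head 0%N V) (ids lrev right) ->
  exists r, map wire_id right = V ++ r.
Proof.
case=> sP pP wP _ _ _ _ _ _ _ aV; have [l [r e]] := contiguous sP aV pP wP.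
have us : uniq (ids lrev right) by rewrite (perm_uniq pP).
rewrite e index_cat; have -> : (head 0%N V \in l) = false.
  move: us; rewrite e; case: V aV {e} => [[[_ []]]//|a V'] aV.
  rewrite cat_uniq /= negb_or => /and3P[_ /andP[h _] _]; exact/negbTE.
have -> : index (head 0%N V) (V ++ r) = 0%N.
  by case: (vertex_size (avail_vertex aV)); case: (V) => //= a V' _; rewrite eqxx.
rewrite addn0 => szl; exists r; move/eqP: e.
by rewrite map_cat eqseq_cat ?size_map ?size_rev // => /andP[_ /eqP].
Qed.

Lemma double_step lrev right fresh nd nt slack tr sw a b :
  state_ok lrev right fresh nd nt slack tr sw -> available sw [:: a; b] ->
  size lrev = index a (ids lrev right) ->
  exists c1 p1 c2 p2 r nd' slack',
    [/\ right = Wire c1 a p1 :: Wire c2 b p2 :: r, fresh, (c1 < c2)%N, nd = nd'.+1 &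
        slack = (p1 + p2 + slack')%N /\
        state_ok (back_left lrev) (back_right lrev (Wire c2 b (~~ p2) :: Wire c1 a (~~ p1) :: r))
          (size lrev < 2)%N nd' nt slack' tr (sweep_vertex sw [:: a; b])].
Proof.
move=> st aV hidx; have [r' er] := pointer_wires st aV hidx.
have vtx := avail_vertex aV.
have [sP pP wP waP ndP slP ntP uP trP ptP] := st.
case: right er st hidx pP wP waP ptP => [|[c1 i1 p1] [|[c2 i2 p2] r]] //= [-> -> er'] st hidx pP wP waP ptP.
have aI : a \in [:: a; b] by rewrite inE eqxx.
have bI : b \in [:: a; b] by rewrite !inE eqxx orbT.
have := vertex_sorted vtx; rewrite /= andbT => ab.
have nab : a != b by rewrite neq_ltn ab.
have okab := vertex_ok vtx aI bI nab; have [la lb cab] := and3P okab.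
have sub : {subset [:: a; b] <= lab} by move=> x; rewrite in_cons mem_seq1 => /orP[]/eqP->.
have remE i : rem sw i = (rem (sweep_vertex sw [:: a; b]) i + (i \in [:: a; b]))%N.
  by rewrite (rem_flip _ aV) andbT.
move: waP; rewrite all_cat /= => /and4P[_ /andP[/eqP /= ec1 /eqP /= ep1] /andP[/eqP /= ec2 /eqP /= ep2] _].
have rema := remE a; have remb := remE b; rewrite aI bI !addn1 in rema remb.
exists c1, p1, c2, p2, r, nd.-1, (\sum_(i <- lab) (rem (sweep_vertex sw [:: a; b]) i)./2)%N.
have fr : fresh.
  by have := ptP _ aV; rewrite /= -hidx; case: (fresh) => //=; rewrite addn1 ltnn.
have sumE : nd.*2 = (\sum_(i <- lab) rem (sweep_vertex sw [:: a; b]) i).+2.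
  rewrite ndP (eq_bigr _ (fun i _ => remE i)) big_split /=.
  have -> : (\sum_(i <- lab) (i \in [:: a; b]) = \sum_(i <- lab) (i \in [:: a; b]) * 1)%N.
    by apply: eq_bigr => i _; rewrite muln1.
  by rewrite (@sum_mem [:: a; b] (fun=> 1%N)) ?(avail_uniq aV) // sum1_size addn2.
have nd0 : nd = nd.-1.+1 by move: sumE; clear; lia.
split=> //; first by rewrite ec1 ec2 ltn_neqAle cab; move: ab; clear; lia.
split.
  (* Lowering an even number by one lowers its rounded half, lowering an odd number does not. So the
     sum of halves drops by the number of raised flags, that is by [p1 + p2]. *)
  rewrite slP; transitivity (\sum_(i <- lab) ((rem (sweep_vertex sw [:: a; b]) i)./2
      + (i \in [:: a; b]) * odd (rem (sweep_vertex sw [:: a; b]) i)))%N.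
    apply: eq_bigr => i _; rewrite remE; case: (i \in _); last by rewrite !addn0.
    by rewrite addn1 mul1n -uphalfE uphalf_half addnC.
  rewrite big_split addnC; congr (_ + _)%N.
  rewrite (@sum_mem [:: a; b] (fun i => odd (rem (sweep_vertex sw [:: a; b]) i))) ?(avail_uniq aV) //.
  by rewrite !big_cons big_nil addn0 ep1 ep2 rema remb /= !negbK.
apply: (state_flip st aV (vs := [:: Wire c1 a p1; Wire c2 b p2])
          (vs' := [:: Wire c2 b (~~ p2); Wire c1 a (~~ p1)])) => //.
- by rewrite /= /wire_ok /= ec1 ec2 !eqxx ep1 ep2 rema remb /= !negbK !eqxx.
- by move: sumE nd0; clear; lia.
case=> [[x y] z]; rewrite trP /=; case TP : (_ \in TS) => //=.
rewrite /sweep_vertex; case: (sw x y) => //=; apply/esym/negbTE/negP => /and3P[xV yV _].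
by have := mem_TS_vertex TP vtx xV yV.
Qed.

Lemma triple_step lrev right fresh nd nt slack tr sw a b c :
  state_ok lrev right fresh nd nt slack tr sw -> available sw [:: a; b; c] ->
  size lrev = index a (ids lrev right) ->
  exists c1 p1 c2 p2 c3 p3 r nt',
    [/\ right = Wire c1 a p1 :: Wire c2 b p2 :: Wire c3 c p3 :: r, (c1 < c2 < c3)%N, nt = nt'.+1 &
        state_ok (back_left lrev) (back_right lrev (Wire c3 c p3 :: Wire c2 b p2 :: Wire c1 a p1 :: r))
          (size lrev < 2)%N nd nt' slack ((a, b, c) :: tr) (sweep_vertex sw [:: a; b; c])].
Proof.
move=> st aV hidx; have [r' er] := pointer_wires st aV hidx.
have vtx := avail_vertex aV.
have [sP pP wP waP ndP slP ntP uP trP ptP] := st.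
case: right er st hidx pP wP waP ptP => [|[c1 i1 p1] [|[c2 i2 p2] [|[c3 i3 p3] r]]] //= [-> -> -> er'] st hidx pP wP waP ptP.
set V := [:: a; b; c] in aV vtx *.
have aI : a \in V by rewrite inE eqxx.
have bI : b \in V by rewrite !inE eqxx orbT.
have cI : c \in V by rewrite !inE eqxx !orbT.
have := vertex_sorted vtx; rewrite /= andbT => /andP[ab bc].
have ac := ltn_trans ab bc.
have [nab nbc nac] : [/\ a != b, b != c & a != c] by rewrite !neq_ltn ab bc ac.
have okab := vertex_ok vtx aI bI nab; have okbc := vertex_ok vtx bI cI nbc.
have okac := vertex_ok vtx aI cI nac.
have remE i : rem sw i = rem (sweep_vertex sw V) i by rewrite (rem_flip _ aV) andbF addn0.
have VTS : (a, b, c) \in TS.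
  by rewrite mem_TS ab bc okab okbc okac /= eq_sym (vertex_eq vtx aI bI nab okac).
have trP' T : (T \in (a, b, c) :: tr) = (T \in TS) && sweep_vertex sw V T.1.1 T.1.2.
  rewrite inE trP /sweep_vertex; have [->|neT] := eqVneq T (a, b, c).
    by rewrite VTS /= aI bI nab orbT.
  case: T neT => [[x y] z] neT /=; case TP : (_ \in TS) => //=; case: (sw x y) => //=.
  apply/esym/negbTE/negP => /and3P[xV yV _]; have [e1 e2 e3] := mem_TS_vertex TP vtx xV yV.
  by rewrite e1 e2 e3 eqxx in neT.
have uP' : uniq ((a, b, c) :: tr) by rewrite /= uP trP /= (negbTE (avail_unswept aV aI bI nab)) andbF.
have szt : (size tr < 14)%N.
  rewrite -size_TS; apply: (uniq_leq_size uP') => T; by rewrite trP' => /andP[].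
have nt0 : nt = nt.-1.+1 by move: ntP szt; clear; lia.
move: waP; rewrite all_cat /= => /and5P[_ w1 w2 w3 _].
exists c1, p1, c2, p2, c3, p3, r, nt.-1; split=> //.
  move: w1 w2 w3 => /andP[/eqP /= -> _] /andP[/eqP /= -> _] /andP[/eqP /= -> _].
  move: okab okbc => /and3P[_ _ h1] /and3P[_ _ h2]; move: h1 h2 ab bc; clear; lia.
apply: (state_flip st aV (vs := [:: Wire c1 a p1; Wire c2 b p2; Wire c3 c p3])
          (vs' := [:: Wire c3 c p3; Wire c2 b p2; Wire c1 a p1])) => //.
- by move: w1 w2 w3; rewrite /= /wire_ok /= !remE => -> -> ->.
- by rewrite ndP; apply: eq_bigr => i _; rewrite remE.
- by rewrite slP; apply: eq_bigr => i _; rewrite remE.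
by rewrite /= addnS -addSn -nt0.
Qed.

Lemma unswept_exists lrev right fresh nd nt slack tr sw :
  state_ok lrev right fresh nd nt slack tr sw -> (0 < nd + nt)%N ->
  exists a b, ok a b /\ ~~ sw a b.
Proof.
case=> sP _ _ _ ndP _ ntP uP trP _; rewrite addn_gt0 => /orP[nd0|nt0].
  have /hasP[i _] : has (fun i => has (fun j => dbl i j && ~~ sw i j) lab) lab.
    apply/negPn/negP => /hasPn h; move: ndP; rewrite big_seq big1; first by move: nd0; clear; lia.
    move=> i il; rewrite /rem big_seq big1 // => j jl; have /hasPn/(_ _ jl) := h i il.
    by move=> /negbTE->.
  by move=> /hasP[j _ /andP[/andP[ij _] nsw]]; exists i, j.
have /hasP[[[a b] c] TP nT] : has (fun T => T \notin tr) TS.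
  apply/negPn/negP => /hasPn h.
  have sub : {subset TS <= tr} by move=> T /h; rewrite negbK.
  by have := uniq_leq_size uniq_TS sub; rewrite size_TS -ntP -[X in (_ <= X)%N]add0n leq_add2r leqNgt nt0.
move: nT; rewrite trP TP /= => nT.
by exists a, b; split=> //; move: TP; rewrite mem_TS => /and5P[].
Qed.

(** At each state the arrangement dictates one branch: cross if an available vertex starts at the
    pointer, otherwise pass one wire. The search contains both branches, so following the dictated
    ones leads to an outcome that lists exactly the triple points. *)
Theorem sweep_sound fuel lrev right fresh nd nt slack tr sw :
  state_ok lrev right fresh nd nt slack tr sw ->
  good (sweep fuel lrev right fresh nd nt slack tr).
Proof.
elim: fuel lrev right fresh nd nt slack tr sw => [|fuel IH] lrev right fresh nd nt slack tr sw st.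
  by exists [::]; [rewrite inE|left].
have [|pos] := posnP (nd + nt).
  move/eqP; rewrite addn_eq0 => /andP[/eqP nd0 /eqP nt0].
  have [_ _ _ _ _ _ ntP uP trP _] := st; rewrite nd0 nt0 in ntP *.
  exists tr; rewrite /= ?inE //; right.
  have sub : {subset tr <= TS} by move=> T; rewrite trP => /andP[].
  by have [|_] := uniq_min_size uP sub; rewrite // size_TS -ntP.
have sP := state_swept st.
have [hnone|[V [aV hV]]] : (forall W, available sw W -> size lrev != index (head 0%N W) (ids lrev right)) \/
    exists V, available sw V /\ size lrev = index (head 0%N V) (ids lrev right).
  have [h|h] := boolp.pselect (exists V, available sw V /\ size lrev = index (head 0%N V) (ids lrev right)).
    by right.
  by left=> W aW; apply/eqP => e; apply: h; exists W.
- have [a [b [ab nab]]] := unswept_exists st pos.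
  have [W aW] := available_exists sP ab nab.
  have hW := hnone _ aW; have le := state_ptr st aW.
  have [l [r e]] := contiguous sP aW (state_perm st) (state_sorted st).
  (* The available vertex [W] starts strictly behind the pointer and consists of consecutive wires,
     at least two of them, which leaves enough wires for the pass branch of [sweep]. *)
  have szr : (1 < size right)%N.
    have : (size lrev < index (head 0%N W) (ids lrev right))%N.
      by move: hW le; rewrite neq_ltn; move: (index _ _) (~~ _ && _) => i x; clear; lia.
    have := congr1 size e; rewrite size_map !size_cat size_rev.
    rewrite e index_cat; have := vertex_size (avail_vertex aW).
    case: (W) => [|x W'] /=; first by case.
    rewrite eqxx addn0; case: ifP => [|_]; last by clear; lia.
    rewrite -index_mem => h1 h2 h3 h4; have := ltn_trans h4 h1; move: h2 h3; clear.
    move: (size l) (size lrev) (size right) (size r) (size W') => p q u v w; clear; lia.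
  case: right szr st hnone {hW le e} => [//|w right] szr st hnone.
  apply: sub_good (IH _ _ _ _ _ _ _ _ (state_pass st hnone)).
  exact: sweep_pass.
have vtx := avail_vertex aV; case: (vertex_size vtx).
  case: V aV hV vtx => [|a [|b []]] // aV hV vtx _.
  have [c1 [p1 [c2 [p2 [r [nd' [slack' [-> -> lt -> [-> st']]]]]]]]] := double_step st aV hV.
  by apply: sub_good (IH _ _ _ _ _ _ _ _ st'); exact: sweep_double.
case: V aV hV vtx => [|a [|b [|c []]]] // aV hV vtx _.
have [c1 [p1 [c2 [p2 [c3 [p3 [r [nt' [-> lt -> st']]]]]]]]] := triple_step st aV hV.
by apply: sub_good (IH _ _ _ _ _ _ _ _ st'); exact: sweep_triple.
Qed.

Theorem leaves_sound :
  (forall i, i \in lab -> odd (count (dbl i) lab) = (i != 1%N)) ->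
  (\sum_(i <- lab) count (dbl i) lab = 16)%N ->
  (\sum_(i <- lab) (count (dbl i) lab)./2 = 3)%N ->
  good leaves.
Proof.
move=> hodd h16 h3; apply: (@sweep_sound _ _ _ _ _ _ _ _ (fun _ _ => false)).
have remE i : rem (fun _ _ => false) i = count (dbl i) lab.
  by rewrite /rem -sum1_count [RHS]big_mkcond; apply: eq_bigr => j _; rewrite andbT; case: ifP.
have idsE : ids [::] init_wires = lab by [].
split; rewrite ?idsE //.
- have -> : rev [::] ++ init_wires = init_wires by [].
  rewrite all_map; apply/allP => i il; have := hodd i il.
  by rewrite /preim /wire_ok inE /= remE => ->; rewrite negbK !eqxx.
- by rewrite (eq_bigr _ (fun i _ => remE i)) h16.
- by rewrite (eq_bigr _ (fun i _ => congr1 half (remE i))) h3.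
by move=> T; rewrite andbF.
Qed.

End Soundness.
End Times.

(** * Certificates for the outcomes of the search *)

(* For each leaf of the search, the index of the matching table and the images
   of the labels 1, ..., 12 under an isomorphism onto it; 12 is the label of the
   line at infinity. *)
Definition leaf_certificates : seq (nat * seq nat) := [::
  (0,[::3;12;2;11;1;9;7;6;5;8;4;10]); (1,[::11;7;2;10;8;3;9;1;5;12;6;4]);
  (10,[::3;12;2;11;1;9;7;6;5;8;4;10]); (11,[::9;1;11;2;12;4;3;6;5;8;7;10]);
  (3,[::12;2;3;4;5;6;7;8;9;10;11;1]); (2,[::1;11;7;9;5;6;4;8;3;10;2;12]);
  (0,[::3;8;4;6;5;9;7;11;1;12;2;10]); (6,[::2;10;1;6;4;8;5;9;7;12;3;11]);
  (5,[::5;6;3;4;12;2;8;7;9;10;1;11]); (3,[::5;12;7;10;1;8;2;6;4;9;3;11]);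
  (7,[::5;9;3;1;10;2;8;4;6;12;7;11]); (11,[::5;12;7;10;1;8;2;6;4;9;3;11]);
  (2,[::5;7;4;9;6;11;8;12;10;3;1;2]); (10,[::5;7;4;9;6;11;8;12;10;3;1;2]);
  (8,[::12;3;11;4;2;6;1;8;10;9;5;7]); (9,[::12;5;4;7;6;9;8;11;10;2;3;1]);
  (4,[::6;2;12;9;7;3;4;1;11;5;8;10]); (10,[::12;10;11;8;9;6;7;4;5;2;3;1]);
  (2,[::12;10;11;8;9;6;7;4;5;2;3;1]); (1,[::7;4;10;12;3;1;9;6;5;2;11;8]);
  (0,[::12;10;11;8;9;6;7;4;5;2;3;1]); (0,[::10;12;8;11;6;9;4;7;5;2;1;3]);
  (1,[::10;12;8;11;6;9;4;7;5;2;1;3]); (5,[::5;10;1;7;9;2;8;4;12;6;3;11]);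
  (11,[::12;2;3;4;5;6;7;8;9;10;11;1]); (10,[::1;11;7;9;5;6;4;8;3;10;2;12]);
  (1,[::8;10;9;3;5;1;6;12;11;4;2;7]); (2,[::5;9;4;6;3;8;2;10;1;12;7;11]);
  (3,[::5;4;7;6;9;8;11;10;12;1;3;2]); (1,[::4;3;6;2;8;1;10;7;12;9;5;11]);
  (1,[::11;3;9;2;7;1;5;8;10;6;12;4]); (0,[::8;1;6;2;4;3;5;11;12;9;10;7]);
  (9,[::8;1;6;2;4;3;5;11;12;9;10;7]); (4,[::4;10;7;5;12;6;2;1;8;3;11;9]);
  (3,[::12;10;11;8;9;6;7;4;5;2;3;1]); (4,[::1;6;3;5;9;10;2;4;8;7;11;12]);
  (11,[::12;10;11;8;9;6;7;4;5;2;3;1]); (9,[::8;3;5;12;11;1;6;4;2;10;9;7]);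
  (4,[::4;10;7;5;12;6;2;1;8;3;11;9]); (9,[::8;3;5;12;11;1;6;4;2;10;9;7]);
  (4,[::1;6;3;5;9;10;2;4;8;7;11;12]); (9,[::8;1;6;2;4;3;5;11;12;9;10;7]);
  (2,[::1;10;2;8;3;6;4;9;5;11;7;12]); (10,[::1;10;2;8;3;6;4;9;5;11;7;12]);
  (0,[::4;3;6;2;8;1;10;7;12;9;5;11]); (7,[::5;4;7;6;9;8;11;10;12;1;3;2]);
  (8,[::5;1;3;10;12;8;11;6;9;4;7;2]); (6,[::2;3;6;7;10;11;5;4;12;1;9;8]);
  (7,[::9;1;11;2;12;4;3;6;5;8;7;10]); (11,[::9;6;11;8;12;10;3;1;5;2;7;4]);
  (3,[::9;6;11;8;12;10;3;1;5;2;7;4]); (8,[::5;4;7;6;9;8;11;10;12;1;3;2]);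
  (7,[::9;1;11;2;12;4;3;6;5;8;7;10]); (5,[::5;3;6;1;10;8;2;4;12;7;9;11]);
  (8,[::12;2;3;4;5;6;7;8;9;10;11;1]); (8,[::12;2;3;4;5;6;7;8;9;10;11;1]);
  (7,[::5;4;7;6;9;8;11;10;12;1;3;2]); (7,[::9;2;7;1;5;10;3;8;12;6;11;4]);
  (11,[::9;8;7;6;5;4;3;2;12;1;11;10]); (6,[::2;3;6;7;10;11;5;4;12;1;9;8]);
  (7,[::9;2;7;1;5;10;3;8;12;6;11;4]); (8,[::5;1;3;10;12;8;11;6;9;4;7;2]);
  (10,[::3;8;4;6;5;9;7;11;1;12;2;10]); (5,[::5;3;6;1;10;8;2;4;12;7;9;11]);
  (8,[::5;4;7;6;9;8;11;10;12;1;3;2]); (10,[::3;6;2;8;1;10;7;12;5;11;4;9]);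
  (2,[::3;6;2;8;1;10;7;12;5;11;4;9]); (10,[::5;9;4;6;3;8;2;10;1;12;7;11]);
  (11,[::5;4;7;6;9;8;11;10;12;1;3;2]); (11,[::1;10;2;8;4;6;3;9;5;11;7;12]);
  (3,[::1;10;2;8;4;6;3;9;5;11;7;12]); (5,[::5;3;1;6;9;11;8;10;12;7;4;2]);
  (4,[::5;1;3;10;12;8;11;6;9;4;7;2]); (2,[::7;1;9;2;11;3;12;4;10;6;5;8]);
  (10,[::5;12;7;10;1;8;2;6;3;9;4;11]); (11,[::5;1;3;10;12;8;11;6;9;4;7;2]);
  (9,[::2;4;6;1;11;12;5;3;8;7;9;10]); (0,[::12;11;5;3;4;2;6;1;8;7;10;9]);
  (1,[::10;8;5;1;7;2;9;3;11;4;12;6]); (9,[::12;8;5;1;7;2;9;3;11;4;10;6]);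
  (4,[::5;4;7;6;9;8;11;10;12;1;3;2]); (11,[::5;9;3;6;4;8;2;10;1;12;7;11]);
  (9,[::2;4;6;1;11;12;5;3;8;7;9;10]); (0,[::5;4;7;6;9;8;11;10;12;1;3;2]);
  (1,[::5;9;6;3;1;10;12;7;4;11;8;2]); (10,[::5;4;7;6;9;8;11;10;12;1;3;2]);
  (3,[::3;12;4;11;2;9;1;7;10;6;5;8]); (3,[::5;9;3;6;4;8;2;10;1;12;7;11]);
  (4,[::5;1;3;10;12;8;11;6;9;4;7;2]); (1,[::5;4;7;6;9;8;11;10;12;1;3;2]);
  (0,[::5;7;4;9;6;11;8;12;10;3;1;2]); (2,[::5;4;7;6;9;8;11;10;12;1;3;2]);
  (12,[::3;7;5;9;1;11;2;12;6;10;4;8]); (2,[::5;12;7;10;1;8;2;6;3;9;4;11]);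
  (3,[::5;1;3;10;12;8;11;6;9;4;7;2]); (4,[::5;4;7;6;9;8;11;10;12;1;3;2]);
  (9,[::12;8;5;1;7;2;9;3;11;4;10;6]); (12,[::5;4;7;6;9;8;11;10;12;1;3;2]);
  (0,[::12;7;10;1;8;2;6;3;4;11;5;9]); (2,[::10;4;12;3;11;2;9;1;7;8;5;6]);
  (1,[::10;4;12;3;11;2;9;1;7;8;5;6]); (3,[::10;7;1;9;2;11;4;12;3;8;5;6]);
  (4,[::4;11;3;12;5;10;7;8;1;6;2;9]); (9,[::4;5;9;8;2;3;6;12;7;1;10;11]);
  (0,[::11;3;9;2;7;1;5;8;10;6;12;4]); (1,[::10;11;3;2;9;8;5;12;4;1;7;6]);
  (10,[::3;11;4;12;5;10;7;8;1;6;2;9]); (11,[::9;2;7;1;5;10;3;8;12;6;11;4]);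
  (2,[::10;8;5;1;7;2;9;3;11;4;12;6]); (9,[::4;9;5;7;12;1;10;2;8;3;6;11]);
  (11,[::8;4;10;2;1;7;5;11;9;12;6;3]); (3,[::8;4;10;2;1;7;5;11;9;12;6;3]);
  (0,[::8;9;10;11;12;3;5;2;4;1;6;7]); (1,[::10;1;7;12;4;8;5;2;9;11;3;6]);
  (10,[::8;9;10;11;12;3;5;2;4;1;6;7]); (1,[::8;9;10;11;12;3;5;2;4;1;6;7]);
  (0,[::11;6;12;8;10;1;5;2;7;3;9;4]); (2,[::8;9;10;11;12;3;5;2;4;1;6;7]);
  (3,[::8;12;6;11;9;7;5;2;1;4;10;3]); (11,[::8;12;6;11;9;7;5;2;1;4;10;3]);
  (4,[::5;1;10;3;9;2;8;7;12;4;6;11]); (9,[::2;8;3;6;4;5;12;9;7;11;1;10]);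
  (4,[::5;4;6;7;12;2;8;3;9;1;10;11]); (9,[::2;8;3;6;4;5;12;9;7;11;1;10]);
  (9,[::12;8;1;5;11;6;2;10;7;4;3;9]); (9,[::12;8;1;5;11;6;2;10;7;4;3;9]);
  (4,[::5;4;6;7;12;2;8;3;9;1;10;11]); (4,[::5;1;10;3;9;2;8;7;12;4;6;11]);
  (4,[::1;11;7;9;5;6;3;8;4;10;2;12]); (9,[::4;5;9;8;2;3;6;12;7;1;10;11]);
  (0,[::12;2;3;4;5;6;7;8;9;10;11;1]); (1,[::4;2;8;9;5;3;6;10;1;7;12;11]);
  (10,[::12;2;3;4;5;6;7;8;9;10;11;1]); (4,[::4;11;3;12;5;10;7;8;1;6;2;9]);
  (1,[::10;2;1;7;5;9;4;11;6;12;8;3]); (0,[::10;2;1;7;5;9;4;11;6;12;8;3]);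
  (2,[::12;2;3;4;5;6;7;8;9;10;11;1]); (12,[::5;1;3;10;12;8;11;6;9;4;7;2]);
  (0,[::8;1;7;2;9;3;11;4;12;5;10;6]); (1,[::10;11;6;2;1;8;12;9;4;5;7;3]);
  (3,[::10;8;5;12;3;11;4;9;2;7;1;6]); (11,[::8;10;5;1;7;2;9;4;11;3;12;6]);
  (9,[::12;1;2;11;6;5;7;8;10;9;4;3]); (2,[::3;2;7;1;5;8;10;6;12;9;11;4]);
  (10,[::8;10;5;12;4;11;3;9;2;7;1;6]); (8,[::5;1;2;10;4;8;6;12;9;11;7;3]);
  (5,[::5;3;1;11;8;7;4;10;12;6;9;2]); (12,[::3;5;7;1;9;2;11;6;12;4;10;8]);
  (10,[::3;11;9;12;6;10;8;5;1;7;2;4]); (7,[::9;2;4;1;6;10;8;5;3;12;11;7]);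
  (11,[::9;8;10;6;1;4;2;5;3;12;11;7]); (3,[::3;4;12;2;11;1;9;10;7;5;6;8]);
  (2,[::7;9;1;11;2;12;3;10;4;5;6;8]); (0,[::4;6;3;8;2;10;1;12;7;5;9;11]);
  (1,[::4;6;3;8;2;10;1;12;7;5;9;11]); (4,[::1;11;7;9;5;6;3;8;4;10;2;12]);
  (2,[::8;1;6;2;4;3;5;11;12;9;10;7]); (10,[::8;1;6;2;4;3;5;11;12;9;10;7]);
  (2,[::3;11;4;12;5;10;7;8;1;6;2;9]); (3,[::9;2;7;1;5;10;3;8;12;6;11;4]);
  (12,[::1;3;5;7;9;4;11;6;8;2;10;12]); (9,[::4;9;5;7;12;1;10;2;8;3;6;11]);
  (1,[::7;6;5;4;10;3;12;2;11;1;9;8]); (0,[::4;9;5;7;12;1;10;2;8;3;6;11]);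
  (2,[::7;6;5;4;10;3;12;2;11;1;9;8]); (10,[::8;1;7;2;9;3;11;4;12;5;10;6]);
  (10,[::3;2;7;1;5;8;10;6;12;9;11;4]); (1,[::10;7;5;4;9;12;8;1;2;6;11;3]);
  (2,[::3;11;9;12;6;10;8;5;1;7;2;4]); (3,[::9;11;12;3;5;2;4;1;6;10;8;7]);
  (11,[::9;11;12;3;5;2;4;1;6;10;8;7]); (7,[::9;11;12;3;5;2;4;1;6;10;8;7]);
  (3,[::3;6;5;7;10;9;1;11;2;12;4;8]); (2,[::3;2;6;1;8;7;10;5;12;4;11;9]);
  (10,[::8;10;9;12;11;5;3;4;2;6;1;7]); (9,[::12;8;9;5;4;11;10;6;7;2;3;1]);
  (11,[::8;12;3;11;4;9;2;7;1;5;10;6]); (3,[::10;1;7;2;9;4;11;3;12;5;8;6]);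
  (4,[::6;4;3;2;12;1;11;7;9;5;8;10]); (12,[::3;10;4;12;6;11;2;9;1;7;5;8]);
  (2,[::10;12;4;11;3;9;2;7;1;5;8;6]); (10,[::3;2;6;1;8;7;10;5;12;4;11;9]);
  (1,[::10;7;1;4;12;5;8;9;2;3;11;6]); (4,[::5;10;1;9;3;8;2;12;7;6;4;11]);
  (9,[::2;1;11;7;9;12;5;4;6;3;8;10]); (9,[::12;1;8;11;5;2;6;7;10;3;4;9]);
  (11,[::8;10;4;1;2;5;7;9;11;6;12;3]); (12,[::1;5;3;9;7;11;4;8;6;10;2;12]);
  (2,[::8;10;9;12;11;5;3;4;2;6;1;7]); (0,[::11;12;6;10;8;5;1;7;2;9;3;4]);
  (4,[::5;6;4;12;7;8;2;9;3;10;1;11]); (3,[::8;10;4;1;2;5;7;9;11;6;12;3]);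
  (9,[::2;1;11;7;9;12;5;4;6;3;8;10]); (9,[::8;6;1;4;2;5;3;12;11;10;9;7]);
  (12,[::1;10;2;8;6;11;4;9;7;5;3;12]); (3,[::9;11;6;12;8;3;10;5;1;7;2;4]);
  (4,[::4;7;10;12;5;2;6;8;1;11;3;9]); (11,[::1;2;10;4;8;3;6;5;9;7;11;12]);
  (9,[::8;5;3;11;12;6;1;2;4;9;10;7]); (10,[::12;11;10;9;8;7;6;5;4;3;2;1]);
  (1,[::7;10;4;3;12;9;1;5;6;11;2;8]); (4,[::4;7;10;12;5;2;6;8;1;11;3;9]);
  (3,[::1;2;10;4;8;3;6;5;9;7;11;12]); (4,[::1;3;6;9;5;2;10;8;4;11;7;12]);
  (2,[::12;11;10;9;8;7;6;5;4;3;2;1]); (0,[::10;8;12;6;11;4;9;5;7;1;2;3]);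
  (4,[::1;3;6;9;5;2;10;8;4;11;7;12]); (11,[::9;11;6;12;8;3;10;5;1;7;2;4]);
  (9,[::8;5;3;11;12;6;1;2;4;9;10;7]); (2,[::8;6;1;4;2;5;3;12;11;10;9;7]);
  (0,[::11;9;3;7;2;5;1;10;8;12;6;4]); (1,[::11;9;3;7;2;5;1;10;8;12;6;4]);
  (4,[::5;10;1;9;3;8;2;12;7;6;4;11]); (9,[::8;6;1;4;2;5;3;12;11;10;9;7]);
  (3,[::8;6;12;9;11;5;7;1;2;10;4;3]); (0,[::12;11;10;9;8;7;6;5;4;3;2;1]);
  (1,[::10;8;12;6;11;4;9;5;7;1;2;3]); (9,[::12;4;5;6;7;8;9;10;11;3;2;1]);
  (11,[::1;11;7;9;5;6;3;8;4;10;2;12]); (3,[::1;11;7;9;5;6;3;8;4;10;2;12]);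
  (3,[::9;8;10;6;1;4;2;5;3;12;11;7]); (8,[::5;7;11;9;12;1;2;10;4;8;6;3]);
  (0,[::8;10;5;12;4;11;3;9;2;7;1;6]); (12,[::5;7;4;9;6;11;8;12;10;3;1;2]);
  (10,[::3;4;8;5;6;7;9;1;11;2;12;10]); (1,[::8;9;10;5;3;6;1;11;12;2;4;7]);
  (0,[::3;4;8;5;6;7;9;1;11;2;12;10]); (12,[::1;2;10;6;8;4;11;7;9;3;5;12]);
  (2,[::5;1;3;10;12;8;11;6;9;4;7;2]); (8,[::12;5;9;4;2;6;1;8;10;11;3;7]);
  (10,[::5;1;3;10;12;8;11;6;9;4;7;2]); (3,[::5;3;9;4;6;2;8;1;10;7;12;11]);
  (11,[::5;3;9;4;6;2;8;1;10;7;12;11]); (7,[::5;3;9;4;6;2;8;1;10;7;12;11]);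
  (1,[::10;12;4;11;3;9;2;7;1;5;8;6]); (0,[::5;3;1;12;10;11;8;9;6;7;4;2]);
  (1,[::5;1;3;10;12;8;11;6;9;4;7;2]); (10,[::5;3;1;12;10;11;8;9;6;7;4;2]);
  (2,[::5;3;1;12;10;11;8;9;6;7;4;2]); (1,[::5;11;8;7;4;10;12;3;1;9;6;2]);
  (0,[::5;1;3;10;12;8;11;6;9;4;7;2]); (4,[::5;3;1;12;10;11;8;9;6;7;4;2]);
  (9,[::2;6;4;11;1;5;12;8;3;9;7;10]); (11,[::5;7;12;1;10;2;8;4;6;3;9;11]);
  (4,[::5;3;9;4;6;2;8;1;10;7;12;11]); (9,[::2;6;4;11;1;5;12;8;3;9;7;10]);
  (9,[::12;5;8;7;1;9;2;11;3;10;4;6]); (9,[::12;5;8;7;1;9;2;11;3;10;4;6]);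
  (4,[::5;3;9;4;6;2;8;1;10;7;12;11]); (3,[::5;7;12;1;10;2;8;4;6;3;9;11]);
  (4,[::5;3;1;12;10;11;8;9;6;7;4;2]); (11,[::5;7;4;9;6;11;8;12;10;3;1;2]);
  (3,[::5;7;4;9;6;11;8;12;10;3;1;2]); (3,[::5;3;1;12;10;11;8;9;6;7;4;2]);
  (11,[::5;3;1;12;10;11;8;9;6;7;4;2]); (7,[::5;7;4;9;6;11;8;12;10;3;1;2]);
  (5,[::5;1;3;10;12;8;11;6;9;4;7;2]); (6,[::2;1;4;10;6;11;8;12;9;3;7;5]);
  (11,[::9;11;1;12;2;3;4;5;6;7;8;10]); (7,[::9;11;1;12;2;3;4;5;6;7;8;10]);
  (8,[::5;3;1;12;10;11;8;9;6;7;4;2]); (10,[::1;7;11;5;9;4;6;3;8;2;10;12]);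
  (2,[::1;7;11;5;9;4;6;3;8;2;10;12]); (5,[::5;6;3;10;1;2;8;12;4;9;7;11]);
  (2,[::5;7;12;1;10;2;8;3;6;4;9;11]); (10,[::5;7;12;1;10;2;8;3;6;4;9;11]);
  (8,[::12;3;2;5;4;7;6;9;8;11;10;1]); (0,[::12;10;7;8;1;6;2;4;3;5;11;9]);
  (8,[::5;7;4;9;6;11;8;12;10;3;1;2]); (0,[::8;10;9;12;11;5;3;4;2;6;1;7]);
  (1,[::8;10;9;12;11;5;3;4;2;6;1;7]); (3,[::12;11;10;9;8;7;6;5;4;3;2;1]);
  (7,[::9;11;1;12;2;3;4;5;6;7;8;10]); (11,[::12;11;10;9;8;7;6;5;4;3;2;1]);
  (3,[::9;7;2;5;1;3;10;12;8;11;6;4]); (11,[::9;7;2;5;1;3;10;12;8;11;6;4]);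
  (3,[::1;7;11;5;9;3;6;4;8;2;10;12]); (11,[::1;7;11;5;9;3;6;4;8;2;10;12]);
  (4,[::4;3;11;5;12;7;10;1;8;2;6;9]); (9,[::4;9;5;2;8;6;3;7;12;10;1;11]);
  (9,[::4;5;9;12;7;10;1;8;2;6;3;11]); (4,[::1;7;11;5;9;3;6;4;8;2;10;12]);
  (9,[::4;9;5;2;8;6;3;7;12;10;1;11]); (4,[::4;3;11;5;12;7;10;1;8;2;6;9]);
  (4,[::1;7;11;5;9;3;6;4;8;2;10;12]); (9,[::4;5;9;12;7;10;1;8;2;6;3;11]);
  (7,[::9;7;2;5;1;3;10;12;8;11;6;4]); (11,[::12;3;2;5;4;7;6;9;8;11;10;1]);
  (3,[::12;3;2;5;4;7;6;9;8;11;10;1]); (0,[::10;1;2;5;7;4;9;6;11;8;12;3]);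
  (1,[::4;8;2;5;9;6;3;1;10;12;7;11]); (9,[::12;1;2;5;7;4;9;6;11;8;10;3]);
  (1,[::10;1;2;5;7;4;9;6;11;8;12;3]); (0,[::12;3;2;5;4;7;6;9;8;11;10;1]);
  (2,[::12;3;2;5;4;7;6;9;8;11;10;1]); (10,[::12;3;2;5;4;7;6;9;8;11;10;1]);
  (5,[::5;1;10;9;7;8;2;12;4;3;6;11]); (6,[::2;1;4;10;6;11;8;12;9;3;7;5]);
  (6,[::2;1;10;4;6;5;8;7;9;3;12;11]); (5,[::5;3;6;12;4;8;2;9;7;1;10;11]);
  (2,[::7;5;6;10;4;12;3;11;2;9;1;8]); (3,[::3;5;6;10;7;1;9;2;11;4;12;8]);
  (10,[::5;4;9;3;6;2;8;1;10;7;12;11]); (2,[::5;4;9;3;6;2;8;1;10;7;12;11]);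
  (0,[::4;5;9;12;7;10;1;8;2;6;3;11]); (8,[::12;3;2;5;4;7;6;9;8;11;10;1]);
  (7,[::5;7;4;9;6;11;8;12;10;3;1;2]); (1,[::7;5;6;10;4;12;3;11;2;9;1;8]);
  (5,[::5;6;9;10;12;1;3;8;11;4;7;2]); (0,[::3;2;12;1;11;7;9;5;6;4;8;10]);
  (2,[::1;2;10;3;8;4;6;5;9;7;11;12]); (12,[::3;4;10;6;12;2;11;1;9;5;7;8]);
  (10,[::3;2;12;1;11;7;9;5;6;4;8;10]); (8,[::5;7;4;9;6;11;8;12;10;3;1;2]);
  (1,[::11;2;7;8;10;9;3;5;1;6;12;4]); (10,[::1;2;10;3;8;4;6;5;9;7;11;12]);
  (5,[::5;6;3;10;1;2;8;12;4;9;7;11]); (12,[::5;3;1;12;10;11;8;9;6;7;4;2]);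
  (8,[::5;11;7;12;9;2;1;4;10;6;8;3]); (10,[::3;7;2;5;1;10;8;12;6;11;9;4]);
  (2,[::3;7;2;5;1;10;8;12;6;11;9;4]); (11,[::9;12;11;5;3;4;2;6;1;8;10;7]);
  (3,[::9;12;11;5;3;4;2;6;1;8;10;7]); (7,[::9;12;11;5;3;4;2;6;1;8;10;7]);
  (4,[::6;5;8;1;11;3;4;9;7;2;12;10]); (4,[::5;6;4;12;7;8;2;9;3;10;1;11]);
  (10,[::8;6;1;4;2;5;3;12;11;10;9;7]); (1,[::10;3;11;9;2;5;8;4;12;7;1;6]);
  (0,[::8;6;1;4;2;5;3;12;11;10;9;7]); (9,[::12;1;8;11;5;2;6;7;10;3;4;9]);
  (11,[::8;6;12;9;11;5;7;1;2;10;4;3]); (11,[::9;7;8;5;6;3;4;12;2;11;1;10]);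
  (7,[::9;7;2;5;1;3;10;12;8;11;6;4]); (2,[::3;4;11;5;12;7;10;1;8;2;6;9]);
  (10,[::3;4;11;5;12;7;10;1;8;2;6;9]); (8,[::5;3;1;12;10;11;8;9;6;7;4;2]);
  (1,[::10;5;8;7;1;9;2;11;3;12;4;6]); (4,[::6;5;8;3;4;12;2;11;1;9;7;10]);
  (3,[::10;5;8;3;12;4;11;2;9;1;7;6]); (2,[::10;5;8;7;1;9;2;11;3;12;4;6]);
  (0,[::12;5;11;4;3;6;2;8;1;10;7;9]); (9,[::12;2;1;7;5;9;4;11;6;10;8;3]);
  (9,[::12;2;1;6;11;7;5;10;8;4;9;3]); (7,[::9;4;2;6;1;8;10;3;5;11;12;7]);
  (11,[::9;10;8;1;6;2;4;3;5;11;12;7]); (3,[::9;10;8;1;6;2;4;3;5;11;12;7]);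
  (2,[::3;9;11;6;12;8;10;1;5;2;7;4]); (10,[::3;9;11;6;12;8;10;1;5;2;7;4]);
  (8,[::5;2;1;4;10;6;8;9;12;7;11;3]); (9,[::12;6;11;7;5;10;8;4;9;1;2;3]);
  (11,[::8;3;12;4;11;2;9;1;7;10;5;6]); (10,[::8;7;1;9;2;11;3;12;4;10;5;6]);
  (1,[::10;6;11;1;2;12;8;4;9;7;5;3]); (0,[::8;7;1;9;2;11;3;12;4;10;5;6]);
  (0,[::8;5;10;4;12;3;11;2;9;1;7;6]); (1,[::10;5;7;9;4;8;12;2;1;11;6;3]);
  (10,[::8;5;10;4;12;3;11;2;9;1;7;6]); (11,[::8;5;10;7;1;9;2;11;4;12;3;6])].

Definition triples_at_infinity : seq triple :=
  [:: (2, 3, 12); (4, 5, 12); (6, 7, 12); (8, 9, 12); (10, 11, 12)].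

Definition sort_triple (a b c : nat) : triple :=
  if a <= b then if b <= c then (a, b, c) else if a <= c then (a, c, b) else (c, a, b)
  else if a <= c then (b, a, c) else if b <= c then (b, c, a) else (c, b, a).

(** Only the inclusion of the [14 + 5] relabelled triples in the table is tested; equality follows
    later from the cardinalities. *)
Definition leaf_ok (T : seq triple) (c : nat * seq nat) : bool :=
  let: (m, p) := c in
  [&& T != [::], m < 13, uniq p, size p == 12, all (fun k => 0 < k <= 12) p &
    all (fun t => let: (i, j, k) := t in
        sort_triple (nth 0 p i.-1) (nth 0 p j.-1) (nth 0 p k.-1) \in nth [::] tables m)
      (T ++ triples_at_infinity)].

Lemma leaves_ok : all2 leaf_ok leaves leaf_certificates.
Proof. vm_compute. reflexivity. Qed.

(** * Partial triple systems on twelve lines *)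

Section TripleSystem.
Variable D : {set {set 'I_12}}.
Hypothesis D_size : #|D| = 19.
Hypothesis D_card : forall S, S \in D -> #|S| = 3.
Hypothesis D_share : forall S S' i j, S \in D -> S' \in D -> i != j ->
  i \in S -> j \in S -> i \in S' -> j \in S' -> S = S'.

Definition joined i j := [exists S in D, (i \in S) && (j \in S)].

Lemma joined_count i j : i != j -> \sum_(S in D) ((i \in S) && (j \in S)) = joined i j.
Proof.
move=> ij; have [/exists_inP[S SD /andP[iS jS]]|/exists_inPn h] := boolP (joined i j); last first.
  by rewrite big1 // => S /h/negbTE->.
rewrite (bigD1 S) //= iS jS big1 ?addn0 // => S' /andP[S'D ne].
by apply/eqP; rewrite eqb0; apply: contra ne => /andP[iS' jS']; rewrite (D_share SD S'D ij).
Qed.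

Definition degree i := #|[set S in D | i \in S]|.

Lemma degreeE i : degree i = \sum_(S in D) (i \in S).
Proof.
rewrite /degree -sum1dep_card big_mkcondr; apply: eq_bigr => S _.
by case: (i \in S).
Qed.

Lemma sum_degree : \sum_i degree i = 57.
Proof.
rewrite (eq_bigr _ (fun i _ => degreeE i)) exchange_big /=.
rewrite (eq_bigr (fun=> 3)) => [|S SD]; first by rewrite sum_nat_const D_size.
transitivity #|S|; last exact: D_card.
by rewrite -sum1_card [RHS]big_mkcond; apply: eq_bigr => i _; case: (i \in S).
Qed.

(** Each triple on [i] joins it to two further lines, and no line is met in two triples because
    distinct triples share at most one line. *)
Lemma card_joined i : #|[set j | (j != i) && joined i j]| = 2 * degree i.
Proof.
rewrite -sum1dep_card big_mkcondr degreeE big_distrr /=.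
rewrite (eq_bigr (fun j => \sum_(S in D) ((i \in S) && (j \in S)))) => [|j ji]; last first.
  by rewrite joined_count 1?eq_sym //; case: (joined i j).
rewrite exchange_big /=; apply: eq_bigr => S SD; case iS : (i \in S) => /=; last by rewrite big1.
have e2 : #|S :\ i| = 2.
  by have := cardsD1 i S; rewrite iS (D_card SD) => e; apply: (@addnI 1); rewrite -[LHS]/(true + _) -e.
transitivity #|S :\ i|; last by rewrite e2.
by rewrite -sum1_card big_mkcond [RHS]big_mkcond; apply: eq_bigr => j _; rewrite !inE; case: (j != i); case: (j \in S).
Qed.

(** Twice a degree is at most [11], so degrees are at most [5]. If none were [5] they would add up
    to at most [12 * 4 = 48], but they add up to [3 * 19 = 57]. *)
Lemma exists_full_line : exists w, degree w = 5.
Proof.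
have le5 i : degree i <= 5.
  have : #|[set j | (j != i) && joined i j]| <= #|[set~ i]|.
    by apply/subset_leq_card/subsetP => j; rewrite !inE => /andP[].
  by rewrite card_joined cardsC1 card_ord; lia.
have [/existsP[w /eqP h]|] := boolP [exists w, degree w == 5]; first by exists w.
rewrite negb_exists => /forallP h; suff : \sum_i degree i <= \sum_(i < 12) 4.
  by rewrite sum_degree sum_nat_const card_ord.
by apply: leq_sum => i _; have := le5 i; have := h i; lia.
Qed.

Section FullLine.
Variable w : 'I_12.
Hypothesis w_full : degree w = 5.

(** The five triples on [w] use up ten of the eleven other lines; [u] is the remaining one and meets
    [w] in a double point. *)
Lemma exists_double : exists2 u, u != w & forall j, j != w -> joined w j = (j != u).
Proof.
have : #|[set j | (j != w) && ~~ joined w j]| = 1.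
  have := cardsID [set j | joined w j] [set~ w]; rewrite cardsC1 card_ord.
  have -> : [set~ w] :&: [set j | joined w j] = [set j | (j != w) && joined w j].
    by apply/setP => j; rewrite !inE.
  have -> : [set~ w] :\: [set j | joined w j] = [set j | (j != w) && ~~ joined w j].
    by apply/setP => j; rewrite !inE andbC.
  by rewrite card_joined w_full => h; apply: (@addnI 10).
move/eqP/cards1P => [u eu]; have := set11 u; rewrite -eu inE => /andP[uw _]; exists u => // j jw.
by have /setP/(_ j) := eu; rewrite !inE jw /= => <-; rewrite negbK.
Qed.

Variable u : 'I_12.
Hypotheses (uw : u != w) (joined_w : forall j, j != w -> joined w j = (j != u)).

Definition partner j := odflt j [pick k | [&& k != w, k != j & [set w; j; k] \in D]].

Lemma partnerP j : j != w -> j != u ->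
  [/\ partner j != w, partner j != j & [set w; j; partner j] \in D].
Proof.
move=> jw ju; rewrite /partner; case: pickP => [k /and3P[-> -> ->] //|nk].
have : joined w j by rewrite joined_w.
move=> /exists_inP[S SD /andP[wS jS]]; exfalso.
have /subsetPn[k kS] : ~~ (S \subset [set w; j]).
  by apply/negP => /subset_leq_card; rewrite (D_card SD) cards2; case: (w != j).
rewrite !inE negb_or => /andP[kw kj].
have := nk k; rewrite kw kj /=; suff -> : [set w; j; k] = S by rewrite SD.
apply/eqP; rewrite eqEcard (D_card SD); apply/andP; split.
  by apply/subsetP => x; rewrite !inE => /orP[/orP[]|] /eqP->.
by rewrite setUC cardsU1 !inE negb_or kw kj cards2 eq_sym jw.
Qed.

Lemma partner_unique j k : j != w -> k != w -> k != j -> [set w; j; k] \in D -> k = partner j.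
Proof.
move=> jw kw kj SD.
have ju : j != u.
  rewrite -joined_w //; apply/exists_inP; exists [set w; j; k] => //.
  by rewrite !inE !eqxx orbT.
have [pw pj PD] := partnerP jw ju.
have wj : w != j by rewrite eq_sym.
have e : [set w; j; k] = [set w; j; partner j].
  by apply: (D_share SD PD wj); rewrite !inE eqxx ?orbT.
have : k \in [set w; j; partner j] by rewrite -e !inE eqxx orbT.
by rewrite !inE (negbTE kw) (negbTE kj) /= => /eqP.
Qed.

Lemma partner_neq_u j : j != w -> j != u -> partner j != u.
Proof.
move=> jw ju; have [pw pj PD] := partnerP jw ju; rewrite -joined_w //.
by apply/exists_inP; exists [set w; j; partner j]; rewrite // !inE !eqxx ?orbT.
Qed.

Lemma partnerK j : j != w -> j != u -> partner (partner j) = j.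
Proof.
move=> jw ju; have [pw pj PD] := partnerP jw ju; apply/esym/partner_unique => //.
  by rewrite eq_sym.
by rewrite -setUA [[set partner j; j]]setUC setUA.
Qed.

End FullLine.
End TripleSystem.

(** * The thirteen lists are not isomorphic *)

Section ColourRefinement.
Implicit Types (D : {set {set 'I_12}}) (c : 'I_12 -> nat) (s : {perm 'I_12}).

Definition refine D c (u : 'I_12) : nat :=
  (\sum_(S in D | u \in S) (\sum_(w in S) c w) ^ 2 %% 7) %% 7.

(* Singling out each line in turn is needed: colour refinement from a constant
   colouring does not separate all thirteen lists. The modulus 7 does, and keeps the
   computation small. *)
Definition colour_invariant D : nat :=
  \sum_v iter 3 (refine D) (fun u => (u != v) : nat) v.

Lemma refine_perm D c s u :
  refine [set s @: S | S : {set 'I_12} in D] c (s u) = refine D (c \o s) u.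
Proof.
have s_inj := @perm_inj _ s.
rewrite /refine; congr (_ %% 7); rewrite big_mkcondr big_imset /=; last first.
  by move=> S T _ _; exact: imset_inj.
rewrite [RHS]big_mkcondr; apply: eq_bigr => S _; rewrite mem_imset //.
by rewrite big_imset //= => x y _ _ /s_inj.
Qed.

Lemma eq_refine D c c' : c =1 c' -> refine D c =1 refine D c'.
Proof.
move=> e u; rewrite /refine; congr (_ %% 7); apply: eq_bigr => S _.
by congr (_ ^ 2 %% 7); apply: eq_bigr => w _; rewrite e.
Qed.

Lemma colour_invariant_perm D s :
  colour_invariant [set s @: S | S : {set 'I_12} in D] = colour_invariant D.
Proof.
rewrite /colour_invariant (reindex_inj (@perm_inj _ s)); apply: eq_bigr => v _.
have step n u : iter n (refine [set s @: S | S : {set 'I_12} in D]) (fun u => (u != s v) : nat) (s u)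
    = iter n (refine D) (fun u => (u != v) : nat) u.
  elim: n u => [|n IH] u /=; first by rewrite (inj_eq (@perm_inj _ s)).
  by rewrite refine_perm; apply: eq_refine => w /=; exact: IH.
exact: step.
Qed.

End ColourRefinement.

Section Lists.
Variable tab : seq (nat * nat * nat).

Definition triple_sum (c : seq nat) (t : nat * nat * nat) : nat :=
  let: (i, j, k) := t in nth 0 c i.-1 + nth 0 c j.-1 + nth 0 c k.-1.

Definition on_triple (x : nat) (t : nat * nat * nat) : bool :=
  let: (i, j, k) := t in [|| x == i, x == j | x == k].

(** A copy of [refine] on plain lists of numbers, made so that the thirteen invariants can be
    computed by [vm_compute]. *)
Definition refine_list (c : seq nat) : seq nat :=
  [seq (foldr (fun t m => if on_triple x t then (triple_sum c t) ^ 2 %% 7 + m else m) 0 tab) %% 7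
     | x <- iota 1 12].

Definition colour_invariant_list : nat :=
  foldr (fun v m => nth 0 (iter 3 refine_list [seq (u != v) : nat | u <- iota 0 12]) v + m) 0 (iota 0 12).

Definition sorted_triple (t : nat * nat * nat) : bool :=
  let: (i, j, k) := t in [&& 0 < i, i < j, j < k & k <= 12].

Hypothesis tab_sorted : all sorted_triple tab.
Hypothesis tab_uniq : uniq tab.

Lemma labelK x : 0 < x <= 12 -> (label x).+1 = x.
Proof. by case: x => // x /andP[_ h]; rewrite /label inordK. Qed.

Lemma mem_unordered_triple u t : sorted_triple t -> (u \in unordered_triple t) = on_triple u.+1 t.
Proof.
case: t => [[i j] k] /and4P[i0 ij jk k12]; rewrite !inE -orbA.
have lE x : 0 < x <= 12 -> (u == label x) = (u.+1 == x).
  by move=> hx; rewrite -{2}(labelK hx) eqSS.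
by rewrite !lE //; lia.
Qed.

Lemma sum_unordered_triple (c : 'I_12 -> nat) (cl : seq nat) t : sorted_triple t ->
  (forall u : 'I_12, c u = nth 0 cl u) -> \sum_(w in unordered_triple t) c w = triple_sum cl t.
Proof.
case: t => [[i j] k] st e; have /and4P[i0 ij jk k12] := st.
have lE x : 0 < x <= 12 -> nat_of_ord (label x) = x.-1.
  by case: x => // x /andP[_ h]; rewrite /label inordK.
have u3 : uniq [:: label i; label j; label k].
  by rewrite /= !inE -!(inj_eq val_inj) /= !lE; lia.
rewrite (eq_bigl (mem [:: label i; label j; label k])) => [|w]; last by rewrite !inE orbA.
by rewrite -big_uniq //= !big_cons big_nil !e !lE ?addn0 ?addnA //; lia.
Qed.

Lemma unordered_triple_inj : {in tab &, injective unordered_triple}.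
Proof.
move=> t t' /(allP tab_sorted) st /(allP tab_sorted) st' e.
have ext x : 0 < x <= 12 -> on_triple x t = on_triple x t'.
  by move=> hx; rewrite -(labelK hx) -!mem_unordered_triple // e.
case: t t' st st' ext {e} => [[i j] k] [[i' j'] k'] /and4P[i0 ij jk k12] /and4P[i0' ij' jk' k12'] ext.
have E : [:: i; j; k] = [:: i'; j'; k'].
  apply: (irr_sorted_eq ltn_trans ltnn); rewrite /= ?ij ?jk ?ij' ?jk' // => x.
  have [hx|hx] := boolP (0 < x <= 12); first by have := ext x hx; rewrite /= !inE.
  rewrite !inE; apply/idP/idP => /or3P[]/eqP h; move: hx; lia.
by case: E => -> -> ->.
Qed.

Lemma refine_listP (c : 'I_12 -> nat) (cl : seq nat) :
  (forall u : 'I_12, c u = nth 0 cl u) ->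
  forall u, refine [set:: map unordered_triple tab] c u = nth 0 (refine_list cl) u.
Proof.
move=> e u; rewrite (nth_map 0) ?size_iota // nth_iota // /refine; congr (_ %% 7).
rewrite big_mkcondr (eq_bigl (mem (map unordered_triple tab))) => [|S]; last by rewrite inE.
rewrite -big_uniq ?map_inj_in_uniq //; last exact: unordered_triple_inj.
rewrite big_map; elim: (tab) tab_sorted => [|t T IH]; first by rewrite big_nil.
move=> /= /andP[st /IH{}IH]; rewrite big_cons IH mem_unordered_triple // add1n.
by case: ifP => // _; rewrite (sum_unordered_triple st e).
Qed.

Lemma colour_invariant_listP :
  colour_invariant [set:: map unordered_triple tab] = colour_invariant_list.
Proof.
rewrite /colour_invariant.
have step (v : 'I_12) n (u : 'I_12) :
    iter n (refine [set:: map unordered_triple tab]) (fun w => (w != v) : nat) u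
    = nth 0 (iter n refine_list [seq (x != v :> nat) : nat | x <- iota 0 12]) u.
  elim: n u => [|n IH] u; last by rewrite !iterS; exact: refine_listP.
  by rewrite /iter (nth_map 0) ?size_iota // nth_iota.
rewrite (eq_bigr _ (fun v _ => step v 3 v)).
rewrite -(big_mkord xpredT (fun v => nth 0 (iter 3 refine_list [seq (u != v) : nat | u <- iota 0 12]) v)).
rewrite /colour_invariant_list /index_iota subn0 unlock; by [].
Qed.

End Lists.

Lemma tables_sorted : all (fun tab => all sorted_triple tab && uniq tab) tables.
Proof. vm_compute. reflexivity. Qed.

Lemma tables_invariants : uniq (map colour_invariant_list tables).
Proof. vm_compute. reflexivity. Qed.

Theorem lists_non_isomorphic (m n : 'I_13) :
  isomorphic_lists (list_C m) (list_C n) -> m = n.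
Proof.
have szt : size tables = 13 by [].
have inv (k : 'I_13) : colour_invariant (list_C k) = nth 0 (map colour_invariant_list tables) k.
  have /andP[h1 h2] := all_nthP [::] tables_sorted k (ltn_ord k).
  by rewrite (nth_map [::]) ?ltn_ord // -colour_invariant_listP.
case=> s e; have := colour_invariant_perm (list_C m) s; rewrite e !inv => /eqP.
by rewrite nth_uniq ?tables_invariants ?size_map ?szt ?ltn_ord // => /eqP/val_inj.
Qed.

Local Open Scope ring_scope.

(** * Orienting and cutting the pseudolines *)

Definition is_sign (R : pzRingType) (x : R) := x = 1 \/ x = -1.

Section Rotation.
Variable R : realFieldType.

(* Position on a projective line, a circle cut at 0, after moving the cut to [a]. *)
Definition rotate (a x : R) : R := if x < a then x - a + 1 else x - a.
Definition wrapped (a x : R) : R := if x < a then -1 else 1.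

Lemma wrapped_sign a x : is_sign (wrapped a x).
Proof. by rewrite /wrapped; case: ifP => _; [right|left]. Qed.

(** The new cut moves exactly the points below [a] to the far end, so only the comparisons between
    such a point and another one are reversed. *)
Lemma rotate_sg a x y : 0 < x < 1 -> 0 < y < 1 ->
  Num.sg (rotate a x - rotate a y) = wrapped a x * wrapped a y * Num.sg (x - y).
Proof.
move=> hx hy; rewrite /rotate /wrapped; case: (ltrP x a) => xa; case: (ltrP y a) => ya.
- by rewrite mulrNN !mul1r; congr Num.sg; ring.
- by rewrite gtr0_sg ?ltr0_sg; [ring| |]; lra.
- by rewrite ltr0_sg ?gtr0_sg; [ring| |]; lra.
- by rewrite !mul1r; congr Num.sg; ring.
Qed.

Lemma rotate_id a : rotate a a = 0.
Proof. by rewrite /rotate ltxx subrr. Qed.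

Lemma rotate_gt0 a x : 0 < a < 1 -> 0 < x < 1 -> x != a -> 0 < rotate a x.
Proof.
by move=> ha hx; rewrite neq_lt /rotate; case: (ltrP x a) => h /= h'; lra.
Qed.

End Rotation.

(** * Reorienting the curves and sending one of them to infinity *)

Section SignAlgebra.
Variables (R : realFieldType) (D : {set {set 'I_12}}).
Hypothesis D_card : forall S, S \in D -> #|S| = 3%N.
Hypothesis D_share : forall S S' i j, S \in D -> S' \in D -> i != j ->
  i \in S -> j \in S -> i \in S' -> j \in S' -> S = S'.

Variables T e ep : 'I_12 -> 'I_12 -> R.
Hypothesis T01 : forall i j, i != j -> 0 < T i j < 1.
Hypothesis e_sign : forall i j, i != j -> is_sign (e i j).
Hypothesis ep_sign : forall i j, i != j -> is_sign (ep i j).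
Hypothesis ep_sym : forall i j, i != j -> ep i j = ep j i.
Hypothesis flip_rule : forall i j k, i != j -> i != k -> j != k ->
  e j i * e j k * Num.sg (T j i - T j k) = - ep i j * (e i j * e i k * Num.sg (T i j - T i k)).
Hypothesis T_eq : forall i j k, i != j -> i != k -> j != k ->
  T i j = T i k <-> [set i; j; k] \in D.

(** This is the side of curve [k] on which the crossing of [i] and [j] lies, for the lift of that
    crossing taken on [i] and multiplied by [e i j]. [flip_rule] compares it with the lift taken on
    [j]. *)
Let X i j k := e i j * e i k * Num.sg (T i j - T i k).

Let XN i j k : X i k j = - X i j k.
Proof. by rewrite /X -opprB sgrN; ring. Qed.

Let X_neq0 i j k : i != j -> i != k -> j != k -> [set i; j; k] \notin D -> X i j k != 0.
Proof.
move=> ij ik jk nD; rewrite /X !mulf_neq0 //.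
- by case: (e_sign ij) => ->; rewrite ?oppr_eq0 oner_eq0.
- by case: (e_sign ik) => ->; rewrite ?oppr_eq0 oner_eq0.
by rewrite sgr_eq0 subr_eq0; apply: contra nD => /eqP /T_eq; apply.
Qed.

(** Three uses of [flip_rule], alternating with the antisymmetry [XN], carry [X i j k] round the
    triangle back to itself. The collected sign must be [1] since [X i j k] does not vanish for a
    non-concurrent triple. *)
Let triangle i j k : i != j -> i != k -> j != k -> [set i; j; k] \notin D ->
  ep i j * ep j k * ep i k = 1.
Proof.
move=> ij ik jk nD; have X0 := X_neq0 ij ik jk nD.
have ji : j != i by rewrite eq_sym.
have kj : k != j by rewrite eq_sym.
have ki : k != i by rewrite eq_sym.
have d1 : X j i k = - ep i j * X i j k := flip_rule ij ik jk.
have d2 : X k j i = - ep j k * X j k i := flip_rule jk ji ki.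
have d3 : X i k j = - ep k i * X k i j := flip_rule ki kj ij.
rewrite XN [X k i j]XN d2 [X j k i]XN d1 -(ep_sym ik) in d3.
apply: (mulIf X0); rewrite mul1r; apply: oppr_inj; rewrite d3; ring.
Qed.

Let delta i := if i == ord0 then 1 else ep ord0 i.

Let delta_sign i : is_sign (delta i).
Proof.
by rewrite /delta; case: eqP => [_|/eqP h]; [left|apply: ep_sign; rewrite eq_sym].
Qed.

Let sign_sqr (x : R) : is_sign x -> x * x = 1.
Proof. by case=> ->; ring. Qed.

(** The sign cocycle [ep] is a coboundary, with [delta] read off the curve [ord0]. [triangle] gives
    this directly unless [ord0], [i], [j] are concurrent. In that case a curve [d] outside their
    triple helps: two curves of the triple are never concurrent with [d], so three triangles through
    [d] are available. *)
Let ep_delta i j : i != j -> ep i j = delta i * delta j.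
Proof.
have nonconc a b : a != b -> a != ord0 -> b != ord0 -> [set ord0; a; b] \notin D ->
    ep a b = delta a * delta b.
  move=> ab a0 b0 nD; rewrite /delta (negbTE a0) (negbTE b0).
  have a0' : ord0 != a by rewrite eq_sym.
  have b0' : ord0 != b by rewrite eq_sym.
  have := triangle a0' b0' ab nD.
  by case: (ep_sign a0') => ->; case: (ep_sign b0') => ->; case: (ep_sign ab) => -> //; lra.
move=> ij; have [i0|i0] := eqVneq i ord0.
  by rewrite i0 /delta eqxx mul1r -i0 eq_sym (negbTE ij).
have [j0|j0] := eqVneq j ord0.
  by rewrite j0 /delta eqxx mulr1 -j0 (negbTE ij) ep_sym.
have [SD|] := boolP ([set ord0; i; j] \in D); last exact: nonconc.
have [d dS] : exists d, d \notin [set ord0; i; j].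
  apply/existsP; rewrite -negb_forall; apply/negP => /forallP h.
  have := D_card SD; rewrite (_ : [set ord0; i; j] = setT) ?cardsT ?card_ord //.
  by apply/setP => x; rewrite [RHS]inE; exact: h.
have [d0 di dj] : [/\ d != ord0, d != i & d != j].
  by move: dS; rewrite !inE !negb_or => /andP[/andP[-> ->] ->].
have sub a b c : a \in [set ord0; i; j] -> b \in [set ord0; i; j] -> a != b ->
    c = d -> [set a; b; c] \notin D.
  move=> aS bS ab ->; apply/negP => h; case/negP: dS.
  by rewrite (D_share SD h ab aS bS) !inE ?eqxx ?orbT.
have S0 : ord0 \in [set ord0; i; j] by rewrite !inE eqxx.
have Si : i \in [set ord0; i; j] by rewrite !inE eqxx orbT.
have Sj : j \in [set ord0; i; j] by rewrite !inE eqxx !orbT.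
have id' : i != d by rewrite eq_sym.
have jd' : j != d by rewrite eq_sym.
have i0' : ord0 != i by rewrite eq_sym.
have j0' : ord0 != j by rewrite eq_sym.
have h1 := nonconc i d id' i0 d0 (sub _ _ _ S0 Si i0' erefl).
have h2 := nonconc j d jd' j0 d0 (sub _ _ _ S0 Sj j0' erefl).
have h3 := triangle ij id' jd' (sub _ _ _ Si Sj ij erefl); rewrite h1 h2 in h3.
rewrite -[RHS]mul1r -h3 -[LHS]mulr1 -[X in _ * X](sign_sqr (delta_sign i)).
rewrite -[LHS]mulr1 -[X in _ * X = _](sign_sqr (delta_sign j)).
rewrite -[LHS]mulr1 -[X in _ * X = _](sign_sqr (delta_sign d)).
ring.
Qed.

(** After the correction by [delta] the signs are alternating in all three indices: this is the
    chirotope of the arrangement, up to the choice of orientations. *)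
Let Y i j k := delta i * X i j k.

Let Y_swap i j k : i != j -> i != k -> j != k -> Y j i k = - Y i j k.
Proof.
move=> ij ik jk; have f : X j i k = - ep i j * X i j k := flip_rule ij ik jk.
rewrite /Y f (ep_delta ij); have := sign_sqr (delta_sign j).
by set a := delta j; set b := delta i; move=> h; rewrite -[RHS]mul1r -h; ring.
Qed.

Variables w u : 'I_12.
Hypothesis wu : w != u.
Hypothesis u_double : forall k, k != w -> k != u -> [set w; u; k] \notin D.

(** The reorientation that adapts the chirotope to [w] as line at infinity: with it [chi w j k]
    becomes the sign of a difference of slopes. *)
Let sigma j := if j == w then delta w else e w j * wrapped (T w u) (T w j).

Let sigma_sign j : is_sign (sigma j).
Proof.
rewrite /sigma; case: eqP => [_|/eqP h] //; rewrite eq_sym in h.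
by case: (e_sign h) => ->; case: (wrapped_sign (T w u) (T w j)) => ->; rewrite /is_sign ?mulrNN ?mul1r ?mulr1; auto.
Qed.

Let chi i j k := sigma i * sigma j * sigma k * Y i j k.

Let chi_swap i j k : i != j -> i != k -> j != k -> chi j i k = - chi i j k.
Proof. by move=> ij ik jk; rewrite /chi Y_swap //; ring. Qed.

Let chi_swap' i j k : chi i k j = - chi i j k.
Proof. by rewrite /chi /Y XN; ring. Qed.

(** The slope of [j] is the place where it meets the line at infinity [w]. Cutting [w] at its double
    point makes [0] the slope of [u], the least of all. *)
Definition slope j : R := rotate (T w u) (T w j).

Let chi_w j k : j != w -> k != w -> j != k -> chi w j k = Num.sg (slope j - slope k).
Proof.
move=> jw kw jk; have wj : w != j by rewrite eq_sym.
have wk : w != k by rewrite eq_sym.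
rewrite /slope rotate_sg ?T01 // /chi /Y /X /sigma eqxx (negbTE jw) (negbTE kw).
set sg := Num.sg _.
by case: (delta_sign w) => ->; case: (e_sign wj) => ->; case: (e_sign wk) => ->; ring.
Qed.

Let tau0 c j := rotate (T c w) (T c j).
Let theta c := sigma c * delta c.
Let h c j := sigma j * e c j * wrapped (T c w) (T c j).

Let theta_sign c : is_sign (theta c).
Proof.
by rewrite /theta; case: (sigma_sign c) => ->; case: (delta_sign c) => ->;
  rewrite /is_sign ?mulrNN ?mul1r ?mulr1; auto.
Qed.

Let h_sign c j : c != j -> is_sign (h c j).
Proof.
move=> cj; rewrite /h; case: (sigma_sign j) => ->; case: (e_sign cj) => ->;
  case: (wrapped_sign (T c w) (T c j)) => ->; rewrite /is_sign ?mulrNN ?mul1r ?mulr1 ?mulrN1 ?opprK; auto.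
Qed.

Let chi_tau0 c j k : c != w -> c != j -> c != k ->
  chi c j k = theta c * h c j * h c k * Num.sg (tau0 c j - tau0 c k).
Proof.
move=> cw cj ck; rewrite /tau0 rotate_sg ?T01 // /chi /Y /X /theta /h.
set sg := Num.sg _; case: (wrapped_sign (T c w) (T c j)) => ->;
  by case: (wrapped_sign (T c w) (T c k)) => ->; ring.
Qed.

Let slope_eq j k : j != w -> k != w -> j != k -> slope j = slope k <-> [set w; j; k] \in D.
Proof.
move=> jw kw jk; rewrite eq_sym in jw; rewrite eq_sym in kw; rewrite -T_eq //.
have : (slope j == slope k) = (T w j == T w k); last by move=> E; split=> /eqP; [rewrite E|rewrite -E] => /eqP.
rewrite -subr_eq0 -[RHS]subr_eq0 -sgr_eq0 -[RHS]sgr_eq0 /slope rotate_sg ?T01 //.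
by rewrite !mulf_eq0; case: (wrapped_sign (T w u) (T w j)) => ->;
  case: (wrapped_sign (T w u) (T w k)) => ->; rewrite ?oppr_eq0 oner_eq0.
Qed.

Let tau0_gt0 c j : c != w -> j != w -> c != j -> slope c != slope j -> 0 < tau0 c j.
Proof.
move=> cw jw cj ns; rewrite /tau0 rotate_gt0 ?T01 //; apply: contra ns => /eqP e1.
apply/eqP/slope_eq => //; have /(T_eq cj cw jw) := e1.
 by congr (_ \in D); apply/setP => x; rewrite !inE; case: (x == w); case: (x == c); case: (x == j).
Qed.

(** [chi c j w] is computed twice: on [w] it compares two slopes, and on [c], which is cut at its
    crossing with [w], the time of [w] is [0] and that of [j] is positive. *)
Let hE c j : c != w -> j != w -> c != j -> slope c != slope j ->
  h c j = theta c * h c w * Num.sg (slope c - slope j).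
Proof.
move=> cw jw cj ns; have wj : w != j by rewrite eq_sym.
have wc : w != c by rewrite eq_sym.
have jc : j != c by rewrite eq_sym.
have := chi_tau0 cw cj cw; rewrite {2}/tau0 rotate_id subr0 gtr0_sg ?tau0_gt0 // mulr1.
have -> : chi c j w = Num.sg (slope c - slope j).
  by rewrite -chi_w // chi_swap' (chi_swap wc wj cj) opprK.
move=> ->; case: (theta_sign c) => ->; case: (h_sign cj) => ->; case: (h_sign cw) => ->; ring.
Qed.

(** The place on [c] measured from its crossing with [w]; the sign [theta c] decides in which
    direction [c] is traversed. *)
Definition time c j : R := theta c * tau0 c j.

Let chi_time c j k : c != w -> j != w -> k != w -> c != j -> c != k ->
  slope c != slope j -> slope c != slope k ->
  chi c j k = Num.sg (slope c - slope j) * Num.sg (slope c - slope k) * Num.sg (time c j - time c k).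
Proof.
move=> cw jw kw cj ck nj nk; rewrite chi_tau0 // (hE cw jw cj nj) (hE cw kw ck nk).
rewrite /time -mulrBr sgrM.
by case: (theta_sign c) => ->; case: (h_sign cw) => ->; rewrite ?sgrN ?sgr1; ring.
Qed.

(** For two lines that meet on [w] it tells which of them a third line meets first. *)
Definition pair_sign i x : R := h i x * h i w.

(** For slopes [p i < p j < p k] the slope signs in [chi_time] are known, and the alternation of
    [chi] turns into the signotope rule. For parallel [i] and [x] the two slope factors on line [k]
    cancel, and [chi i x k] is evaluated on [i] instead. *)
Lemma sign_data_affine : exists (p : 'I_12 -> R) (tau kap : 'I_12 -> 'I_12 -> R),
  [/\ (forall j k, j != w -> k != w -> j != k -> p j = p k <-> [set w; j; k] \in D),
      (forall j, j != w -> j != u -> p u < p j),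
      (forall i j k, i != w -> j != w -> k != w -> p i < p j < p k ->
         Num.sg (tau i j - tau i k) = Num.sg (tau j i - tau j k) /\
         Num.sg (tau i j - tau i k) = Num.sg (tau k i - tau k j)),
      (forall i x k, i != w -> x != w -> k != w -> i != x -> p i = p x -> p i != p k ->
         is_sign (kap i x) /\
         Num.sg (tau k i - tau k x) = kap i x * Num.sg (p k - p i)) &
      (forall i j k, i != w -> j != w -> k != w -> i != j -> i != k -> j != k ->
         tau i j = tau i k <-> [set i; j; k] \in D)].
Proof.
exists slope, time, pair_sign; split.
- exact: slope_eq.
- move=> j jw ju; rewrite /slope rotate_id rotate_gt0 ?T01 //; first by rewrite eq_sym.
  have wj : w != j by rewrite eq_sym.
  have uj : u != j by rewrite eq_sym.
  apply/eqP => e1; have /(T_eq wu wj uj) := esym e1.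
  by rewrite (negbTE (u_double jw ju)).
- move=> i j k iw jw kw /andP[pij pjk]; have pik := lt_trans pij pjk.
  have nij : i != j by apply: contraTneq pij => ->; rewrite ltxx.
  have njk : j != k by apply: contraTneq pjk => ->; rewrite ltxx.
  have nik : i != k by apply: contraTneq pik => ->; rewrite ltxx.
  have nji : j != i by rewrite eq_sym.
  have nkj : k != j by rewrite eq_sym.
  have nki : k != i by rewrite eq_sym.
  have := chi_time iw jw kw nij nik (negbT (lt_eqF pij)) (negbT (lt_eqF pik)).
  have := chi_time jw iw kw nji njk (negbT (gt_eqF pij)) (negbT (lt_eqF pjk)).
  have := chi_time kw iw jw nki nkj (negbT (gt_eqF pik)) (negbT (gt_eqF pjk)).
  have -> : chi k i j = chi i j k by rewrite chi_swap // chi_swap' opprK.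
  rewrite chi_swap //.
  have s1 : Num.sg (slope i - slope j) = -1 by rewrite ltr0_sg // subr_lt0.
  have s2 : Num.sg (slope i - slope k) = -1 by rewrite ltr0_sg // subr_lt0.
  have s3 : Num.sg (slope j - slope k) = -1 by rewrite ltr0_sg // subr_lt0.
  have s1' : Num.sg (slope j - slope i) = 1 by rewrite gtr0_sg // subr_gt0.
  have s2' : Num.sg (slope k - slope i) = 1 by rewrite gtr0_sg // subr_gt0.
  have s3' : Num.sg (slope k - slope j) = 1 by rewrite gtr0_sg // subr_gt0.
  by rewrite s1 s2 s3 s1' s2' s3' => h1 h2 h3; split; lra.
- move=> i x k iw xw kw ix ex nk; split.
    by rewrite /pair_sign; case: (h_sign ix) => ->; case: (h_sign iw) => ->;
      rewrite /is_sign ?mulrNN ?mul1r ?mulr1; auto.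
  have ik : i != k by apply: contraNneq nk => ->.
  have xk : x != k by apply: contraNneq nk => <-; rewrite ex.
  have ki : k != i by rewrite eq_sym.
  have kx : k != x by rewrite eq_sym.
  have nki : slope k != slope i by rewrite eq_sym.
  have nkx : slope k != slope x by rewrite -ex.
  have := chi_time kw iw xw ki kx nki nkx; rewrite -ex.
  have -> : chi k i x = chi i x k by rewrite chi_swap // chi_swap' opprK.
  have sk : Num.sg (slope k - slope i) * Num.sg (slope k - slope i) = 1.
    by case: (ltgtP (slope k) (slope i)) nki => // h1 _; [rewrite ltr0_sg ?subr_lt0|rewrite gtr0_sg ?subr_gt0] => //; ring.
  rewrite sk mul1r => <-; rewrite chi_tau0 // (hE iw kw ik nk).
  (* [i], [x] and [w] are concurrent, so [x] meets [i] exactly at the cut. *)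
  have -> : tau0 i x = 0.
    have /slope_eq - /(_ iw xw ix) h1 := ex.
    rewrite /tau0; suff -> : T i x = T i w by rewrite rotate_id.
    apply/T_eq => //; move: h1; congr (_ \in D); apply/setP => y.
    by rewrite !inE; case: (y == w); case: (y == i); case: (y == x).
  have s0 : Num.sg (0 - tau0 i k) = -1 by rewrite sub0r ltr0_sg // oppr_lt0 tau0_gt0.
  rewrite s0 /pair_sign -(opprB (slope i) (slope k)) sgrN.
  by case: (theta_sign i) => ->; ring.
move=> i j k iw jw kw ij ik jk; rewrite -T_eq //.
have : (time i j == time i k) = (T i j == T i k); last by move=> E; split=> /eqP; [rewrite E|rewrite -E] => /eqP.
rewrite -subr_eq0 -[RHS]subr_eq0 /time -mulrBr mulf_eq0.
have -> : (theta i == 0) = false by case: (theta_sign i) => ->; rewrite ?oppr_eq0 oner_eq0.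
rewrite /= -sgr_eq0 -[RHS]sgr_eq0 /tau0 rotate_sg ?T01 //.
by rewrite !mulf_eq0; case: (wrapped_sign (T i w) (T i j)) => ->;
  case: (wrapped_sign (T i w) (T i k)) => ->; rewrite ?oppr_eq0 oner_eq0.
Qed.

End SignAlgebra.

(** * Labelling an arrangement *)

Lemma sg_lt (R : realDomainType) (a b c d : R) : Num.sg (a - b) = Num.sg (c - d) ->
  (a < b) = (c < d) /\ (b < a) = (d < c).
Proof.
move=> e; split; first by rewrite -subr_lt0 -[RHS]subr_lt0 -sgr_lt0 -[RHS]sgr_lt0 e.
by rewrite -subr_gt0 -[RHS]subr_gt0 -sgr_gt0 -[RHS]sgr_gt0 e.
Qed.

Section Labelled.
Variables (R : realFieldType) (D : {set {set 'I_12}}).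
Hypothesis D_size : #|D| = 19%N.
Hypothesis D_card : forall S, S \in D -> #|S| = 3%N.
Hypothesis D_share : forall S S' i j, S \in D -> S' \in D -> i != j ->
  i \in S -> j \in S -> i \in S' -> j \in S' -> S = S'.
Variables (w u : 'I_12) (p : 'I_12 -> R) (tau kap : 'I_12 -> 'I_12 -> R).
Hypothesis w_full : degree D w = 5%N.
Hypotheses (uw : u != w) (joined_w : forall j, j != w -> joined D w j = (j != u)).
Hypothesis slope_eq : forall j k, j != w -> k != w -> j != k ->
  p j = p k <-> [set w; j; k] \in D.
Hypothesis slope_u : forall j, j != w -> j != u -> p u < p j.
Hypothesis sign_rule : forall i j k, i != w -> j != w -> k != w -> p i < p j < p k ->
  Num.sg (tau i j - tau i k) = Num.sg (tau j i - tau j k) /\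
  Num.sg (tau i j - tau i k) = Num.sg (tau k i - tau k j).
Hypothesis pair_rule : forall i x k, i != w -> x != w -> k != w -> i != x -> p i = p x ->
  p i != p k -> is_sign (kap i x) /\
  Num.sg (tau k i - tau k x) = kap i x * Num.sg (p k - p i).
Hypothesis time_eq : forall i j k, i != w -> j != w -> k != w -> i != j -> i != k -> j != k ->
  tau i j = tau i k <-> [set i; j; k] \in D.

Let prt := partner D w.

Let prtP j : j != w -> j != u -> [/\ prt j != w, prt j != j & [set w; j; prt j] \in D].
Proof. exact: partnerP. Qed.

Let slope_prt j : j != w -> j != u -> p (prt j) = p j.
Proof.
by move=> jw ju; have [h1 h2 h3] := prtP jw ju; apply/esym/slope_eq; rewrite // eq_sym.
Qed.

(** The line [u] serves as the third line: its slope is below all others, so it is parallel neither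
    to [j] nor to its partner. *)
Let kap_anti j : j != w -> j != u -> is_sign (kap j (prt j)) /\ kap (prt j) j = - kap j (prt j).
Proof.
move=> jw ju; have [h1 h2 h3] := prtP jw ju; have ep := slope_prt jw ju.
have hu : prt j != u := partner_neq_u D_card joined_w jw ju.
have lt := slope_u jw ju; have lt' := slope_u h1 hu.
have jp : j != prt j by rewrite eq_sym.
have [s1 e1] := pair_rule jw h1 uw jp (esym ep) (negbT (gt_eqF lt)).
have [s2 e2] := pair_rule h1 jw uw h2 ep (negbT (gt_eqF lt')).
split=> //; move: e2; rewrite ep -(opprB (tau u j)) sgrN e1 ltr0_sg ?subr_lt0 // !mulrN1 opprK.
by move=> /(congr1 -%R); rewrite opprK.
Qed.

(** From each pair of parallel lines the one that will get the even label; by [kap_anti] exactly one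
    of the two qualifies. *)
Let firsts := [set a | [&& a != w, a != u & kap a (prt a) == 1]].

Let firstsP a : a \in firsts -> [/\ a != w, a != u & kap a (prt a) = 1].
Proof. by rewrite inE => /and3P[-> -> /eqP->]. Qed.

Let prt_firsts a : a != w -> a != u -> (prt a \in firsts) = (a \notin firsts).
Proof.
move=> aw au; have [h1 h2 h3] := prtP aw au.
have hu : prt a != u := partner_neq_u D_card joined_w aw au.
have [s1 e1] := kap_anti aw au; rewrite !inE h1 hu aw au /= /prt (partnerK D_card D_share joined_w aw au) -/prt e1.
case: s1 => ->; rewrite ?opprK eqxx /=; first by rewrite eq_sym -subr_eq0 opprK -(natrD _ 1 1) pnatr_eq0.
by rewrite eq_sym -subr_eq0 opprK -(natrD _ 1 1) pnatr_eq0.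
Qed.

Let card_firsts : #|firsts| = 5%N.
Proof.
have prt_inj : {in [set~ w] :\ u &, injective prt}.
  move=> a b; rewrite !inE => /andP[au aw] /andP[bu bw] e.
  rewrite -(partnerK D_card D_share joined_w aw au) -(partnerK D_card D_share joined_w bw bu).
  by congr (partner D w _).
have c10 : #|[set~ w] :\ u| = 10%N.
  by have := cardsD1 u [set~ w]; rewrite cardsC1 card_ord !inE uw => e; apply: (@addnI 1); exact: esym e.
have sub : firsts \subset [set~ w] :\ u.
  by apply/subsetP => a /firstsP[aw au _]; rewrite !inE aw au.
have eC : ([set~ w] :\ u) :\: firsts = prt @: firsts.
  apply/setP => a; apply/idP/imsetP.
    rewrite !in_setD !inE => /and3P[na au aw]; exists (prt a).
      by rewrite prt_firsts // inE aw au; move: na; rewrite aw au.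
    by rewrite /prt (partnerK D_card D_share joined_w aw au).
  move=> [b bF ->]; have [bw bu _] := firstsP bF; have [h1 h2 _] := prtP bw bu.
  rewrite in_setD prt_firsts // negbK bF !inE h1 andbT /=.
  exact: (partner_neq_u D_card joined_w bw bu).
have := cardsID firsts ([set~ w] :\ u); rewrite c10 eC (setIidPr sub) card_in_imset.
  by move: #|firsts| => n; lia.
by move=> a b /(subsetP sub) h1 /(subsetP sub) h2; exact: prt_inj.
Qed.

Let reps := sort (relpre p <=%R) (enum firsts).

Let size_reps : size reps = 5%N.
Proof. by rewrite size_sort -cardE card_firsts. Qed.

Let mem_reps a : (a \in reps) = (a \in firsts).
Proof. by rewrite mem_sort mem_enum. Qed.

Let uniq_reps : uniq reps.
Proof. by rewrite sort_uniq enum_uniq. Qed.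

(* The label 12 falls off the list of representatives and denotes [w]. *)
Definition line l : 'I_12 :=
  if l == 1%N then u else
  let a := nth w reps (l./2).-1 in if odd l then prt a else a.

Lemma line12 : line 12 = w.
Proof. by rewrite /line /= nth_default // size_reps. Qed.

Let rep_in c : (0 < c < 6)%N -> nth w reps c.-1 \in firsts.
Proof. by move=> hc; rewrite -mem_reps mem_nth // size_reps; lia. Qed.

Let class_slope c : R := if c == 0%N then p u else p (nth w reps c.-1).

Let class_slope_lt c d : (c < d < 6)%N -> class_slope c < class_slope d.
Proof.
move=> /andP[cd d6]; rewrite /class_slope [d == _]gtn_eqF ?(leq_ltn_trans _ cd) //.
have hd : (0 < d < 6)%N by move: cd d6; clear; lia.
have [rw' ru _] := firstsP (rep_in hd).
case: eqP => [_|/eqP c0]; first exact: slope_u.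
have hc : (0 < c < 6)%N by move: c0 cd d6; clear; lia.
have [cw cu kc] := firstsP (rep_in hc).
have [sc sd le ncd] : [/\ (c.-1 < size reps)%N, (d.-1 < size reps)%N, (c.-1 <= d.-1)%N & c.-1 != d.-1].
  by rewrite size_reps; split; move: hc hd cd; clear; lia.
have ne : nth w reps c.-1 != nth w reps d.-1 by rewrite nth_uniq.
rewrite lt_neqAle; apply/andP; split.
  apply/eqP => /slope_eq - /(_ cw rw' ne) SD.
  have e : nth w reps d.-1 = prt (nth w reps c.-1).
    by apply: (partner_unique D_card D_share joined_w); rewrite // eq_sym.
  by have := rep_in hd; rewrite e prt_firsts // rep_in.
have tot : total (relpre p <=%R) by move=> a b; exact: le_total.
have trans : transitive (relpre p <=%R) by move=> a b c'; exact: le_trans.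
exact: (sorted_leq_nth trans (fun a => le_refl (p a)) w (sort_sorted tot (enum firsts))).
Qed.

Lemma lineP l : l \in lab -> line l != w /\ p (line l) = class_slope l./2.
Proof.
rewrite mem_lab => hl; rewrite /line; case: (l =P 1%N) => [->|/eqP l1]; first by rewrite uw.
have hc : (0 < l./2 < 6)%N by lia.
have [rw' ru _] := firstsP (rep_in hc); have [h1 h2 _] := prtP rw' ru.
rewrite /class_slope gtn_eqF; last by case/andP: hc.
by case: (odd l); rewrite ?slope_prt.
Qed.

Let slope_lt i j : ok i j -> (i < j)%N -> p (line i) < p (line j).
Proof.
move=> /and3P[li lj ij] lt; have [_ ->] := lineP li; have [_ ->] := lineP lj.
by apply: class_slope_lt; move: lj ij; rewrite mem_lab; lia.
Qed.

Let ok_slope i j : ok i j -> p (line i) != p (line j).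
Proof.
move=> ij; have := ok_neq ij; rewrite neq_ltn => /orP[] lt.
  by rewrite lt_eqF // slope_lt.
by rewrite gt_eqF // slope_lt // ok_sym.
Qed.

Let line_pair i x : (i < x)%N -> i \in lab -> x \in lab -> i./2 = x./2 ->
  line i \in firsts /\ line x = prt (line i).
Proof.
rewrite !mem_lab => ix hi hx e; have xE : x = i.+1 by lia.
have oi : odd i = false by lia.
have i1 : (i == 1%N) = false by apply/eqP => h; rewrite h in oi.
have x1 : (x == 1%N) = false by rewrite xE; apply/eqP; lia.
rewrite /line i1 x1 oi -e; have -> : odd x by rewrite xE /= oi.
by split=> //; apply: rep_in; lia.
Qed.

Lemma line_inj : {in lab &, injective line}.
Proof.
have wl i x : (i < x)%N -> i \in lab -> x \in lab -> line i != line x.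
  move=> ix li lx; have [e|ne] := eqVneq i./2 x./2.
    have [fi ->] := line_pair ix li lx e; have [h1 h2 _] := firstsP fi.
    by have [_ h _] := prtP h1 h2; rewrite eq_sym.
  apply: contraNneq (ok_slope (i := i) (j := x) _) => [->//|].
  by rewrite /ok li lx.
move=> i x li lx e; case: (ltngtP i x) => // h; first by have := wl _ _ h li lx; rewrite e eqxx.
by have := wl _ _ h lx li; rewrite e eqxx.
Qed.

Let t i j := tau (line i) (line j).

Lemma line_signotope : signotope t.
Proof.
move=> i j k ij jk ik /andP[lt1 lt2].
have [li lj _] := and3P ij; have [_ lk _] := and3P ik.
have [wi _] := lineP li; have [wj _] := lineP lj; have [wk _] := lineP lk.
have h1 := slope_lt ij lt1; have h2 := slope_lt jk lt2.
have [/sg_lt[e1 e2] /sg_lt[e3 e4]] := sign_rule wi wj wk (introT andP (conj h1 h2)).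
by rewrite /t; split.
Qed.

Lemma line_parallel_order : parallel_order t.
Proof.
move=> i x k ix e ik lx; have [li lk ne] := and3P ik.
have [fi ex] := line_pair ix li lx e; have [iw iu ki] := firstsP fi.
have [xw px] := lineP lx; have [_ pi] := lineP li; have [kw _] := lineP lk.
have nix : line i != line x.
  by apply/eqP => /(line_inj li lx) h; rewrite h ltnn in ix.
have epx : p (line i) = p (line x) by rewrite px pi e.
have [_ sgE] := pair_rule iw xw kw nix epx (ok_slope ik).
rewrite {2}ex ki mul1r in sgE; have [e1 e2] := sg_lt sgE.
case: ifP => [lt|/negbT]; first by rewrite e2 slope_lt.
by rewrite -leqNgt leq_eqVlt eq_sym (negbTE (ok_neq ik)) /= => lt; rewrite e1 slope_lt // ok_sym.
Qed.

Lemma line_conc a b c : ok a b -> ok a c -> line b != line c ->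
  (t a b == t a c) = ([set line a; line b; line c] \in D).
Proof.
move=> ab ac bc; have [la lb _] := and3P ab; have [_ lc _] := and3P ac.
have [aw _] := lineP la; have [bw _] := lineP lb; have [cw _] := lineP lc.
have nab : line a != line b by apply: contraNneq (ok_slope ab) => ->.
have nac : line a != line c by apply: contraNneq (ok_slope ac) => ->.
by apply/eqP/idP => h; apply/(time_eq aw bw cw).
Qed.

Lemma line_simple_vertices a b : ok a b -> (size (on_vertex t a b) <= 3)%N.
Proof.
move=> ab; have [la lb _] := and3P ab; have uV : uniq (on_vertex t a b) by rewrite filter_uniq ?iota_uniq.
have nab : line a != line b by apply: contraNneq (ok_slope ab) => ->.
have [/hasP[x xV]|/hasPn h] := boolP (has (fun x => (x != a) && (x != b)) (on_vertex t a b)); last first.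
  have sub : {subset on_vertex t a b <= [:: a; b]}.
    by move=> x /h; rewrite negb_and !negbK !inE.
  by apply: leq_trans (uniq_leq_size uV sub) _.
move=> /andP[xa xb]; move: xV; rewrite mem_filter (negbTE xa) /= => /andP[/andP[ax tx] lx].
have xb' : line x != line b by apply: contra xb => /eqP /(line_inj lx lb) ->.
rewrite line_conc // in tx.
have sub : {subset map line (on_vertex t a b) <= enum [set line a; line x; line b]}.
  move=> _ /mapP[y yV ->]; rewrite mem_enum; move: yV; rewrite mem_filter => /andP[/orP[/eqP->|/andP[ay ty]] ly].
    by rewrite !inE eqxx.
  have [->|yb] := eqVneq y b; first by rewrite !inE eqxx !orbT.
  have yb' : line y != line b by apply: contra yb => /eqP /(line_inj ly lb) ->.
  rewrite line_conc // in ty.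
  by rewrite (D_share tx ty nab) !inE ?eqxx ?orbT.
rewrite -(size_map line); apply: leq_trans (uniq_leq_size _ sub) _; last by rewrite -cardE (D_card tx).
rewrite map_inj_in_uniq // => x1 x2; rewrite !mem_filter => /andP[_ l1] /andP[_ l2]; exact: line_inj.
Qed.

Let cond (T : triple) := let: (a, b, c) := T in
  [&& (a < b < c)%N, ok a b, ok b c, ok a c & t a b == t a c].

Let TS : seq triple :=
  [seq T <- [seq (x, c) | x <- [seq (a, b) | a <- lab, b <- lab], c <- lab] | cond T].

Let uniq_TS : uniq TS.
Proof.
apply: filter_uniq; apply: allpairs_uniq; rewrite ?iota_uniq //; by move=> [x1 x2] [y1 y2].
Qed.

Let mem_TS a b c : ((a, b, c) \in TS) =
  [&& (a < b < c)%N, ok a b, ok b c, ok a c & t a b == t a c].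
Proof.
rewrite mem_filter; apply/andb_idr => /and5P[_ /and3P[la lb _] /and3P[_ lc _] _ _].
apply: (allpairs_f (fun x c => (x, c)) _ lc).
exact: (allpairs_f (fun a b => (a, b)) la lb).
Qed.

Let line_onto x : x != w -> exists2 l, l \in lab & line l = x.
Proof.
move=> xw; have uL : uniq (map line lab) by rewrite map_inj_in_uniq ?iota_uniq //; exact: line_inj.
have sub : {subset map line lab <= enum [set~ w]}.
  by move=> _ /mapP[l ll ->]; rewrite mem_enum !inE; have [] := lineP ll.
have [|_ h] := uniq_min_size uL sub; first by rewrite -cardE cardsC1 card_ord size_map.
have : x \in enum [set~ w] by rewrite mem_enum !inE.
by rewrite -h => /mapP[l ll ->]; exists l.
Qed.

Let labels_of S : S \in D -> w \notin S -> exists a b c,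
  [/\ [seq l <- lab | line l \in S] = [:: a; b; c], (a, b, c) \in TS & S = [set line a; line b; line c]].
Proof.
move=> SD wS; set s := [seq l <- lab | line l \in S].
have s_lab l : l \in s -> l \in lab by rewrite mem_filter => /andP[].
have us : uniq (map line s).
  by rewrite map_inj_in_uniq ?filter_uniq ?iota_uniq // => x y /s_lab lx /s_lab ly; exact: line_inj.
have Ss x : (x \in S) = (x \in map line s).
  apply/idP/mapP => [xS|[l + ->]]; last by rewrite mem_filter => /andP[].
  have [|l ll e] := line_onto (x := x); first by apply: contraNneq wS => <-.
  by exists l => //; rewrite mem_filter e xS.
have sz : size s = 3%N.
  rewrite -(size_map line) -(card_uniqP us); apply/eqP.
  by rewrite -(eq_card Ss) D_card.
have srt : sorted ltn s by apply: sorted_filter; [exact: ltn_trans|].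
case: s s_lab us Ss sz srt => [|a [|b [|c []]]] // s_lab us Ss _ /=; rewrite andbT => /andP[ab bc].
have eS : S = [set line a; line b; line c].
  by apply/setP => x; rewrite Ss !inE orbA.
have [la lb lc] : [/\ a \in lab, b \in lab & c \in lab].
  by rewrite !s_lab ?inE ?eqxx ?orbT.
have okS x y : x \in [:: a; b; c] -> y \in [:: a; b; c] -> (x < y)%N -> ok x y.
  move=> xs ys lt; have lx := s_lab _ xs; have ly := s_lab _ ys.
  rewrite /ok lx ly /=; apply/negP => /eqP e.
  have [fx ey] := line_pair lt lx ly e; have [h1 h2 _] := firstsP fx.
  have [_ h3 PD] := prtP h1 h2.
  have xS : line x \in S by rewrite Ss map_f.
  have yS : prt (line x) \in S by rewrite -ey Ss map_f.
  have h3' : line x != prt (line x) by rewrite eq_sym.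
  have SE : S = [set w; line x; prt (line x)].
    by apply: (D_share SD PD h3'); rewrite // !inE eqxx ?orbT.
  by rewrite SE !inE eqxx in wS.
have ac := ltn_trans ab bc.
have [oab obc oac] : [/\ ok a b, ok b c & ok a c].
  by rewrite !okS ?inE ?eqxx ?orbT.
exists a, b, c; split=> //; rewrite mem_TS ab bc oab obc oac /= line_conc //.
  by rewrite -eS.
by apply/eqP => /(line_inj lb lc) h; rewrite h ltnn in bc.
Qed.

Let TS_set a b c : (a, b, c) \in TS ->
  [/\ [set line a; line b; line c] \in D, w \notin [set line a; line b; line c],
      a \in lab, b \in lab & c \in lab].
Proof.
rewrite mem_TS => /and5P[/andP[ab bc] oab obc oac e].
have [la lb _] := and3P oab; have [_ lc _] := and3P oac.
have [aw _] := lineP la; have [bw _] := lineP lb; have [cw _] := lineP lc.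
split=> //; last by rewrite !inE !negb_or ![w == _]eq_sym aw bw cw.
rewrite -line_conc //; apply/eqP => /(line_inj lb lc) h; by rewrite h ltnn in bc.
Qed.

Let set_of (T : triple) : {set 'I_12} := let: (a, b, c) := T in [set line a; line b; line c].

Let set_of_inj : {in TS &, injective set_of}.
Proof.
move=> [[a b] c] [[a' b'] c'] hT hT' e.
have [SD wS la lb lc] := TS_set hT; have [_ _ la' lb' lc'] := TS_set hT'.
have mem_label l x y z : l \in lab -> x \in lab -> y \in lab -> z \in lab ->
    (line l \in [set line x; line y; line z]) = (l \in [:: x; y; z]).
  by move=> ll lx ly lz; rewrite !inE !(inj_in_eq line_inj) // orbA.
have E : [:: a; b; c] = [:: a'; b'; c'].
  apply: (irr_sorted_eq ltn_trans ltnn).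
  - by move: hT; rewrite mem_TS /= andbT => /and5P[].
  - by move: hT'; rewrite mem_TS /= andbT => /and5P[].
  move=> l; have [ll|ll] := boolP (l \in lab).
    by have := congr1 (fun S : {set 'I_12} => line l \in S) e; rewrite /= !mem_label.
  rewrite !inE; apply/idP/idP => /or3P[]/eqP h; by rewrite h ?la ?lb ?lc ?la' ?lb' ?lc' in ll.
by case: E => -> -> ->.
Qed.

(** Five of the nineteen triples contain [w], and [set_of] matches the sorted label triples with the
    remaining ones. *)
Let size_TS : size TS = 14%N.
Proof.
rewrite -(size_map set_of).
have <- : #|[set S in D | w \notin S]| = 14%N.
  have := cardsID [set S : {set 'I_12} | w \in S] D; rewrite D_size.
  have -> : D :&: [set S : {set 'I_12} | w \in S] = [set S in D | w \in S].
    by apply/setP => S; rewrite !inE.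
  have -> : D :\: [set S : {set 'I_12} | w \in S] = [set S in D | w \notin S].
    by apply/setP => S; rewrite !inE andbC.
  by rewrite -/(degree D w) w_full => h; apply: (@addnI 5).
rewrite cardE; apply: perm_size; apply: uniq_perm.
- by rewrite map_inj_in_uniq ?uniq_TS //; exact: set_of_inj.
- exact: enum_uniq.
move=> S; rewrite mem_enum inE; apply/mapP/andP => [[[[a b] c] /TS_set[h1 h2 _ _ _] ->] //|[SD wS]].
by have [a [b [c [_ hT eS]]]] := labels_of SD wS; exists (a, b, c).
Qed.

Let others := [set S in D | w \notin S].

Let label_count S : S \in others -> (\sum_(l <- lab) (line l \in S) = 3)%N.
Proof.
rewrite inE => /andP[SD wS]; have [a [b [c [e _ _]]]] := labels_of SD wS.
have -> : (\sum_(l <- lab) (line l \in S) = \sum_(l <- lab | line l \in S) 1)%N.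
  by rewrite [RHS]big_mkcond; apply: eq_bigr => l _; case: (line l \in S).
by rewrite -big_filter e !big_cons big_nil.
Qed.

Let through i := (\sum_(S in others) (line i \in S))%N.

Let sum_through : (\sum_(i <- lab) through i = 42)%N.
Proof.
rewrite exchange_big /= (eq_bigr (fun=> 3%N)) => [|S]; last exact: label_count.
rewrite sum_nat_const -size_TS -(size_map set_of).
suff -> : #|others| = size (map set_of TS) by rewrite size_map size_TS.
rewrite cardE; apply: perm_size; apply: uniq_perm.
- exact: enum_uniq.
- by rewrite map_inj_in_uniq ?uniq_TS //; exact: set_of_inj.
move=> S; rewrite mem_enum inE; apply/andP/mapP => [[SD wS]|[[[a b] c] /TS_set[h1 h2 _ _ _] ->] //].
by have [a [b [c [_ hT eS]]]] := labels_of SD wS; exists (a, b, c).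
Qed.

Let others_ok S i j : S \in others -> i \in lab -> j \in lab -> i != j ->
  line i \in S -> line j \in S -> ok i j.
Proof.
rewrite inE => /andP[SD wS] li lj ij iS jS; have [a [b [c [e hT eS]]]] := labels_of SD wS.
have mS l : l \in lab -> line l \in S -> l \in [:: a; b; c].
  by move=> ll lS; rewrite -e mem_filter ll lS.
move: hT; rewrite mem_TS => /and5P[_ oab obc oac _]; move: ij (mS _ li iS) (mS _ lj jS).
rewrite !inE => nij /or3P[]/eqP ei /or3P[]/eqP ej; move: nij; rewrite ei ej ?eqxx // => _;
  by rewrite // ok_sym.
Qed.

Let card3 (x y z : 'I_12) : uniq [:: x; y; z] -> #|[set x; y; z]| = 3%N.
Proof.
move=> uq; transitivity #|[:: x; y; z]|; last exact: (card_uniqP uq).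
by apply: eq_card => v; rewrite !inE orbA.
Qed.

Let dbl_joined i j : ok i j ->
  dbl t i j = ~~ [exists S in others, (line i \in S) && (line j \in S)].
Proof.
move=> ij; have [li lj _] := and3P ij; rewrite /dbl ij andTb.
have nij : line i != line j by apply: contraNneq (ok_slope ij) => ->.
have [iw _] := lineP li; have [jw _] := lineP lj.
apply/allP/exists_inPn => [h S|h x lx].
  rewrite inE => /andP[SD wS]; apply/negP => /andP[iS jS].
  have [x xS] : exists2 x, x \in S & x \notin [set line i; line j].
    apply/subsetPn; apply/negP => /subset_leq_card; rewrite (D_card SD) cards2.
    by case: (_ != _).
  rewrite !inE negb_or => /andP[xi xj].
  have [|l ll e] := line_onto (x := x); first by apply: contraNneq wS => <-.
  have li' : i != l by apply: contraNneq xi => ->; rewrite e.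
  have lj' : l != j by apply: contraNneq xj => <-; rewrite e.
  have SO : S \in others by rewrite inE SD.
  have oil : ok i l by apply: (others_ok SO) => //; rewrite e.
  have := h l ll; rewrite oil (negbTE lj') implybF /=; apply/negP; rewrite negbK.
  rewrite line_conc ?e //; suff -> : [set line i; x; line j] = S by [].
  apply/eqP; rewrite eqEcard (D_card SD) card3 ?leqnn ?andbT; last first.
    by rewrite /= !inE negb_or nij xj eq_sym xi.
  by apply/subsetP => y; rewrite !inE => /orP[/orP[]|] /eqP->.
apply/implyP => ix; apply/implyP => e; apply/negPn/negP => xj.
have nxj : line x != line j by apply: contra xj => /eqP /(line_inj lx lj) ->.
have [xw _] := lineP lx.
rewrite line_conc // in e; have := h [set line i; line x; line j].
rewrite inE e !inE !negb_or ![w == _]eq_sym iw xw jw => /(_ isT).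
by rewrite !eqxx !orbT.
Qed.

Let dbl_ok i j : dbl t i j -> ok i j.
Proof. by case/andP. Qed.

Let others_count i j : i \in lab -> j \in lab -> j != i ->
  (\sum_(S in others) ((line i \in S) && (line j \in S)) = ok i j && ~~ dbl t i j :> nat)%N.
Proof.
move=> li lj ji; have nij : line i != line j.
  by apply: contraNneq ji => /(line_inj li lj) ->.
have ij : i != j by rewrite eq_sym.
have [oij|nok] := boolP (ok i j); last first.
  rewrite big1 // => S SO; apply/eqP; rewrite eqb0; apply: contra nok => /andP[iS jS].
  exact: (others_ok SO li lj ij).
rewrite dbl_joined // negbK /=.
case: (boolP [exists S in others, (line i \in S) && (line j \in S)])
  => [/exists_inP[S SO /andP[iS jS]]|/exists_inPn h]; last first.
  by rewrite big1 // => S /h/negbTE->.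
rewrite (bigD1 S) //= iS jS big1 ?addn0 // => S' /andP[S'O ne].
apply/eqP; rewrite eqb0; apply: contra ne => /andP[iS' jS'].
move: SO S'O; rewrite !inE => /andP[SD _] /andP[S'D _].
by rewrite (D_share SD S'D nij).
Qed.

Let sum_lab (P : pred nat) : count P lab = (\sum_(j <- lab) (P j : nat))%N.
Proof. by rewrite -sum1_count big_mkcond; apply: eq_bigr => j _; case: (P j). Qed.

(** Every line that crosses [i] in the affine part does so in a double point or is one of the two
    further lines of a triple through [i]. *)
Let ok_count i : i \in lab -> count (ok i) lab = (count (dbl t i) lab + 2 * through i)%N.
Proof.
move=> li; have okii : ok i i = false by rewrite /ok eqxx !andbF.
have dblii : dbl t i i = false by apply/negP => /dbl_ok; rewrite okii.
rewrite !sum_lab !(bigD1_seq i li (iota_uniq _ _)) /= okii dblii !add0n.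
transitivity (\sum_(j <- lab | j != i) ((dbl t i j : nat) +
    \sum_(S in others) ((line i \in S) && (line j \in S))))%N.
  rewrite big_seq_cond [RHS]big_seq_cond; apply: eq_bigr => j /andP[lj ji]; rewrite others_count //.
  by case: (boolP (dbl t i j)) => [/dbl_ok->|]; case: (ok i j).
rewrite big_split /=; congr (_ + _)%N.
rewrite exchange_big /= /through big_distrr /=; apply: eq_bigr => S SO.
case iS : (line i \in S); last by rewrite big1.
have := label_count SO; rewrite (bigD1_seq i li (iota_uniq _ _)) /= iS => -[e].
by rewrite muln1; exact: e.
Qed.

Let ok_count_lab : all (fun i => count (ok i) lab == 9 + (i == 1))%N lab.
Proof. vm_compute. reflexivity. Qed.

Lemma line_leaves_sound : good TS leaves.
Proof.
have c1 i : i \in lab -> (count (dbl t i) lab + 2 * through i = 9 + (i == 1))%N.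
  by move=> li; rewrite -ok_count //; have /allP/(_ i li)/eqP := ok_count_lab.
have odd1 i : i \in lab -> odd (count (dbl t i) lab) = (i != 1%N).
  move=> li; have := congr1 odd (c1 i li); rewrite oddD oddM /= addbF => ->.
  by rewrite oddD /= oddb; case: (i == 1%N).
have s16 : (\sum_(i <- lab) count (dbl t i) lab = 16)%N.
  have : (\sum_(i <- lab) (count (dbl t i) lab + 2 * through i) = \sum_(i <- lab) (9 + (i == 1)))%N.
    by rewrite big_seq [RHS]big_seq; apply: eq_bigr => i li; exact: c1.
  rewrite big_split /= -big_distrr /= sum_through => h.
  (* The numbers of affine crossings add up to [9 * 11 + 1 = 100], of which [2 * 42 = 84] belong to
     triple points. *)
  apply/eqP; rewrite -(eqn_add2r 84); apply/eqP; rewrite h unlock.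
  by vm_compute.
apply: (leaves_sound line_signotope line_parallel_order line_simple_vertices mem_TS uniq_TS size_TS) => //.
(* Each number is its parity plus twice its rounded half. The parities contribute [10], so that
   twice the sum of the halves is [6]. *)
have : (\sum_(i <- lab) ((i != 1%N) + (count (dbl t i) lab)./2.*2) = 16)%N.
  rewrite -s16 big_seq [RHS]big_seq; apply: eq_bigr => i li.
  by rewrite -{2}[count (dbl t i) lab]odd_double_half odd1.
rewrite big_split /= [X in (X + _)%N = _ -> _](_ : _ = 10)%N; last by rewrite unlock; vm_compute.
rewrite (eq_bigr (fun i => 2 * (count (dbl t i) lab)./2)%N) => [|i _]; last by rewrite mul2n.
by rewrite -big_distrr /=; move: (\sum_(i <- lab) _)%N => n; lia.
Qed.

Let all_lines := map line (iota 1 12).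

Let mem_12 l : (l \in iota 1 12) = (l == 12%N) || (l \in lab).
Proof. by rewrite mem_lab mem_iota; clear; lia. Qed.

Let line_inj12 : {in iota 1 12 &, injective line}.
Proof.
move=> i j; rewrite !mem_12 => /orP[/eqP->|li] /orP[/eqP->|lj] //; last exact: line_inj.
  by rewrite line12 => e; have [] := lineP lj; rewrite -e eqxx.
by rewrite line12 => e; have [] := lineP li; rewrite e eqxx.
Qed.

Let mem_all_lines x : x \in all_lines.
Proof.
have [->|xw] := eqVneq x w; first by rewrite -line12 map_f.
by have [l ll <-] := line_onto xw; rewrite map_f // mem_12 ll orbT.
Qed.

Let label_of x := (index x all_lines).+1.

Let label_of_line l : (0 < l <= 12)%N -> label_of (line l) = l.
Proof.
move=> hl; have ll : l \in iota 1 12 by rewrite mem_iota; move: hl; clear; lia.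
have lt : (l.-1 < 12)%N by move: hl; clear; lia.
have el : (1 + l.-1)%N = l by move: hl; clear; lia.
have -> : line l = nth w all_lines l.-1 by rewrite (nth_map 0%N) ?size_iota // nth_iota // el.
have ua : uniq all_lines by rewrite map_inj_in_uniq ?iota_uniq //; exact: line_inj12.
by rewrite /label_of index_uniq ?size_map ?size_iota // -add1n.
Qed.

Let label_of_bound x : (0 < label_of x <= 12)%N.
Proof. by have := mem_all_lines x; rewrite -index_mem size_map size_iota. Qed.

Let line_of_label x : line (label_of x) = x.
Proof.
have /mapP[l ll ->] := mem_all_lines x; rewrite label_of_line //.
by move: ll; rewrite mem_iota; clear; lia.
Qed.

Lemma triple_at_infinity S : S \in D -> w \in S -> exists i,
  (2 * i, (2 * i).+1, 12)%N \in triples_at_infinity /\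
  S = [set line (2 * i); line (2 * i).+1; line 12].
Proof.
move=> SD wS.
have /subsetPn[x xS] : ~~ (S \subset [set w]).
  by apply/negP => /subset_leq_card; rewrite (D_card SD) cards1.
rewrite inE => xw; have wx : w != x by rewrite eq_sym.
have xu : x != u by rewrite -joined_w //; apply/exists_inP; exists S; rewrite // wS xS.
have [l ll e] := line_onto xw.
have l1 : l != 1%N by apply: contraNneq xu => l1; rewrite -e l1.
move: (ll); rewrite mem_lab => hl.
have hi : (0 < l./2 < 6)%N by move: hl l1; clear; lia.
have [i1 i2] : (2 * l./2 \in lab /\ (2 * l./2).+1 \in lab)%N.
  by rewrite !mem_lab; move: hi; clear; lia.
have [fi eo] := line_pair (ltnSn _) i1 i2 ltac:(clear; lia).
have [h1 h2 _] := firstsP fi; have [h3 h4 PD] := prtP h1 h2.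
exists l./2; split.
  by move: hi; case: (l./2) => [|[|[|[|[|[|n]]]]]].
rewrite line12 eo.
have -> : [set line (2 * l./2); prt (line (2 * l./2)); w] = [set w; line (2 * l./2); prt (line (2 * l./2))].
  by rewrite setUC setUA.
have xI : x \in [set w; line (2 * l./2); prt (line (2 * l./2))].
  rewrite -e -eo !inE; have [e'|e'] : l = (2 * l./2)%N \/ l = (2 * l./2).+1 by clear; lia.
    by apply/orP; left; apply/orP; right; apply/eqP; congr line.
  by apply/orP; right; apply/eqP; congr line.
by apply: (D_share SD PD wx); rewrite // inE !inE eqxx.
Qed.

Lemma unordered_sort_triple x y z :
  unordered_triple (sort_triple x y z) = [set label x; label y; label z].
Proof.
rewrite /sort_triple; case: ifP => _; case: ifP => _; try case: ifP => _; rewrite /unordered_triple;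
  by apply/setP => v; rewrite !inE; do 3 case: (v == _).
Qed.

Lemma certificate_isomorphism T m pl : T =i TS -> leaf_ok T (m, pl) ->
  exists (k : 'I_13) (g : {perm 'I_12}), forall S, S \in D -> g @: S \in list_C k.
Proof.
move=> eT /and5P[_ m13 upl /eqP spl /andP[/allP pl12 /allP hT]].
pose g0 x := label (nth 0%N pl (label_of x).-1).
have bound x : (0 < nth 0%N pl (label_of x).-1 <= 12)%N.
  by apply: pl12; rewrite mem_nth // spl; have := label_of_bound x; clear; lia.
have label_inj a b : (0 < a <= 12)%N -> (0 < b <= 12)%N -> label a = label b -> a = b.
  move=> ha hb /(congr1 val); rewrite /label /= !inordK; move: ha hb; clear; lia.
have g0_inj : injective g0.
  move=> x y /label_inj - /(_ (bound x) (bound y)) /eqP.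
  have hx := label_of_bound x; have hy := label_of_bound y.
  have sx : ((label_of x).-1 < size pl)%N by rewrite spl; move: hx; clear; lia.
  have sy : ((label_of y).-1 < size pl)%N by rewrite spl; move: hy; clear; lia.
  rewrite (nth_uniq 0%N sx sy upl) => /eqP e; have e' : label_of x = label_of y := congr1 S e.
  by rewrite -(line_of_label x) e' line_of_label.
exists (Ordinal m13), (perm g0_inj) => S SD.
have [a [b [c [tI ha hb hc eS]]]] : exists a b c, [/\ (a, b, c) \in T ++ triples_at_infinity,
    (0 < a <= 12)%N, (0 < b <= 12)%N, (0 < c <= 12)%N & S = [set line a; line b; line c]].
  have [wS|wS] := boolP (w \in S).
    have [i [iI eS]] := triple_at_infinity SD wS.
    exists (2 * i)%N, (2 * i).+1, 12%N; rewrite mem_cat iI orbT; split=> //.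
      by move: iI; rewrite !inE => /or4P[| | |/orP[]] /eqP[-> _].
    by move: iI; rewrite !inE => /or4P[| | |/orP[]] /eqP[_ ->].
  have [a [b [c [_ hT' eS]]]] := labels_of SD wS.
  have [_ _ la lb lc] := TS_set hT'.
  exists a, b, c; rewrite mem_cat eT hT'; split=> //;
    by [move: la; rewrite mem_lab; clear; lia|move: lb; rewrite mem_lab; clear; lia|
        move: lc; rewrite mem_lab; clear; lia].
have := hT _ tI => /= h; rewrite inE; apply/mapP.
exists (sort_triple (nth 0%N pl a.-1) (nth 0%N pl b.-1) (nth 0%N pl c.-1)); first exact: h.
rewrite unordered_sort_triple eS !imsetU !imset_set1 !permE /g0.
by rewrite !label_of_line.
Qed.

Lemma all2_mem (A : eqType) (B : Type) (r : A -> B -> bool) s s' x :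
  all2 r s s' -> x \in s -> exists y, r x y.
Proof.
elim: s s' => [|a s IH] [|b s'] //= /andP[rab /IH h]; rewrite inE => /orP[/eqP->|/h //].
by exists b.
Qed.

Lemma triples_in_table :
  exists (k : 'I_13) (g : {perm 'I_12}), forall S, S \in D -> g @: S \in list_C k.
Proof.
have [T Tl hT] := line_leaves_sound.
have [[m pl] ok1] := all2_mem leaves_ok Tl.
case: hT => [T0|eT]; last exact: certificate_isomorphism eT ok1.
by move: ok1; rewrite T0.
Qed.

End Labelled.

Local Close Scope ring_scope.

From mathcomp Require Import generic_quotient finmap.
From mathcomp Require Import all_classical all_reals all_analysis.
From mathcomp Require Import complex ring lra zify.
Import Order.TTheory GRing.Theory Num.Theory.
Import numFieldNormedType.Exports.

Local Open Scope classical_set_scope.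
Local Open Scope card_scope.

(** * Incidences *)

Lemma card_finset (T : finType) (B : {set T}) : [set x | x \in B] #= `I_#|B|.
Proof.
have -> : [set x | x \in B] = [set` [fset x in enum B]%fset].
  by apply/seteqP; split=> x /=; rewrite !inE /= mem_enum.
by apply/card_eq_fsetP; rewrite card_fseq undup_id ?enum_uniq // -cardE.
Qed.

Lemma card_image_finset (T : finType) (U : Type) (f : T -> U) (B : {set T}) r :
  {in B &, injective f} -> f @` [set x | x \in B] #= `I_r <-> #|B| = r.
Proof.
move=> finj; have e : f @` [set x | x \in B] #= [set x | x \in B].
  by apply: inj_card_eq => x y; rewrite !inE; exact: finj.
split=> [h|<-]; last exact: card_eq_trans e (card_finset B).
apply/card_eq_II; rewrite card_eq_sym in e; have := card_eq_trans e h.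
rewrite card_eq_sym => h'; rewrite card_eq_sym; exact: card_eq_trans h' (card_finset B).
Qed.

Section Incidence.
Variable R : realType.
Local Notation P2 := (projective_plane R).
Variable L : 'I_12 -> set P2.
Hypothesis Linj : injective L.

Lemma in_lines_through p i : (i \in lines_through L p) = `[< L i p >].
Proof. by rewrite inE; apply/idP/asboolP; rewrite inE. Qed.

Lemma lines_throughP p i : reflect (L i p) (i \in lines_through L p).
Proof. by rewrite in_lines_through; exact: asboolP. Qed.

Lemma multiple_pointsE r :
  multiple_points (range L) r = [set p | #|lines_through L p| = r].
Proof.
apply/seteqP; split=> p /=; rewrite /multiple_points /=.
all: have -> : [set C | range L C /\ C p] = L @` [set i | i \in lines_through L p].
1,3: apply/seteqP; split=> [C /= [[i _ <-] /lines_throughP h]|C [i /= /lines_throughP h <-]];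
  by [exists i|split=> //; exists i].
all: by move/(card_image_finset r (in2W Linj)).
Qed.

Lemma mem_triple_list S :
  (S \in triple_list L) <-> exists2 p, #|lines_through L p| = 3 & S = lines_through L p.
Proof. by rewrite inE multiple_pointsE; split=> [/asboolP|h] //; apply/asboolP. Qed.

Lemma card_lines_through_sets r n (D : {set {set 'I_12}}) :
  (forall p q, #|lines_through L p| = r -> lines_through L p = lines_through L q -> p = q) ->
  (forall S, S \in D <-> exists2 p, #|lines_through L p| = r & S = lines_through L p) ->
  multiple_points (range L) r #= `I_n -> #|D| = n.
Proof.
move=> inj hD; rewrite multiple_pointsE => h.
have e : lines_through L @` [set p | #|lines_through L p| = r] #= [set p | #|lines_through L p| = r].
  by apply: inj_card_eq => p q; rewrite !inE => hp hq; exact: inj.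
have {}e := card_eq_trans e h.
have eD : lines_through L @` [set p | #|lines_through L p| = r] = [set S | S \in D].
  by apply/seteqP; split=> [_ [p hp <-]|S /= /hD[p hp ->]]; [apply/hD|]; exists p.
rewrite eD in e; apply/card_eq_II; rewrite card_eq_sym in e; rewrite card_eq_sym.
exact: card_eq_trans e (card_finset D).
Qed.

End Incidence.

Local Close Scope card_scope.
Local Open Scope ring_scope.

(** * Discrete lifting *)

Section DiscreteLifting.
Variable R : realType.
Implicit Types (d : R) (x y z : R * R).

Definition close d x y := (`|x.1 - y.1| < d) && (`|x.2 - y.2| < d).

Lemma close_refl d x : 0 < d -> close d x x.
Proof. by move=> d0; rewrite /close !subrr normr0 d0. Qed.

Lemma close_sym d x y : close d x y = close d y x.
Proof. by rewrite /close distrC (distrC x.2). Qed.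

Lemma close_trans d1 d2 x y z :
  close d1 x y -> close d2 y z -> close (d1 + d2) x z.
Proof.
move=> /andP[a1 a2] /andP[b1 b2]; apply/andP; split.
- by rewrite -(subrKA y.1); apply: le_lt_trans (ler_normD _ _) (ltrD a1 b1).
- by rewrite -(subrKA y.2); apply: le_lt_trans (ler_normD _ _) (ltrD a2 b2).
Qed.

Lemma close_le d1 d2 x y : d1 <= d2 -> close d1 x y -> close d2 x y.
Proof.
by move=> d12 /andP[a b]; rewrite /close (lt_le_trans a d12) (lt_le_trans b d12).
Qed.

Definition scale2 (s : R) x : R * R := (s * x.1, s * x.2).

Variables (d : R) (sg : R * R -> R * R -> bool).
Hypothesis d0 : 0 < d.
Hypothesis cocycle : forall x y z,
  close d x y -> close d y z -> close d x z -> sg x y (+) sg y z = sg x z.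

Let path_sum (p : nat -> R * R) (a n : nat) :=
  \big[addb/false]_(j < n) sg (p (a + j)%N) (p (a + j).+1).

Let path_sumS p a n :
  path_sum p a n.+1 = path_sum p a n (+) sg (p (a + n)%N) (p (a + n).+1).
Proof. by rewrite /path_sum big_ord_recr. Qed.

Let sg_refl x : sg x x = false.
Proof.
have /= := cocycle (close_refl x d0) (close_refl x d0) (close_refl x d0).
by case: (sg x x).
Qed.

Let path_sum_close p a n :
    (forall i j, (a <= i <= a + n)%N -> (a <= j <= a + n)%N ->
       close d (p i) (p j)) ->
  path_sum p a n = sg (p a) (p (a + n)%N).
Proof.
elim: n => [|n IHn] H; first by rewrite /path_sum big_ord0 addn0 sg_refl.
rewrite path_sumS IHn; last by move=> i j Hi Hj; apply: H; lia.
by rewrite cocycle ?addnS//; apply: H; lia.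
Qed.

Let path_sum_split p a n m :
  path_sum p a (n + m) = path_sum p a n (+) path_sum p (a + n) m.
Proof.
elim: m => [|m IHm]; first by rewrite addn0 /path_sum big_ord0 addbF.
by rewrite addnS !path_sumS IHm addnA addbA.
Qed.

Let ray x (N k : nat) : R * R := scale2 (k%:R / N%:R) x.

Let good x (N : nat) := (`|x.1| < d / 2 * N%:R) && (`|x.2| < d / 2 * N%:R).

Let good_gt0 x N : good x N -> (0 < N)%N.
Proof.
case: N => //; rewrite /good mulr0 => /andP[+ _].
by rewrite ltNge normr_ge0.
Qed.

Let ray_close x N i j k : good x N -> (0 < k)%N -> (i <= j <= i + k)%N ->
  close (d / 2) (ray x (N * k) i) (ray x (N * k) j).
Proof.
move=> gN k0 /andP[ij jk]; have N0 := good_gt0 gN.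
have NR : 0 < N%:R :> R by rewrite ltr0n.
have kR : 0 < k%:R :> R by rewrite ltr0n.
have gen (u : R) : `|u| < d / 2 * N%:R ->
   `|i%:R / (N * k)%:R * u - j%:R / (N * k)%:R * u| < d / 2.
  move=> hu; rewrite -mulrBl -mulrBl normrM normrM normfV natrM.
  rewrite (ger0_norm (ltW (mulr_gt0 NR kR))) distrC -natrB// (ger0_norm (ler0n _ _)).
  apply: (@le_lt_trans _ _ (`|u| / N%:R)); last by rewrite ltr_pdivrMr.
  rewrite [leLHS]mulrC ler_wpM2l// ler_pdivrMr ?mulr_gt0// mulKf ?gt_eqF//.
  by rewrite ler_nat leq_subLR.
by case/andP: gN => g1 g2; rewrite /close /= !gen.
Qed.

(** The points that subdivide one step of the coarse path are all [d]-close to each other, so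
    [cocycle] collapses their sum to the single coarse step. *)
Let path_ray_refine x N M : good x N -> (0 < M)%N ->
  path_sum (ray x (N * M)) 0 (N * M) = path_sum (ray x N) 0 N.
Proof.
move=> gN M0; have N0 := good_gt0 gN.
suff H k : path_sum (ray x (N * M)) 0 (k * M) = path_sum (ray x N) 0 k by [].
elim: k => [|k IHk]; first by rewrite mul0n /path_sum !big_ord0.
rewrite mulSn addnC path_sum_split IHk path_sumS; congr (_ (+) _).
rewrite add0n path_sum_close; last first.
  move=> i j Hi Hj; have dd : d / 2 <= d by have := d0; lra.
  have [ij|/ltnW ij] := leqP i j.
    by apply: (close_le dd); apply: ray_close => //; lia.
  by rewrite close_sym; apply: (close_le dd); apply: ray_close => //; lia.
rewrite -mulSnr /ray !natrM.
have MR : M%:R != 0 :> R by rewrite pnatr_eq0 -lt0n.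
by rewrite -!mulf_div divff// !mulr1.
Qed.

Let size_of x := (Num.truncn ((`|x.1| + `|x.2|) / (d / 2))).+1.

Let good_size_of x : good x (size_of x).
Proof.
have h : (`|x.1| + `|x.2|) / (d / 2) < (size_of x)%:R.
  by rewrite truncnS_gt.
have d2 : 0 < d / 2 by rewrite divr_gt0.
rewrite ltr_pdivrMr// mulrC in h.
by rewrite /good; apply/andP; split; apply: le_lt_trans h;
  rewrite ?lerDl ?lerDr.
Qed.

(** A cocycle modulo 2 on pairs of close points is a coboundary because the plane is simply
    connected. The potential of [x] is the sum of [sg] along a fine subdivision of the segment from
    the origin to [x]; two segments with close ends are compared after a common refinement. *)
Lemma discrete_lifting :
  exists e : R * R -> bool,
    forall x y, close (d / 2) x y -> sg x y = e x (+) e y.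
Proof.
exists (fun x => path_sum (ray x (size_of x)) 0 (size_of x)) => x y xy.
set N := size_of x; set M := size_of y.
have gN : good x N := good_size_of x.
have gM : good y M := good_size_of y.
have [N0 M0] := (good_gt0 gN, good_gt0 gM).
rewrite -(path_ray_refine gN M0) -(path_ray_refine gM N0) (mulnC M N).
set K := (N * M)%N; have K0 : (0 < K)%N by rewrite muln_gt0 N0.
have d2 : 0 < d / 2 by rewrite divr_gt0.
have dd : d / 2 <= d by have := d0; lra.
have dE : d = d / 2 + d / 2 by field.
have across k : (k <= K)%N -> close (d / 2) (ray x K k) (ray y K k).
  move=> kK; case/andP: xy => x1 x2; rewrite /close /= -!mulrBr !(normrM (k%:R / K%:R)).
  have q : `|k%:R / K%:R : R| <= 1.
    by rewrite ger0_norm ?divr_ge0// ler_pdivrMr ?ltr0n// mul1r ler_nat.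
  by rewrite (le_lt_trans (ler_piMl _ q) x1)// (le_lt_trans (ler_piMl _ q) x2).
have along u n k : good u n -> (exists2 m, (0 < m)%N & K = n * m)%N ->
   close (d / 2) (ray u K k) (ray u K k.+1).
  by move=> gn [m m0 ->]; apply: ray_close => //; lia.
have ax k : close (d / 2) (ray x K k) (ray x K k.+1).
  by apply: (along _ N) => //; exists M.
have ay k : close (d / 2) (ray y K k) (ray y K k.+1).
  by apply: (along _ M) => //; exists N => //; rewrite mulnC.
(* The two segments form a ladder. Each square between consecutive rungs is cut into two triangles,
   to which [cocycle] applies. *)
have prism k : (k <= K)%N ->
   sg (ray x K k) (ray y K k) =
   path_sum (ray x K) 0 k (+) path_sum (ray y K) 0 k.
  elim: k => [|k IHk] kK.
    rewrite /path_sum !big_ord0 addbF.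
    have -> : ray x K 0 = ray y K 0 by rewrite /ray /scale2 !mul0r.
    exact: sg_refl.
  rewrite !path_sumS !add0n.
  have e1 : sg (ray x K k) (ray x K k.+1) (+) sg (ray x K k.+1) (ray y K k.+1)
            = sg (ray x K k) (ray y K k.+1).
    apply: cocycle; [exact: close_le (ax k)|exact: close_le (across _ kK)|].
    by rewrite dE; apply: close_trans (ax k) (across _ kK).
  have e2 : sg (ray x K k) (ray y K k) (+) sg (ray y K k) (ray y K k.+1)
            = sg (ray x K k) (ray y K k.+1).
    apply: cocycle; [exact: close_le (across _ (ltnW kK))|exact: close_le (ay k)|].
    by rewrite dE; apply: close_trans (across _ (ltnW kK)) (ay k).
  move: e1 e2; rewrite (IHk (ltnW kK)) => <-.
  move: (path_sum _ 0 k) (path_sum _ 0 k) (sg (ray x K k) (ray x K k.+1))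
    (sg (ray y K k) _) (sg (ray x K k.+1) _).
  by do 5 case.
have := prism K (leqnn K).
have rK u : ray u K K = u.
  by rewrite /ray divff ?pnatr_eq0 -?lt0n// /scale2 !mul1r; case: u.
by rewrite !rK.
Qed.

End DiscreteLifting.

Local Open Scope complex_scope.

(** * Monodromy of loops in the punctured plane *)

Local Notation Re := (@complex.Re _).
Local Notation Im := (@complex.Im _).

Lemma continuous_pair (T U V : topologicalType) (f : T -> U) (g : T -> V) x :
    {for x, continuous f} -> {for x, continuous g} ->
  {for x, continuous (fun y => (f y, g y))}.
Proof. by move=> cf cg; exact: (cvg_pair cf cg). Qed.

Section Monodromy.
Variable R : realType.
Implicit Types (z w v : R[i]) (d : R).

Definition cdot z w : R := Re z * Re w + Im z * Im w.
Definition ccross z w : R := Re z * Im w - Im z * Re w.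

Lemma cdotC z w : cdot z w = cdot w z.
Proof. by rewrite /cdot; ring. Qed.

Lemma cdotNl z w : cdot (- z) w = - cdot z w.
Proof. by case: z => a b; rewrite /cdot /=; ring. Qed.

Lemma cdotNr z w : cdot z (- w) = - cdot z w.
Proof. by rewrite cdotC cdotNl cdotC. Qed.

Lemma cdotMl u z w : cdot (u * z) (u * w) = (Re u ^+ 2 + Im u ^+ 2) * cdot z w.
Proof. by case: z w u => a b [a' b'] [c d]; rewrite /cdot /=; ring. Qed.

Lemma norm2_gt0 z : z != 0 -> 0 < Re z ^+ 2 + Im z ^+ 2.
Proof.
case: z => a b; rewrite eq_complex /= => h.
by rewrite lt0r addr_ge0 ?sqr_ge0// andbT paddr_eq0 ?sqr_ge0// !sqrf_eq0.
Qed.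

Lemma cdot_neq0 z w : 0 < cdot z w -> z != 0.
Proof.
by apply: contraTneq => ->; rewrite /cdot /= !mul0r addr0 ltxx.
Qed.

Lemma cdot_sqr z w : cdot (z ^+ 2) (w ^+ 2) = cdot z w ^+ 2 - ccross z w ^+ 2.
Proof. by case: z w => a b [c d]; rewrite /cdot /ccross /=; ring. Qed.

Lemma cdot_mul_cross z w v :
  (Re w ^+ 2 + Im w ^+ 2) * cdot z v = cdot z w * cdot w v - ccross z w * ccross w v.
Proof. by case: z w v => a b [c d] [e f]; rewrite /cdot /ccross /=; ring. Qed.

(** Squares at less than a right angle have roots that, up to sign, are less than half a right angle
    apart, so their cross product is smaller than their dot product in absolute value. In
    [cdot_mul_cross] the product of the dot products then decides the sign. *)
Lemma sqrt_cocycle z w v :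
    0 < cdot (z ^+ 2) (w ^+ 2) -> 0 < cdot (w ^+ 2) (v ^+ 2) ->
  (cdot z w < 0) (+) (cdot w v < 0) = (cdot z v < 0).
Proof.
move=> zw wv.
have w0 : w != 0 by have := cdot_neq0 wv; rewrite expf_eq0.
have := norm2_gt0 w0; have := cdot_mul_cross z w v.
move: zw wv; rewrite !cdot_sqr !subr_gt0; move: (Re w ^+ 2 + _) => n.
move: (cdot z w) (cdot w v) (cdot z v) (ccross z w) (ccross w v).
move=> a b c p q pa qb e n0.
have pq : `|p * q| < `|a * b|.
  rewrite !normrM ltr_pM//.
  - by rewrite -ltr_sqr ?nnegrE// !real_normK ?num_real.
  - by rewrite -ltr_sqr ?nnegrE// !real_normK ?num_real.
have [c0|c0] := ltP c 0.
- have nc : n * c < 0 by rewrite pmulr_rlt0.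
  have ab : a * b < 0.
    rewrite ltNge; apply/negP => ab; move: pq.
    by rewrite (ger0_norm ab) ltr_norml e in nc *; lra.
  have [a0|a0] := ltP a 0; have [b0|b0] := ltP b 0 => //; nra.
- have nc : 0 <= n * c by rewrite pmulr_rge0.
  have ab : 0 < a * b.
    rewrite ltNge; apply/negP => ab; move: pq.
    by rewrite (ler0_norm ab) ltr_norml e in nc *; lra.
  have [a0|a0] := ltP a 0; have [b0|b0] := ltP b 0 => //; nra.
Qed.

(** The principal roots jump; by [sqrt_cocycle] the signs by which close ones disagree form a
    cocycle, and [discrete_lifting] supplies the corrections. *)
Lemma branch_exists d (w : R * R -> R[i]) : 0 < d ->
    (forall x y, close d x y -> 0 < cdot (w x) (w y)) ->
  exists s : R * R -> R[i], (forall x, s x ^+ 2 = w x) /\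
    forall x y, close (d / 2) x y -> 0 < cdot (s x) (s y).
Proof.
move=> d0 wd; pose r x := sqrtc (w x).
have rE x : r x ^+ 2 = w x by rewrite sqr_sqrtc.
have [|e eE] := @discrete_lifting R d (fun x y => cdot (r x) (r y) < 0) d0.
  by move=> x y z xy yz xz; rewrite sqrt_cocycle ?rE ?wd.
exists (fun x => if e x then - r x else r x); split=> [x|x y xy].
  by case: (e x); rewrite ?sqrrN rE.
have xy' : close d x y by apply: close_le xy; lra.
have n0 : cdot (r x) (r y) != 0.
  apply/eqP => c0; have := wd _ _ xy'; rewrite -(rE x) -(rE y) cdot_sqr c0.
  by rewrite expr0n sub0r oppr_gt0 ltNge sqr_ge0.
have := eE _ _ xy; case: (e x); case: (e y) => /=;
  rewrite ?cdotNl ?cdotNr ?opprK ?oppr_gt0 => h; rewrite ?h// lt0r n0 leNgt h//.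
Qed.

Definition in_box (a b a' b' : R) (x : R * R) :=
  (a <= x.1 <= b) && (a' <= x.2 <= b').

(** The Lebesgue number of a covering of a rectangle, for properties of pairs of points. *)
Lemma lebesgue_box (P : R * R -> R * R -> Prop) (a b a' b' : R) :
    (forall z : R * R, in_box a b a' b' z -> exists2 d : R, 0 < d & forall x y,
       in_box a b a' b' x -> in_box a b a' b' y ->
       close d z x -> close d z y -> P x y) ->
  exists2 d : R, 0 < d & forall x y,
    in_box a b a' b' x -> in_box a b a' b' y -> close d x y -> P x y.
Proof.
move=> loc.
pose K := `[a, b]%classic `*` `[a', b']%classic.
have KE x : K x <-> in_box a b a' b' x.
  by rewrite /K /in_box /= !in_itv /=; split=> [[-> ->]|/andP[-> ->]].
have /compact_near_coveringP cK : compact K.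
  by apply: compact_setX; exact: segment_compact.
have := cK _ (0 : R)^'+
  (fun d x => forall y, in_box a b a' b' x -> in_box a b a' b' y ->
     close d x y -> P x y) _.
move=> /(_ _)[|d /= d0 hd].
  move=> x /KE /loc[d d0 hd].
  have d2 : 0 < d / 2 by rewrite divr_gt0.
  exists (ball x (d / 2), [set e : R | 0 < e /\ e < d / 2]) => /=.
    split; first exact: nbhsx_ballx.
    by near=> e; split; near: e; [exact: nbhs_right_gt|exact: nbhs_right_lt].
  move=> [y e] /= [[y1 y2] [e0 ed]] z Ky Kz yz.
  apply: hd => //; first by apply: (@close_le _ (d / 2)); [lra|rewrite /close y1 y2].
  rewrite (splitr d); apply: (@close_trans _ _ _ _ y); first by rewrite /close y1 y2.
  by apply: close_le yz; exact: ltW.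
exists (d / 2); first by rewrite divr_gt0.
move=> x y Kx Ky; apply: (hd (d / 2)) => //=; rewrite ?divr_gt0//; last exact/KE.
by rewrite sub0r normrN gtr0_norm ?divr_gt0// ltr_pdivrMr// mulr_natr mulr2n ltrDl.
Unshelve. all: by end_near. Qed.

Lemma lebesgue_itv (P : R -> R -> Prop) (a b : R) :
    (forall z : R, a <= z <= b -> exists2 d : R, 0 < d & forall x y,
       a <= x <= b -> a <= y <= b -> `|z - x| < d -> `|z - y| < d -> P x y) ->
  exists2 d : R, 0 < d & forall x y,
    a <= x <= b -> a <= y <= b -> `|x - y| < d -> P x y.
Proof.
move=> loc.
have [|d d0 hd] := @lebesgue_box (fun x y => P x.2 y.2) 0 0 a b.
  move=> z /andP[_ /loc[d d0 hd]]; exists d => // x y /andP[_ Kx] /andP[_ Ky].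
  by move=> /andP[_ zx] /andP[_ zy]; exact: hd.
exists d => // x y xab yab xy; apply: (hd (0, x) (0, y)).
- by rewrite /in_box /= lexx.
- by rewrite /in_box /= lexx.
- by rewrite /close /= subrr normr0 d0.
Qed.

Lemma chain_const (T : Type) (f : R -> T) (a b d : R) : 0 < d ->
    (forall s t, a <= s <= b -> a <= t <= b -> `|s - t| < d -> f s = f t) ->
  forall s t, a <= s <= b -> a <= t <= b -> f s = f t.
Proof.
move=> d0 fd.
suff H s t : a <= s -> s <= t -> t <= b -> f s = f t.
  move=> s t /andP[s1 s2] /andP[t1 t2].
  by have [st|/ltW st] := leP s t; [exact: H|rewrite (H t s)].
move=> a1 st tb.
pose N := (Num.truncn ((t - s) / d)).+1.
have N0 : 0 < N%:R :> R by rewrite ltr0n.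
have hN : (t - s) / N%:R < d.
  by rewrite ltr_pdivrMr// mulrC -ltr_pdivrMr// truncnS_gt.
pose p (k : nat) := s + (t - s) / N%:R * k%:R.
have pin k : (k <= N)%N -> a <= p k <= b.
  move=> kN; have q0 : 0 <= (t - s) / N%:R by rewrite divr_ge0 ?subr_ge0// ltW.
  have q1 : (t - s) / N%:R * k%:R <= t - s.
    by rewrite mulrAC ler_pdivrMr// ler_wpM2l ?subr_ge0// ler_nat.
  have q2 : 0 <= (t - s) / N%:R * k%:R by rewrite mulr_ge0.
  by rewrite /p; apply/andP; split; lra.
have pd k : `|p k - p k.+1| < d.
  rewrite /p -[k.+1]addn1 natrD (_ : _ - _ = - ((t - s) / N%:R)); last by ring.
  by rewrite normrN ger0_norm// divr_ge0 ?subr_ge0// ltW.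
have H k : (k <= N)%N -> f (p 0%N) = f (p k).
  elim: k => // k IHk kN; rewrite IHk ?(ltnW kN)//.
  by apply: fd => //; apply: pin => //; exact: ltnW.
have := H N (leqnn N); rewrite /p mulr0 addr0 divfK ?gt_eqF//.
by rewrite addrC subrK.
Qed.

Lemma locally_const (T : Type) (f : R -> T) (a b : R) :
    (forall z : R, a <= z <= b -> exists2 d : R, 0 < d & forall x,
       a <= x <= b -> `|z - x| < d -> f x = f z) ->
  forall s t, a <= s <= b -> a <= t <= b -> f s = f t.
Proof.
move=> loc; have [|d d0 hd] := @lebesgue_itv (fun x y => f x = f y) a b.
  move=> z /loc[d d0 hd]; exists d => // x y Kx Ky zx zy.
  by rewrite (hd x)// (hd y).
exact: (chain_const d0).
Qed.

Lemma chain_const2 (T : Type) (f : R * R -> T) d : 0 < d ->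
    (forall x y, close d x y -> f x = f y) -> forall x y, f x = f y.
Proof.
move=> d0 fd x y.
pose p s : R * R := (x.1 + s * (y.1 - x.1), x.2 + s * (y.2 - x.2)).
pose M := `|y.1 - x.1| + `|y.2 - x.2| + 1.
have M0 : 0 < M by rewrite /M; have := normr_ge0 (y.1 - x.1);
  have := normr_ge0 (y.2 - x.2); lra.
have -> : x = p 0 by rewrite /p !mul0r !addr0; case: (x).
have -> : y = p 1 by rewrite /p !mul1r !subrKC; case: (y).
apply: (@chain_const _ (f \o p) 0 1 (d / M)); rewrite ?divr_gt0//; last 2 first.
- by rewrite lexx ler01.
- by rewrite lexx ler01.
move=> s t _ _ st; rewrite /=; apply: fd; rewrite /close /p /=.
have E (a b : R) : a + s * b - (a + t * b) = (s - t) * b by ring.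
rewrite !E !normrM.
rewrite ltr_pdivlMr// in st.
by apply/andP; split; apply: le_lt_trans st; apply: ler_wpM2l => //;
  rewrite /M; have := normr_ge0 (y.1 - x.1); have := normr_ge0 (y.2 - x.2); lra.
Qed.

(** Positivity of the dot product at uniformly small distance stands for continuity of the root: it
    is what [branch_exists] delivers and what rules out a change of sign in [branch_unique]. *)
Definition branch (u s : R -> R[i]) :=
  (forall t, s t ^+ 2 = u t) /\
  exists2 d : R, 0 < d & forall t t', `|t - t'| < d -> 0 < cdot (s t) (s t').

(** For a closed loop [c] is the parity of the winding number, written as [1] or [-1]. For a loop
    that returns as its negative, [c] is ['i] or its negative, a fourth root of unity in the place
    of half a turn. *)
Definition mono (u : R -> R[i]) (c : R[i]) :=
  exists2 s, branch u s & forall t, s (t + 1) = c * s t.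

Lemma branch_unique u s s' : branch u s -> branch u s' ->
  exists2 e : R[i], e = 1 \/ e = -1 & forall t, s' t = e * s t.
Proof.
move=> [sE [d d0 sd]] [sE' [d' d'0 sd']].
have s0 t : s t != 0.
  by apply: (@cdot_neq0 _ (s t)); apply: sd; rewrite subrr normr0.
pose e t := s' t / s t.
have eE t : s' t = e t * s t by rewrite /e divfK.
have e1 t : e t ^+ 2 = 1 by rewrite expr_div_n sE sE' divff// -sE expf_neq0.
have econst t : e t = e 0.
  pose m := Num.max `|t| 1.
  apply: (@chain_const _ e (- m) m (Num.min d d')); rewrite ?lt_min ?d0//; last 2 first.
  - by rewrite -ler_norml le_max lexx.
  - by rewrite oppr_le0 andbb le_max ler01 orbT.
  move=> a b _ _; rewrite lt_min => /andP[/sd h /sd'].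
  move: (e1 a) (e1 b) => /eqP + /eqP; rewrite !sqrf_eq1 !eE.
  by move=> /orP[]/eqP-> /orP[]/eqP->; rewrite // ?mulN1r ?mul1r ?cdotNl ?cdotNr;
    rewrite oppr_gt0 ltNge (ltW h).
exists (e 0); last by move=> t; rewrite eE econst.
by have /eqP := e1 0; rewrite sqrf_eq1 => /orP[]/eqP->; [left|right].
Qed.

Lemma mono_unique u c c' : mono u c -> mono u c' -> c = c'.
Proof.
move=> [s bs sc] [s' bs' sc']; have [e e1 eE] := branch_unique bs bs'.
have [_ [d d0 /(_ 0 0)]] := bs'; rewrite subrr normr0 => /(_ d0)/cdot_neq0 s0.
apply: (mulIf s0); rewrite -sc' !eE sc; ring.
Qed.

Lemma cdot_cvg (w : R * R -> R[i]) (x : R * R) :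
    {for x, continuous (Re \o w)} -> {for x, continuous (Im \o w)} ->
    w x != 0 ->
  exists2 d : R, 0 < d &
    forall y y' : R * R, close d x y -> close d x y' -> 0 < cdot (w y) (w y').
Proof.
move=> cr ci wx0; have := norm2_gt0 wx0.
set r := Re (w x); set i := Im (w x) => n0.
(* With deviations below this bound and below [1] the errors in the dot product add up to at most
   [2 * e' * (1 + |r| + |i|)], which is at most half of [r ^+ 2 + i ^+ 2]. *)
pose e := (r ^+ 2 + i ^+ 2) / (4 * (1 + `|r| + `|i|)).
have M0 : 0 < 1 + `|r| + `|i| by have := normr_ge0 r; have := normr_ge0 i; lra.
pose e' := Num.min 1 e.
have e'0 : 0 < e' by rewrite lt_min ltr01 divr_gt0// mulr_gt0.
have /cvgrPdist_lt/(_ _ e'0) hr := cr.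
have /cvgrPdist_lt/(_ _ e'0) hi := ci.
have /nbhs_ballP[d /= d0 hd] : \forall y \near x,
    (`|r - Re (w y)| < e') && (`|i - Im (w y)| < e').
  by near=> y; apply/andP; split; near: y; [exact: hr|exact: hi].
exists d => // y z /andP[y1 y2] /andP[z1 z2].
have /andP[] : (`|r - Re (w y)| < e') && (`|i - Im (w y)| < e') by apply: hd.
have /andP[] : (`|r - Re (w z)| < e') && (`|i - Im (w z)| < e') by apply: hd.
rewrite /cdot; move: (Re (w y)) (Im (w y)) (Re (w z)) (Im (w z)) => a b a' b'.
have ee : e' * (4 * (1 + `|r| + `|i|)) <= r ^+ 2 + i ^+ 2.
  by rewrite -ler_pdivlMr ?mulr_gt0// ge_min lexx orbT.
have e1 : e' <= 1 by rewrite ge_min lexx.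
clear hr hi hd cr ci.
have bnd p q q' : `|p - q| < e' -> `|p - q'| < e' ->
    p ^+ 2 - 2 * `|p| * e' - e' ^+ 2 <= q * q'.
  move=> h1 h2.
  have -> : q * q' = p ^+ 2 - p * (p - q) - p * (p - q') + (p - q) * (p - q').
    by ring.
  have k1 : p * (p - q) <= `|p| * e'.
    by apply: le_trans (ler_norm _) _; rewrite normrM ler_wpM2l// ltW.
  have k2 : p * (p - q') <= `|p| * e'.
    by apply: le_trans (ler_norm _) _; rewrite normrM ler_wpM2l// ltW.
  have k3 : - (e' ^+ 2) <= (p - q) * (p - q').
    apply: (@le_trans _ _ (- `|(p - q) * (p - q')|)).
      by rewrite lerN2 normrM expr2 ler_pM// ltW.
    by rewrite lerNl -normrN ler_norm.
  lra.
move=> h1 h2 h3 h4.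
have := bnd _ _ _ h3 h1; have := bnd _ _ _ h4 h2.
have : e' ^+ 2 <= e' by rewrite expr2 ler_piMr// ltW.
have : e' * `|r| >= 0 by rewrite mulr_ge0// ltW.
have : e' * `|i| >= 0 by rewrite mulr_ge0// ltW.
nra.
Unshelve. all: by end_near. Qed.

Definition clamp (x : R) : R := Num.max 0 (Num.min 1 x).

Lemma clamp_in x : 0 <= clamp x <= 1.
Proof. by rewrite /clamp le_max lexx /= ge_max ler01 ge_min lexx. Qed.

Lemma clamp_id x : 0 <= x <= 1 -> clamp x = x.
Proof. by move=> /andP[x0 x1]; rewrite /clamp min_r// max_r. Qed.

Lemma clamp_lip x y : `|clamp x - clamp y| <= `|x - y|.
Proof.
by rewrite /clamp; case: (leP 1 x) => ?; case: (leP 1 y) => ?;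
  rewrite ?(max_r ler01); do ?case: (leP 0 _) => ?;
  do ?case: ger0P => ?; do ?case: ger0P => ?; lra.
Qed.

Lemma clamp_continuous : continuous clamp.
Proof.
move=> x; apply/cvgrPdist_lt => e e0; near=> y.
by apply: le_lt_trans (clamp_lip _ _) _; near: y; apply: cvgr_dist_lt.
Unshelve. all: by end_near. Qed.

Lemma quasiperiod_int (T : Type) (w : T -> R -> R[i]) (tau : R) : tau ^+ 2 = 1 ->
    (forall l t, w l (t + 1) = tau%:C * w l t) -> forall n : int,
  exists2 e : R, e ^+ 2 = 1 & forall l t, w l (t + n%:~R) = e%:C * w l t.
Proof.
move=> t1 wt.
have H (k : nat) : exists2 e : R, e ^+ 2 = 1 &
    forall l t, w l (t + k%:R) = e%:C * w l t.
  elim: k => [|k [e e1 eE]].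
    by exists 1; [rewrite expr1n|move=> l t; rewrite addr0 mul1r].
  exists (tau * e); first by rewrite exprMn t1 e1 mulr1.
  by move=> l t; rewrite -addn1 natrD addrA wt eE mulrA rmorphM.
case=> k; first by have [e e1 eE] := H k; exists e.
have [e e1 eE] := H k.+1; exists e => // l t.
rewrite -{2}(subrK (k.+1%:R) t) eE mulrA -rmorphM -expr2 e1 mul1r.
by rewrite NegzE mulrNz.
Qed.

Lemma cdotMr (e : R) z w : cdot (e%:C * z) (e%:C * w) = e ^+ 2 * cdot z w.
Proof. by rewrite cdotMl /= expr0n addr0. Qed.

Lemma uniform_cdot_box (w : R * R -> R[i]) (a b : R) :
    continuous (Re \o w) -> continuous (Im \o w) ->
    (forall l t, 0 <= l <= 1 -> a <= t <= b -> w (l, t) != 0) ->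
  exists2 d : R, 0 < d & forall x y, in_box 0 1 a b x -> in_box 0 1 a b y ->
    close d x y -> 0 < cdot (w x) (w y).
Proof.
move=> cr ci w0; apply: lebesgue_box => z /andP[z1 z2].
have wz : w z != 0 by case: z z1 z2 => z1 z2 /=; exact: w0.
have [d d0 hd] := cdot_cvg (cr z) (ci z) wz.
by exists d => // x y _ _; exact: hd.
Qed.

(** Compactness gives a bound for second coordinates between [-1] and [2]. Shifting a close pair by
    the integer part of [x.2] brings both points there and multiplies both values by the same
    sign. *)
Lemma uniform_cdot (w : R * R -> R[i]) (tau : R) : tau ^+ 2 = 1 ->
    continuous (Re \o w) -> continuous (Im \o w) ->
    (forall l t, 0 <= l <= 1 -> w (l, t) != 0) ->
    (forall l t, w (l, t + 1) = tau%:C * w (l, t)) ->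
  exists2 d : R, 0 < d &
    forall x y, close d x y -> 0 < cdot (w (clamp x.1, x.2)) (w (clamp y.1, y.2)).
Proof.
move=> t1 cr ci w0 wt.
have [d d0 hd] := @uniform_cdot_box w (-1) 2 cr ci (fun l t l01 _ => w0 l t l01).
exists (Num.min d 1); first by rewrite lt_min d0 ltr01.
move=> x y xy.
have [e e1 eE] := quasiperiod_int (w := fun l t => w (l, t)) t1 wt (Num.floor x.2).
have := floor_le x.2; have := floorD1_gt x.2; rewrite intrD1 => f1 f2.
rewrite -(subrK (Num.floor x.2)%:~R x.2) -(subrK (Num.floor x.2)%:~R y.2).
rewrite !eE cdotMr e1 mul1r.
move: f1 f2; set n := (Num.floor x.2)%:~R => f1 f2.
case/andP: xy; rewrite !lt_min => /andP[h1 _] /andP[h2]; rewrite ltr_norml => /andP[h3 h4].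
apply: hd; rewrite /in_box /close /= ?clamp_in /=.
- by apply/andP; split; lra.
- by apply/andP; split; lra.
- rewrite (le_lt_trans (clamp_lip _ _) h1)/=.
  by rewrite opprB addrA subrK.
Qed.

(** The quotient of the root one period later by the root now has a constant square, and between
    close points it cannot change to its negative; hence it is constant on the whole strip. *)
Lemma mono_homotopy (w : R * R -> R[i]) (tau : R) : tau ^+ 2 = 1 ->
    continuous (Re \o w) -> continuous (Im \o w) ->
    (forall l t, 0 <= l <= 1 -> w (l, t) != 0) ->
    (forall l t, w (l, t + 1) = tau%:C * w (l, t)) ->
  exists2 c : R[i], c ^+ 2 = tau%:C &
    forall l, 0 <= l <= 1 -> mono (fun t => w (l, t)) c.
Proof.
move=> t1 cr ci w0 wt.
have [d d0 wd] := uniform_cdot t1 cr ci w0 wt.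
have [s [sE sd]] := branch_exists d0 wd.
have d2 : 0 < d / 2 by rewrite divr_gt0.
have s0 x : s x != 0.
  by apply: (@cdot_neq0 _ (s x)); apply: sd; rewrite close_refl.
pose sh (x : R * R) : R * R := (x.1, x.2 + 1).
pose c x := s (sh x) / s x.
have cE x : s (sh x) = c x * s x by rewrite /c divfK.
have c2 x : c x ^+ 2 = tau%:C.
  by rewrite expr_div_n !sE /= wt mulfK// w0 ?clamp_in.
have cc x y : c x = c y.
  apply: (chain_const2 d2) => {}x {}y xy.
  have /eqP : c x ^+ 2 = c y ^+ 2 by rewrite !c2.
  rewrite eqf_sqr => /orP[/eqP//|/eqP cxy].
  have : 0 < cdot (s (sh x)) (s (sh y)).
    apply: sd; move: xy; rewrite /close /sh /= => /andP[-> ].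
    by rewrite opprD addrACA subrr addr0 => ->.
  rewrite !cE cxy mulNr cdotNl cdotMl oppr_gt0 ltNge mulr_ge0//.
    by rewrite addr_ge0 ?sqr_ge0.
  by rewrite ltW// sd.
exists (c (0, 0)) => // l l01; exists (fun t => s (l, t)); last first.
  by move=> t; rewrite -[(l, t + 1)]/(sh (l, t)) cE (cc _ (0, 0)).
split=> [t|]; first by rewrite sE /= clamp_id.
exists (d / 2) => // t t' tt'; apply: sd.
by rewrite /close /= subrr normr0 d2.
Qed.

(** Monodromy over a single period, for the families near a crossing, which are required to close up
    only between [a] and [a + 1]. *)
Definition mono_on (a : R) (u : R -> R[i]) (c : R[i]) :=
  exists s : R -> R[i], [/\ forall t, a <= t <= a + 1 -> s t ^+ 2 = u t,
    (exists2 d : R, 0 < d & forall t t', a <= t <= a + 1 -> a <= t' <= a + 1 ->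
       `|t - t'| < d -> 0 < cdot (s t) (s t')) & s (a + 1) = c * s a].

Lemma mono_mono_on a u c : mono u c -> mono_on a u c.
Proof.
move=> [s [sE [d d0 sd]] sc]; exists s; split=> //.
by exists d => // t t' _ _; exact: sd.
Qed.

Lemma mono_on_ext a (u v : R -> R[i]) c : (forall t, a <= t <= a + 1 -> u t = v t) ->
  mono_on a u c -> mono_on a v c.
Proof. by move=> uv [s [sE sd sc]]; exists s; split=> // t ta; rewrite sE// uv. Qed.

Lemma branch_sign_const (s s' : R -> R[i]) (a b : R) :
    (exists2 d : R, 0 < d & forall t t', a <= t <= b -> a <= t' <= b ->
       `|t - t'| < d -> 0 < cdot (s t) (s t')) ->
    (exists2 d : R, 0 < d & forall t t', a <= t <= b -> a <= t' <= b ->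
       `|t - t'| < d -> 0 < cdot (s' t) (s' t')) ->
    (forall t, a <= t <= b -> s t ^+ 2 = s' t ^+ 2) ->
  exists2 e : R[i], e = 1 \/ e = -1 & forall t, a <= t <= b -> s' t = e * s t.
Proof.
move=> [d d0 sd] [d' d'0 sd'] ss'.
have [ab|ab] := leP a b; last first.
  exists 1; first by left.
  by move=> t /andP[h1 h2]; move: ab; rewrite ltNge (le_trans h1 h2).
have s0 t : a <= t <= b -> s t != 0.
  by move=> ta; apply: (@cdot_neq0 _ (s t)); apply: sd; rewrite // subrr normr0.
pose e t := s' t / s t.
have eE t : a <= t <= b -> s' t = e t * s t by move=> /s0; rewrite /e => ?; rewrite divfK.
have e1 t : a <= t <= b -> e t ^+ 2 = 1.
  by move=> ta; rewrite expr_div_n -ss'// divff// expf_neq0// s0.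
have econst : forall t t', a <= t <= b -> a <= t' <= b -> e t = e t'.
  apply: (@chain_const _ e a b (Num.min d d')); rewrite ?lt_min ?d0//.
  move=> x y xa ya; rewrite lt_min => /andP[/(sd _ _ xa ya) h /(sd' _ _ xa ya)].
  move: (e1 x xa) (e1 y ya) => /eqP + /eqP; rewrite !sqrf_eq1 !eE//.
  by move=> /orP[]/eqP-> /orP[]/eqP->; rewrite // ?mulN1r ?mul1r ?cdotNl ?cdotNr;
    rewrite oppr_gt0 ltNge (ltW h).
have aa : a <= a <= b by rewrite lexx.
exists (e a); last by move=> t ta; rewrite (econst a t)// eE.
by have /eqP := e1 a aa; rewrite sqrf_eq1 => /orP[]/eqP->; [left|right].
Qed.

Lemma mono_on_unique a u c c' : mono_on a u c -> mono_on a u c' -> c = c'.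
Proof.
move=> [s [sE sd sc]] [s' [sE' sd' sc']].
have a1 : a <= a + 1 by rewrite lerDl.
have [|e e1 eE] := branch_sign_const sd sd'; first by move=> t ta; rewrite sE ?sE'.
have s0 : s' a != 0.
  case: sd' => d d0 /(_ a a); rewrite lexx a1 subrr normr0.
  by move=> /(_ isT isT d0)/cdot_neq0.
apply: (mulIf s0); rewrite -sc' !eE ?lexx ?a1// sc; ring.
Qed.

Lemma mono_on_homotopy (w : R * R -> R[i]) (tau : R) (a : R) :
    continuous (Re \o w) -> continuous (Im \o w) ->
    (forall l t, 0 <= l <= 1 -> a <= t <= a + 1 -> w (l, t) != 0) ->
    (forall l, 0 <= l <= 1 -> w (l, a + 1) = tau%:C * w (l, a)) ->
  exists c, forall l, 0 <= l <= 1 -> mono_on a (fun t => w (l, t)) c.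
Proof.
move=> cr ci w0 wt.
have [d d0 hd] := uniform_cdot_box cr ci w0.
pose ca t := a + clamp (t - a).
have ca_in t : a <= ca t <= a + 1.
  by have := clamp_in (t - a); rewrite lerDl lerD2l.
have ca_id t : a <= t <= a + 1 -> ca t = t.
  by move=> /andP[h1 h2]; rewrite /ca clamp_id ?subrKC// subr_ge0 h1 lerBlDl.
pose v x := w (clamp x.1, ca x.2).
have vd x y : close d x y -> 0 < cdot (v x) (v y).
  move=> /andP[h1 h2]; apply: hd; rewrite /in_box ?clamp_in ?ca_in//.
  rewrite /close /= (le_lt_trans (clamp_lip _ _) h1)/= /ca.
  rewrite opprD addrACA subrr add0r (le_lt_trans (clamp_lip _ _))//.
  by rewrite opprB addrA subrK.
have [s [sE sd]] := branch_exists d0 vd.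
have d2 : 0 < d / 2 by rewrite divr_gt0.
have s0 x : s x != 0.
  by apply: (@cdot_neq0 _ (s x)); apply: sd; rewrite close_refl.
have a1 : a <= a + 1 by rewrite lerDl.
pose c l := s (l, a + 1) / s (l, a).
have cE l : s (l, a + 1) = c l * s (l, a) by rewrite /c divfK.
have c2 l : c l ^+ 2 = tau%:C.
  rewrite expr_div_n !sE /v /= !ca_id ?lexx ?a1// wt ?clamp_in// mulfK//.
  by rewrite w0 ?clamp_in// lexx.
have cc x y : 0 <= x <= 1 -> 0 <= y <= 1 -> c x = c y.
  apply: (chain_const d2) => {}x {}y _ _ xy.
  have /eqP : c x ^+ 2 = c y ^+ 2 by rewrite !c2.
  rewrite eqf_sqr => /orP[/eqP//|/eqP cxy].
  have : 0 < cdot (s (x, a + 1)) (s (y, a + 1)).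
    by apply: sd; rewrite /close /= subrr normr0 xy d2.
  rewrite !cE cxy mulNr cdotNl cdotMl oppr_gt0 ltNge mulr_ge0//.
    by rewrite addr_ge0 ?sqr_ge0.
  by rewrite ltW// sd// /close /= subrr normr0 xy d2.
exists (c 0) => l l01; exists (fun t => s (l, t)); split; last 1 first.
- by rewrite cE (cc 0 l)// lexx ler01.
- by move=> t ta; rewrite sE /v /= clamp_id// ca_id.
exists (d / 2) => // t t' _ _ tt'; apply: sd.
by rewrite /close /= subrr normr0 d2.
Qed.

End Monodromy.

Local Open Scope quotient_scope.

(** * The projective plane *)

Section ProjectivePoints.
Variable R : realType.
Local Notation V3 := 'rV[R]_3.
Local Notation P2 := (projective_plane R).
Local Notation Q2 := (quotient_topology {eq_quot (same_line_equiv R)}).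

Definition vec (x y z : R) : V3 := \row_i [:: x; y; z]`_i.
Definition cx (v : V3) : R := v 0 (@Ordinal 3 0 isT).
Definition cy (v : V3) : R := v 0 (@Ordinal 3 1 isT).
Definition cz (v : V3) : R := v 0 (@Ordinal 3 2 isT).

Lemma cx_vec x y z : cx (vec x y z) = x. Proof. by rewrite /cx mxE. Qed.
Lemma cy_vec x y z : cy (vec x y z) = y. Proof. by rewrite /cy mxE. Qed.
Lemma cz_vec x y z : cz (vec x y z) = z. Proof. by rewrite /cz mxE. Qed.
Definition c_vec := (cx_vec, cy_vec, cz_vec).

Lemma vec_eqP (u v : V3) : cx u = cx v -> cy u = cy v -> cz u = cz v -> u = v.
Proof.
move=> hx hy hz; apply/rowP => -[[|[|[|//]]] i3].
- by rewrite (_ : Ordinal i3 = @Ordinal 3 0 isT) //; apply/val_inj.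
- by rewrite (_ : Ordinal i3 = @Ordinal 3 1 isT) //; apply/val_inj.
- by rewrite (_ : Ordinal i3 = @Ordinal 3 2 isT) //; apply/val_inj.
Qed.

Lemma vec_eq0 (v : V3) : (v == 0) = [&& cx v == 0, cy v == 0 & cz v == 0].
Proof.
apply/eqP/and3P => [->|[/eqP x0 /eqP y0 /eqP z0]].
  by rewrite /cx /cy /cz !mxE.
by apply: vec_eqP; rewrite ?x0 ?y0 ?z0 /cx /cy /cz !mxE.
Qed.

Lemma cxD u v : cx (u + v) = cx u + cx v. Proof. by rewrite /cx mxE. Qed.
Lemma cyD u v : cy (u + v) = cy u + cy v. Proof. by rewrite /cy mxE. Qed.
Lemma czD u v : cz (u + v) = cz u + cz v. Proof. by rewrite /cz mxE. Qed.
Lemma cxN u : cx (- u) = - cx u. Proof. by rewrite /cx mxE. Qed.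
Lemma cyN u : cy (- u) = - cy u. Proof. by rewrite /cy mxE. Qed.
Lemma czN u : cz (- u) = - cz u. Proof. by rewrite /cz mxE. Qed.
Lemma cxZ k u : cx (k *: u) = k * cx u. Proof. by rewrite /cx mxE. Qed.
Lemma cyZ k u : cy (k *: u) = k * cy u. Proof. by rewrite /cy mxE. Qed.
Lemma czZ k u : cz (k *: u) = k * cz u. Proof. by rewrite /cz mxE. Qed.
Definition cE := (cxD, cyD, czD, cxN, cyN, czN, cxZ, cyZ, czZ, c_vec).

Lemma cx_continuous : continuous cx. Proof. exact: coord_continuous. Qed.
Lemma cy_continuous : continuous cy. Proof. exact: coord_continuous. Qed.
Lemma cz_continuous : continuous cz. Proof. exact: coord_continuous. Qed.

Fact one_neq0 : (const_mx 1 : V3) \in [set v : V3 | v != 0].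
Proof.
rewrite inE /=; apply/eqP => /matrixP/(_ 0 0); rewrite !mxE => /eqP.
by rewrite oner_eq0.
Qed.

Definition nzv (v : V3) : nonzero_vector R :=
  insubd (exist _ (const_mx 1 : V3) one_neq0 : nonzero_vector R) v.

Lemma nzvK v : v != 0 -> set_val (nzv v) = v.
Proof. by move=> v0; rewrite set_valE; apply: insubdK; rewrite inE. Qed.

(* Junk at v = 0. *)
Definition pt (v : V3) : P2 := (\pi_Q2 (nzv v) : Q2).

Lemma nzv_neq0 (u : nonzero_vector R) : set_val u != 0.
Proof. by case: u => v vp; rewrite set_valE; exact: (set_mem vp). Qed.

Lemma nzv_val (u : nonzero_vector R) : nzv (set_val u) = u.
Proof. by apply: val_inj => /=; rewrite -set_valE nzvK ?nzv_neq0. Qed.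

Lemma pt_surj (p : P2) : exists2 v, v != 0 & p = pt v.
Proof.
exists (set_val (repr (p : Q2) : nonzero_vector R)); first exact: nzv_neq0.
by rewrite /pt nzv_val reprK.
Qed.

Lemma pt_eqP u v : u != 0 -> v != 0 ->
  pt u = pt v <-> exists2 k : R, k != 0 & u = k *: v.
Proof.
move=> u0 v0; split.
  move=> /(@eqmodP _ (same_line_equiv R)).
  rewrite /= /same_line !nzvK// => /andP[/sub_rVP[k uE] _].
  exists k => //; apply: contra_neq u0 => k0; by rewrite uE k0 scale0r.
move=> [k k0 uE]; apply/(@eqmodP _ (same_line_equiv R)).
rewrite /= /same_line !nzvK// uE.
by rewrite scalemx_sub// -{1}(scalerK k0 v) scalemx_sub.
Qed.

Lemma ptZ k v : k != 0 -> pt (k *: v) = pt v.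
Proof.
move=> k0; have [->|v0] := eqVneq v 0; first by rewrite scaler0.
by apply/pt_eqP; rewrite ?scaler_eq0 ?negb_or ?k0//; exists k.
Qed.

Lemma open_neq0 : open [set v : V3 | v != 0].
Proof.
rewrite (_ : [set v | v != 0] = ~` [set (0 : V3)]).
  by rewrite openC; exact: (accessible_closed_set1 (hausdorff_accessible (@norm_hausdorff _ _))).
by apply/seteqP; split=> v /= /eqP.
Qed.

Lemma open_pt (U : set P2) :
  open U <-> open [set v : V3 | v != 0 /\ U (pt v)].
Proof.
split.
- rewrite /open /= /quotient_open => -[A oA AU].
  have -> : [set v : V3 | v != 0 /\ U (pt v)] = A `&` [set v | v != 0].
    rewrite eqEsubset; split=> v /= [].
      move=> v0 Uv; split=> //.
      have : (\pi_Q2 @^-1` U) (nzv v) by [].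
      by rewrite -AU /= nzvK.
    move=> Av v0; split=> //.
    have : (set_val @^-1` A) (nzv v) by rewrite /= nzvK.
    by rewrite AU.
  exact: (openI oA open_neq0).
- move=> oU; rewrite /open /= /quotient_open.
  exists [set v : V3 | v != 0 /\ U (pt v)] => //.
  by apply/seteqP; split=> u /=; rewrite /pt nzv_val nzv_neq0 => // -[].
Qed.

(** The converse direction says that [pt] is an open map: an open set of vectors stays open when it
    is spread over all nonzero multiples. *)
Lemma nbhs_pt v (W : set P2) : v != 0 ->
  nbhs (pt v) W <-> nbhs v (pt @^-1` W).
Proof.
move=> v0; split.
  rewrite nbhsE => -[U [oU Uv] UW]; rewrite nbhsE.
  exists [set u : V3 | u != 0 /\ U (pt u)]; first by split=> //; exact/open_pt.
  by move=> u /= [_ Uu]; exact: UW.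
rewrite nbhsE => -[V [oV Vv] VW].
rewrite nbhsE; exists (pt @` (V `&` [set u | u != 0])).
  split; last by exists v.
  apply/open_pt; rewrite openE => u /= [u0 [w [Vw w0] /esym /pt_eqP]].
  move=> /(_ u0 w0)[k k0 uE].
  have : nbhs (k^-1 *: u) V.
    by rewrite uE scalerK// nbhsE; exists V.
  move=> /(@scaler_continuous _ _ (k^-1) u) hV.
  have hu0 : nbhs u [set x : V3 | x != 0].
    by apply: open_nbhs_nbhs; split=> //; exact: open_neq0.
  have : nbhs u ([set x : V3 | V (k^-1 *: x)] `&` [set x | x != 0]) by exact: filterI.
  rewrite /interior; apply: filterS => x /= [Vx x0]; split=> //.
  exists (k^-1 *: x); last by rewrite ptZ// invr_neq0.
  by split=> //=; rewrite scaler_eq0 negb_or invr_neq0.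
by move=> _ [u [Vu u0] <-]; exact: VW.
Qed.

Lemma pt_continuous v : v != 0 -> {for v, continuous pt}.
Proof. by move=> v0 W /= /(nbhs_pt _ v0). Qed.

Lemma continuous_from_pt (T : topologicalType) (g : P2 -> T) v : v != 0 ->
  {for v, continuous (g \o pt)} -> {for pt v, continuous g}.
Proof. by move=> v0 cg W /cg h; apply/nbhs_pt. Qed.

Definition dt (u v : V3) : R := cx u * cx v + cy u * cy v + cz u * cz v.
Definition cr (u v : V3) : V3 :=
  vec (cy u * cz v - cz u * cy v) (cz u * cx v - cx u * cz v)
      (cx u * cy v - cy u * cx v).

Lemma dtC u v : dt u v = dt v u. Proof. by rewrite /dt; ring. Qed.
Lemma dtZl k u v : dt (k *: u) v = k * dt u v.
Proof. by rewrite /dt !cE; ring. Qed.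

Lemma dtvv_gt0 v : v != 0 -> 0 < dt v v.
Proof.
rewrite vec_eq0 /dt -!expr2 => v0.
by rewrite lt0r !addr_ge0 ?sqr_ge0// andbT !paddr_eq0 ?addr_ge0 ?sqr_ge0// !sqrf_eq0 -andbA.
Qed.

Lemma dt_continuous (T : topologicalType) (f g : T -> V3) x :
    {for x, continuous f} -> {for x, continuous g} ->
  {for x, continuous (fun y => dt (f y) (g y))}.
Proof.
move=> cf cg; apply: cvgD; first apply: cvgD; apply: cvgM.
- exact: (continuous_comp cf (@cx_continuous _)).
- exact: (continuous_comp cg (@cx_continuous _)).
- exact: (continuous_comp cf (@cy_continuous _)).
- exact: (continuous_comp cg (@cy_continuous _)).
- exact: (continuous_comp cf (@cz_continuous _)).
- exact: (continuous_comp cg (@cz_continuous _)).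
Qed.

(** A closed curve lifted to vectors and continued to all real times. The factor [tau] is [1] or
    [-1] according to whether the lift returns to itself or to its negative. *)
Record loop_of (C : set P2) (al : R -> V3) (tau : R) : Prop := LoopOf {
  loop_cont : continuous al;
  loop_neq0 : forall t, al t != 0;
  loop_sqr : tau ^+ 2 = 1;
  loop_per : forall t, al (t + 1) = tau *: al t;
  loop_im : forall p, C p <-> exists t, p = pt (al t);
  loop_inj : forall s t, pt (al s) = pt (al t) -> exists n : int, s = t + n%:~R }.

Definition flip (b : bool) (v : V3) : V3 := if b then - v else v.

Lemma flip_norm b v : `|flip b v| = `|v|.
Proof. by case: b; rewrite ?normrN. Qed.

Lemma flip_sub b u v : `|flip b u - flip b v| = `|u - v|.
Proof. by case: b; rewrite // -opprD normrN. Qed.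

Lemma flip_addb b c v : flip b (flip c v) = flip (b (+) c) v.
Proof. by case: b; case: c; rewrite //= opprK. Qed.

Lemma pt_flip b v : pt (flip b v) = pt v.
Proof. by case: b; rewrite //= -scaleN1r ptZ// oppr_eq0 oner_eq0. Qed.

Lemma unit_rep : exists u : P2 -> V3, forall p, `|u p| = 1 /\ pt (u p) = p.
Proof.
suff /boolp.choice[u uP] : forall p, exists u : V3, `|u| = 1 /\ pt u = p.
  by exists u.
move=> p.
have [v v0 ->] := pt_surj p; exists (`|v|^-1 *: v).
rewrite ptZ ?invr_neq0 ?normr_eq0//; split=> //.
by rewrite normrZ normfV normr_id mulVf// normr_eq0.
Qed.

Lemma unit_same (u v : V3) : `|u| = 1 -> `|v| = 1 -> pt u = pt v ->
  exists b, u = flip b v.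
Proof.
move=> u1 v1; have n0 (w : V3) : `|w| = 1 -> w != 0.
  by move=> w1; rewrite -normr_eq0 w1 oner_eq0.
move=> /(pt_eqP (n0 _ u1) (n0 _ v1)) [k k0 uE].
have /eqP : `|k| = 1 by move: u1; rewrite uE normrZ v1 mulr1.
rewrite eqr_norml ler01 andbT => /orP[]/eqP kE; rewrite uE kE.
- by exists false; rewrite scale1r.
- by exists true; rewrite scaleN1r.
Qed.

Lemma unit_rep_near (u : P2 -> V3) (p : P2) (e : R) :
    (forall p, `|u p| = 1 /\ pt (u p) = p) -> 0 < e ->
  \forall q \near p, exists b, `|flip b (u q) - u p| < e.
Proof.
move=> uP e0; have [u1 up] := uP p.
have u0 : u p != 0 by rewrite -normr_eq0 u1 oner_eq0.
rewrite -{1}up; apply/(nbhs_pt _ u0).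
pose nrm (v : V3) := `|v|^-1 *: v.
have cn : {for u p, continuous nrm}.
  have c1 : {for u p, continuous (fun v : V3 => `|v|^-1)}.
    have n0 : `|u p| != 0 by rewrite normr_eq0.
    exact: (cvgV n0 (@norm_continuous _ _ (u p))).
  exact: (cvgZ c1 cvg_id).
have nu : nrm (u p) = u p by rewrite /nrm u1 invr1 scale1r.
have /cvgrPdist_lt/(_ _ e0) hn := cn.
have hv0 : \forall v \near u p, v != 0.
  by apply: open_nbhs_nbhs; split=> //; exact: open_neq0.
near=> v.
have v0 : v != 0 by near: v.
have n0 : `|v| != 0 by rewrite normr_eq0.
have [w1 wp] := uP (pt v).
have [|||b wE] := @unit_same (nrm v) (u (pt v)) => //.
- by rewrite /nrm normrZ normfV normr_id mulVf.
- by rewrite wp /nrm ptZ// invr_neq0.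
exists b; rewrite -wE distrC -{1}nu; near: v; exact: hn.
Unshelve. all: by end_near. Qed.

Definition upto (e : R) (u v : V3) := exists b, `|flip b u - v| < e.

Lemma upto_sym e u v : upto e u v -> upto e v u.
Proof.
move=> [b ub]; exists b; rewrite distrC -(flip_sub b) flip_addb addbb.
by rewrite distrC in ub *.
Qed.

Lemma upto_trans e e' u v w : upto e u v -> upto e' v w -> upto (e + e') u w.
Proof.
move=> [b ub] [c vc]; exists (c (+) b); rewrite -flip_addb.
rewrite -(subrKA (flip c v)); apply: le_lt_trans (ler_normD _ _) (ltrD _ vc).
by rewrite flip_sub.
Qed.

(** Going round the three vectors accumulates an error below [3 / 4], while a unit vector and its
    negative are at distance [2]; so the three sign corrections must be compatible. *)
Lemma upto_cocycle (u v w : V3) : `|u| = 1 -> `|v| = 1 -> `|w| = 1 ->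
    upto (1 / 4) u v -> upto (1 / 4) v w -> upto (1 / 4) u w ->
  ~~ (`|u - v| < 1 / 4) (+) ~~ (`|v - w| < 1 / 4) = ~~ (`|u - w| < 1 / 4).
Proof.
have flipP (x y : V3) : upto (1 / 4) x y ->
    `|flip (~~ (`|x - y| < 1 / 4)) x - y| < 1 / 4.
  move=> [b xb]; have [xy|xy] := boolP (`|x - y| < 1 / 4) => //=.
  by case: b xb => //= h; rewrite h in xy.
move=> u1 v1 w1 /flipP + /flipP + /flipP.
move: (~~ (`|u - v| < _)) (~~ (`|v - w| < _)) (~~ (`|u - w| < _)) => a b c uv vw uw.
have uw' : `|flip (b (+) a) u - w| < 1 / 4 + 1 / 4.
  rewrite -flip_addb -(subrKA (flip b v)).
  by apply: le_lt_trans (ler_normD _ _) (ltrD _ vw); rewrite flip_sub.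
rewrite addbC; apply/eqP/negPn/negP => ne.
have : `|flip (b (+) a) u - flip c u| < 1 / 4 + 1 / 4 + 1 / 4.
  rewrite -(subrKA w); apply: le_lt_trans (ler_normD _ _) (ltrD uw' _).
  by rewrite distrC.
have h2 : `|u + u| = 2.
  by rewrite -mulr2n normrMn u1.
by move: ne; case: (b (+) a); case: c uw => //= _ _; rewrite ?opprK -?opprD ?normrN h2; lra.
Qed.

Lemma frac_in (t : R) : 0 <= t - (Num.floor t)%:~R <= 1.
Proof.
have := floor_le t; have := floorD1_gt t; rewrite intrD1 => f1 f2.
by apply/andP; split; lra.
Qed.

(** Unit representatives of the points of the curve are chosen without any continuity. Close points
    have representatives close up to sign, these signs form a cocycle by [upto_cocycle], and
    [discrete_lifting] makes them consistent. *)
Lemma simple_closed_curve_loop (C : set P2) : simple_closed_curve C ->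
  exists al tau, loop_of C al tau.
Proof.
move=> [f [fc f01 finj CE]].
have [u uP] := unit_rep.
pose fr (t : R) := t - (Num.floor t)%:~R.
pose F t := f (fr t).
pose e t := u (F t).
have e1 t : `|e t| = 1 by case: (uP (F t)).
have eF t : pt (e t) = F t by case: (uP (F t)).
have unif0 (h : R) : 0 < h -> exists2 d : R, 0 < d & forall s t,
    0 <= s <= 1 -> 0 <= t <= 1 -> `|s - t| < d -> upto h (u (f s)) (u (f t)).
  move=> h0; apply: lebesgue_itv => z z01.
  have h2 : 0 < h / 2 by rewrite divr_gt0.
  have /(subspace_continuousP) := fc.
  move=> /(_ z); rewrite /= in_itv /= => /(_ z01) fz.
  have := fz _ (unit_rep_near (f z) uP h2); rewrite /= => /nbhs_ballP[d /= d0 hd].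
  exists d => // s t s01 t01 zs zt; rewrite (splitr h).
  apply: (@upto_trans _ _ _ (u (f z))).
    by apply: hd => //=; rewrite in_itv.
  by apply: upto_sym; apply: hd => //=; rewrite in_itv.
have unif (h : R) : 0 < h -> exists2 d : R, 0 < d & forall s t,
    `|s - t| < d -> upto h (e s) (e t).
  move=> h0; have h2 : 0 < h / 2 by rewrite divr_gt0.
  have [d d0 hd] := unif0 _ h2.
  exists (Num.min d 1); first by rewrite lt_min d0 ltr01.
  suff H s t : s <= t -> `|s - t| < Num.min d 1 -> upto h (e s) (e t).
    move=> s t st; have [le|/ltW le] := leP s t; first exact: H.
    by apply: upto_sym; apply: H; rewrite // distrC.
  move=> st; rewrite lt_min distrC ger0_norm ?subr_ge0// => /andP[std st1].
  have mono2 : upto (h / 2) (e s) (e t) -> upto h (e s) (e t).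
    by move=> [b hb]; exists b; apply: lt_trans hb _; lra.
  have fs := frac_in s; have ft := frac_in t.
  have [fl|fl] := eqVneq (Num.floor s) (Num.floor t).
    apply: mono2; apply: hd => //; rewrite /fr fl opprB addrA subrK.
    by rewrite distrC ger0_norm ?subr_ge0.
  have fle : (Num.floor s <= Num.floor t)%R by rewrite floor_ge_int (le_trans (floor_le s)).
  have flt : (Num.floor s + 1)%:~R <= (Num.floor t)%:~R :> R.
    by rewrite ler_int lezD1 lt_neqAle fl.
  rewrite intrD1 in flt.
  move: fs ft => /andP[s0 s1] /andP[t0 t1].
  (* An integer lies between [s] and [t]; the comparison passes through the common value
     [f 0 = f 1]. *)
  rewrite (splitr h); apply: (@upto_trans _ _ _ (u (f 1))).
    apply: hd; rewrite ?lexx ?ler01//.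
      by apply/andP; split.
    by rewrite /fr ltr_norml; apply/andP; split; lra.
  rewrite -f01; apply: hd; rewrite ?lexx ?ler01//.
    by apply/andP; split.
  by rewrite /fr ltr_norml; apply/andP; split; lra.
have q0 : 0 < 1 / 4 :> R by lra.
have [d d0 hd] := unif _ q0.
have [|eps epsE] := @discrete_lifting R d
    (fun x y => ~~ (`|e x.2 - e y.2| < 1 / 4)) d0.
  by move=> x y z /andP[_ xy] /andP[_ yz] /andP[_ xz]; apply: upto_cocycle => //; exact: hd.
pose al t := flip (eps (0, t)) (e t).
have d2 : 0 < d / 2 by rewrite divr_gt0.
have aE t : exists b, al t = flip b (e t) by exists (eps (0, t)).
have a1 t : `|al t| = 1 by rewrite flip_norm.
have apt t : pt (al t) = F t by rewrite pt_flip.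
have aclose s t : `|s - t| < d / 2 -> `|al s - al t| < 1 / 4.
  move=> st; have cl : close (d / 2) (0, s) (0, t).
    by rewrite /close /= subrr normr0 d2.
  have std : `|s - t| < d by apply: lt_le_trans st _; lra.
  have := epsE _ _ cl; rewrite /= /al; have [b hb] := hd _ _ std.
  case: (boolP (`|e s - e t| < _)) => /= h.
    by case: (eps (0, s)); case: (eps (0, t)) => //= _; rewrite // -opprD normrN.
  have {h hb} : `|e s + e t| < 1 / 4.
    by case: b hb => /= hb; [rewrite -normrN opprD|rewrite hb in h].
  by case: (eps (0, s)); case: (eps (0, t)) => //= hb _; rewrite ?opprK//
    -opprD normrN.
have Fper t : F (t + 1) = F t.
  by rewrite /F /fr floorDrz ?rpred1// floor1 intrD1 opprD addrACA subrr addr0.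
have [tau tau1 tauE] : exists2 tau : R, tau ^+ 2 = 1 & forall t, al (t + 1) = tau *: al t.
  have step t : exists b, al (t + 1) = flip b (al t).
    by apply: unit_same; rewrite // !apt Fper.
  pose b t := `[< al (t + 1) = al t >].
  have bP t : al (t + 1) = flip (~~ b t) (al t).
    rewrite /b; case: asboolP => //= h; have [[] hb] := step t => //.
  have two t : `|al t + al t| = 2 by rewrite -mulr2n normrMn a1.
  have bc s t : b s = b t.
    have := @chain_const2 R bool (fun x => b x.2) (d / 2) d2.
    move=> /(_ _ (0, s) (0, t)); apply=> x y /andP[_ /= xy].
    have h1 := aclose _ _ xy.
    have h2 : `|al (x.2 + 1) - al (y.2 + 1)| < 1 / 4.
      by apply: aclose; rewrite opprD addrACA subrr addr0.
    apply/eqP/negPn/negP => ne.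
    have h3 : `|al x.2 + al y.2| < 1 / 4.
      move: h2 ne; rewrite !bP; case: (b x.2); case: (b y.2) => //= h2 _.
        by rewrite -[al y.2]opprK.
      by rewrite -normrN opprD.
    have := two x.2; rewrite (_ : _ + _ = (al x.2 - al y.2) + (al x.2 + al y.2)).
      by move=> h; have := ler_normD (al x.2 - al y.2) (al x.2 + al y.2); rewrite h; lra.
    by rewrite addrACA [- _ + _]addrC subrr addr0.
  exists (if b 0 then 1 else - 1); first by case: (b 0); rewrite ?sqrrN expr1n.
  by move=> t; rewrite bP (bc t 0); case: (b 0) => /=; rewrite ?scale1r ?scaleN1r.
exists al, tau; split => //.
- move=> t; apply/cvgrPdist_lt => h h0.
  have h4 : 0 < Num.min h (1 / 4) by rewrite lt_min h0.
  have [d' d'0 hd'] := unif _ h4.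
  near=> s.
  have ts : `|t - s| < d' by near: s; exact: cvgr_dist_lt.
  have ts2 : `|t - s| < d / 2 by near: s; exact: cvgr_dist_lt.
  have [b] : upto (Num.min h (1 / 4)) (al t) (al s).
    have [b hb] := hd' _ _ ts; rewrite /al.
    exists (eps (0, s) (+) b (+) eps (0, t)).
    rewrite flip_addb -addbA addbb addbF -flip_addb flip_sub//.
  rewrite lt_min => /andP[h1 h2]; have h3 := aclose _ _ ts2.
  case: b h1 h2 => //= _ h2.
  have two : `|al t + al t| = 2 by rewrite -mulr2n normrMn a1.
  have h5 : `|al t + al s| < 1 / 4 by rewrite -normrN opprD.
  exfalso; move: two; rewrite (_ : _ + _ = (al t - al s) + (al t + al s)).
    by move=> h6; have := ler_normD (al t - al s) (al t + al s); rewrite h6; lra.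
  by rewrite addrACA [- _ + _]addrC subrr addr0.
- by move=> t; rewrite -normr_eq0 a1 oner_eq0.
- move=> p; rewrite CE; split=> [[t /=]|[t ->]].
    rewrite in_itv /= => /andP[t0 t1] <-; rewrite le_eqVlt in t1.
    have [t1'|t1'] := eqVneq t 1.
      by exists 0; rewrite apt /F /fr floor0 subr0 t1'.
    exists t; rewrite apt /F /fr (floor_def (m := 0)) ?subr0//.
    by rewrite t0 add0r; move: t1; rewrite (negbTE t1').
  by rewrite apt; exists (fr t) => //=; rewrite in_itv /= frac_in.
- move=> s t; rewrite !apt => /finj; rewrite !inE /= !in_itv /=.
  have lt1 x : 0 <= fr x < 1.
    have /andP[-> _] := frac_in x.
    by have := floorD1_gt x; rewrite intrD1 /fr; lra.
  move=> /(_ (lt1 _) (lt1 _)); rewrite /fr => h.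
  exists (Num.floor s - Num.floor t); rewrite intrD intrN.
  by move: h; lra.
Unshelve. all: by end_near. Qed.

End ProjectivePoints.

Local Close Scope quotient_scope.

(** * Monodromy of a curve seen from a point *)

Section Pencil.
Variable R : realType.
Local Notation V3 := 'rV[R]_3.
Local Notation P2 := (projective_plane R).
Implicit Types (a y z v : V3).

Lemma dtNl u v : dt (- u) v = - dt u v. Proof. by rewrite /dt !cE; ring. Qed.
Lemma dtNr u v : dt u (- v) = - dt u v. Proof. by rewrite dtC dtNl dtC. Qed.
Lemma dtZr k u v : dt u (k *: v) = k * dt u v. Proof. by rewrite dtC dtZl dtC. Qed.
Lemma crC u v : cr u v = - cr v u.
Proof. by apply: vec_eqP; rewrite !cE; ring. Qed.
Lemma crNl u v : cr (- u) v = - cr u v.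
Proof. by apply: vec_eqP; rewrite !cE; ring. Qed.
Lemma crZl k u v : cr (k *: u) v = k *: cr u v.
Proof. by apply: vec_eqP; rewrite !cE; ring. Qed.
Lemma crZr k u v : cr u (k *: v) = k *: cr u v.
Proof. by apply: vec_eqP; rewrite !cE; ring. Qed.
Lemma dt_cr_cr u v w x : dt (cr u v) (cr w x) = dt u w * dt v x - dt u x * dt v w.
Proof. by rewrite /dt !cE; ring. Qed.

Lemma cr_eq0 u v : u != 0 -> v != 0 -> cr u v = 0 -> pt u = pt v.
Proof.
move=> u0 v0 uv0; apply/(pt_eqP u0 v0).
have : (cr u v == 0) by apply/eqP.
rewrite vec_eq0 !c_vec !subr_eq0 => /and3P[/eqP e1 /eqP e2 /eqP e3].
have nz (k : R) : u = k *: v -> exists2 k : R, k != 0 & u = k *: v.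
  by move=> uE; exists k => //; apply: contra_neq u0 => k0; rewrite uE k0 scale0r.
move: (v0); rewrite vec_eq0 !negb_and => /or3P[h|h|h].
- apply: (nz (cx u / cx v)); apply: vec_eqP; rewrite !cE ?divfK//.
    by apply: (mulIf h); rewrite mulrAC divfK// -e3.
  by apply: (mulIf h); rewrite mulrAC divfK// e2.
- apply: (nz (cy u / cy v)); apply: vec_eqP; rewrite !cE ?divfK//.
    by apply: (mulIf h); rewrite mulrAC divfK// e3.
  by apply: (mulIf h); rewrite mulrAC divfK// -e1.
- apply: (nz (cz u / cz v)); apply: vec_eqP; rewrite !cE ?divfK//.
    by apply: (mulIf h); rewrite mulrAC divfK// -e2.
  by apply: (mulIf h); rewrite mulrAC divfK// e1.
Qed.

Lemma cr_neq0 u v : u != 0 -> v != 0 -> pt u <> pt v -> cr u v != 0.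
Proof. by move=> u0 v0 uv; apply/eqP => /(cr_eq0 u0 v0). Qed.

(* The direction of v seen from z, in the frame (y x a, - a) of the plane R^3/z. *)
Definition view a y z v : R[i] := dt (cr y a) (cr z v) +i* (- dt a (cr z v)).

(** If the imaginary part vanishes, [cr z v] is orthogonal to [a] and to [z], hence parallel to
    [cr z a]; since [cr y a] is not orthogonal to [cr z a], the real part cannot vanish as well. *)
Lemma view_neq0 a y z v : 0 < dt (cr y a) (cr z a) -> cr z v != 0 ->
  view a y z v != 0.
Proof.
move=> ya zv; rewrite eq_complex /= negb_and oppr_eq0.
have [im0|] := eqVneq (dt a (cr z v)) 0; rewrite ?orbT// orbF.
set n := cr z a.
have n0 : n != 0.
  by apply: contraTneq ya => n0; rewrite -/n n0 /dt /cx /cy /cz !mxE !mulr0 !addr0 ltxx.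
(* z and v are both orthogonal to n, so that [cr z v] is parallel to n *)
have par : dt n n *: cr z v = dt n (cr z v) *: n.
  have e1 : dt n z = 0 by rewrite /n /dt !cE; ring.
  have e2 : dt n v = 0.
    by rewrite -[LHS]opprK -oppr0 -im0 /n /dt !cE; congr (- _); ring.
  have e3 : cr (cr z v) n = 0.
    have -> : cr (cr z v) n = dt n z *: v - dt n v *: z.
      by apply: vec_eqP; rewrite /dt !cE; ring.
    by rewrite e1 e2 !scale0r subrr.
  have -> : dt n n *: cr z v = dt n (cr z v) *: n + cr n (cr (cr z v) n).
    by apply: vec_eqP; rewrite /dt !cE; ring.
  rewrite e3 (_ : cr n 0 = 0) ?addr0//.
  by apply: vec_eqP; rewrite !cE /cx /cy /cz !mxE; ring.
apply/eqP => re0.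
have : dt (cr y a) (dt n n *: cr z v) = 0 by rewrite dtZr re0 mulr0.
rewrite par dtZr => /eqP; rewrite mulf_eq0 (gt_eqF ya) orbF => /eqP nz.
move: par; rewrite nz scale0r => /eqP; rewrite scaler_eq0 (negbTE zv) orbF.
by rewrite gt_eqF// dtvv_gt0.
Qed.

Lemma view_opp_swap a y z v : view a y z v = - view a y v z.
Proof. by rewrite /view (crC z v) !dtNr; apply/eqP; rewrite eq_complex /= !eqxx. Qed.

Lemma viewZr a y z k v : view a y z (k *: v) = k%:C * view a y z v.
Proof.
by rewrite /view crZr !dtZr; apply/eqP; rewrite eq_complex /=; apply/andP; split; apply/eqP; ring.
Qed.

(** The real part has two factors that both change sign with [z], the imaginary part has one:
    negating [z] reverses the orientation of the plane of directions. *)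
Lemma view_conj a z v : view a (- z) (- z) v = (view a z z v)^*.
Proof.
by rewrite /view !crNl dtNl !dtNr; apply/eqP; rewrite eq_complex /= opprK !eqxx.
Qed.

Lemma view_continuous (T : topologicalType) a (f g h : T -> V3) (x : T) :
    {for x, continuous f} -> {for x, continuous g} -> {for x, continuous h} ->
  {for x, continuous (Re \o (fun y : T => view a (f y) (g y) (h y)))} /\
  {for x, continuous (Im \o (fun y : T => view a (f y) (g y) (h y)))}.
Proof.
move=> cf cg ch; have ca : {for x, continuous (fun _ : T => a)} by exact: cvg_cst.
split.
- rewrite (_ : _ \o _ = fun y : T => dt (f y) (g y) * dt a (h y) - dt (f y) (h y) * dt a (g y)).
    by apply: cvgB; apply: cvgM; exact: dt_continuous.
  by apply/funext => y /=; rewrite dt_cr_cr.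
- have cX (k : T -> V3) : {for x, continuous k} -> {for x, continuous (@cx R \o k)}.
    by move=> ck; exact: (continuous_comp ck (@cx_continuous _ _)).
  have cY (k : T -> V3) : {for x, continuous k} -> {for x, continuous (@cy R \o k)}.
    by move=> ck; exact: (continuous_comp ck (@cy_continuous _ _)).
  have cZ (k : T -> V3) : {for x, continuous k} -> {for x, continuous (@cz R \o k)}.
    by move=> ck; exact: (continuous_comp ck (@cz_continuous _ _)).
  rewrite (_ : _ \o _ = fun y : T => - (
     cx a * ((@cy R \o g) y * (@cz R \o h) y - (@cz R \o g) y * (@cy R \o h) y) +
     cy a * ((@cz R \o g) y * (@cx R \o h) y - (@cx R \o g) y * (@cz R \o h) y) +
     cz a * ((@cx R \o g) y * (@cy R \o h) y - (@cy R \o g) y * (@cx R \o h) y))).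
    apply: cvgN; apply: cvgD; first apply: cvgD; apply: cvgM; try exact: cvg_cst;
      by apply: cvgB; apply: cvgM; first [exact: cX|exact: cY|exact: cZ].
  by apply/funext => y /=; rewrite /dt !cE.
Qed.

Lemma mono_conj (u : R -> R[i]) (c : R[i]) : mono u c ->
  mono (fun t => (u t)^*) (c^*).
Proof.
move=> [s [sE [d d0 sd]] sc]; exists (fun t => (s t)^*).
  split=> [t|]; first by rewrite -rmorphXn sE.
  exists d => // t t' /sd; case: (s t) (s t') => p q [p' q'].
  by rewrite /cdot /= mulrNN.
by move=> t; rewrite sc rmorphM.
Qed.

Section Loop.
Variables (C : set P2) (al : R -> V3) (tau : R).
Hypothesis lp : loop_of C al tau.

(** The base point [al 0] of the curve completes the frame, as it is not proportional to any [z] off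
    the curve. *)
Definition sight z t : R[i] := view (al 0) z z (al t).

Lemma loop_pt t : C (pt (al t)).
Proof. by apply/(loop_im lp); exists t. Qed.

Lemma sight_neq0 z t : z != 0 -> ~ C (pt z) -> sight z t != 0.
Proof.
move=> z0 zC; have al0 := loop_neq0 lp.
have zt s : cr z (al s) != 0.
  by apply: cr_neq0 => // e; apply: zC; rewrite e; exact: loop_pt.
by apply: view_neq0 => //; apply: dtvv_gt0.
Qed.

Lemma sight_per z t : sight z (t + 1) = tau%:C * sight z t.
Proof. by rewrite /sight (loop_per lp) viewZr. Qed.

Lemma mono_path (z : R -> V3) (p q : R) (c : R[i]) : p <= q ->
    continuous z -> (forall l, p <= l <= q -> z l != 0) ->
    (forall l, p <= l <= q -> ~ C (pt (z l))) ->
    mono (sight (z p)) c ->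
  mono (sight (z q)) c.
Proof.
move=> pq cz z0 zC mp.
pose g (x : R * R) := z (p + x.1 * (q - p)).
have lin l : 0 <= l <= 1 -> p <= p + l * (q - p) <= q.
  move=> /andP[l0 l1]; have qp : 0 <= q - p by rewrite subr_ge0.
  have h1 : 0 <= l * (q - p) by rewrite mulr_ge0.
  have h2 : l * (q - p) <= q - p by rewrite ler_piMl.
  by apply/andP; split; lra.
have cg : continuous g.
  move=> x; apply: (@continuous_comp _ _ _ (fun x : R * R => p + x.1 * (q - p)) z);
    last exact: cz.
  apply: cvgD; first exact: cvg_cst.
  by apply: cvgM; [exact: cvg_fst|exact: cvg_cst].
have ca : continuous (fun x : R * R => al x.2).
  move=> x; apply: (@continuous_comp _ _ _ snd al); first exact: cvg_snd.
  exact: (loop_cont lp).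
have [c' _ hc'] := @mono_homotopy R
  (fun x => view (al 0) (g x) (g x) (al x.2)) tau (loop_sqr lp)
  (fun x => proj1 (view_continuous _ (cg x) (cg x) (ca x)))
  (fun x => proj2 (view_continuous _ (cg x) (cg x) (ca x)))
  (fun l t l01 => sight_neq0 t (z0 _ (lin l l01)) (zC _ (lin l l01)))
  (fun l t => sight_per _ t).
have := hc' 0; rewrite lexx ler01 => /(_ isT) m0.
have := hc' 1; rewrite lexx ler01 => /(_ isT) m1.
have cc : c = c'.
  apply: (mono_unique mp); move: m0; rewrite /g /=.
  by under eq_fun do rewrite mul0r addr0.
rewrite cc; move: m1; rewrite /g /=.
by under eq_fun do rewrite mul1r subrKC.
Qed.

Lemma mono_sight_exists z : z != 0 -> ~ C (pt z) ->
  exists2 c, c ^+ 2 = tau%:C & mono (sight z) c.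
Proof.
move=> z0 zC.
have cz : continuous (fun _ : R * R => z) by move=> x; exact: cvg_cst.
have ca : continuous (fun x : R * R => al x.2).
  move=> x; apply: (@continuous_comp _ _ _ snd al); first exact: cvg_snd.
  exact: (loop_cont lp).
have [c' c2 hc'] := @mono_homotopy R
  (fun x => view (al 0) z z (al x.2)) tau (loop_sqr lp)
  (fun x => proj1 (view_continuous _ (cz x) (cz x) (ca x)))
  (fun x => proj2 (view_continuous _ (cz x) (cz x) (ca x)))
  (fun l t l01 => sight_neq0 t z0 zC)
  (fun l t => sight_per _ t).
by exists c' => //; apply: (hc' 0); rewrite lexx ler01.
Qed.

(** For an imaginary [c] conjugation is a change of sign: the two lifts of a point lie on different
    sides of the curve, which is why sides belong to the double cover. *)
Lemma mono_sightN z c : mono (sight z) c -> mono (sight (- z)) (c^*).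
Proof.
move=> /mono_conj; rewrite /sight.
by under eq_fun do rewrite -view_conj.
Qed.

Lemma mono_sightZ z k c : z != 0 -> ~ C (pt z) -> 0 < k ->
  mono (sight z) c -> mono (sight (k *: z)) c.
Proof.
move=> z0 zC k0 m.
pose zz (l : R) := (1 + l * (k - 1)) *: z.
have cf l : 0 <= l <= 1 -> 0 < 1 + l * (k - 1).
  move=> /andP[l0 l1].
  have : l * (1 - k) < 1; last lra.
  have [k1|k1] := leP 1 k.
    by apply: le_lt_trans ltr01; rewrite mulr_ge0_le0// subr_le0.
  apply: (@le_lt_trans _ _ (1 - k)); last lra.
  by rewrite ler_piMl// subr_ge0 ltW.
have z0' : zz 0 = z by rewrite /zz mul0r addr0 scale1r.
have z1' : zz 1 = k *: z by rewrite /zz mul1r subrKC.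
rewrite -z1'; apply: (@mono_path zz 0 1 c ler01); rewrite ?z0'//.
- move=> l; apply: cvgZl; apply: cvgD; first exact: cvg_cst.
  by apply: cvgM; [exact: cvg_id|exact: cvg_cst].
- by move=> l /cf h; rewrite scaler_eq0 negb_or z0 andbT gt_eqF.
- by move=> l /cf h; rewrite ptZ// gt_eqF.
Qed.

End Loop.
End Pencil.

(** * Local form of a crossing *)

Section Crossing.
Variable R : realType.
Local Notation V3 := 'rV[R]_3.
Local Notation P2 := (projective_plane R).

Definition clamp_to (a b t : R) : R := a + (b - a) * clamp ((t - a) / (b - a)).

Lemma clamp_to_in a b t : a <= b -> a <= clamp_to a b t <= b.
Proof.
move=> ab; have /andP[c0 c1] := clamp_in ((t - a) / (b - a)).
have h1 : 0 <= (b - a) * clamp ((t - a) / (b - a)) by rewrite mulr_ge0 ?subr_ge0.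
have h2 : (b - a) * clamp ((t - a) / (b - a)) <= b - a.
  by rewrite ler_piMr ?subr_ge0.
by rewrite /clamp_to; apply/andP; split; lra.
Qed.

Lemma clamp_to_id a b t : a < b -> a <= t <= b -> clamp_to a b t = t.
Proof.
move=> ab /andP[h1 h2]; have ba : 0 < b - a by rewrite subr_gt0.
rewrite /clamp_to clamp_id; first by rewrite mulrC divfK ?gt_eqF// subrKC.
by rewrite divr_ge0 ?subr_ge0 ?(ltW ab)//= ler_pdivrMr// mul1r; lra.
Qed.

Lemma clamp_to_le a b t : a < b -> t <= a -> clamp_to a b t = a.
Proof.
move=> ab ta; have ba : 0 < b - a by rewrite subr_gt0.
have le0 : (t - a) / (b - a) <= 0 by rewrite ler_pdivrMr// mul0r; lra.
rewrite /clamp_to /clamp min_r ?(le_trans le0)// max_l//.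
by rewrite mulr0 addr0.
Qed.

Lemma clamp_to_ge a b t : a < b -> b <= t -> clamp_to a b t = b.
Proof.
move=> ab ta; have ba : 0 < b - a by rewrite subr_gt0.
have le0 : 1 <= (t - a) / (b - a) by rewrite ler_pdivlMr// mul1r; lra.
by rewrite /clamp_to /clamp min_l// max_r// mulr1 subrKC.
Qed.

Lemma clamp_to_continuous a b : continuous (clamp_to a b).
Proof.
move=> t; apply: cvgD; first exact: cvg_cst.
apply: cvgM; first exact: cvg_cst.
apply: (@continuous_comp _ _ _ (fun t => (t - a) / (b - a)) (@clamp R));
  last exact: clamp_continuous.
by apply: cvgM; [apply: cvgB; [exact: cvg_id|exact: cvg_cst]|exact: cvg_cst].
Qed.

Definition in_square (r : R) (Q : R * R) := (`|Q.1| <= r) && (`|Q.2| <= r).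

Lemma dtl_continuous (v : V3) : continuous (fun w : V3 => dt w v).
Proof.
move=> w; have ci : {for w, continuous (@id V3)} by exact: cvg_id.
have cc : {for w, continuous (fun _ : V3 => v)} by exact: cst_continuous.
exact: (dt_continuous ci cc).
Qed.

(** The chart is inverted on a small square, made global by clamping, and lifted to vectors; the
    normalisation [dt (m Q) pv = 1] fixes length and sign, hence gives continuity. The square is so
    small that the vectors [cr (m Q) a] are pairwise at acute angles, so viewpoint and frame of
    [view] may move in it independently. *)
Lemma local_box (C D : set P2) (p : P2) (a : V3) :
    cross_at C D p -> a != 0 -> pt a <> p ->
  exists (pv : V3) (r : R) (m : R * R -> V3) (h : P2 -> R * R) (N : set P2),
  [/\ [/\ pv != 0, pt pv = p, 0 < r & h p = (0, 0)],
      [/\ continuous m, forall Q, dt (m Q) pv = 1 &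
          forall Q Q', 0 < dt (cr (m Q) a) (cr (m Q') a)],
      forall Q, in_square r Q -> [/\ h (pt (m Q)) = Q,
         C (pt (m Q)) <-> Q.2 = 0 & D (pt (m Q)) <-> Q.1 = 0] &
      [/\ open N, N p & forall q, N q ->
         [/\ {for q, continuous h}, in_square r (h q) & q = pt (m (h q))]]].
Proof.
move=> [U [h [[[oU Up] hc hinj hopen hp] CD]]] a0 ap.
have [pv pv0 pE] := pt_surj p.
have [u uP] := unit_rep R.
have un0 q : u q != 0 by rewrite -normr_eq0 (proj1 (uP q)) oner_eq0.
pose mu q : V3 := (dt (u q) pv)^-1 *: u q.
have muE v : v != 0 -> mu (pt v) = (dt v pv)^-1 *: v.
  move=> v0; have [_ e] := uP (pt v).
  have [k k0 kE] := (iffLR (pt_eqP (un0 _) v0)) e.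
  by rewrite /mu kE dtZl scalerA invfM mulrAC mulVf// mul1r.
have pp := dtvv_gt0 pv0.
pose m0 := (dt pv pv)^-1 *: pv.
have mup : mu p = m0 by rewrite pE muE.
have cpos : 0 < dt (cr m0 a) (cr m0 a).
  rewrite /m0 crZl dtZl dtZr !mulr_gt0 ?invr_gt0//; apply: dtvv_gt0.
  by apply: cr_neq0 => // e; apply: ap; rewrite pE.
have mu_cont v : v != 0 -> dt v pv != 0 -> {for pt v, continuous mu}.
  move=> v0 d0; apply: (continuous_from_pt v0).
  have cd : {for v, continuous (fun v => (dt v pv)^-1 *: v)}.
    have c1 := @dtl_continuous pv v.
    exact: (cvgZ (cvgV d0 c1) cvg_id).
  have nz : \forall w \near v, w != 0.
    by apply: open_nbhs_nbhs; split=> //; exact: open_neq0.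
  have e : mu (pt v) = (dt v pv)^-1 *: v by rewrite muE.
  suff : (mu \o @pt R) x @[x --> v] --> mu (pt v) by [].
  rewrite e; apply: cvg_trans cd.
  apply: (@near_eq_cvg _ _ (nbhs v)); move: nz; apply: filterS => w w0.
  by rewrite /= muE.
have [E nE Epos] : exists2 E : set V3, nbhs m0 E &
    forall v v', E v -> E v' -> 0 < dt (cr v a) (cr v' a).
  have cg : {for (m0, m0), continuous (fun x : V3 * V3 => dt (cr x.1 a) (cr x.2 a))}.
    rewrite (_ : (fun x => _) = fun x : V3 * V3 =>
        dt x.1 x.2 * dt a a - dt x.1 a * dt a x.2); last first.
      by apply/funext => x; rewrite dt_cr_cr.
    have c1 : {for (m0, m0), continuous (@fst V3 V3)} by exact: cvg_fst.
    have c2 : {for (m0, m0), continuous (@snd V3 V3)} by exact: cvg_snd.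
    have ca : {for (m0, m0), continuous (fun _ : V3 * V3 => a)} by exact: cvg_cst.
    exact: (cvgB (cvgM (dt_continuous c1 c2) (dt_continuous ca ca))
                 (cvgM (dt_continuous c1 ca) (dt_continuous ca c2))).
  have : \forall x \near (m0, m0), 0 < dt (cr x.1 a) (cr x.2 a).
    exact: (cvgr_gt _ cg).
  case=> -[E1 E2] /= [n1 n2] sub; exists (E1 `&` E2); first exact: filterI.
  by move=> v v' [v1 _] [_ v2]; exact: (sub (v, v')).
have nW : nbhs p (U `&` [set q | E (mu q)] `&` [set q | dt (u q) pv != 0]).
  apply: filterI; first apply: filterI.
  - exact: open_nbhs_nbhs.
  - have := mu_cont _ pv0 (lt0r_neq0 pp); rewrite -pE => h1.
    by apply: h1; rewrite mup.
  - rewrite pE; apply/nbhs_pt => //.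
    have c1 := @dtl_continuous pv pv.
    have h1 : \forall w \near pv, dt w pv > 0 by exact: (cvgr_gt _ c1).
    have nz : \forall w \near pv, w != 0.
      by apply: open_nbhs_nbhs; split=> //; exact: open_neq0.
    near=> w => /=.
    have w0 : w != 0 by near: w.
    have [k k0 kE] := (iffLR (pt_eqP (un0 _) w0)) (proj2 (uP (pt w))).
    by rewrite kE dtZl mulf_neq0// gt_eqF//; near: w.
move: nW; rewrite nbhsE => -[W [oW Wp] WU].
have WUU : W `<=` U by move=> q /WU[[]].
have oHW := hopen _ oW WUU.
have : nbhs ((0, 0) : R * R) (h @` W).
  by apply: open_nbhs_nbhs; split=> //; exists p.
move=> /nbhs_ballP[r0 /= r00 hr0].
pose r := r0 / 2; have r_gt0 : 0 < r by rewrite divr_gt0.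
have rr0 : r < r0 by rewrite /r; lra.
pose cl (Q : R * R) := (clamp_to (- r) r Q.1, clamp_to (- r) r Q.2).
have rr : - r < r by lra.
have cl_in Q : in_square r (cl Q).
  by rewrite /in_square /= !ler_norml !clamp_to_in// ltW.
have cl_id Q : in_square r Q -> cl Q = Q.
  by case: Q => x y; rewrite /in_square /= !ler_norml => /andP[x1 y1]; rewrite /cl /= !clamp_to_id.
have cl_cont : continuous cl.
  move=> Q; apply: (@continuous_pair _ _ _ (fun Q => clamp_to (- r) r Q.1)
    (fun Q => clamp_to (- r) r Q.2)).
    by apply: continuous_comp; [exact: cvg_fst|exact: clamp_to_continuous].
  by apply: continuous_comp; [exact: cvg_snd|exact: clamp_to_continuous].
have /boolp.choice[k kP] : forall Q, exists q, W q /\ h q = cl Q.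
  move=> Q; have [q Wq <-] : (h @` W) (cl Q).
    apply: hr0; have /andP[h1 h2] := cl_in Q.
    split; [change (`|0 - (cl Q).1| < r0)|change (`|0 - (cl Q).2| < r0)];
      by rewrite sub0r normrN; apply: le_lt_trans rr0.
  by exists q.
have kc : continuous k.
  move=> Q B /= nB; have [Wk hk] := kP Q.
  have : nbhs (k Q) (B `&` W).
    by apply: filterI => //; exact: open_nbhs_nbhs.
  rewrite nbhsE => -[G [oG Gk] GBW].
  have oh : open (h @` G).
    by apply: hopen => // q /GBW[_ /WUU].
  have nh : nbhs (cl Q) (h @` G).
    by apply: open_nbhs_nbhs; split=> //; exists (k Q).
  have nQ : nbhs Q (cl @^-1` (h @` G)) := cl_cont Q _ nh.
  suff sub : cl @^-1` (h @` G) `<=` k @^-1` B by exact: (filterS sub nQ).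
  move=> Q' /= [q Gq qE].
  have [Wk' hk'] := kP Q'.
  have -> : k Q' = q.
    apply: hinj; rewrite ?inE; [exact: WUU|by apply: WUU; case: (GBW _ Gq)|].
    by rewrite hk' qE.
  by case: (GBW _ Gq).
have Wd q : W q -> dt (u q) pv != 0 by move=> /WU[_].
have ptmu q : W q -> pt (mu q) = q.
  by move=> /Wd d; rewrite /mu ptZ ?invr_neq0// (proj2 (uP q)).
have hC q : U q -> {for q, continuous h}.
  move=> Uq; have := hc; rewrite continuous_open_subspace// => h1.
  by apply: h1; rewrite inE.
exists pv, r, (mu \o k), h, (W `&` h @^-1` [set Q | (`|Q.1| < r) && (`|Q.2| < r)]).
split; first by split.
- split.
  + move=> Q; have [Wk _] := kP Q.
    have ck : {for k Q, continuous mu}.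
      rewrite -[k Q](proj2 (uP (k Q))); apply: mu_cont => //; exact: Wd.
    exact: (continuous_comp (kc Q) ck).
  + by move=> Q; have [Wk _] := kP Q; rewrite /= /mu dtZl mulVf// Wd.
  + move=> Q Q'; have [/WU[[_ E1] _] _] := kP Q; have [/WU[[_ E2] _] _] := kP Q'.
    exact: Epos.
- move=> Q Qr; have [Wk hk] := kP Q; rewrite /= ptmu// hk cl_id//.
  have [c1 c2] := CD _ (WUU _ Wk).
  by split=> //; rewrite ?c1 ?c2 hk cl_id.
- split.
  + rewrite openE => q [Wq hq]; rewrite /interior.
    apply: filterI; first exact: open_nbhs_nbhs.
    have cq := hC _ (WUU _ Wq).
    apply: cq; case/andP: hq => h1 h2.
    have n1 : \forall Q \near h q, `|Q.1| < r.
      have c1 : {for h q, continuous (fun Q : R * R => `|Q.1|)}.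
        by apply: (@continuous_comp _ _ _ fst (fun x : R => `|x|)); [exact: cvg_fst|exact: norm_continuous].
      exact: (cvgr_lt _ c1).
    have n2 : \forall Q \near h q, `|Q.2| < r.
      have c2 : {for h q, continuous (fun Q : R * R => `|Q.2|)}.
        by apply: (@continuous_comp _ _ _ snd (fun x : R => `|x|)); [exact: cvg_snd|exact: norm_continuous].
      exact: (cvgr_lt _ c2).
    by near=> Q => /=; apply/andP; split; near: Q.
  + by split=> //=; rewrite hp /= normr0 r_gt0.
  + move=> q [Wq /andP[h1 h2]].
    have hr : in_square r (h q) by rewrite /in_square !ltW.
    split=> //; first exact: hC (WUU _ Wq).
    have [Wk hk] := kP (h q); rewrite /= ptmu//.
    by apply: hinj; rewrite ?inE; [exact: WUU|exact: WUU|rewrite hk cl_id].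
Unshelve. all: by end_near. Qed.

Lemma int_in_unit (n : int) : -1 < n%:~R :> R -> n%:~R < 1 :> R -> n = 0.
Proof. by rewrite -[-1]/((-1)%:~R) -[1]/(1%:~R) !ltr_int; lia. Qed.

Lemma int_in_two (n : int) : -1 < n%:~R :> R -> n%:~R < 2 :> R -> n = 0 \/ n = 1.
Proof. by rewrite -[-1]/((-1)%:~R) -[2]/(2%:~R) !ltr_int; lia. Qed.

(** Near [t0] the coordinate along the axis is continuous and injective, hence monotone with
    direction [s], and [t1], [t2] are the times at which it reaches [- (s * rho)] and [s * rho]. As
    the curve is simple, it does not return to this piece of the axis between [t2] and [t1 + 1]. *)
Lemma loop_window (C : set P2) al tau (N : set P2) (h1 : P2 -> R) (k : R -> P2)
    (t0 : R) : loop_of C al tau -> open N -> N (pt (al t0)) ->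
    h1 (pt (al t0)) = 0 ->
    (forall q, N q -> {for q, continuous h1}) ->
    (forall q, N q -> C q -> q = k (h1 q)) ->
  exists2 rho0 : R, 0 < rho0 & forall rho, 0 < rho <= rho0 ->
    exists (t1 t2 s : R) (xi : R -> R),
    [/\ [/\ t1 < t0, t0 < t2, t2 < t1 + 1 & s = 1 \/ s = -1],
        [/\ continuous xi, forall t, `|xi t| <= rho,
            forall t, t <= t1 -> xi t = - (s * rho) &
            forall t, t2 <= t -> xi t = s * rho],
        forall t, t1 <= t <= t2 -> pt (al t) = k (xi t) &
        forall t x, t2 <= t <= t1 + 1 -> `|x| <= rho -> pt (al t) = k x ->
          (t = t2 /\ x = s * rho) \/ (t = t1 + 1 /\ x = - (s * rho))].
Proof.
move=> lp oN Np h10 hc hk.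
pose g t := h1 (pt (al t)).
have cpt t : {for t, continuous (fun t => pt (al t))}.
  apply: (@continuous_comp _ _ _ al (@pt R)); first exact: (loop_cont lp).
  by apply: pt_continuous; exact: (loop_neq0 lp).
have : nbhs t0 [set t | N (pt (al t))].
  by apply: (cpt t0); exact: open_nbhs_nbhs.
move=> /nbhs_ballP[e0 /= e00 he0].
pose e := Num.min (e0 / 2) (1 / 4).
have e_gt0 : 0 < e by rewrite lt_min divr_gt0//; lra.
have ele : e <= 1 / 4 by rewrite ge_min lexx orbT.
have ee0 : e < e0 by rewrite gt_min; apply/orP; left; lra.
have inN t : t0 - e <= t <= t0 + e -> N (pt (al t)).
  move=> /andP[h1' h2]; apply: he0; change (`|t0 - t| < e0).
  by rewrite ltr_norml; apply/andP; split; lra.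
have cg t : t0 - e <= t <= t0 + e -> {for t, continuous g}.
  move=> /inN Nt; exact: (continuous_comp (cpt t) (hc _ Nt)).
have gk t : t0 - e <= t <= t0 + e -> pt (al t) = k (g t).
  by move=> /inN Nt; apply: hk => //; apply/(loop_im lp); exists t.
have cgw : {within `[t0 - e, t0 + e], continuous g}.
  by apply: continuous_in_subspaceT => t; rewrite inE /= in_itv /=; exact: cg.
have ginj : {in `[t0 - e, t0 + e] &, injective g}.
  move=> x y; rewrite !in_itv /= => xI yI gxy.
  have [|n nE] := @loop_inj _ _ _ _ lp x y; first by rewrite gk// gk// gxy.
  move/andP: xI => [x1 x2]; move/andP: yI => [y1 y2].
  have n1 : n%:~R < 1 :> R by lra.
  have n2 : -1 < n%:~R :> R by lra.
  have n0 := int_in_unit n2 n1.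
  by rewrite nE n0 addr0.
have [s s1 smono] : exists2 s : R, s = 1 \/ s = -1 & forall x y,
    t0 - e <= x <= t0 + e -> t0 - e <= y <= t0 + e -> (s * g x <= s * g y) = (x <= y).
  have [/le_mono_in gm|/le_nmono_in gm] := itv_continuous_inj_mono cgw ginj.
    exists 1; first by left.
    by move=> x y xI yI; rewrite !mul1r; apply: gm; rewrite in_itv.
  exists (-1); first by right.
  by move=> x y xI yI; rewrite !mulN1r lerN2; apply: gm; rewrite in_itv.
have ss : s * s = 1 by case: s1 => ->; rewrite ?mulrNN mulr1.
have I1 : t0 - e <= t0 - e <= t0 + e by apply/andP; split; lra.
have I2 : t0 - e <= t0 + e <= t0 + e by apply/andP; split; lra.
have I0 : t0 - e <= t0 <= t0 + e by apply/andP; split; lra.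
have smonoT x y : t0 - e <= x <= t0 + e -> t0 - e <= y <= t0 + e ->
    (s * g x < s * g y) = (x < y).
  by move=> xI yI; rewrite !ltNge smono.
have g1 : s * g (t0 - e) < 0.
  by rewrite -[ltRHS](mulr0 s) -h10 smonoT// ltrBlDl ltrDr.
have g2 : 0 < s * g (t0 + e).
  by rewrite -[ltLHS](mulr0 s) -h10 smonoT// ltrDl.
exists (Num.min (- (s * g (t0 - e))) (s * g (t0 + e))).
  by rewrite lt_min oppr_gt0 g1.
move=> rho; rewrite le_min => /and3P[rho0 r1 r2].
have csg a b : t0 - e <= a -> b <= t0 + e -> {within `[a, b], continuous (fun t => s * g t)}.
  move=> h1' h2; apply: continuous_in_subspaceT => t.
  rewrite inE /= in_itv /= => /andP[t1 t2].
  have ct : {for t, continuous g} by apply: cg; apply/andP; split; lra.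
  exact: (cvgM (cvg_cst s) ct).
have ivt a b v : t0 - e <= a -> b <= t0 + e -> a <= b -> s * g a <= v <= s * g b ->
    exists2 t, a <= t <= b & s * g t = v.
  move=> h1' h2 ab /andP[v1 v2].
  have [|c] := @IVT R (fun t => s * g t) a b v ab (csg _ _ h1' h2).
    by rewrite ge_min v1 le_max v2 orbT.
  by rewrite in_itv /= => ? ?; exists c.
have [t1 t1I g1E] : exists2 t, t0 - e <= t <= t0 & s * g t = - rho.
  apply: ivt => //; try lra.
  by apply/andP; split; [lra|rewrite /g h10 mulr0; lra].
have [t2 t2I g2E] : exists2 t, t0 <= t <= t0 + e & s * g t = rho.
  apply: ivt => //; try lra.
  by apply/andP; split; [rewrite /g h10 mulr0; lra|lra].
move/andP: t1I => [t11 t12]; move/andP: t2I => [t21 t22].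
have J1 : t0 - e <= t1 <= t0 + e by apply/andP; split; lra.
have J2 : t0 - e <= t2 <= t0 + e by apply/andP; split; lra.
have lt1 : t1 < t0 by rewrite -smonoT// g1E [s * g t0](_ : _ = 0) ?oppr_lt0// /g h10 mulr0.
have lt2 : t0 < t2 by rewrite -smonoT// g2E [s * g t0](_ : _ = 0) // /g h10 mulr0.
have t12' : t1 < t2 by lra.
have sgE t : g t = s * (s * g t) by rewrite mulrA ss mul1r.
have J t : t1 <= t <= t2 -> t0 - e <= t <= t0 + e.
  by move=> /andP[? ?]; apply/andP; split; lra.
pose xi t := g (clamp_to t1 t2 t).
exists t1, t2, s, xi; split.
- by split=> //; lra.
- split.
  + move=> t; apply: (@continuous_comp _ _ _ (clamp_to t1 t2) g).
      exact: clamp_to_continuous.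
    by apply: cg; apply: J; rewrite clamp_to_in// ltW.
  + move=> t; have ct := clamp_to_in t (ltW t12').
    have := ct => /andP[c1 c2].
    have e1 : `|xi t| = `|s * xi t|.
      by rewrite normrM; case: s1 => ->; rewrite ?normrN normr1 mul1r.
    rewrite e1 ler_norml -g1E -g2E !smono ?c1 ?c2//; exact: J.
  + by move=> t tt1; rewrite /xi clamp_to_le// sgE g1E mulrN.
  + by move=> t tt1; rewrite /xi clamp_to_ge// sgE g2E.
- by move=> t tI; rewrite /xi clamp_to_id// gk//; exact: J.
- move=> t x /andP[tt2 tt1] xr ptk.
  have [t' t'I gt'] : exists2 t', t1 <= t' <= t2 & s * g t' = s * x.
    apply: ivt; try lra.
    rewrite g1E g2E -ler_norml normrM.
    by case: s1 => ->; rewrite ?normrN normr1 mul1r.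
  have {}gt' : g t' = x by rewrite sgE gt' mulrA ss mul1r.
  have [|n nE] := @loop_inj _ _ _ _ lp t t'; first by rewrite ptk -gt' -gk//; exact: J.
  move/andP: t'I => [t'1 t'2].
  have n1 : n%:~R < 2 :> R by lra.
  have n2 : -1 < n%:~R :> R by lra.
  case: (int_in_two n2 n1) => n0; move: nE; rewrite n0 ?addr0 => tE; [left|right].
  + have te : t' = t2 by lra.
    by rewrite -gt' tE te sgE g2E.
  + have te : t' = t1 by lra.
    by rewrite -gt' tE te sgE g1E mulrN.
Qed.

End Crossing.

(** * The monodromy flips at a crossing *)

Section Flip.
Variable R : realType.
Local Notation V3 := 'rV[R]_3.
Local Notation P2 := (projective_plane R).

(** The two equations compare the root branches of both sides at [t2] and at [t1 + 1]. All signs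
    appear twice and cancel, and the two factors ['i] leave [-1]. *)
Lemma flip_algebra (e e' f cp cm th n1 n2 r1 r2 : R[i]) :
    e = 1 \/ e = -1 -> e' = 1 \/ e' = -1 -> f = 1 \/ f = -1 ->
    th != 0 -> r1 != 0 -> r2 != 0 -> n1 != 0 ->
    e' * ('i * th * r2 * n1) = f * (e * (th * r2 * n2)) ->
    cm * (e' * ('i * th * r1 * n2)) = f * (cp * (e * (th * r1 * n1))) ->
  cp = - cm.
Proof.
move=> he he' hf th0 r10 r20 n10 E1 E2.
have e2 : e * e = 1 by case: he => ->; rewrite ?mulrNN mulr1.
have e2' : e' * e' = 1 by case: he' => ->; rewrite ?mulrNN mulr1.
have f2 : f * f = 1 by case: hf => ->; rewrite ?mulrNN mulr1.
have i2 : 'i * 'i = -1 :> R[i] by rewrite -expr2 sqr_i.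
have E1' : e' * 'i * n1 = f * e * n2.
  apply: (mulIf r20); apply: (mulIf th0).
  rewrite (_ : _ * th = e' * ('i * th * r2 * n1)); last by ring.
  by rewrite E1; ring.
have E2' : cm * e' * 'i * n2 = f * cp * e * n1.
  apply: (mulIf r10); apply: (mulIf th0).
  rewrite (_ : _ * th = cm * (e' * ('i * th * r1 * n2))); last by ring.
  by rewrite E2; ring.
apply: (mulIf n10).
have -> : cp * n1 = (e * e) * (f * f) * cp * n1 by rewrite e2 f2 !mul1r.
have -> : e * e * (f * f) * cp * n1 = (f * e) * (f * cp * e * n1) by ring.
rewrite -E2'.
have -> : f * e * (cm * e' * 'i * n2) = cm * e' * 'i * (f * e * n2) by ring.
rewrite -E1'.
have -> : cm * e' * 'i * (e' * 'i * n1) = cm * (e' * e') * ('i * 'i) * n1 by ring.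
by rewrite e2' i2 mulr1 mulrN1.
Qed.

(** * Deforming the views from the two sides of a crossing *)

Section Core.
Variables (C : set P2) (al : R -> V3) (tau : R) (m : R * R -> V3) (pv : V3).
Variables (r rho e t1 t2 s : R) (xi : R -> R).
Hypothesis lp : loop_of C al tau.
Hypothesis mc : continuous m.
Hypothesis mpv : forall Q, dt (m Q) pv = 1.
Hypothesis mpos : forall Q Q', 0 < dt (cr (m Q) (al 0)) (cr (m Q') (al 0)).
Hypothesis minj : forall Q Q', in_square r Q -> in_square r Q' ->
  pt (m Q) = pt (m Q') -> Q = Q'.
Hypothesis mC : forall Q, in_square r Q -> C (pt (m Q)) -> Q.2 = 0.
Hypothesis rho0 : 0 < rho.
Hypothesis rhor : rho <= r.
Hypothesis e0 : 0 < e.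
Hypothesis er : e <= r.
Hypothesis t12 : t1 < t2.
Hypothesis t21 : t2 < t1 + 1.
Hypothesis s1 : s = 1 \/ s = -1.
Hypothesis xic : continuous xi.
Hypothesis xir : forall t, `|xi t| <= rho.
Hypothesis xi1 : forall t, t <= t1 -> xi t = - (s * rho).
Hypothesis xi2 : forall t, t2 <= t -> xi t = s * rho.
Hypothesis inner : forall t, t1 <= t <= t2 -> pt (al t) = pt (m (xi t, 0)).
Hypothesis outer : forall t x, t2 <= t <= t1 + 1 -> `|x| <= rho ->
  pt (al t) = pt (m (x, 0)) ->
  (t = t2 /\ x = s * rho) \/ (t = t1 + 1 /\ x = - (s * rho)).

(** For [sg] equal to [1] or [-1] the family [w sg] begins with the loop seen from [m (0, sg * e)].
    Then the piece of the loop at the crossing is bent by [bump] away from the viewpoint, and the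
    viewpoint moves to the opposite point of the square. At the end the two families agree outside
    the window, and inside it they exchange viewpoint and curve point. *)
Let bump t := rho - `|xi t|.
(** On the window this is [xi]; over the rest of the period it runs back linearly from [s * rho] to
    [- (s * rho)], so that the moving viewpoint closes up. *)
Let chi t := xi t - 2 * (s * rho) * clamp ((t - t2) / (t1 + 1 - t2)).
Let P (sg : R) (x : R * R) : V3 := al x.2 +
  dt (al x.2) pv *: (m (xi x.2, - (sg * x.1 * bump x.2)) - m (xi x.2, 0)).
Let Z (sg : R) (x : R * R) : V3 :=
  m (- (x.1 * chi x.2), sg * ((1 - x.1) * e + x.1 * bump x.2)).
Let Y (sg : R) (x : R * R) : V3 := m (0, sg * (1 - x.1) * e).
Let w sg x := view (al 0) (Y sg x) (Z sg x) (P sg x).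

Let m_neq0 Q : m Q != 0.
Proof.
apply/eqP => h; have := mpv Q.
by rewrite h /dt /cx /cy /cz !mxE !mul0r !addr0 => /esym/eqP; rewrite oner_eq0.
Qed.

Let sabs : `|s| = 1. Proof. by case: s1 => ->; rewrite ?normrN normr1. Qed.

Let bump_ge0 t : 0 <= bump t. Proof. by rewrite subr_ge0. Qed.
Let bump_le t : bump t <= rho. Proof. by rewrite /bump gerBl. Qed.

Let chi_le t : t2 <= t -> `|chi t| <= rho.
Proof.
move=> tt; rewrite /chi xi2//.
have -> : s * rho - 2 * (s * rho) * clamp ((t - t2) / (t1 + 1 - t2)) =
  s * (rho * (1 - 2 * clamp ((t - t2) / (t1 + 1 - t2)))) by ring.
rewrite normrM sabs mul1r normrM (gtr0_norm rho0) ler_piMr ?(ltW rho0)//.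
have := clamp_in ((t - t2) / (t1 + 1 - t2)).
by move: (clamp _) => c /andP[c0 c1]; rewrite ler_norml; apply/andP; split; lra.
Qed.

Let chi_in t : t <= t2 -> chi t = xi t.
Proof.
move=> tt; have d0 : 0 < t1 + 1 - t2 by rewrite subr_gt0.
have le0 : (t - t2) / (t1 + 1 - t2) <= 0.
  by rewrite ler_pdivrMr// mul0r subr_le0.
rewrite /chi /clamp min_r ?(le_trans le0)// max_l//.
by rewrite mulr0 subr0.
Qed.

Let chi_end : chi (t1 + 1) = - (s * rho).
Proof.
have d0 : 0 < t1 + 1 - t2 by rewrite subr_gt0.
rewrite /chi divff ?gt_eqF// clamp_id ?lexx ?ler01// xi2 ?(ltW t21)//.
by rewrite mulr1; ring.
Qed.

Let chi_le' t : `|chi t| <= rho.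
Proof.
have [tt|/ltW tt] := leP t2 t; first exact: chi_le.
by rewrite chi_in.
Qed.

Let al_inner t : t1 <= t <= t2 ->
  dt (al t) pv != 0 /\ al t = dt (al t) pv *: m (xi t, 0).
Proof.
move=> ti; have [k k0 kE] := (iffLR (pt_eqP (loop_neq0 lp t) (m_neq0 _))) (inner ti).
have -> : dt (al t) pv = k by rewrite kE dtZl mpv mulr1.
by [].
Qed.

Let P_inner sg l t : t1 <= t <= t2 ->
  P sg (l, t) = dt (al t) pv *: m (xi t, - (sg * l * bump t)).
Proof.
move=> ti; rewrite /P /= {1}(proj2 (al_inner ti)) -scalerDr.
by rewrite addrC subrK.
Qed.

Let bump0 t : t <= t1 \/ t2 <= t -> bump t = 0.
Proof.
by case=> h; rewrite /bump ?(xi1 h) ?(xi2 h) ?normrN normrM sabs mul1r gtr0_norm// subrr.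
Qed.

Let P_outer sg l t : t <= t1 \/ t2 <= t -> P sg (l, t) = al t.
Proof. by move=> h; rewrite /P /= bump0// mulr0 oppr0 subrr scaler0 addr0. Qed.

Let sq_Z sg l t : `|sg| = 1 -> 0 <= l <= 1 ->
  in_square r (- (l * chi t), sg * ((1 - l) * e + l * bump t)).
Proof.
move=> sg1 /andP[l0 l1]; rewrite /in_square /= normrN !normrM sg1 mul1r.
rewrite (ger0_norm l0); apply/andP; split.
  by apply: le_trans rhor; apply: le_trans (chi_le' t); rewrite ler_piMl.
have h1 : 0 <= (1 - l) * e by rewrite mulr_ge0 ?subr_ge0// ltW.
have h2 : 0 <= l * bump t by rewrite mulr_ge0.
rewrite ger0_norm ?addr_ge0//.
have h3 : (1 - l) * e <= (1 - l) * r by rewrite ler_wpM2l ?subr_ge0.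
have h4 : l * bump t <= l * r by rewrite ler_wpM2l// (le_trans (bump_le t)).
by apply: (le_trans (lerD h3 h4)); rewrite -mulrDl subrK mul1r.
Qed.

Let sq_P sg l t : `|sg| = 1 -> 0 <= l <= 1 ->
  in_square r (xi t, - (sg * l * bump t)).
Proof.
move=> sg1 /andP[l0 l1]; rewrite /in_square /= normrN !normrM sg1 mul1r.
rewrite (ger0_norm l0) (ger0_norm (bump_ge0 t)) (le_trans (xir t) rhor)/=.
apply: le_trans rhor; apply: le_trans (bump_le t); exact: ler_piMl.
Qed.

Let w_neq0 sg l t : `|sg| = 1 -> 0 <= l <= 1 -> t1 <= t <= t1 + 1 ->
  w sg (l, t) != 0.
Proof.
move=> sg1 l01 /andP[tt1 tt2]; have /andP[l0 l1] := l01.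
have sg0 : sg != 0 by rewrite -normr_eq0 sg1 oner_eq0.
apply: view_neq0; first exact: mpos.
have [tt|tt] := leP t t2.
- have ti : t1 <= t <= t2 by rewrite tt1.
  have [k0 _] := al_inner ti.
  rewrite P_inner// crZr scaler_eq0 negb_or k0 /=.
  apply: cr_neq0; rewrite ?m_neq0// /Z /=.
  move=> /(minj (sq_Z t sg1 l01) (sq_P t sg1 l01)) [E1 E2].
  have x0 : xi t = 0.
    have : (1 + l) * xi t = 0 by move: E1; rewrite chi_in// => E1; rewrite mulrDl mul1r; lra.
    by move=> /eqP; rewrite mulf_eq0 => /orP[/eqP|/eqP//]; lra.
  move: E2; rewrite -mulrA -mulrN => /(mulfI sg0).
  rewrite /bump x0 normr0 subr0 => E2.
  have h1 : 0 <= (1 - l) * e by rewrite mulr_ge0 ?subr_ge0// ltW.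
  have h2 : 0 <= l * rho by rewrite mulr_ge0// ltW.
  have h3 : l * rho = 0 by lra.
  have l00 : l = 0 by move/eqP: h3; rewrite mulf_eq0 (gt_eqF rho0) orbF => /eqP.
  by move: E2; rewrite l00 subr0 !mul0r addr0 oppr0 mul1r => h4; move: e0; rewrite h4 ltxx.
- have to : t <= t1 \/ t2 <= t by right; exact: ltW.
  rewrite P_outer//; apply: cr_neq0; rewrite ?m_neq0 ?(loop_neq0 lp)//.
  rewrite /Z /= => ptE.
  have /= := mC (sq_Z t sg1 l01) _; rewrite ptE => /(_ (loop_pt lp t)).
  rewrite bump0// mulr0 addr0 => /eqP.
  rewrite !mulf_eq0 (negbTE sg0) (gt_eqF e0) orbF /= subr_eq0 => /eqP l1E.
  move: ptE; rewrite -l1E subrr mul0r add0r !mul1r bump0// mulr0 => /esym ptE.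
  have tb : t2 <= t <= t1 + 1 by rewrite (ltW tt).
  have xr : `|- chi t| <= rho by rewrite normrN chi_le'.
  (* Only the end [t1 + 1] is left as a possible collision, and there the curve is at [- (s * rho)]
     but the viewpoint at [s * rho]. *)
  case: (outer tb xr ptE) => -[tE xE].
  + by move: tt; rewrite tE ltxx.
  + move: xE; rewrite tE chi_end opprK => h.
    have : s * rho = 0 by lra.
    by move=> /eqP; rewrite mulf_eq0 (gt_eqF rho0) orbF -normr_eq0 sabs oner_eq0.
Qed.

Let cont_m (f g : R * R -> R) : continuous f -> continuous g ->
  continuous (fun x => m (f x, g x)).
Proof.
move=> cf cg x; apply: (@continuous_comp _ _ _ (fun x => (f x, g x)) m); last exact: mc.
exact: (continuous_pair (cf x) (cg x)).
Qed.

Let c1 : continuous (@fst R R). Proof. by move=> x; exact: cvg_fst. Qed.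
Let c2 : continuous (@snd R R). Proof. by move=> x; exact: cvg_snd. Qed.
Let cc (k : R) : continuous (fun _ : R * R => k). Proof. by move=> x; exact: cvg_cst. Qed.
Let cadd (f g : R * R -> R) : continuous f -> continuous g -> continuous (fun x => f x + g x).
Proof. by move=> cf cg x; exact: (cvgD (cf x) (cg x)). Qed.
Let cmul (f g : R * R -> R) : continuous f -> continuous g -> continuous (fun x => f x * g x).
Proof. by move=> cf cg x; exact: (cvgM (cf x) (cg x)). Qed.
Let copp (f : R * R -> R) : continuous f -> continuous (fun x => - f x).
Proof. by move=> cf x; exact: (cvgN (cf x)). Qed.
Let csnd (f : R -> R) : continuous f -> continuous (fun x : R * R => f x.2).
Proof. by move=> cf x; apply: (@continuous_comp _ _ _ snd f); [exact: c2|exact: cf]. Qed.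

Let cxi : continuous (fun x : R * R => xi x.2). Proof. exact: csnd. Qed.
Let cbump : continuous (fun x : R * R => bump x.2).
Proof.
apply: csnd => t; apply: cvgB; first exact: cvg_cst.
by apply: (@continuous_comp _ _ _ xi (fun x : R => `|x|)); [exact: xic|exact: norm_continuous].
Qed.
Let cchi : continuous (fun x : R * R => chi x.2).
Proof.
apply: csnd => t; apply: cvgB; first exact: xic.
apply: cvgM; first exact: cvg_cst.
apply: (@continuous_comp _ _ _ (fun t => (t - t2) / (t1 + 1 - t2)) (@clamp R));
  last exact: clamp_continuous.
by apply: cvgM; [apply: cvgB; [exact: cvg_id|exact: cvg_cst]|exact: cvg_cst].
Qed.

Let cw sg : continuous (Re \o w sg) /\ continuous (Im \o w sg).
Proof.
have cY : continuous (Y sg).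
  by apply: cont_m; [exact: cc|apply: cmul; [apply: cmul; [exact: cc|apply: cadd;
    [exact: cc|exact: copp]]|exact: cc]].
have cZ : continuous (Z sg).
  apply: cont_m; first by apply: copp; apply: cmul.
  apply: cmul; first exact: cc.
  apply: cadd; apply: cmul => //; first by apply: cadd; [exact: cc|exact: copp].
have cal : continuous (fun x : R * R => al x.2).
  by move=> x; apply: (@continuous_comp _ _ _ snd al); [exact: c2|exact: (loop_cont lp)].
have cP : continuous (P sg).
  have h1 : continuous (fun x : R * R => m (xi x.2, - (sg * x.1 * bump x.2))).
    by apply: cont_m => //; apply: copp; apply: cmul => //; apply: cmul => //; exact: cc.
  have h2 : continuous (fun x : R * R => m (xi x.2, 0)).
    by apply: cont_m => //; exact: cc.
  move=> x; apply: cvgD; first exact: cal.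
  apply: cvgZ; last exact: (cvgB (h1 x) (h2 x)).
  have cpv : {for x, continuous (fun _ : R * R => pv)} by exact: cst_continuous.
  exact: (dt_continuous (cal x) cpv).
split=> x.
- exact: (proj1 (view_continuous _ (cY x) (cZ x) (cP x))).
- exact: (proj2 (view_continuous _ (cY x) (cZ x) (cP x))).
Qed.

Let w_per sg l : `|sg| = 1 -> 0 <= l <= 1 ->
  w sg (l, t1 + 1) = tau%:C * w sg (l, t1).
Proof.
move=> sg1 l01; rewrite /w !P_outer; [|by left|by right; exact: ltW].
have EZ : Z sg (l, t1 + 1) = Z sg (l, t1).
  rewrite /Z /= chi_end chi_in ?(ltW t12)// xi1// !bump0//; first by left.
  by right; exact: ltW.
by rewrite EZ (loop_per lp t1) viewZr.
Qed.

Let end_mono sg : `|sg| = 1 -> exists c, mono (sight al (m (0, sg * e))) c /\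
  mono_on t1 (fun t => w sg (1, t)) c.
Proof.
move=> sg1; have [cr ci] := cw sg.
have [c hc] := mono_on_homotopy cr ci
  (fun l t l01 tI => w_neq0 sg1 l01 tI) (fun l l01 => w_per sg1 l01).
exists c; split; last by apply: hc; rewrite lexx ler01.
have sq : in_square r (0, sg * e).
  rewrite /in_square /= normr0 normrM sg1 mul1r (gtr0_norm e0) er.
  by rewrite (le_trans (ltW e0) er).
have [] := @mono_sight_exists R C al tau lp (m (0, sg * e)) (m_neq0 _).
  move=> /(mC sq) /= /eqP; rewrite mulf_eq0 (gt_eqF e0) orbF -normr_eq0 sg1.
  by rewrite oner_eq0.
move=> c' _ hm; have := mono_mono_on t1 hm.
have := hc 0; rewrite lexx ler01 => /(_ isT) h0 h1.
suff -> : c = c' by [].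
apply: (mono_on_unique h0); apply: mono_on_ext h1 => t _.
rewrite /sight /w /Y /Z /P /= !mul0r subr0 !mulr1 mul1r !mulr0 mul0r oppr0 subrr.
by rewrite scaler0 !addr0.
Qed.

Let be (x : R) := rho - `|x|.
(** One function describes both final families on the window: up to the factor [dt (al t) pv] they
    are [Psi (xi t)] and [- Psi (- xi t)], the minus sign coming from the exchange of viewpoint and
    curve point. *)
Let Psi (x : R) := view (al 0) (m (0, 0)) (m (- x, be x)) (m (x, - be x)).

Let sq_be x y : `|x| <= rho -> `|y| = be x -> in_square r (x, y).
Proof.
move=> xr yE; rewrite /in_square /= yE (le_trans xr rhor)/=.
by rewrite (le_trans _ rhor)// gerBl.
Qed.

Let Psi_neq0 x : `|x| <= rho -> Psi x != 0.
Proof.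
move=> xr; have b0 : 0 <= be x by rewrite subr_ge0.
apply: view_neq0; first exact: mpos.
have q1 : in_square r (- x, be x).
  by apply: sq_be; rewrite ?normrN// ger0_norm// /be normrN.
have q2 : in_square r (x, - be x).
  by apply: sq_be; rewrite // normrN ger0_norm.
apply: (cr_neq0 (m_neq0 _) (m_neq0 _)) => /(minj q1 q2) [h1 h2].
 have x0 : x = 0 by lra.
by move: h2; rewrite /be x0 normr0 subr0 => h; move: rho0; rewrite lt_neqAle; lra.
Qed.

Let branch_Psi : exists n : R -> R[i],
  (forall x, `|x| <= rho -> n x ^+ 2 = Psi x) /\
  exists2 d : R, 0 < d & forall x y, `|x - y| < d -> 0 < cdot (n x) (n y).
Proof.
pose cl := clamp_to (- rho) rho.
have rr : - rho < rho by have := rho0; lra.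
pose W (x : R * R) := Psi (cl x.2).
have ccl : continuous (fun x : R * R => cl x.2) by apply: csnd; exact: clamp_to_continuous.
have cbe : continuous (fun x : R * R => be (cl x.2)).
  move=> x; apply: cvgB; first exact: cvg_cst.
  by apply: (@continuous_comp _ _ _ (fun x : R * R => cl x.2) (fun x : R => `|x|)); [exact: ccl|exact: norm_continuous].
have k0 : continuous (fun x : R * R => m (0, 0)) by apply: cont_m; exact: cc.
have k1 : continuous (fun x : R * R => m (- cl x.2, be (cl x.2))).
  by apply: cont_m => //; exact: copp.
have k2 : continuous (fun x : R * R => m (cl x.2, - be (cl x.2))).
  by apply: cont_m => //; exact: copp.
have cl_in x : `|cl x| <= rho by rewrite ler_norml clamp_to_in// ltW.
have cl_id x : `|x| <= rho -> cl x = x by move=> xr; rewrite /cl clamp_to_id// -ler_norml.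
have [d d0 hd] := @uniform_cdot_box R W (- rho) rho
  (fun x => proj1 (view_continuous _ (k0 x) (k1 x) (k2 x)))
  (fun x => proj2 (view_continuous _ (k0 x) (k1 x) (k2 x)))
  (fun l t _ _ => Psi_neq0 (cl_in t)).
have lip x y : `|cl x - cl y| <= `|x - y|.
  rewrite /cl /clamp_to opprD addrACA subrr add0r -mulrBr normrM.
  have p2 : 0 < rho - - rho by rewrite subr_gt0.
  rewrite (gtr0_norm p2) -ler_pdivlMl//.
  apply: (le_trans (clamp_lip _ _)); rewrite -mulrBl normrM normfV (gtr0_norm p2).
  by rewrite mulrC opprB addrA subrK.
have [|n [nE nd]] := @branch_exists R d (fun x => W (clamp x.1, cl x.2)) d0.
  move=> x y /andP[xy1 xy2]; apply: hd.
  - by rewrite /in_box clamp_in -ler_norml cl_in.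
  - by rewrite /in_box clamp_in -ler_norml cl_in.
  - by rewrite /close /= (le_lt_trans (clamp_lip _ _) xy1) (le_lt_trans (lip _ _) xy2).
exists (fun x => n (0, x)); split=> [x xr|].
  by rewrite nE /W /= !cl_id.
exists (d / 2); first by rewrite divr_gt0.
by move=> x y xy; apply: nd; rewrite /close /= subrr normr0 xy divr_gt0.
Qed.

(** A single branch of the root of [Psi] provides branches for both sides on the window, and outside
    it the two loops are equal. Following the two branches round one period and comparing them at
    both ends of the window gives opposite monodromies. *)
Lemma core_flip : exists c, mono (sight al (m (0, e))) c /\
  mono (sight al (m (0, - e))) (- c).
Proof.
have [cp [mp ep]] := end_mono (normr1 R).
have [cm [mm em]] := end_mono (etrans (normrN 1) (normr1 R)).
rewrite mul1r in mp; rewrite mulN1r in mm.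
suff cpE : cp = - cm by exists cp; split=> //; rewrite cpE opprK.
case: ep => sp [spE spd spc]; case: em => sm [smE smd smc].
have [n [nE [d d0 nd]]] := branch_Psi.
pose ka t := dt (al t) pv.
have cka : continuous ka.
  move=> t; have cpv : {for t, continuous (fun _ : R => pv)} by exact: cst_continuous.
  have cal : {for t, continuous al} by exact: (loop_cont lp).
  exact: (dt_continuous cal cpv).
have ka0 t : t1 <= t <= t2 -> ka t != 0 by move=> /al_inner[].
(* [th] is a square root of the constant sign of [ka] on the window *)
have [th th0 thE] : exists2 th : R[i], th != 0 &
    forall t, t1 <= t <= t2 -> (ka t)%:C = th ^+ 2 * (Num.sqrt `|ka t|)%:C ^+ 2.
  have sgc : forall x y, t1 <= x <= t2 -> t1 <= y <= t2 -> (0 < ka x) = (0 < ka y).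
    apply: locally_const => z zI; have zk := ka0 _ zI.
    have az : 0 < `|ka z| by rewrite normr_gt0.
    have /cvgrPdist_lt/(_ _ az)/nbhs_ballP[d' /= d'0 hd'] := cka z.
    exists d' => // x xI zx; have := hd' x zx => /= {}hd'.
    have xk := ka0 _ xI.
    case: (ltgtP 0 (ka z)) zk hd' => //= [k0 _|k0 _].
      by rewrite (gtr0_norm k0) ltr_norml => /andP[h1 h2]; apply/idP; lra.
    by rewrite (ltr0_norm k0) ltr_norml => /andP[h1 h2]; apply/negbTE; rewrite -leNgt; lra.
  have t1I : t1 <= t1 <= t2 by rewrite lexx ltW.
  have sqE t : (Num.sqrt `|ka t|)%:C ^+ 2 = `|ka t|%:C.
    by rewrite -rmorphXn /= sqr_sqrtr.
  have [k0|k0] := boolP (0 < ka t1).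
    exists 1; first exact: oner_neq0.
    by move=> t tI; rewrite expr1n mul1r sqE gtr0_norm// -(sgc t1).
  exists 'i; first by rewrite eq_complex /= oner_eq0 andbF.
  move=> t tI; rewrite sqr_i mulN1r sqE.
  have : ka t <= 0 by rewrite leNgt -(sgc t1).
  by move=> /ler0_norm ->; rewrite rmorphN opprK.
pose rt t := Num.sqrt `|ka t|.
have rt_gt0 t : t1 <= t <= t2 -> 0 < rt t by move=> /ka0 h; rewrite sqrtr_gt0 normr_gt0.
have rt0 t : t1 <= t <= t2 -> (rt t)%:C != 0 :> R[i].
  by move=> /rt_gt0 h; rewrite eq_complex /= eqxx andbT gt_eqF.
have n0 x : n x != 0 by apply: (@cdot_neq0 _ _ (n x)); apply: nd; rewrite subrr normr0.
have xiu : exists2 d' : R, 0 < d' & forall x y, t1 <= x <= t2 -> t1 <= y <= t2 ->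
    `|x - y| < d' -> `|xi x - xi y| < d.
  apply: lebesgue_itv => z _.
  have d2 : 0 < d / 2 by rewrite divr_gt0.
  have /cvgrPdist_lt/(_ _ d2)/nbhs_ballP[d' /= d'0 hd'] := @xic z.
  exists d' => // x y _ _ zx zy.
  have h1 := hd' x zx; have h2 := hd' y zy.
  rewrite (splitr d) -(subrKA (xi z)) (le_lt_trans (ler_normD _ _))// ltrD//.
  by rewrite distrC.
case: xiu => d' d'0 xid.
pose np t := th * (rt t)%:C * n (xi t).
(* The factor ['i] is the root of the minus sign in front of [Psi (- xi t)]. *)
pose nm t := 'i * th * (rt t)%:C * n (- xi t).
have i0 : 'i != 0 :> R[i] by rewrite eq_complex /= oner_eq0 andbF.
have scal (u z z' : R[i]) (a b : R) : u != 0 -> 0 < a -> 0 < b ->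
    0 < cdot z z' -> 0 < cdot (u * a%:C * z) (u * b%:C * z').
  move=> u0 a0 b0 zz; rewrite -!mulrA cdotMl mulr_gt0 ?norm2_gt0//.
  have -> : cdot (a%:C * z) (b%:C * z') = a * b * cdot z z'.
    by case: z z' {zz} => p q [p' q']; rewrite /cdot /=; ring.
  by rewrite !mulr_gt0.
have npd : exists2 d : R, 0 < d & forall t t', t1 <= t <= t2 -> t1 <= t' <= t2 ->
    `|t - t'| < d -> 0 < cdot (np t) (np t').
  exists d' => // t t' tI t'I tt'; apply: scal; rewrite ?rt_gt0//.
  by apply: nd; exact: xid.
have nmd : exists2 d : R, 0 < d & forall t t', t1 <= t <= t2 -> t1 <= t' <= t2 ->
    `|t - t'| < d -> 0 < cdot (nm t) (nm t').
  exists d' => // t t' tI t'I tt'; apply: scal; rewrite ?rt_gt0 ?mulf_neq0//.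
  by apply: nd; rewrite opprK addrC distrC; exact: xid.
have sub t : t1 <= t <= t2 -> t1 <= t <= t1 + 1.
  by move=> /andP[-> h]; rewrite (le_trans h)// ltW.
have sub' t : t2 <= t <= t1 + 1 -> t1 <= t <= t1 + 1.
  by move=> /andP[h ->]; rewrite andbT (le_trans _ h)// ltW.
have beN x : be (- x) = be x by rewrite /be normrN.
have wp t : t1 <= t <= t2 -> w 1 (1, t) = (ka t)%:C * Psi (xi t).
  move=> tI; rewrite /w P_inner// viewZr /Psi /Y /Z /=; congr (_ * view _ _ _ _).
  - by rewrite subrr mulr0 mul0r.
  - by rewrite subrr mul0r add0r !mul1r chi_in//; case/andP: tI.
  - by rewrite !mul1r.
have wm t : t1 <= t <= t2 -> w (-1) (1, t) = - ((ka t)%:C * Psi (- xi t)).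
  move=> tI; rewrite /w P_inner// viewZr /Psi beN [in LHS]view_opp_swap mulrN.
  congr (- (_ * view _ _ _ _)).
  - by rewrite /Y /= subrr mulr0 mul0r.
  - by rewrite opprK mulr1 mulN1r opprK.
  - by rewrite /Z /= subrr mul0r add0r !mul1r mulN1r chi_in//; case/andP: tI.
have xin t : `|- xi t| <= rho by rewrite normrN.
have [ee eep spN] : exists2 e : R[i], e = 1 \/ e = -1 &
    forall t, t1 <= t <= t2 -> sp t = e * np t.
  apply: branch_sign_const npd _ _.
    case: spd => dd dd0 h; exists dd => // t t' tI t'I; apply: h; exact: sub.
  move=> t tI; rewrite spE ?sub// wp// /np !exprMn nE// thE//.
have [ee' eem smN] : exists2 e : R[i], e = 1 \/ e = -1 &
    forall t, t1 <= t <= t2 -> sm t = e * nm t.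
  apply: branch_sign_const nmd _ _.
    case: smd => dd dd0 h; exists dd => // t t' tI t'I; apply: h; exact: sub.
  move=> t tI; rewrite smE ?sub// wm// /nm !exprMn nE// sqr_i thE//; ring.
have [f fp smp] : exists2 f : R[i], f = 1 \/ f = -1 &
    forall t, t2 <= t <= t1 + 1 -> sm t = f * sp t.
  apply: branch_sign_const.
  - case: spd => dd dd0 h; exists dd => // t t' tI t'I; apply: h; exact: sub'.
  - case: smd => dd dd0 h; exists dd => // t t' tI t'I; apply: h; exact: sub'.
  - move=> t tI; rewrite spE ?sub'// smE ?sub'//.
    have to : t <= t1 \/ t2 <= t by right; case/andP: tI.
    by rewrite /w !P_outer// /Y /Z /= subrr !mulr0 !mul0r bump0// mulr0 addr0 !mulr0.
have T1 : t1 <= t1 <= t2 by rewrite lexx ltW.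
have T2 : t1 <= t2 <= t2 by rewrite lexx ltW.
have T3 : t2 <= t2 <= t1 + 1 by rewrite lexx ltW.
have T4 : t2 <= t1 + 1 <= t1 + 1 by rewrite lexx ltW.
have x12 : xi t1 = - xi t2 by rewrite xi1// xi2.
apply: (flip_algebra eep eem fp th0 (rt0 _ T1) (rt0 _ T2) (n0 (xi t1)) (n2 := n (xi t2))).
- have := smp _ T3; rewrite smN// spN// /nm /np -x12.
  by rewrite !mulrA.
- have := smp _ T4; rewrite smc spc smN// spN// /nm /np x12 opprK.
  by rewrite !mulrA.
Qed.

End Core.
End Flip.

(** * Sides of curves and the signs of an arrangement *)

Section SignData.
Variable R : realType.
Local Notation V3 := 'rV[R]_3.
Local Notation P2 := (projective_plane R).

(** Near the crossing the lift of [D] is [k u] times a vector on the second axis of the square, with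
    [k] of constant sign. So [core_flip] applies to its points before and after; a negative [k]
    conjugates both monodromies, and [s'] only decides which comes first. *)
Lemma crossing_flip C D al tau be tau' (p : P2) (t0 : R) :
    loop_of C al tau -> loop_of D be tau' -> (forall q, C q -> D q -> q = p) ->
    cross_at C D p -> pt (al 0) <> p -> pt (be t0) = p ->
  exists u1 u2 c, [/\ u1 < t0, t0 < u2 & u2 < u1 + 1] /\
    mono (sight al (be u1)) c /\ mono (sight al (be u2)) (- c).
Proof.
move=> lC lD CD xp al0p bep.
have [pv [r [m [h [N [[pv0 pvE r0 hp] [mc mpv mpos] box [oN Np hN]]]]]]] :=
  local_box xp (loop_neq0 lC 0) al0p.
have m_neq0 Q : m Q != 0.
  apply/eqP => hh; have := mpv Q.
  by rewrite hh /dt /cx /cy /cz !mxE !mul0r !addr0 => /esym/eqP; rewrite oner_eq0.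
have sq0 : in_square r (0, 0) by rewrite /in_square /= normr0 ltW.
have pE : p = pt (m (0, 0)) by case: (hN _ Np) => _ _; rewrite hp.
have [_ C0 D0] := box _ sq0.
have Cp : C p by rewrite pE; apply/C0.
have [tc tcE] := (iffLR (loop_im lC p)) Cp.
have NC : N (pt (al tc)) by rewrite -tcE.
have hC0 : (h (pt (al tc))).1 = 0 by rewrite -tcE hp.
have hCc q : N q -> {for q, continuous (fun q => (h q).1)}.
  move=> /hN[hc _ _]; apply: (@continuous_comp _ _ _ h fst); first exact: hc.
  exact: cvg_fst.
have hCk q : N q -> C q -> q = pt (m ((h q).1, 0)).
  move=> /hN[_ sq qE] Cq; have [_ Cm _] := box _ sq.
  have h20 : (h q).2 = 0 by apply/Cm; rewrite -qE.
  by rewrite {1}qE -h20; case: (h q).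
have [rho0 rho00 winC] := @loop_window R C al tau N _ (fun x => pt (m (x, 0))) tc
  lC oN NC hC0 hCc hCk.
have ND : N (pt (be t0)) by rewrite bep.
have hD0 : (h (pt (be t0))).2 = 0 by rewrite bep hp.
have hDc q : N q -> {for q, continuous (fun q => (h q).2)}.
  move=> /hN[hc _ _]; apply: (@continuous_comp _ _ _ h snd); first exact: hc.
  exact: cvg_snd.
have hDk q : N q -> D q -> q = pt (m (0, (h q).2)).
  move=> /hN[_ sq qE] Dq; have [_ _ Dm] := box _ sq.
  have h20 : (h q).1 = 0 by apply/Dm; rewrite -qE.
  by rewrite {1}qE -h20; case: (h q).
have [eps0 eps00 winD] := @loop_window R D be tau' N _ (fun y => pt (m (0, y))) t0
  lD oN ND hD0 hDc hDk.
pose rho := Num.min rho0 r.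
pose e := Num.min eps0 r.
have rho_gt0 : 0 < rho by rewrite lt_min rho00.
have e_gt0 : 0 < e by rewrite lt_min eps00.
have rho_r : rho <= r by rewrite ge_min lexx orbT.
have e_r : e <= r by rewrite ge_min lexx orbT.
have [|t1 [t2 [s [xi [[a1 a2 a3 s1] [xic xir xi1 xi2] inn out]]]]] := winC rho.
  by rewrite rho_gt0 ge_min lexx.
have [|u1 [u2 [s' [eta [[b1 b2 b3 s1'] [etac etar eta1 eta2] inn' _]]]]] := winD e.
  by rewrite e_gt0 ge_min lexx.
have minj Q Q' : in_square r Q -> in_square r Q' -> pt (m Q) = pt (m Q') -> Q = Q'.
  by move=> /box[h1 _ _] /box[h2 _ _] hQ; rewrite -h1 hQ.
have mC Q : in_square r Q -> C (pt (m Q)) -> Q.2 = 0 by move=> /box[_ h1 _] /h1.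
have [c [mp mm]] := core_flip lC mc mpv mpos minj mC rho_gt0 rho_r e_gt0 e_r
  (lt_trans a1 a2) a3 s1 xic xir xi1 xi2 inn out.
have u12 : u1 < u2 by exact: lt_trans b1 b2.
have U1 : u1 <= u1 <= u2 by rewrite lexx ltW.
have U2 : u1 <= u2 <= u2 by rewrite lexx ltW.
pose k u := dt (be u) pv.
have kE u : u1 <= u <= u2 -> k u != 0 /\ be u = k u *: m (0, eta u).
  move=> ui; have [k' k0 kE] := (iffLR (pt_eqP (loop_neq0 lD u) (m_neq0 _))) (inn' _ ui).
  have -> : k u = k' by rewrite /k kE dtZl mpv mulr1.
  by [].
have ck : continuous k.
  move=> t; have cpv : {for t, continuous (fun _ : R => pv)} by exact: cst_continuous.
  have cbe : {for t, continuous be} by exact: (loop_cont lD).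
  exact: (dt_continuous cbe cpv).
have ksg : (0 < k u1) = (0 < k u2).
  apply: (@locally_const R bool (fun u => 0 < k u) u1 u2) => // z zI.
  have [zk _] := kE _ zI.
  have az : 0 < `|k z| by rewrite normr_gt0.
  have /cvgrPdist_lt/(_ _ az)/nbhs_ballP[d' /= d'0 hd'] := ck z.
  exists d' => // x xI zx; have := hd' x zx => /= {}hd'.
  have [xk _] := kE _ xI.
  case: (ltgtP 0 (k z)) zk hd' => //= [k0 _|k0 _].
    by rewrite (gtr0_norm k0) ltr_norml => /andP[h1 h2]; apply/idP; lra.
  by rewrite (ltr0_norm k0) ltr_norml => /andP[h1 h2]; apply/negbTE; rewrite -leNgt; lra.
have notC y : 0 < `|y| -> `|y| <= r -> ~ C (pt (m (0, y))).
  move=> y0 yr; have sq : in_square r (0, y) by rewrite /in_square /= normr0 ltW.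
  by move=> /(mC _ sq) /= yE; move: y0; rewrite yE normr0 ltxx.
have scal y c' (k' : R) : 0 < `|y| -> `|y| <= r -> k' != 0 -> mono (sight al (m (0, y))) c' ->
    mono (sight al (k' *: m (0, y))) (if 0 < k' then c' else c'^*).
  move=> y0 yr k'0 mm'.
  have [kp|kn] := ltrP 0 k'; first exact: (mono_sightZ lC (m_neq0 _) (notC _ y0 yr) kp mm').
  have kp : 0 < - k' by rewrite oppr_gt0 lt_neqAle k'0.
  rewrite -[k']opprK scaleNr; apply: mono_sightN.
  exact: (mono_sightZ lC (m_neq0 _) (notC _ y0 yr) kp mm').
have [k10 kE1] := kE _ U1; have [k20 kE2] := kE _ U2.
have ae : `|e| = e by rewrite gtr0_norm.
have aNe : `|- e| = e by rewrite normrN gtr0_norm.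
have conjN (z : R[i]) : (- z)^* = - z^* by rewrite rmorphN.
exists u1, u2; case: s1' eta1 eta2 => -> eta1 eta2.
- exists (if 0 < k u1 then - c else (- c)^*); split=> //; split.
  + rewrite kE1 eta1// mul1r; apply: scal => //; rewrite aNe//.
  + rewrite kE2 eta2// mul1r ksg.
    have -> : - (if 0 < k u2 then - c else (- c)^*) = if 0 < k u2 then c else c^*.
      by case: ifP; rewrite ?conjN opprK.
    by apply: scal => //; rewrite ae.
- exists (if 0 < k u1 then c else c^*); split=> //; split.
  + by rewrite kE1 eta1// mulN1r opprK; apply: scal => //; rewrite ae.
  + rewrite kE2 eta2// mulN1r ksg.
    have -> : - (if 0 < k u2 then c else c^*) = if 0 < k u2 then - c else (- c)^*.
      by case: ifP; rewrite ?conjN.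
    by apply: scal => //; rewrite aNe.
Qed.

(** Between [t0] and [t0 + 1] the curve [D] avoids [C], so the monodromy seen there is constant. It
    differs by a sign from the one just before [t0], which forces the lift of [D] to return as its
    negative; then conjugation negates [c], so [c] is imaginary and its square [tau] is [-1]. *)
Lemma crossing_sign C D al tau be tau' (p : P2) (t0 : R) :
    loop_of C al tau -> loop_of D be tau' -> (forall q, C q -> D q -> q = p) ->
    cross_at C D p -> pt (al 0) <> p -> pt (be t0) = p ->
  [/\ tau = -1, tau' = -1 & exists2 e : R, e = 1 \/ e = -1 &
    forall t, t0 < t < t0 + 1 -> mono (sight al (be t)) (0 +i* e)].
Proof.
move=> lC lD CD xp al0p bep.
have [u1 [u2 [c [[b1 b2 b3] [m1 m2]]]]] := crossing_flip lC lD CD xp al0p bep.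
have be0 t : be t != 0 by exact: (loop_neq0 lD).
have notC t : t0 < t < t0 + 1 -> ~ C (pt (be t)).
  move=> /andP[h1 h2] Ct.
  have Dt : D (pt (be t)) by apply/(loop_im lD); exists t.
  have := CD _ Ct Dt; rewrite -bep => /(loop_inj lD)[n nE].
  have n1 : -1 < n%:~R :> R by lra.
  have n2 : n%:~R < 1 :> R by lra.
  by move: h1; rewrite nE (int_in_unit n1 n2) addr0 ltxx.
have const t : t0 < t < t0 + 1 -> mono (sight al (be t)) (- c).
  move=> /andP[h1 h2].
  have [t2|/ltW t2] := leP u2 t.
    apply: (mono_path lC t2 (loop_cont lD) _ _ m2) => // l /andP[l1 l2].
    by apply: notC; apply/andP; split; lra.
  have [|c' _ mt] := mono_sight_exists lC (be0 t).
    by apply: notC; rewrite h1.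
  have m2' : mono (sight al (be u2)) c'.
    apply: (mono_path lC t2 (loop_cont lD) _ _ mt) => // l /andP[l1 l2].
    by apply: notC; apply/andP; split; lra.
  by rewrite (mono_unique m2 m2').
have [|c' c2 mc'] := mono_sight_exists lC (be0 u2).
  by apply: notC; apply/andP; split; lra.
have cE := mono_unique m2 mc'; rewrite -cE sqrrN in c2.
(* The time [u1 + 1] is again past the crossing, although the vector is [tau'] times the one at
   [u1], from which [c] is seen. *)
have m3 : mono (sight al (be (u1 + 1))) (- c).
  by apply: const; apply/andP; split; lra.
have c0 : c != 0.
  apply/eqP => c0; have := loop_sqr lC; move: c2; rewrite c0 expr0n => /= -[<-].
  by rewrite expr0n => /eqP; rewrite eq_sym oner_eq0.
have nn (z : R[i]) : z != 0 -> z <> - z.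
  move=> z0 /eqP; rewrite -addr_eq0 -mulr2n mulrn_eq0/=.
  exact/negP.
have : tau' = 1 \/ tau' = -1.
  by have /eqP := loop_sqr lD; rewrite sqrf_eq1 => /orP[]/eqP->; [left|right].
case=> tE; move: m3; rewrite (loop_per lD) tE ?scale1r ?scaleN1r => m3.
  by have := nn _ c0 (mono_unique m1 m3).
have := mono_unique (mono_sightN m1) m3.
case: c c0 c2 {m1 m2 m3 cE nn} const => x y c0 c2 const [xE].
have x0 : x = 0 by lra.
move: c2; rewrite x0 => -[]; rewrite !mul0r sub0r => tauE _.
have tau1 : tau = -1.
  have /eqP := loop_sqr lC; rewrite sqrf_eq1 => /orP[]/eqP tau1 //.
  by move: tauE; rewrite tau1; have := sqr_ge0 y; rewrite expr2 => h1 h2; lra.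
split=> //; exists (- y); last first.
  by move=> t /const; rewrite x0 (_ : - (0 +i* y) = 0 +i* - y)//; apply/eqP; rewrite eq_complex /= oppr0 !eqxx.
have /eqP : y ^+ 2 = 1 by move: tauE; rewrite tau1 expr2; lra.
rewrite sqrf_eq1 => /orP[]/eqP ->; [right|left] => //.
by rewrite opprK.
Qed.

Lemma loop_shift C al tau (s : R) : loop_of C al tau ->
  loop_of C (fun t => al (t + s)) tau.
Proof.
move=> lC; split.
- move=> t; apply: (@continuous_comp _ _ _ (fun t => t + s) al);
    last exact: (loop_cont lC).
  by apply: cvgD; [exact: cvg_id|exact: cvg_cst].
- by move=> t; exact: (loop_neq0 lC).
- exact: (loop_sqr lC).
- by move=> t; rewrite addrAC (loop_per lC).
- move=> p; split=> [/(loop_im lC)[t tE]|[t tE]]; last by apply/(loop_im lC); exists (t + s).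
  by exists (t - s); rewrite subrK.
- move=> t t' /(loop_inj lC)[n nE]; exists n.
  by apply: (addIr s); rewrite nE addrAC.
Qed.

Lemma loop_time C al tau p : loop_of C al tau -> C p ->
  exists2 t : R, 0 <= t < 1 & pt (al t) = p.
Proof.
move=> lC /(loop_im lC)[t ->].
have ptper (k : nat) u : pt (al (u + k%:R)) = pt (al u).
  have t0 : tau != 0 by apply/eqP => t0; have /eqP := loop_sqr lC; rewrite t0 expr0n /= eq_sym oner_eq0.
  elim: k => [|k IHk]; first by rewrite addr0.
  by rewrite -addn1 natrD addrA (loop_per lC) ptZ.
exists (t - (Num.floor t)%:~R).
  have := floor_le t; have := floorD1_gt t; rewrite intrD1 => f1 f2.
  by apply/andP; split; lra.
case: (Num.floor t) => k; first by rewrite -[in RHS](subrK (k%:~R) t) ptper.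
by rewrite NegzE mulrNz opprK ptper.
Qed.

Lemma exists_time_notin (s : seq R) : exists2 t : R, 0 <= t < 1 & t \notin s.
Proof.
pose c := [seq (k%:R / (size s).+1%:R : R) | k <- iota 0 (size s).+1].
have n0 : (size s).+1%:R != 0 :> R by rewrite pnatr_eq0.
have uc : uniq c.
  rewrite map_inj_uniq ?iota_uniq// => a b /(mulIf (invr_neq0 n0))/eqP.
  by rewrite eqr_nat => /eqP.
have [/allP h|] := boolP (all (mem s) c).
  by have := uniq_leq_size uc h; rewrite size_map size_iota ltnn.
move=> /allPn[t /mapP[k]]; rewrite mem_iota add0n => /andP[_ kn] -> nt.
exists (k%:R / (size s).+1%:R) => //.
by rewrite divr_ge0//= ltr_pdivrMr ?ltr0n// mul1r ltr_nat.
Qed.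

(* [sight_sign al z e]: the pseudoline parametrized by al separates the sphere
   into two sides, and z lies on the side e = 1 or e = -1. *)
Definition sight_sign (al : R -> V3) z (e : R) := mono (sight al z) (0 +i* e).

Lemma sight_sign_unique al z e e' : sight_sign al z e -> sight_sign al z e' -> e = e'.
Proof. by move=> h1 h2; have [] := mono_unique h1 h2. Qed.

Lemma sight_signN al z e : sight_sign al z e -> sight_sign al (- z) (- e).
Proof. by move=> /mono_sightN. Qed.

Lemma sight_signZ C al tau z k e : loop_of C al tau -> z != 0 -> ~ C (pt z) ->
  k != 0 -> sight_sign al z e -> sight_sign al (k *: z) (Num.sg k * e).
Proof.
move=> lC z0 zC k0 ze.
have [kp|kn] := ltrP 0 k.
  by rewrite gtr0_sg// mul1r; exact: (mono_sightZ lC z0 zC kp ze).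
have kn' : k < 0 by rewrite lt_neqAle k0.
have kp : 0 < - k by rewrite oppr_gt0.
rewrite ltr0_sg// mulN1r -[k in k *: _]opprK scaleNr; apply: sight_signN.
exact: (mono_sightZ lC z0 zC kp ze).
Qed.

(* T i j is the time at which the i-th curve meets the j-th one, e i j the side
   of the j-th curve on which the i-th one lies just afterwards. *)
Lemma arrangement_sign_data (I : finType) (A : set (set P2)) (L : I -> set P2) :
    pseudoline_arrangement A -> (forall i, A (L i)) -> injective L ->
  exists (T e ep : I -> I -> R),
    [/\ forall i j, i != j -> 0 < T i j < 1,
        forall i j, i != j -> e i j = 1 \/ e i j = -1,
        forall i j, i != j -> (ep i j = 1 \/ ep i j = -1) /\ ep i j = ep j i,
        forall i j k, i != j -> i != k -> j != k ->
          e j i * e j k * Num.sg (T j i - T j k) =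
          - ep i j * (e i j * e i k * Num.sg (T i j - T i k)) &
        forall i j k, i != j -> i != k ->
          T i j = T i k <-> exists p, [/\ L i p, L j p & L k p]].
Proof.
move=> [_ Aps Ax] AL Linj.
have /boolp.choice[al0 /boolp.choice[tau0 lp0]] :
    forall i, exists al tau, loop_of (L i) al tau.
  by move=> i; have [scc _] := Aps _ (AL i); exact: simple_closed_curve_loop.
have /boolp.choice[pp ppP] : forall ij : I * I, exists p, ij.1 != ij.2 ->
    L ij.1 `&` L ij.2 = [set p] /\ cross_at (L ij.1) (L ij.2) p.
  move=> [i j] /=; have [->|ij] := eqVneq i j; first by exists (pt 0).
  have [|p hp] := Ax _ _ (AL i) (AL j).
    by move=> /Linj/eqP; rewrite (negbTE ij).
  by exists p.
pose p i j := pp (i, j).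
have pI i j : i != j -> L i `&` L j = [set p i j] by move=> ij; case: (ppP (i, j) ij).
have px i j : i != j -> cross_at (L i) (L j) (p i j) by move=> ij; case: (ppP (i, j) ij).
have pin i j : i != j -> L i (p i j) /\ L j (p i j).
  by move=> /pI h; have : [set p i j] (p i j) by []; rewrite -h.
have puni i j q : i != j -> L i q -> L j q -> q = p i j.
  by move=> /pI h qi qj; have : (L i `&` L j) q by []; rewrite h.
have psym i j : i != j -> p i j = p j i.
  by move=> ij; apply: puni; rewrite 1?eq_sym//; case: (pin _ _ ij).
have /boolp.choice[t0 t0P] : forall ij : I * I, exists t : R, ij.1 != ij.2 ->
    0 <= t < 1 /\ pt (al0 ij.1 t) = p ij.1 ij.2.
  move=> [i j] /=; have [->|ij] := eqVneq i j; first by exists 0.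
  by have [t h1 h2] := loop_time (lp0 i) (proj1 (pin _ _ ij)); exists t.
(* Each lift is restarted at a time when it is on no other curve, so that all crossings occur
   strictly inside the period and [al i 0] is never a crossing point. *)
have /boolp.choice[s0 s0P] : forall i, exists s : R, forall j, i != j ->
    pt (al0 i s) <> p i j.
  move=> i; have [t t01 tn] := exists_time_notin [seq t0 (i, j) | j <- enum I].
  exists t => j ij; have [h1 h2] := t0P (i, j) ij; rewrite -h2 => /(loop_inj (lp0 i))[n nE].
  case/andP: t01 h1 => a1 a2 /andP[b1 b2].
  have n1 : -1 < n%:~R :> R by move: nE; set u := t0 _ => nE; rewrite -/u in b1 b2; lra.
  have n2 : n%:~R < 1 :> R by move: nE; set u := t0 _ => nE; rewrite -/u in b1 b2; lra.
  move: nE; rewrite (int_in_unit n1 n2) addr0 => tE.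
  by move: tn; rewrite tE; apply/negP/negPn/map_f; rewrite mem_enum.
pose al i t := al0 i (t + s0 i).
have lp i : loop_of (L i) (al i) (tau0 i) by exact: loop_shift.
have al0p i j : i != j -> pt (al i 0) <> p i j by rewrite /al add0r; exact: s0P.
have /boolp.choice[TT TTP] : forall ij : I * I, exists t : R, ij.1 != ij.2 ->
    0 < t < 1 /\ pt (al ij.1 t) = p ij.1 ij.2.
  move=> [i j] /=; have [->|ij] := eqVneq i j; first by exists 0.
  have [t /andP[h0 h1] h2] := loop_time (lp i) (proj1 (pin _ _ ij)).
  exists t => _; split=> //; rewrite h1 andbT lt_neqAle h0 andbT.
  by apply/eqP => t00; apply: (al0p _ _ ij); rewrite -h2 -t00.
pose T i j := TT (i, j).
have T01 i j : i != j -> 0 < T i j < 1 by move=> /(TTP (i, j))[].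
have Tp i j : i != j -> pt (al i (T i j)) = p i j by move=> /(TTP (i, j))[].
have xs i j : i != j -> [/\ tau0 j = -1, tau0 i = -1 & exists2 e : R, e = 1 \/ e = -1 &
    forall t, T i j < t < T i j + 1 -> sight_sign (al j) (al i t) e].
  move=> ij; have ji : j != i by rewrite eq_sym.
  apply: (crossing_sign (lp j) (lp i) _ (px _ _ ji) (al0p _ _ ji)).
    by move=> q qj qi; apply: puni.
  by rewrite Tp// psym.
have /boolp.choice[ee eeP] : forall ij : I * I, exists e : R, ij.1 != ij.2 ->
    (e = 1 \/ e = -1) /\ forall t, T ij.1 ij.2 < t < T ij.1 ij.2 + 1 ->
      sight_sign (al ij.2) (al ij.1 t) e.
  move=> [i j] /=; have [->|ij] := eqVneq i j; first by exists 0.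
  by have [_ _ [e e1 h]] := xs _ _ ij; exists e.
pose e i j := ee (i, j).
have e1 i j : i != j -> e i j = 1 \/ e i j = -1 by move=> /(eeP (i, j))[].
have eP i j t : i != j -> T i j < t < T i j + 1 -> sight_sign (al j) (al i t) (e i j).
  by move=> /(eeP (i, j))[_]; apply.
have aN i j t : i != j -> al i (t + 1) = - al i t.
  by move=> /xs[_ tE _]; rewrite (loop_per (lp i)) tE scaleN1r.
(* [X i j] and [X j i] lift the same crossing, taken on the two curves; [ep i j] will be [-1] if
   they point the same way and [1] otherwise. *)
pose X i j := e i j *: al i (T i j).
have e_neq0 i j : i != j -> e i j != 0.
  by move=> /e1[]->; rewrite ?oppr_eq0 oner_eq0.
have X0 i j : i != j -> X i j != 0.
  by move=> ij; rewrite scaler_eq0 negb_or e_neq0// (loop_neq0 (lp i)).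
have ptX i j : i != j -> pt (X i j) = p i j by move=> ij; rewrite ptZ ?e_neq0// Tp.
have Teq i j k : i != j -> i != k -> T i j = T i k <-> p i j = p i k.
  move=> ij ik; split=> [Tjk|]; first by rewrite -Tp// -(Tp i k)// Tjk.
  rewrite -Tp// -(Tp i k)// => /(loop_inj (lp i))[n nE].
  have /andP[a1 a2] := T01 _ _ ij; have /andP[b1 b2] := T01 _ _ ik.
  have n1 : -1 < n%:~R :> R by lra.
  have n2 : n%:~R < 1 :> R by lra.
  by rewrite nE (int_in_unit n1 n2) addr0.
have Xsgn i j k : i != j -> i != k -> T i j != T i k ->
    sight_sign (al k) (X i j) (e i j * e i k * Num.sg (T i j - T i k)).
  move=> ij ik Tn; rewrite /X.
  have /andP[a1 a2] := T01 _ _ ij; have /andP[b1 b2] := T01 _ _ ik.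
  have base : sight_sign (al k) (al i (T i j)) (e i k * Num.sg (T i j - T i k)).
    case: (ltgtP (T i j) (T i k)) Tn => // lt _.
      (* One period later the lift is the opposite vector, and that time lies in the interval where
         [eP] applies. *)
      rewrite ltr0_sg ?subr_lt0// mulrN1 -[al i _]opprK -(aN _ _ _ ij).
      apply: sight_signN; apply: eP => //; apply/andP; split; lra.
    rewrite gtr0_sg ?subr_gt0// mulr1; apply: eP => //; apply/andP; split; lra.
  by case: (e1 _ _ ij) => ->; rewrite ?scale1r ?mul1r// scaleN1r !mulN1r mulNr; exact: sight_signN.
have kap i j : i != j -> exists2 k : R, k != 0 & X j i = k *: X i j.
  move=> ij; have ji : j != i by rewrite eq_sym.
  by apply/(pt_eqP (X0 _ _ ji) (X0 _ _ ij)); rewrite !ptX// psym.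
have /boolp.choice[kk kkP] : forall ij : I * I, exists k : R, ij.1 != ij.2 ->
    k != 0 /\ X ij.2 ij.1 = k *: X ij.1 ij.2.
  move=> [i j] /=; have [->|ij] := eqVneq i j; first by exists 0.
  by have [k k0 kE] := kap _ _ ij; exists k.
pose ep i j := - Num.sg (kk (i, j)).
have kP i j : i != j -> kk (i, j) != 0 /\ X j i = kk (i, j) *: X i j by move=> /(kkP (i, j)).
exists T, e, ep; split => //.
- move=> i j ij; have ji : j != i by rewrite eq_sym.
  have [k0 kE] := kP _ _ ij; have [k0' kE'] := kP _ _ ji.
  split; first by rewrite /ep; case: sgrP k0 => // _ _; [right|left; rewrite opprK].
  have : (kk (j, i) * kk (i, j)) *: X i j = X i j by rewrite -scalerA -kE -kE'.
  rewrite -[RHS]scale1r => /eqP; rewrite -subr_eq0 -scalerBl scaler_eq0 (negbTE (X0 _ _ ij)) orbF.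
  rewrite subr_eq0 => /eqP kk1; rewrite /ep; congr (- _).
  have : Num.sg (kk (j, i)) * Num.sg (kk (i, j)) = 1 by rewrite -sgrM kk1 sgr1.
  by case: (sgrP (kk (j, i))) => _; case: (sgrP (kk (i, j))) => _;
    rewrite ?mulr0 ?mul0r ?mulrN1 ?mulr1 //; lra.
- move=> i j k ij ik jk; have ji : j != i by rewrite eq_sym.
  have [k0 kE] := kP _ _ ij.
  have [Tjk|Tjk] := eqVneq (T i j) (T i k).
    have pE := (iffLR (Teq _ _ _ ij ik)) Tjk.
    have Tji : T j i = T j k.
      apply/Teq => //; rewrite -psym//; apply: puni => //; first by case: (pin _ _ ij).
      by rewrite pE; case: (pin _ _ ik).
    by rewrite Tji Tjk !subrr sgr0 !mulr0.
  have Tji : T j i != T j k.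
    apply: contra_neq Tjk => Tji; apply/Teq => //.
    have pE := (iffLR (Teq _ _ _ ji jk)) Tji.
    apply: puni => //; first by case: (pin _ _ ij).
    by rewrite psym// pE; case: (pin _ _ jk).
  have h1 := Xsgn _ _ _ ij ik Tjk; have h2 := Xsgn _ _ _ ji jk Tji.
  have nL : ~ L k (pt (X i j)).
    rewrite ptX// => Lk; move: Tjk; apply/negP/negPn/eqP/Teq => //.
    by apply: puni => //; case: (pin _ _ ij).
  rewrite kE in h2; rewrite /ep opprK.
  exact: (sight_sign_unique h2 (sight_signZ (lp k) (X0 _ _ ij) nL k0 h1)).
- move=> i j k ij ik; rewrite Teq//; split=> [pE|[q [qi qj qk]]].
    by exists (p i j); split; [case: (pin _ _ ij)|case: (pin _ _ ij)|rewrite pE; case: (pin _ _ ik)].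
  by rewrite -(puni _ _ _ ij qi qj) -(puni _ _ _ ik qi qk).
Qed.

End SignData.

Local Close Scope complex_scope.

(** * Graphs as pseudolines *)

Section Graphs.
Variable R : realType.
Local Notation V3 := 'rV[R]_3.
Local Notation P2 := (projective_plane R).

Lemma vec_continuous (T : topologicalType) (x y z : T -> R) t :
    {for t, continuous x} -> {for t, continuous y} -> {for t, continuous z} ->
  {for t, continuous (fun u => vec (x u) (y u) (z u))}.
Proof.
have vecD a b c : vec a b c = a *: vec 1 0 0 + b *: vec 0 1 0 + c *: vec (0 : R) 0 1.
  by apply: vec_eqP; rewrite !cE; ring.
move=> hx hy hz; rewrite (_ : (fun u => _) = (fun u => x u *: vec 1 0 0 + y u *: vec 0 1 0 + z u *: vec 0 0 1)).
  exact: (cvgD (cvgD (cvgZr_tmp hx) (cvgZr_tmp hy)) (cvgZr_tmp hz)).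
by apply/funext => u; rewrite vecD.
Qed.

Section Graph.
(* The graph of [x |-> s * x + b x], with [b] bounded, together with its point at
   infinity; in homogeneous coordinates it is the zero set of an odd function. *)
Variables (s : R) (b : R -> R).
Hypothesis b_cont : continuous b.
Hypothesis b_bounded : exists M : R, forall x, `|b x| <= M.

Definition height (w x : R) : R := s * x + w * b (x / w).
Definition graph : set P2 := [set p | exists v, [/\ v != 0, p = pt v & cz v = height (cx v) (cy v)]].

(** Where [w] vanishes the argument [x / w] of [b] is a default value without meaning, but since [b]
    is bounded the term [w * b (x / w)] tends to [0]. *)
Lemma height_continuous (T : topologicalType) (w x : T -> R) t :
    {for t, continuous w} -> {for t, continuous x} ->
  {for t, continuous (fun u => height (w u) (x u))}.
Proof.
move=> cw cx; rewrite /height; apply: (@cvgD _ _ _ _ _ (fun u => s * x u) (fun u => w u * b (x u / w u))).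
  exact: (cvgM (cvg_cst s) cx).
have [w0|w0] := eqVneq (w t) 0; last first.
  apply: (cvgM cw); apply: (@continuous_comp _ _ _ (fun u => x u / w u) b); last exact: b_cont.
  exact: (cvgM cx (cvgV w0 cw)).
rewrite w0 mul0r; have [M bM] := b_bounded.
have M0 : 0 <= M := le_trans (normr_ge0 _) (bM 0).
apply/cvgrPdist_lt => e e0; have e1 : 0 < e / (M + 1) by rewrite divr_gt0 // ltr_pwDr.
have cw' : w @ t --> (0 : R) by rewrite -w0; exact: cw.
move/cvgrPdist_lt: cw' => /(_ _ e1); apply: filterS => u.
rewrite !sub0r !normrN normrM => lt; apply: le_lt_trans (ler_wpM2l (normr_ge0 _) (bM _)) _.
rewrite ltr_pdivlMr ?ltr_pwDr // in lt; apply: le_lt_trans lt.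
by rewrite ler_wpM2l // lerDl.
Qed.

Lemma heightZ k w x : k != 0 -> height (k * w) (k * x) = k * height w x.
Proof.
move=> k0; rewrite /height mulrDr !mulrA [s * k]mulrC; congr (_ + _ * b _).
have [->|w0] := eqVneq w 0; first by rewrite mulr0 invr0 !mulr0.
by field; rewrite w0 k0.
Qed.

Lemma graph_pt v : v != 0 -> graph (pt v) <-> cz v = height (cx v) (cy v).
Proof.
move=> v0; split=> [[u [u0 /(pt_eqP v0 u0)[k k0 ->] e]]|e]; last by exists v.
by rewrite !cE heightZ // e.
Qed.

Lemma graph_affine x y : graph (pt (vec 1 x y)) <-> y = s * x + b x.
Proof.
have v0 : vec 1 x y != 0 by rewrite vec_eq0 !cE oner_eq0.
by rewrite graph_pt // !cE /height mul1r divr1.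
Qed.

Lemma graph_infinity y : graph (pt (vec 0 1 y)) <-> y = s.
Proof.
have v0 : vec 0 1 y != 0 by rewrite vec_eq0 !cE oner_eq0 andbF.
by rewrite graph_pt // !cE /height mulr1 mul0r addr0.
Qed.

(** The first two coordinates run along the half [w >= 0] of the square [|w| + |x| = 1] from
    [(0, -1)] to [(0, 1)]; its two ends are antipodal and give the same point. *)
Definition graph_curve (t : R) : V3 :=
  vec (1 - `|2 * t - 1|) (2 * t - 1) (height (1 - `|2 * t - 1|) (2 * t - 1)).

Lemma graph_curve_neq0 t : graph_curve t != 0.
Proof.
rewrite vec_eq0 !cE; apply/negP => /and3P[/eqP h1 /eqP h2 _].
by move: h1; rewrite h2 normr0 subr0 => /eqP; rewrite oner_eq0.
Qed.

Lemma graph_curve_continuous : continuous graph_curve.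
Proof.
move=> t; have lin : {for t, continuous (fun t : R => 2 * t - 1)}.
  exact: (cvgB (cvgM (cvg_cst (2 : R)) (@cvg_id _ (nbhs t))) (cvg_cst (1 : R))).
have cw : {for t, continuous (fun t : R => 1 - `|2 * t - 1|)}.
  exact: (cvgB (cvg_cst (1 : R)) (cvg_norm lin)).
exact: (vec_continuous cw lin (height_continuous cw lin)).
Qed.

Lemma graph_curve_inj (t u : R) : 0 <= t < 1 -> 0 <= u < 1 ->
  pt (graph_curve t) = pt (graph_curve u) -> t = u.
Proof.
move=> t01 u01 /(pt_eqP (graph_curve_neq0 _) (graph_curve_neq0 _))[k k0 e].
have := congr1 (@cx R) e; have := congr1 (@cy R) e; rewrite !cE => e1 e2.
set p := 2 * t - 1 in e1 e2; set q := 2 * u - 1 in e1 e2.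
suff : p = q by rewrite /p /q; lra.
have hp : -1 <= p < 1 by rewrite /p; lra.
have hq : -1 <= q < 1 by rewrite /q; lra.
clearbody p q; clear -hp hq k0 e1 e2.
have [hk|hk] := ltP k 0.
  have [P1|P1] := lerP 0 p; have [Q1|Q1] := lerP 0 q;
    rewrite ?(ger0_norm P1) ?(ger0_norm Q1) ?(ltr0_norm P1) ?(ltr0_norm Q1) in e2; nra.
have {}hk : 0 < k by rewrite lt0r k0.
have : p * (1 - `|q|) = q * (1 - `|p|).
  by rewrite e2 {1}e1; ring.
have [P1|P1] := lerP 0 p; have [Q1|Q1] := lerP 0 q;
    rewrite ?(ger0_norm P1) ?(ger0_norm Q1) ?(ltr0_norm P1) ?(ltr0_norm Q1); nra.
Qed.

Lemma graph_curve_onto p : graph p -> exists2 t, 0 <= t <= 1 & p = pt (graph_curve t).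
Proof.
move=> [v [v0 -> e]].
pose n := `|cx v| + `|cy v|.
have n0 : 0 < n.
  rewrite lt0r addr_ge0 ?normr_ge0 // andbT paddr_eq0 ?normr_ge0 // !normr_eq0.
  apply: contra v0 => /andP[/eqP h1 /eqP h2]; rewrite vec_eq0 h1 h2 eqxx /= e h1 h2.
  by rewrite /height mulr0 mul0r addr0.
pose k := if 0 <= cx v then n^-1 else - n^-1.
have k0 : k != 0 by rewrite /k; case: ifP => _; rewrite ?oppr_eq0 invr_eq0 gt_eqF.
have kw : k * cx v = 1 - `|k * cy v|.
  rewrite normrM (_ : `|k| = n^-1); last first.
    by rewrite /k; case: ifP => _; rewrite ?normrN gtr0_norm ?invr_gt0.
  have -> : k * cx v = n^-1 * `|cx v|.
    rewrite /k; case: ifP => h; first by rewrite ger0_norm.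
    by rewrite ltr0_norm ?mulrN ?mulNr // ltNge h.
  by apply/eqP; rewrite eq_sym subr_eq -mulrDr mulVf // gt_eqF.
have hy : `|k * cy v| <= 1.
  have : 0 <= k * cx v.
    rewrite /k; case: ifP => h; first by rewrite mulr_ge0 // invr_ge0 ltW.
    by rewrite mulNr -mulrN mulr_ge0 ?invr_ge0 ?(ltW n0) // oppr_ge0 ltW // ltNge h.
  by rewrite kw subr_ge0.
exists ((k * cy v + 1) / 2); first by move: hy; rewrite ler_norml; lra.
rewrite -(ptZ v k0); congr pt; apply: vec_eqP; rewrite /graph_curve !cE;
  rewrite (_ : 2 * ((k * cy v + 1) / 2) - 1 = k * cy v) //; try by field.
by rewrite -kw heightZ // e.
Qed.

Lemma graph_simple_closed_curve : simple_closed_curve graph.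
Proof.
exists (fun t => pt (graph_curve t)); split.
- apply: continuous_subspaceT => t.
  apply: (@continuous_comp _ _ _ graph_curve (@pt R)); first exact: graph_curve_continuous.
  exact: pt_continuous (graph_curve_neq0 t).
- apply/pt_eqP; rewrite ?graph_curve_neq0 //; exists (-1); first by rewrite oppr_eq0 oner_eq0.
  have e0 : 2 * (0 : R) - 1 = -1 by ring.
  have e1 : 2 * (1 : R) - 1 = 1 by ring.
  by apply: vec_eqP; rewrite /graph_curve /height !cE e0 e1 ?normrN ?normr1 ?subrr; ring.
- move=> t u; rewrite !inE /= !in_itv /= => t01 u01; exact: graph_curve_inj.
apply/seteqP; split=> [p /graph_curve_onto[t t01 ->]|_ [t _ <-]].
  by exists t; rewrite //= in_itv.
by apply/graph_pt; [exact: graph_curve_neq0|rewrite /graph_curve !cE].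
Qed.

(** [height] changes sign with its arguments, so every point off the graph has a lift above it. Such
    a lift is joined to the vertical vector by shrinking the first two coordinates while the height
    above the graph is interpolated with [1], staying positive. *)
Lemma graph_complement_connected : connected (~` graph).
Proof.
pose path (v : V3) (t : R) : V3 := vec (t * cx v) (t * cy v)
  (height (t * cx v) (t * cy v) + ((1 - t) + t * (cz v - height (cx v) (cy v)))).
pose above := [set v : V3 | v != 0 /\ height (cx v) (cy v) < cz v].
have path_ok v t : above v -> 0 <= t <= 1 -> path v t != 0 /\
    height (cx (path v t)) (cy (path v t)) < cz (path v t).
  move=> [v0 hv] t01; have hpos : 0 < (1 - t) + t * (cz v - height (cx v) (cy v)) by move: hv t01; rewrite -subr_gt0; set d := _ - _; move=> d0 t01; clearbody d; clear -d0 t01; nra.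
  split; last by rewrite /path !cE ltrDl.
  rewrite vec_eq0 !cE; apply/negP => /and3P[/eqP h1 /eqP h2].
  by rewrite h1 h2 /height mulr0 mul0r !add0r gt_eqF.
have -> : ~` graph = \bigcup_(v in above) ((fun t => pt (path v t)) @` `[0, 1]).
  apply/seteqP; split=> [p gp|p [v av [t]]] /=; last first.
    rewrite in_itv /= => t01 <- /graph_pt; have [h0 h1] := path_ok v t av t01.
    by move=> /(_ h0) e; rewrite e ltxx in h1.
  have [v v0 pv] := pt_surj p; have nv : cz v != height (cx v) (cy v).
    by apply/eqP => e; apply: gp; rewrite pv; apply/graph_pt.
  have path1 u : path u 1 = u by apply: vec_eqP; rewrite /path !cE !mul1r //; ring.
  have in01 : `[0, 1]%classic (1 : R) by rewrite /= in_itv /= ler01 lexx.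
  move: nv; rewrite neq_lt => /orP[lt|gt]; last first.
    by exists v => //; exists 1 => //; rewrite path1.
  exists (-1 *: v); last first.
    by exists 1; rewrite ?path1 ?ptZ // oppr_eq0 oner_eq0.
  have n1 : (-1 : R) != 0 by rewrite oppr_eq0 oner_eq0.
  by split; [rewrite scaler_eq0 negb_or n1|rewrite !cE heightZ // !mulN1r ltrN2].
apply: bigcup_connected.
  exists (pt (vec 0 0 1)) => v av; exists 0; first by rewrite /= in_itv /= ler01 lexx.
  congr pt; apply: vec_eqP; rewrite /path !cE ?mul0r //.
  by rewrite /height mulr0 mul0r; ring.
move=> v av; apply: connected_continuous_connected; first exact: segment_connected.
have cpath : continuous (path v).
  move=> t; have c1 (a : R) : {for t, continuous (fun t : R => t * a)}.
    exact: (cvgM cvg_id (cvg_cst a)).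
  apply: (vec_continuous (c1 _) (c1 _)).
  exact: (cvgD (height_continuous (c1 (cx v)) (c1 (cy v)))
    (cvgD (cvgB (cvg_cst (1 : R)) (@cvg_id _ (nbhs t))) (c1 _))).
apply: continuous_in_subspaceT => t; rewrite inE /= in_itv /= => t01.
apply: (@continuous_comp _ _ _ (path v) (@pt R)); first exact: cpath.
by apply: pt_continuous; have [] := path_ok v t av t01.
Qed.

Lemma graph_pseudoline : pseudoline graph.
Proof. by split; [exact: graph_simple_closed_curve|exact: graph_complement_connected]. Qed.

End Graph.

(** * A chart at the crossing of two affine pieces *)

Section AffineChart.
Variables (x0 y0 a a' e : R).
Hypotheses (e_gt0 : 0 < e) (a_neq : a' != a).

(** The homogeneous form of the condition [|x - x0| < e], positive exactly over the strip. *)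
Let strip (v : V3) : R := e * `|cx v| - `|cy v - x0 * cx v|.

Let stripZ k v : strip (k *: v) = `|k| * strip v.
Proof. by rewrite /strip !cE mulrCA -mulrBr !normrM mulrBr mulrCA. Qed.

Let U : set P2 := [set p | exists v, [/\ v != 0, p = pt v & 0 < strip v]].

Let U_pt v : v != 0 -> U (pt v) <-> 0 < strip v.
Proof.
move=> v0; split=> [[u [u0 /(pt_eqP v0 u0)[k k0 ->] h]]|h]; last by exists v.
by rewrite stripZ mulr_gt0 // normr_gt0.
Qed.

Let U_open : open U.
Proof.
apply/open_pt.
have -> : [set v | v != 0 /\ U (pt v)] = [set v | v != 0] `&` strip @^-1` [set r | 0 < r].
  by apply/seteqP; split=> v [/= v0] /(U_pt v0).
apply: openI; first exact: open_neq0.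
apply: open_comp; last exact: open_gt.
move=> v _; have cX := @cx_continuous R v; have cY := @cy_continuous R v.
exact: (cvgB (cvgM (cvg_cst e) (cvg_norm cX)) (cvg_norm (cvgB cY (cvgM (cvg_cst x0) cX)))).
Qed.

Let from_affine (u : R * R) : V3 :=
  vec 1 (x0 + (u.1 - u.2) / (a - a')) (u.2 + y0 + a * ((u.1 - u.2) / (a - a'))).

(** The heights above the two affine lines are taken as coordinates; they are independent because
    [a'] differs from [a], and [from_affine] is the inverse map. *)
Lemma cross_at_affine (C D : set P2) :
  (forall x y, `|x - x0| < e -> C (pt (vec 1 x y)) <-> y = y0 + a * (x - x0)) ->
  (forall x y, `|x - x0| < e -> D (pt (vec 1 x y)) <-> y = y0 + a' * (x - x0)) ->
  cross_at C D (pt (vec 1 x0 y0)).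
Proof.
move=> hC hD; have [rep repP] := unit_rep R.
have rep0 p : rep p != 0 by have [h _] := repP p; rewrite -normr_eq0 h oner_eq0.
pose X p := cy (rep p) / cx (rep p); pose Y p := cz (rep p) / cx (rep p).
have XYE v : v != 0 -> X (pt v) = cy v / cx v /\ Y (pt v) = cz v / cx v.
  move=> v0; have [_ /(pt_eqP (rep0 _) v0)[k k0 e1]] := repP (pt v).
  by rewrite /X /Y e1 !cE -!mulf_div divff // !mul1r.
have v10 x y : vec (1 : R) x y != 0 by rewrite vec_eq0 !cE oner_eq0.
have XY1 x y : X (pt (vec 1 x y)) = x /\ Y (pt (vec 1 x y)) = y.
  by have [-> ->] := XYE _ (v10 x y); rewrite !cE !divr1.
pose h (p : P2) := (Y p - (y0 + a' * (X p - x0)), Y p - (y0 + a * (X p - x0))).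
have strip1 x y : 0 < strip (vec 1 x y) <-> `|x - x0| < e.
  by rewrite /strip !cE normr1 !mulr1 subr_gt0.
have UP q : U q -> q = pt (vec 1 (X q) (Y q)) /\ `|X q - x0| < e.
  move=> [v [v0 -> hv]]; have cv : cx v != 0.
    by apply: contraTneq hv => c0; rewrite /strip c0 normr0 !mulr0 sub0r -leNgt oppr_le0.
  have [-> ->] := XYE v v0.
  have ev : vec 1 (cy v / cx v) (cz v / cx v) = (cx v)^-1 *: v.
    by apply: vec_eqP; rewrite !cE ?mulVf // mulrC.
  rewrite ev ptZ ?invr_eq0 //; split=> //; apply/(strip1 _ (cz v / cx v)).
  by rewrite ev stripZ mulr_gt0 // normr_gt0 invr_eq0.
have U1 x y : U (pt (vec 1 x y)) <-> `|x - x0| < e by rewrite U_pt.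
have aa : a - a' != 0 by rewrite subr_eq0 eq_sym.
have hK q : U q -> pt (from_affine (h q)) = q.
  move=> Uq; rewrite [in RHS](UP q Uq).1 /from_affine /h /=; congr (pt (vec _ _ _)); field; exact: aa.
have Kh u : h (pt (from_affine u)) = u.
  have [e1 e2] := XY1 (x0 + (u.1 - u.2) / (a - a')) (u.2 + y0 + a * ((u.1 - u.2) / (a - a'))).
  rewrite /h /from_affine e1 e2 [RHS]surjective_pairing; congr (_, _); field; exact: aa.
have XYc v : v != 0 -> cx v != 0 -> {for pt v, continuous X} /\ {for pt v, continuous Y}.
  move=> v0 cv; have near0 : \forall w \near v, w != 0.
    by apply: open_nbhs_nbhs; split=> //; exact: open_neq0.
  have cX := @cx_continuous R v; have cY := @cy_continuous R v; have cZ := @cz_continuous R v.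
  have [eX eY] := XYE v v0.
  split; apply: (continuous_from_pt v0); rewrite /prop_for /continuous_at /= ?eX ?eY.
    have eq_near : {near nbhs v, (fun w => cy w / cx w) =1 X \o @pt R}.
      by apply: filterS near0 => w /XYE[/= ->].
    exact: (cvg_trans (near_eq_cvg eq_near) (cvgM cY (cvgV cv cX))).
  have eq_near : {near nbhs v, (fun w => cz w / cx w) =1 Y \o @pt R}.
    by apply: filterS near0 => w /XYE[_ /= ->].
  exact: (cvg_trans (near_eq_cvg eq_near) (cvgM cZ (cvgV cv cX))).
have h_cont q : U q -> {for q, continuous h}.
  move=> /UP[eq _]; have [cX cY] := XYc _ (v10 (X q) (Y q)) ltac:(by rewrite cE oner_eq0).
  have cL (c : R) : {for pt (vec 1 (X q) (Y q)), continuous (fun p => Y p - (y0 + c * (X p - x0)))}.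
    exact: (cvgB cY (cvgD (cvg_cst y0) (cvgM (cvg_cst c) (cvgB cX (cvg_cst x0))))).
  by rewrite eq; exact: (continuous_pair (cL a') (cL a)).
have psi_cont : continuous (fun u => pt (from_affine u)).
  move=> u; apply: (@continuous_comp _ _ _ from_affine (@pt R)); last exact: (pt_continuous (v10 _ _)).
  have c1 : {for u, continuous (@fst R R)} by exact: cvg_fst.
  have c2 : {for u, continuous (@snd R R)} by exact: cvg_snd.
  have cd : {for u, continuous (fun u : R * R => (u.1 - u.2) / (a - a'))}.
    exact: (cvgM (cvgB c1 c2) (cvg_cst (a - a')^-1)).
  apply: (vec_continuous (cvg_cst (1 : R)) (cvgD (cvg_cst x0) cd)).
  exact: (cvgD (cvgD c2 (cvg_cst y0)) (cvgM (cvg_cst a) cd)).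
exists U, h; split; last first.
  move=> q Uq; have [e1 hx] := UP q Uq.
  rewrite {1 3}e1 (hC _ _ hx) (hD _ _ hx) /h /=.
  by split; split=> [->|/eqP]; rewrite ?subrr // subr_eq0 => /eqP.
have Up0 : U (pt (vec 1 x0 y0)) by apply/U1; rewrite subrr normr0.
split=> //.
- by apply: continuous_in_subspaceT => q; rewrite inE => /h_cont.
- by move=> p q; rewrite !inE => /hK{2}<- /hK{2}<- ->.
- move=> W oW WU; have -> : h @` W = (fun u => pt (from_affine u)) @^-1` W.
    apply/seteqP; split=> [_ [q Wq <-]|u /= Wu]; first by rewrite /= hK //; exact: WU.
    by exists (pt (from_affine u)).
  by apply: open_comp oW => u _; exact: psi_cont.
by rewrite /h; have [-> ->] := XY1 x0 y0; rewrite !subrr !mulr0 !addr0 subrr.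
Qed.
End AffineChart.
End Graphs.

(** * Pseudoline arrangements from wiring diagrams *)

Section Interpolation.
Variable R : realType.

(** The piecewise linear function through the values [u 0], ..., [u K] at the integers, constant
    outside. Writing it as a sum of clamped increments makes continuity and boundedness
    inductive. *)
Fixpoint interp (u : nat -> R) (K : nat) (x : R) : R :=
  if K is K'.+1 then interp u K' x + (u K - u K') * clamp (x - K'%:R) else u 0%N.

Lemma clamp_below (x : R) : x <= 0 -> clamp x = 0.
Proof. by move=> h; rewrite /clamp max_l // ge_min h orbT. Qed.

Lemma clamp_above (x : R) : 1 <= x -> clamp x = 1.
Proof. by move=> h; rewrite /clamp min_l // max_r. Qed.

Lemma clamp_le1 (x : R) : `|clamp x| <= 1.
Proof. by have /andP[h1 h2] := clamp_in x; rewrite ger0_norm. Qed.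

Lemma interp_continuous u K : continuous (interp u K).
Proof.
elim: K => [|K IH] x; first exact: cvg_cst.
apply: (cvgD (IH x) (cvgM (cvg_cst _) _)).
apply: (@continuous_comp _ _ _ (fun x : R => x - K%:R) (@clamp R)); last exact: clamp_continuous.
exact: (cvgB (@cvg_id _ (nbhs x)) (cvg_cst (K%:R : R))).
Qed.

Lemma interp_bounded u K : exists M : R, forall x, `|interp u K x| <= M.
Proof.
elim: K => [|K [M hM]]; first by exists `|u 0%N|.
exists (M + `|u K.+1 - u K|) => x /=; apply: le_trans (ler_normD _ _) (lerD (hM x) _).
by rewrite normrM ler_piMr ?clamp_le1.
Qed.

Lemma interp_left u K x : x <= 0 -> interp u K x = u 0%N.
Proof.
move=> x0; elim: K => //= K ->; have hK := ler0n R K.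
by rewrite clamp_below ?mulr0 ?addr0 //; lra.
Qed.

Lemma interp_right u K x : K%:R <= x -> interp u K x = u K.
Proof.
elim: K => //= K IH hx; rewrite -natr1 in hx; rewrite IH; last by lra.
by rewrite clamp_above; [ring|lra].
Qed.

Lemma interp_segment u K k x : (k < K)%N -> k%:R <= x <= k.+1%:R ->
  interp u K x = u k + (u k.+1 - u k) * (x - k%:R).
Proof.
elim: K => //= K IH; rewrite ltnS leq_eqVlt => /orP[/eqP<-|kK] hx.
  rewrite interp_right; last by case/andP: hx.
  rewrite -natr1 in hx; rewrite clamp_id //; lra.
have le : k.+1%:R <= K%:R :> R by rewrite ler_nat.
by rewrite IH // clamp_below ?mulr0 ?addr0 //; lra.
Qed.

Lemma interp_locate K (x : R) : [\/ x <= 0, K%:R <= x |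
  exists2 k, (k < K)%N & k%:R <= x <= k.+1%:R].
Proof.
elim: K => [|K [h|h|[k kK h]]].
- by case: (lerP x 0) => h; [constructor 1|constructor 2; rewrite ltW].
- by constructor 1.
- case: (lerP K.+1%:R x) => h'; first by constructor 2.
  by constructor 3; exists K => //; rewrite h ltW.
by constructor 3; exists k => //; rewrite ltnS ltnW.
Qed.

End Interpolation.

Lemma segments_disjoint (R : realFieldType) (a b c d q : R) : 0 <= q <= 1 -> b < a -> d < c ->
  b + (d - b) * q != a + (c - a) * q.
Proof.
move=> /andP[q0 q1] ba dc; apply/eqP => e.
have h1 : 0 <= (1 - q) * (a - b) by rewrite mulr_ge0 // subr_ge0 // ltW.
have h2 : 0 <= q * (c - d) by rewrite mulr_ge0 // subr_ge0 ltW.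
have [h|h] := lerP q (1 / 2).
  have : 0 < (1 - q) * (a - b) by rewrite mulr_gt0 // subr_gt0 //; lra.
  lra.
have : 0 < q * (c - d) by rewrite mulr_gt0 // ?subr_gt0 //; lra.
lra.
Qed.

(** * Piecewise linear wires and their crossings *)

Section Wiring.
Variable R : realType.
Local Notation P2 := (projective_plane R).
Variables (n K : nat) (pos : nat -> nat -> nat) (kappa : nat -> nat -> nat).
Hypothesis pos_order : forall i j k, (i < j < n)%N -> (k <= K)%N ->
  if (k <= kappa i j)%N then (pos k i < pos k j)%N else (pos k j < pos k i)%N.
Hypothesis kappa_lt : forall i j, (i < j < n)%N -> (kappa i j < K)%N.

(** Twice the height of wire [i] in the middle of step [k]; the wires of a reversed block share
    it. *)
Definition level k i := (pos k i + pos k.+1 i)%N.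

Hypothesis level_eq : forall i j, (i < j < n)%N ->
  level (kappa i j) i = level (kappa i j) j.

(** The summand [i * k] cancels the slope [-i] at the integers, so that [wire_height i] has the
    value [pos k i] at [k]. Outside the diagram the wires are rays of the distinct slopes [-i]. *)
Definition bounded_part (i : nat) : R -> R :=
  interp (fun k => (pos k i)%:R + (i * k)%:R) K.

Definition wire_height (i : nat) (x : R) : R := - i%:R * x + bounded_part i x.

Definition pseudowire (i : nat) : set P2 := graph (- i%:R) (bounded_part i).

Lemma pseudowire_pseudoline i : pseudoline (pseudowire i).
Proof. by apply: graph_pseudoline; [exact: interp_continuous|exact: interp_bounded]. Qed.

Lemma pseudowire_affine i x y : pseudowire i (pt (vec 1 x y)) <-> y = wire_height i x.
Proof. exact: graph_affine. Qed.

Lemma wire_left i x : x <= 0 -> wire_height i x = (pos 0 i)%:R - i%:R * x.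
Proof. by move=> x0; rewrite /wire_height /bounded_part interp_left // muln0; ring. Qed.

Lemma wire_right i x : K%:R <= x -> wire_height i x = (pos K i)%:R - i%:R * (x - K%:R).
Proof. by move=> x0; rewrite /wire_height /bounded_part interp_right // natrM; ring. Qed.

Lemma wire_segment i k x : (k < K)%N -> k%:R <= x <= k.+1%:R ->
  wire_height i x = (pos k i)%:R + ((pos k.+1 i)%:R - (pos k i)%:R) * (x - k%:R).
Proof.
move=> kK hx; rewrite /wire_height /bounded_part (interp_segment _ kK hx) !natrM -natr1; ring.
Qed.

Definition crossing_time k : R := k%:R + 1 / 2.

Lemma crossing_time_in k : k%:R <= crossing_time k <= k.+1%:R.
Proof. by rewrite /crossing_time; have := @natr1 R k; move: k.+1%:R => q e; apply/andP; split; lra. Qed.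

Lemma wire_crossing i k : (k < K)%N -> wire_height i (crossing_time k) = (level k i)%:R / 2.
Proof.
move=> kK; by rewrite (wire_segment i kK (crossing_time_in k)) /level natrD /crossing_time; field.
Qed.

(** Left of [0] and right of [K] the rays diverge. In between, two segments whose order is the same
    at both ends do not meet, and in the step that exchanges them they meet only in the middle. *)
Lemma wire_meet i j x : (i < j < n)%N ->
  wire_height i x = wire_height j x <-> x = crossing_time (kappa i j).
Proof.
move=> ij; have kK := kappa_lt ij; have lij : (i%:R < j%:R :> R) by rewrite ltr_nat; case/andP: ij.
split=> [|->]; last by rewrite !wire_crossing // (level_eq ij).
have K0 : 0 <= K%:R :> R by [].
case: (interp_locate K x) => [h|h|[k hk h]].
- have := pos_order ij (leq0n K); rewrite leq0n -(ltr_nat R) !wire_left //; nra.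
- have := pos_order ij (leqnn K); rewrite leqNgt kK /= -(ltr_nat R) !wire_right //; nra.
rewrite !(wire_segment _ hk h).
have hq : 0 <= x - k%:R <= 1 by move: h; have := @natr1 R k; move: k.+1%:R => q e h; lra.
have := pos_order ij (ltnW hk); have := pos_order ij hk.
case: (ltngtP k (kappa i j)) => hkk.
- rewrite -!(ltr_nat R) => h1 h2 /eqP; rewrite eq_sym; apply: contraTeq => _.
  by rewrite eq_sym segments_disjoint.
- rewrite -!(ltr_nat R) => h1 h2 /eqP; apply: contraTeq => _.
  by rewrite eq_sym segments_disjoint.
rewrite hkk; have := congr1 (fun m : nat => m%:R : R) (level_eq ij); rewrite /level !natrD.
rewrite -!(ltr_nat R) /crossing_time; move: (pos _ _)%:R (pos _ _)%:R (pos _ _)%:R (pos _ _)%:R => a b c d.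
move=> e _ ba e2; have : (x - (kappa i j)%:R - 1 / 2) * (a - c) = 0 by nra.
by move/eqP; rewrite mulf_eq0 => /orP[/eqP|/eqP]; lra.
Qed.

Definition crossing_point i j : P2 :=
  pt (vec 1 (crossing_time (kappa i j)) ((level (kappa i j) i)%:R / 2)).

Lemma pseudowire_meet i j : (i < j < n)%N ->
  pseudowire i `&` pseudowire j = [set crossing_point i j].
Proof.
move=> ij; have kK := kappa_lt ij; have lij : (i < j)%N by case/andP: ij.
apply/seteqP; split=> [p [pi pj]|_ ->]; last first.
  by split; apply/pseudowire_affine; rewrite wire_crossing // (level_eq ij).
have [v v0 pv] := pt_surj p; rewrite pv in pi pj *.
have [c0|c0] := eqVneq (cx v) 0.
  move: pi pj; rewrite /pseudowire !graph_pt // /height c0 !mul0r !addr0 => e1 e2.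
  have cy0 : cy v = 0.
    have : (i%:R - j%:R) * cy v = 0 by rewrite -[RHS](subrr (cz v)) {1}e2 e1; ring.
    by move/eqP; rewrite mulf_eq0 subr_eq0 eqr_nat ltn_eqF //= => /eqP.
  by move: v0; rewrite vec_eq0 c0 cy0 e1 cy0 mulr0 eqxx.
have ev : pt v = pt (vec 1 (cy v / cx v) (cz v / cx v)).
  rewrite -(ptZ v (_ : (cx v)^-1 != 0)) ?invr_eq0 //; congr pt.
  by apply: vec_eqP; rewrite !cE ?mulVf // mulrC.
move: pi pj; rewrite ev !pseudowire_affine => e1 e2.
have /(wire_meet _ ij) ex : wire_height i (cy v / cx v) = wire_height j (cy v / cx v) by rewrite -e1.
by rewrite /crossing_point e1 ex wire_crossing.
Qed.

Lemma pseudowire_cross i j : (i < j < n)%N ->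
  cross_at (pseudowire i) (pseudowire j) (crossing_point i j) /\
  cross_at (pseudowire j) (pseudowire i) (crossing_point i j).
Proof.
move=> ij; have kK := kappa_lt ij; set k := kappa i j in kK.
pose a l : R := (pos k.+1 l)%:R - (pos k l)%:R.
have ha : a i != a j.
  have := pos_order ij kK; have := pos_order ij (ltnW kK); rewrite leqnn ltnn -!(ltr_nat R).
  by rewrite /a => h1 h2; apply/eqP; lra.
have loc l x y : level k l = level k i -> `|x - crossing_time k| < 1 / 2 ->
    pseudowire l (pt (vec 1 x y)) <-> y = (level k i)%:R / 2 + a l * (x - crossing_time k).
  move=> <- hx; rewrite pseudowire_affine (wire_segment _ kK); last first.
    by move: hx; rewrite ltr_norml /crossing_time; have := @natr1 R k; move: k.+1%:R => q e; lra.
  rewrite /a /level natrD /crossing_time.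
  by set rhs := (X in _ <-> y = X); rewrite (_ : _ + _ * _ = rhs) // /rhs; field.
have e0 : 0 < 1 / 2 :> R by lra.
have lj : level k j = level k i by rewrite (level_eq ij).
split; [apply: (cross_at_affine (e := 1 / 2) (a := a i) (a' := a j)) => //|
        apply: (cross_at_affine (e := 1 / 2) (a := a j) (a' := a i)) => //].
all: by [rewrite eq_sym|move=> x y; exact: loc].
Qed.

Lemma pseudowire_inj : injective pseudowire.
Proof.
move=> i j e.
have h k : pseudowire k (pt (vec 0 1 (- i%:R))) <-> - i%:R = - k%:R :> R by exact: graph_infinity.
have : pseudowire i (pt (vec 0 1 (- i%:R))) by apply/h.
by rewrite e => /h/oppr_inj/eqP; rewrite eqr_nat => /eqP.
Qed.

End Wiring.

(** * Checking a diagram given as a list of steps *)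

Section WiringData.

Definition reverse_block (p : seq nat) (st : nat * nat) : seq nat :=
  take st.1 p ++ rev (take st.2 (drop st.1 p)) ++ drop (st.1 + st.2) p.

Definition positions (steps : seq (nat * nat)) : seq (seq nat) :=
  [seq [seq index i p | i <- iota 0 12]
     | p <- iota 0 12 :: scanl reverse_block (iota 0 12) steps].

Variables (P : seq (seq nat)) (steps : seq (nat * nat)).
Variables (sg : seq nat) (tab : seq (nat * nat * nat)).

Definition pos_at k i := nth 0%N (nth [::] P k) i.
(** For [i < j] this is the last row of positions in which [i] still stands before [j], which is
    also the index of the step that exchanges them. *)
Definition swap_time i j := (find (fun row => nth 0%N row j < nth 0%N row i)%N P).-1.
(* Twice the position at which the reversed block of the k-th step meets. *)
Definition centre k := ((nth (0, 0)%N steps k).1.*2 + (nth (0, 0)%N steps k).2.-1)%N.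
(** A wire outside the reversed block keeps its position and has twice that position as level, which
    is never the centre of the block. *)
Definition block k := [seq i <- iota 0 12 | level pos_at k i == centre k].
Definition block_is k (t : nat * nat * nat) :=
  let: (a, b, c) := t in
  [&& (a <= 12)%N, (b <= 12)%N, (c <= 12)%N &
     perm_eq [seq nth 0%N sg i.-1 | i <- [:: a; b; c]] (block k)].

(** A diagram has [19 + 9 = 28] steps, one for each multiple point, and hence [29] rows of
    positions. The last two clauses match the triple blocks and the triples of the table in both
    directions. *)
Definition wiring_ok : bool :=
  [&& all (fun j => all (fun i => let k0 := swap_time i j in
         [&& (k0 < 28)%N,
             all (fun k => if (k <= k0)%N then (pos_at k i < pos_at k j)%N
                           else (pos_at k j < pos_at k i)%N) (iota 0 29),
             level pos_at k0 i == centre k0 & level pos_at k0 j == centre k0])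
        (iota 0 j)) (iota 0 12),
      all (fun k => size (block k) \in [:: 2; 3]%N) (iota 0 28),
      count (fun k => size (block k) == 3%N) (iota 0 28) == 19%N,
      count (fun k => size (block k) == 2%N) (iota 0 28) == 9%N,
      perm_eq sg (iota 0 12),
      all (fun k => (size (block k) == 3%N) ==> has (block_is k) tab) (iota 0 28) &
      all (fun t => has (block_is^~ t) (iota 0 28)) tab].

Variable R : realType.
Hypothesis ok : wiring_ok.

Let pairs i j : (i < j < 12)%N -> [/\ (swap_time i j < 28)%N,
    forall k, (k <= 28)%N -> if (k <= swap_time i j)%N then (pos_at k i < pos_at k j)%N
                           else (pos_at k j < pos_at k i)%N,
    level pos_at (swap_time i j) i = centre (swap_time i j) &
    level pos_at (swap_time i j) j = centre (swap_time i j)].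
Proof.
move=> /andP[ij j12]; have /andP[/allP h _] := ok.
have := h j; rewrite mem_iota => /(_ j12)/allP/(_ i); rewrite mem_iota => /(_ ij) /and4P[h1 /allP h2 /eqP h3 /eqP h4].
by split=> // k k28; apply: h2; rewrite mem_iota.
Qed.

Let wires (i : 'I_12) : nat := nth 0%N sg i.
Let L (i : 'I_12) : set (projective_plane R) := @pseudowire R 28 pos_at (wires i).
Let point k := pt (vec 1 (@crossing_time R k) ((centre k)%:R / 2)).

Let perm_sg : perm_eq sg (iota 0 12).
Proof. by have /and5P[_ _ _ _ /andP[]] := ok. Qed.

Let size_sg : size sg = 12%N.
Proof. by rewrite (perm_size perm_sg) size_iota. Qed.

Let wires_lt i : (wires i < 12)%N.
Proof. by have := mem_nth 0%N (etrans (congr1 (leq i.+1) size_sg) (ltn_ord i)); rewrite (perm_mem perm_sg) mem_iota. Qed.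

Let wires_inj : injective wires.
Proof.
move=> i j /eqP; rewrite nth_uniq ?size_sg ?ltn_ord // ?(perm_uniq perm_sg) ?iota_uniq //.
by move=> /eqP/val_inj.
Qed.

Let L_inj : injective L.
Proof. by move=> i j /pseudowire_inj/wires_inj. Qed.

Let meet i j : (i < j < 12)%N ->
  @pseudowire R 28 pos_at i `&` @pseudowire R 28 pos_at j = [set point (swap_time i j)].
Proof.
move=> ij; rewrite (@pseudowire_meet R 12 28 pos_at swap_time) // => [|a b k ab k28|a b ab|a b ab].
- by rewrite /crossing_point; have [_ _ -> _] := pairs ij.
- by have [_ h _ _] := pairs ab; exact: h.
- by have [] := pairs ab.
- by have [_ _ -> ->] := pairs ab.
Qed.

Let cross i j : (i < j < 12)%N ->
  cross_at (@pseudowire R 28 pos_at i) (@pseudowire R 28 pos_at j) (point (swap_time i j)) /\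
  cross_at (@pseudowire R 28 pos_at j) (@pseudowire R 28 pos_at i) (point (swap_time i j)).
Proof.
move=> ij; have := @pseudowire_cross R 12 28 pos_at swap_time.
rewrite /crossing_point => /(_ _ _ _ i j ij); have [_ _ -> _] := pairs ij.
apply=> [a b k ab k28|a b ab|a b ab].
- by have [_ h _ _] := pairs ab; exact: h.
- by have [] := pairs ab.
- by have [_ _ -> ->] := pairs ab.
Qed.

Let mem_point k i : (k < 28)%N -> (i \in lines_through L (point k)) = (wires i \in block k).
Proof.
move=> k28; rewrite mem_filter mem_iota leq0n wires_lt !andbT; apply/(lines_throughP L)/eqP.
  move=> /pseudowire_affine; rewrite wire_crossing // => /(congr1 (fun x => x * 2)).
  by rewrite !divfK ?pnatr_eq0 // => /eqP; rewrite eqr_nat => /eqP.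
by move=> e; apply/pseudowire_affine; rewrite wire_crossing // e.
Qed.

Let card_point k : (k < 28)%N -> #|lines_through L (point k)| = size (block k).
Proof.
move=> k28; rewrite cardE -(size_map wires); apply: perm_size.
apply: uniq_perm; rewrite ?(map_inj_uniq wires_inj) ?enum_uniq ?filter_uniq ?iota_uniq // => x.
apply/mapP/idP => [h|xb]; first by case: h => i; rewrite mem_enum mem_point // => h ->.
have : x \in sg by rewrite (perm_mem perm_sg); move: xb; rewrite mem_filter => /andP[].
move=> xsg; have lt : (index x sg < 12)%N by rewrite -size_sg index_mem.
by exists (Ordinal lt); rewrite ?mem_enum ?mem_point // /wires /= nth_index.
Qed.

Let point_inj : injective point.
Proof.
have n0 x y : vec (1 : R) x y != 0 by rewrite vec_eq0 !cE oner_eq0.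
move=> k l /(pt_eqP (n0 _ _) (n0 _ _))[c c0 e].
have := congr1 (@cx R) e; have := congr1 (@cy R) e; rewrite !cE => e1 e2.
move: e1; rewrite -[c]mulr1 -e2 mul1r => /addIr/eqP; by rewrite eqr_nat => /eqP.
Qed.

Let multiple p : (1 < #|lines_through L p|)%N -> exists2 k : 'I_28, True & p = point k.
Proof.
move=> /card_gt1P[i [j [/lines_throughP pi /lines_throughP pj ij]]].
wlog lt : i j pi pj ij / (wires i < wires j)%N.
  move=> wl; have : wires i != wires j by rewrite (inj_eq wires_inj).
  by rewrite neq_ltn => /orP[]; [apply: wl|apply: wl; rewrite // eq_sym].
have h : (wires i < wires j < 12)%N by rewrite lt wires_lt.
have [k28 _ _ _] := pairs h; exists (Ordinal k28) => //.
by have : (L i `&` L j) p by []; rewrite /L meet.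
Qed.

Let multiple_pointsP r : (1 < r)%N ->
  multiple_points (range L) r = (fun k : 'I_28 => point k) @` [set k | k \in [set k : 'I_28 | size (block k) == r]%SET].
Proof.
move=> r1; rewrite multiple_pointsE //; apply/seteqP; split=> [p /= pr|p /= [k +]] /=.
  have [k _ pk] := @multiple p ltac:(by rewrite pr).
  by exists k; rewrite ?pk //= inE -card_point // -pk pr.
by rewrite inE => /eqP <- <-; rewrite card_point.
Qed.

Let card_count Q : #|[set k : 'I_28 | Q (val k)]%SET| = count Q (iota 0 28).
Proof. by rewrite -sum1dep_card -sum1_count -(big_mkord Q (fun=> 1%N)). Qed.

Let card_multiple r : (1 < r)%N ->
  (multiple_points (range L) r #= `I_(count (fun k => size (block k) == r) (iota 0 28)))%card.
Proof.
move=> r1; rewrite multiple_pointsP // card_image_finset.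
  exact: (card_count (fun k => size (block k) == r)).
by move=> k l _ _ /point_inj/val_inj.
Qed.

Let block_isP k t : (k < 28)%N -> block_is k t -> lines_through L (point k) = unordered_triple t.
Proof.
case: t => [[a b] c] k28 /and4P[a12 b12 c12 pe]; apply/setP => i.
rewrite mem_point // -(perm_mem pe) !inE.
have lb x : (x <= 12)%N -> (wires i == nth 0%N sg x.-1) = (i == label x).
  move=> x12; have lt : (x.-1 < 12)%N by case: x x12.
  by rewrite -(inj_eq wires_inj) /wires /label inordK.
by rewrite !lb // orbA.
Qed.

Lemma wiring_realization : exists A : set (set (projective_plane R)),
  special_arrangement A /\ exists L, labelling A L /\
    triple_list L = [set:: map unordered_triple tab]%SET.
Proof.
have /and5P[_ /allP hsz /eqP h19 /eqP h9 /and3P[_ /allP h1 /allP h2]] := ok.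
exists (range L); split; last first.
  exists L; split.
    by split=> [i _|i j _ _ /L_inj //|C [i _ <-]]; exists i.
  apply/setP => S; apply/idP/idP.
    move=> /(mem_triple_list L_inj)[p p3 ->].
    have [k _ pk] := @multiple p ltac:(by rewrite p3).
    have kI : nat_of_ord k \in iota 0 28 by rewrite mem_iota ltn_ord.
    have := h1 _ kI; rewrite -card_point // -pk p3 /= => /hasP[t tI kt].
    by rewrite inE pk (block_isP _ kt) // map_f.
  rewrite inE => /mapP[t tI ->]; have /hasP[k kI kt] := h2 _ tI.
  have k28 : (k < 28)%N by move: kI; rewrite mem_iota.
  apply/(mem_triple_list L_inj); exists (point k); last by rewrite (block_isP k28 kt).
  rewrite card_point //; case: t kt {tI} => [[a b] c] /and4P[_ _ _ /perm_size <-] //.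
split.
- split.
  + exact: finite_image.
  + by move=> C [i _ <-]; exact: pseudowire_pseudoline.
  + move=> _ _ [i _ <-] [j _ <-] nij.
    have : wires i != wires j by apply/eqP => e; apply: nij; rewrite /L e.
    rewrite neq_ltn => /orP[] lt.
      have h : (wires i < wires j < 12)%N by rewrite lt wires_lt.
      by exists (point (swap_time (wires i) (wires j))); rewrite /L meet //; split=> //; have [] := cross h.
    have h : (wires j < wires i < 12)%N by rewrite lt wires_lt.
    by exists (point (swap_time (wires j) (wires i))); rewrite /L setIC meet //; split=> //; have [] := cross h.
- have -> : [set: 'I_12] = [set i | i \in [set: 'I_12]%SET] by apply/seteqP; split=> i; rewrite /= ?inE.
  by apply/(card_image_finset 12 (in2W L_inj)); rewrite cardsT card_ord.
- by rewrite -h19; exact: card_multiple.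
- by have := card_multiple (isT : (1 < 2)%N); rewrite h9.
move=> r r4; have e0 : count (fun k => size (block k) == r) (iota 0 28) = 0%N.
  apply/eqP; rewrite -leqn0 leqNgt -has_count; apply/hasPn => k /hsz.
  by rewrite !inE => /orP[]/eqP->; rewrite eq_sym gtn_eqF // (leq_trans _ r4).
by have := card_multiple (leq_trans (isT : (1 < 4)%N) r4); rewrite e0.
Qed.

End WiringData.

(* For each table, the steps (position, size) of a wiring diagram with 12 wires, and
   the wires that carry the labels 1, ..., 12. *)
Definition wiring_diagrams : seq (seq (nat * nat) * seq nat) := [::
  ([:: (0,2);(1,3);(3,3);(5,3);(7,3);(9,3);(8,2);(7,2);(6,2);(4,3);(2,3);(0,3);(6,3);(4,3);(2,3);(8,3);(6,3);(4,3);(3,2);(1,3);(8,2);(6,3);(4,3);(3,2);(4,2);(5,3);(8,3);(7,2)],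
   [:: 4;2;1;10;8;9;6;11;7;0;5;3]);
  ([:: (0,2);(1,3);(3,3);(5,3);(7,3);(9,3);(8,2);(7,2);(6,2);(4,3);(2,3);(0,3);(6,3);(4,3);(2,3);(8,3);(6,3);(4,3);(3,2);(1,3);(4,2);(8,2);(6,3);(5,2);(3,3);(5,3);(8,3);(7,2)],
   [:: 9;2;7;0;8;10;3;4;6;5;1;11]);
  ([:: (0,2);(1,3);(3,3);(5,3);(7,3);(9,3);(8,2);(6,3);(5,2);(4,2);(2,3);(0,3);(5,3);(4,2);(2,3);(4,3);(6,3);(8,3);(7,2);(5,3);(3,3);(1,3);(7,3);(6,2);(5,2);(3,3);(5,3);(7,2)],
   [:: 1;10;8;6;4;7;2;9;5;11;3;0]);
  ([:: (0,2);(1,3);(3,3);(5,3);(7,3);(9,3);(8,2);(6,3);(5,2);(4,2);(2,3);(0,3);(5,3);(4,2);(2,3);(4,3);(8,2);(6,3);(8,3);(7,2);(5,3);(3,3);(1,3);(5,2);(3,3);(7,3);(5,3);(7,2)],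
   [:: 0;3;2;5;4;7;6;9;8;11;10;1]);
  ([:: (0,2);(1,3);(3,3);(5,3);(7,3);(9,3);(8,2);(6,3);(4,3);(2,3);(1,2);(0,2);(1,3);(3,3);(5,3);(4,2);(2,3);(7,3);(5,3);(9,2);(7,3);(6,2);(4,3);(3,2);(1,3);(3,3);(6,3);(5,2)],
   [:: 9;3;7;6;11;1;4;10;5;0;8;2]);
  ([:: (0,2);(1,3);(3,3);(5,3);(7,3);(9,3);(8,2);(6,3);(4,3);(3,2);(2,2);(0,3);(6,2);(4,3);(2,3);(4,2);(8,3);(7,2);(5,3);(3,3);(1,3);(7,3);(5,3);(3,3);(9,2);(7,3);(5,3);(7,2)],
   [:: 10;7;2;5;1;3;9;6;8;11;0;4]);
  ([:: (0,2);(1,3);(3,3);(5,3);(7,3);(9,3);(8,2);(6,3);(4,3);(3,2);(2,2);(0,3);(8,3);(6,3);(4,3);(2,3);(1,2);(4,2);(5,3);(3,3);(2,2);(7,3);(5,3);(3,3);(9,2);(7,3);(5,3);(7,2)],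
   [:: 2;1;10;4;6;5;8;7;9;3;0;11]);
  ([:: (0,2);(1,3);(3,3);(5,3);(7,3);(9,3);(8,2);(6,3);(4,3);(3,2);(2,2);(0,3);(3,3);(2,2);(5,3);(3,3);(7,3);(5,3);(7,2);(8,3);(6,3);(4,3);(2,3);(1,2);(2,2);(3,3);(5,3);(7,2)],
   [:: 5;7;2;9;1;8;10;6;3;4;0;11]);
  ([:: (0,2);(1,3);(3,3);(5,3);(7,3);(9,3);(8,2);(6,3);(4,3);(3,2);(2,2);(0,3);(3,3);(2,2);(5,3);(3,3);(1,3);(7,3);(5,3);(3,3);(7,2);(5,3);(8,3);(7,2);(6,2);(4,3);(2,3);(1,2)],
   [:: 6;4;3;5;10;7;0;9;11;8;2;1]);
  ([:: (0,2);(1,3);(3,3);(5,3);(7,3);(9,3);(8,2);(6,3);(4,3);(2,3);(1,2);(0,2);(8,3);(6,3);(4,3);(2,3);(1,2);(6,2);(4,3);(2,3);(4,2);(7,3);(5,3);(3,3);(7,2);(8,3);(6,3);(5,2)],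
   [:: 0;11;10;2;3;4;5;6;7;8;9;1]);
  ([:: (0,2);(1,3);(3,3);(5,3);(7,3);(9,3);(8,2);(7,2);(6,2);(4,3);(2,3);(0,3);(6,3);(4,3);(2,3);(4,2);(8,3);(6,3);(5,2);(3,3);(1,3);(8,2);(6,3);(5,2);(3,3);(5,3);(8,3);(7,2)],
   [:: 4;2;1;10;8;9;6;11;7;0;5;3]);
  ([:: (0,2);(1,3);(3,3);(5,3);(7,3);(9,3);(8,2);(7,2);(6,2);(4,3);(2,3);(0,3);(6,3);(4,3);(2,3);(4,2);(5,3);(7,3);(6,2);(9,2);(7,3);(5,3);(3,3);(1,3);(5,2);(3,3);(5,3);(7,2)],
   [:: 3;5;6;7;8;9;10;11;1;0;2;4]);
  ([:: (0,2);(1,3);(3,3);(5,3);(7,3);(9,3);(8,2);(6,3);(4,3);(2,3);(0,3);(4,2);(2,3);(1,2);(6,2);(4,3);(2,3);(6,3);(5,2);(8,3);(6,3);(4,3);(3,2);(1,3);(8,2);(6,3);(4,3);(3,2)],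
   [:: 4;6;1;10;2;8;3;0;5;11;7;9])].

Lemma wiring_diagrams_ok :
  all2 (fun d tab => wiring_ok (positions d.1) d.1 d.2 tab) wiring_diagrams tables.
Proof. vm_compute. reflexivity. Qed.

Theorem all_lists_realized (R : realType) (m : 'I_13) :
  exists A : set (set (projective_plane R)), special_arrangement A /\
    exists L, labelling A L /\ triple_list L = list_C m.
Proof.
pose d := nth ([::], [::]) wiring_diagrams m.
apply: (@wiring_realization (positions d.1) d.1 d.2 (nth [::] tables m) R).
have := wiring_diagrams_ok; rewrite all2E => /andP[/eqP sz /(all_nthP (([::], [::]), [::]))/(_ m)].
rewrite size_zip sz minnn nth_zip //; apply; exact: ltn_ord.
Qed.

Local Close Scope ring_scope.

(** * The classification *)

Lemma arrangement_enumeration (R : realType) (A : set (set (projective_plane R))) :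
  (A #= `I_12)%card -> exists L : 'I_12 -> set (projective_plane R), injective L /\ range L = A.
Proof.
rewrite card_eq_sym => /card_set_bijP[f [fA finj fsurj]].
exists (fun i : 'I_12 => f i); split=> [i j e|].
  by apply/val_inj/finj; rewrite ?inE //=; exact: ltn_ord.
apply/seteqP; split=> [_ [i _ <-]|C AC]; first by apply: fA; exact: ltn_ord.
by have [i i12 <-] := fsurj _ AC; exists (Ordinal i12).
Qed.

Lemma special_arrangement_table (R : realType) (A : set (set (projective_plane R))) :
  special_arrangement A -> exists L : 'I_12 -> set (projective_plane R),
    labelling A L /\ exists m : 'I_13, triple_list L = list_C m.
Proof.
move=> [arrA cardA t3 t2 tr]; have [L [Linj LA]] := arrangement_enumeration cardA.
rewrite -LA in arrA t3 tr; have AL i : range L (L i) by exists i.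
have [_ _ meet] := arrA.
have same_point i j p q : i != j -> L i p -> L j p -> L i q -> L j q -> p = q.
  move=> ij ip jp iq jq; have [|x [e _]] := meet (L i) (L j) (AL i) (AL j).
    by move=> /Linj e; rewrite e eqxx in ij.
  have : (L i `&` L j) p by []; have : (L i `&` L j) q by [].
  by rewrite e => -> ->.
have le3 p : (#|lines_through L p| <= 3)%N.
  rewrite leqNgt; apply/negP => h; have := tr _ h; rewrite multiple_pointsE //.
  by rewrite II0 card_eq0 => /eqP/seteqP[/(_ p erefl)].
pose D := triple_list L.
have D_mem S : S \in D <-> exists2 p, #|lines_through L p| = 3%N & S = lines_through L p.
  exact: mem_triple_list.
have D_card S : S \in D -> #|S| = 3%N by move=> /D_mem[p h ->].
have D_share S S' i j : S \in D -> S' \in D -> i != j ->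
    i \in S -> j \in S -> i \in S' -> j \in S' -> S = S'.
  move=> /D_mem[p _ ->] /D_mem[q _ ->] ij /lines_throughP ip /lines_throughP jp
    /lines_throughP iq /lines_throughP jq.
  by rewrite (same_point i j p q).
have D_size : #|D| = 19%N.
  apply: (card_lines_through_sets Linj _ D_mem t3) => p q p3 e.
  have /card_gt1P[i [j [ip jp ij]]] : (1 < #|lines_through L p|)%N by rewrite p3.
  have iq := ip; have jq := jp; rewrite e in iq jq.
  by apply: (same_point i j) => //; exact/lines_throughP.
have card3 (i j k : 'I_12) : i != j -> i != k -> j != k -> #|[set i; j; k]%SET| = 3%N.
  move=> ij ik jk; have u3 : uniq [:: i; j; k] by rewrite /= !inE negb_or ij ik jk.
  transitivity #|[:: i; j; k]|; last exact: (card_uniqP u3).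
  by apply: eq_card => v; rewrite !inE orbA.
have D_conc (i j k : 'I_12) : i != j -> i != k -> j != k ->
    (exists p, [/\ L i p, L j p & L k p]) <-> [set i; j; k]%SET \in D.
  move=> ij ik jk; split=> [[p [ip jp kp]]|/D_mem[p _ e]].
    have e : [set i; j; k]%SET = lines_through L p.
      apply/eqP; rewrite eqEcard card3 // le3 andbT; apply/fintype.subsetP => x.
      by rewrite !inE => /orP[/orP[]|] /eqP->; apply/asboolP; rewrite ?inE.
    by apply/D_mem; exists p => //; rewrite -e card3.
  by exists p; split; apply/lines_throughP; rewrite -e !inE eqxx ?orbT.
have [T [e [ep [T01 e_sign ep_sign flip_law T_eq]]]] := arrangement_sign_data arrA AL Linj.
have [w w_full] := exists_full_line D_size D_card D_share.
have [u uw joined_w] := exists_double D_card D_share w_full.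
have wu : w != u by rewrite eq_sym.
have u_double k : k != w -> k != u -> [set w; u; k]%SET \notin D.
  move=> kw ku; apply/negP => SD; have := joined_w u uw; rewrite eqxx => /exists_inP[].
  by exists [set w; u; k]%SET; rewrite // !inE !eqxx ?orbT.
have T_eqD (i j k : 'I_12) : i != j -> i != k -> j != k -> T i j = T i k <-> [set i; j; k]%SET \in D.
  by move=> ij ik jk; rewrite -D_conc //; exact: T_eq.
have [p [tau [kap [h1 h2 h3 h4 h5]]]] := sign_data_affine D_card D_share T01 e_sign
  (fun i j ij => (ep_sign i j ij).1) (fun i j ij => (ep_sign i j ij).2) flip_law T_eqD wu u_double.
have [m [g hg]] := triples_in_table D_size D_card D_share w_full uw joined_w h1 h2 h3 h4 h5.
(* Relabelling the curves by the inverse of [g] moves the label sets of all points by [g]. *)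
pose L' i := L (g^-1%g i).
have L'inj : injective L' by move=> i j /Linj/perm_inj.
have rangeL' : range L' = range L.
  apply/seteqP; split=> C [i _ <-]; first by exists (g^-1%g i).
  by exists (g i); rewrite /L' ?permK.
exists L'; split.
  by rewrite -LA -rangeL'; split=> [i _|i j _ _ /L'inj //|C [i _ <-]]; exists i.
exists m.
have through' q : lines_through L' q = (g @: lines_through L q)%SET.
  apply/setP => i; rewrite -(permKV g i) mem_imset; last exact: perm_inj.
  by rewrite !in_lines_through /L' permK.
have sub : triple_list L' \subset list_C m.
  apply/fintype.subsetP => S /(mem_triple_list L'inj)[q q3 ->]; rewrite through'; apply: hg.
  apply/D_mem; exists q => //; move: q3; rewrite through' card_imset //; exact: perm_inj.
have e' : triple_list L' = [set g @: S | S : {set 'I_12} in D]%SET.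
  apply/setP => S; apply/idP/imsetP.
    move=> /(mem_triple_list L'inj)[q q3 ->]; exists (lines_through L q); last exact: through'.
    by apply/D_mem; exists q => //; move: q3; rewrite through' card_imset //; exact: perm_inj.
  move=> [S0 /D_mem[q q3 ->] ->]; apply/(mem_triple_list L'inj); exists q; rewrite through' //.
  by rewrite card_imset //; exact: perm_inj.
(* The relabelled list has nineteen triples and a table has at most nineteen, so the inclusion is an
   equality. *)
apply/eqP; rewrite eqEcard sub e' card_imset ?D_size; last exact: (imset_inj (@perm_inj _ g)).
apply: leq_trans (_ : size (nth [::] tables m) <= _)%N.
  rewrite /list_C -(size_map unordered_triple) -(eq_card (A := mem (map unordered_triple (nth [::] tables m)))).
    exact: card_size.
  by move=> S; rewrite inE.
have /allP h : all (fun s => size s <= 19)%N tables by [].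
by apply: h; apply: mem_nth.
Qed.

Theorem mainTheorem1 (R : realType) :
  [/\ (forall A : set (set (projective_plane R)), special_arrangement A ->
         exists L : 'I_12 -> set (projective_plane R),
           labelling A L /\ exists m : 'I_13, triple_list L = list_C m),
      (forall m : 'I_13, exists A : set (set (projective_plane R)),
         special_arrangement A /\
         exists L : 'I_12 -> set (projective_plane R),
           labelling A L /\ triple_list L = list_C m) &
      (forall m n : 'I_13, isomorphic_lists (list_C m) (list_C n) -> m = n)].
Proof.
split; [exact: special_arrangement_table|exact: all_lists_realized|exact: lists_non_isomorphic].
Qed.
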